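(* Let $G$ be a locally compact group, and let $M(G)$ be its measure algebra, regarded as a dual Banach algebra with predual $\mathcal{C}_0(G)$. Then the following are equivalent: (i) $G$ is amenable; (ii) $M(G)$ is Connes-amenable; (iii) $M(G)$ has a normal, virtual diagonal.
   Context: Locally compact groups are Hausdorff. $G$ is amenable if there is a left-invariant mean on $L^\infty(G)$. $M(G)$ denotes the Banach algebra of complex regular Borel measures on $G$ with convolution as product and total variation norm, identified as a Banach space with $\mathcal{C}_0(G)^\ast$; its $w^\ast$-topology is the one induced by $\mathcal{C}_0(G)$. A Banach algebra $\mathfrak{A}$ is called dual if it is a dual Banach space, $\mathfrak{A} = (\mathfrak{A}_\ast)^\ast$ with a given predual $\mathfrak{A}_\ast$, such that multiplication in $\mathfrak{A}$ is separately $w^\ast$-continuous. $M(G)$ with predual $\mathcal{C}_0(G)$ is a dual Banach algebra. A Banach bimodule $E$ over a dual Banach algebra $\mathfrak{A}$ is called normal if $E$ is a dual Banach space such that the module operations $\mathfrak{A} \times E \to E$, $(a,x) \mapsto a \cdot x$ and $(a,x) \mapsto x \cdot a$, are separately $w^\ast$-continuous (in each of the two variables, with respect to the $w^\ast$-topologies of $\mathfrak{A}$ and $E$). A derivation $D : \mathfrak{A} \to E$ is a bounded linear map with $D(ab) = a \cdot D(b) + D(a) \cdot b$ for $a, b \in \mathfrak{A}$; it is inner if there is $x \in E$ with $D(a) = a \cdot x - x \cdot a$ for all $a \in \mathfrak{A}$. A dual Banach algebra $\mathfrak{A}$ is called Connes-amenable if, for every normal Banach $\mathfrak{A}$-bimodule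 $E$, every $w^\ast$-continuous (i.e. $w^\ast$-$w^\ast$-continuous) derivation $D : \mathfrak{A} \to E$ is inner. For a dual Banach algebra $\mathfrak{A}$, let $\mathcal{L}^2_{w^\ast}(\mathfrak{A},\mathbb{C})$ be the Banach space of bounded, separately $w^\ast$-continuous bilinear functionals $\Phi : \mathfrak{A} \times \mathfrak{A} \to \mathbb{C}$. It is a Banach $\mathfrak{A}$-bimodule via $(a \cdot \Phi)(b,c) = \Phi(b, ca)$ and $(\Phi \cdot a)(b,c) = \Phi(ab, c)$, and its dual $\mathcal{L}^2_{w^\ast}(\mathfrak{A},\mathbb{C})^\ast$ is a Banach $\mathfrak{A}$-bimodule via $\langle \Phi, a \cdot \mathrm{M} \rangle = \langle \Phi \cdot a, \mathrm{M} \rangle$ and $\langle \Phi, \mathrm{M} \cdot a \rangle = \langle a \cdot \Phi, \mathrm{M} \rangle$. (Elementary tensors $b \otimes c$ act on $\mathcal{L}^2_{w^\ast}(\mathfrak{A},\mathbb{C})$ by evaluation at $(b,c)$, so that $a \cdot (b \otimes c) = ab \otimes c$ and $(b \otimes c) \cdot a = b \otimes ca$.) The multiplication map $\Delta : \mathfrak{A} \otimes \mathfrak{A} \to \mathfrak{A}$, $b \otimes c \mapsto bc$, extends to a continuous $\mathfrak{A}$-bimodule homomorphism $\Delta : \mathcal{L}^2_{w^\ast}(\mathfrak{A},\mathbb{C})^\ast \to \mathfrak{A} = (\mathfrak{A}_\ast)^\ast$ given by $\langle \phi, \Delta \mathrm{M} \rangle = \langle \Phi_\phi, \mathrm{M}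 \rangle$ for $\phi \in \mathfrak{A}_\ast$, where $\Phi_\phi(b,c) = \langle \phi, bc \rangle$. A normal, virtual diagonal for $\mathfrak{A}$ is an element $\mathrm{M} \in \mathcal{L}^2_{w^\ast}(\mathfrak{A},\mathbb{C})^\ast$ such that $a \cdot \mathrm{M} = \mathrm{M} \cdot a$ and $a\, \Delta \mathrm{M} = a$ for all $a \in \mathfrak{A}$. *)

(* Defs.v *)
From HB Require Import structures.
From mathcomp Require Import all_boot all_order all_algebra.
From mathcomp Require Import complex.
From mathcomp Require Import all_classical all_reals all_analysis.

Set Implicit Arguments.
Unset Strict Implicit.
Unset Printing Implicit Defensive.

Import Order.TTheory GRing.Theory Num.Theory.
Import numFieldNormedType.Exports.

Local Open Scope classical_set_scope.
Local Open Scope complex_scope.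
Local Open Scope ring_scope.

(* Pointedness is only there because the measurable types of the library are
   pointed; the distinguished point plays no role. *)
HB.mixin Record isTopologicalGroup G & PointedTopological G & Group G := {
  mulg_continuous : continuous (fun p : G * G => (p.1 * p.2)%g);
  invg_continuous : continuous (fun x : G => (x^-1)%g) }.

#[short(type="topologicalGroupType")]
HB.structure Definition TopologicalGroup :=
  {G of PointedTopological G & Group G & isTopologicalGroup G}.


Local Notation Re := (@complex.Re _).
Local Notation Im := (@complex.Im _).
Notation borel G := (g_sigma_algebraType (@open G)).

Section complex_measure.
Context (R : realType) d (T : measurableType d).
Local Notation C := (R[i]^o).
Implicit Types m : set T -> C.

(* A complex measure is a set function on all sets, normalised to 0 off the
   sigma-algebra, so that it is determined by its values on measurable sets. *)
Record is_complex_measure m : Prop := {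
  complex_measure_out : forall E, ~ measurable E -> m E = 0 ;
  complex_measure0 : m set0 = 0 ;
  complex_measure_sigma_additive : forall F : nat -> set T,
    (forall i, measurable (F i)) -> trivIset setT F ->
    (fun n => \sum_(0 <= i < n) m (F i) : C) @ \oo --> m (\bigcup_i F i) }.

(* The total variation |m|(E). *)
Definition tvariation m (E : set T) : \bar R :=
  ereal_sup [set x | exists (n : nat) (F : nat -> set T),
    [/\ forall i, measurable (F i), trivIset setT F, forall i, F i `<=` E
      & x = (\sum_(0 <= i < n) Re `|m (F i)|)%:E]].

Lemma ReD (x y : C) : Re (x + y) = Re x + Re y.
Proof. by case: x; case: y. Qed.

Lemma ImD (x y : C) : Im (x + y) = Im x + Im y.
Proof. by case: x; case: y. Qed.

Lemma ReB (x y : C) : Re (x - y) = Re x - Re y.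
Proof. by case: x; case: y. Qed.

Lemma ImB (x y : C) : Im (x - y) = Im x - Im y.
Proof. by case: x; case: y. Qed.

Lemma Re_norm_ge0 (x : C) : 0 <= Re `|x|.
Proof. by rewrite normc_def /= sqrtr_ge0. Qed.

Lemma normCE (x : C) : `|x| = (Re `|x|)%:C.
Proof. by rewrite normc_def. Qed.

Lemma Re_normM (x y : C) : Re `|x * y| = Re `|x| * Re `|y|.
Proof. by rewrite normrM [X in X * _]normCE [X in _ * X]normCE -rmorphM. Qed.

Lemma Re_normD (x y : C) : Re `|x + y| <= Re `|x| + Re `|y|.
Proof. by have := ler_normD x y; rewrite lecE => /andP[_]; rewrite ReD. Qed.

Lemma tvariation_ge0 m E : (0 <= tvariation m E)%E.
Proof.
apply: ereal_sup_ubound; exists 0%N, (fun=> set0); split => //.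
- by move=> i j _ _ [x []].
- by move=> _; exact: sub0set.
- by rewrite big_geq.
Qed.

Lemma tvariation_linear (a : R[i]) m1 m2 E :
  (tvariation (fun A => a * m1 A + m2 A)%R E
    <= (Re `|a|)%:E * tvariation m1 E + tvariation m2 E)%E.
Proof.
apply: ge_ereal_sup => _ [n [F [mF tF FE ->]]].
apply: (@le_trans _ _ ((Re `|a|)%:E * (\sum_(0 <= i < n) Re `|m1 (F i)|)%:E
   + (\sum_(0 <= i < n) Re `|m2 (F i)|)%:E)%E).
  rewrite -EFinM -EFinD lee_fin mulr_sumr -big_split /=.
  by apply: ler_sum => i _; rewrite (le_trans (Re_normD _ _))// Re_normM.
apply: leeD; last by apply: ereal_sup_ubound; exists n, F.
apply: lee_wpmul2l; first by rewrite lee_fin Re_norm_ge0.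
by apply: ereal_sup_ubound; exists n, F.
Qed.

Lemma tvariation_le m E E' : E `<=` E' ->
  (tvariation m E <= tvariation m E')%E.
Proof.
move=> EE'; apply: ge_ereal_sup => _ [n [F [mF tF FE ->]]].
by apply: ereal_sup_ubound; exists n, F; split => // i x /FE /EE'.
Qed.

Lemma Re_le_norm (x : C) : `|Re x| <= Re `|x|.
Proof. by rewrite normc_def /= -sqrtr_sqr ler_sqrt ?lerDl ?addr_ge0 ?sqr_ge0. Qed.

Lemma Im_le_norm (x : C) : `|Im x| <= Re `|x|.
Proof. by rewrite normc_def /= -sqrtr_sqr ler_sqrt ?lerDr ?addr_ge0 ?sqr_ge0. Qed.

Lemma norm_le_ReIm (x : C) : Re `|x| <= `|Re x| + `|Im x|.
Proof.
rewrite -lecR -normCE {1}(complexE x) (le_trans (ler_normD _ _))//.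
rewrite normrM (_ : `|'i%C| = 1 :> R[i]) ?mul1r; last first.
  by rewrite normc_def /= expr0n expr1n add0r sqrtr1.
by rewrite !normc_def /= expr0n /= !addr0 !sqrtr_sqr rmorphD.
Qed.

Lemma cvg_Re (u : nat -> C) (l : C) :
  u @ \oo --> l -> (fun n => Re (u n)) @ \oo --> Re l.
Proof.
move=> /cvgrPdist_lt ul; apply/cvgrPdist_lt => e e0.
have := ul e%:C; rewrite ltcR => /(_ e0).
apply: filterS => n; rewrite normCE ltcR; apply: le_lt_trans.
by rewrite -ReB Re_le_norm.
Qed.

Lemma cvg_Im (u : nat -> C) (l : C) :
  u @ \oo --> l -> (fun n => Im (u n)) @ \oo --> Im l.
Proof.
move=> /cvgrPdist_lt ul; apply/cvgrPdist_lt => e e0.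
have := ul e%:C; rewrite ltcR => /(_ e0).
apply: filterS => n; rewrite normCE ltcR; apply: le_lt_trans.
by rewrite -ImB Im_le_norm.
Qed.



Definition re_charge m & is_complex_measure m : set T -> \bar R :=
  fun E => (Re (m E))%:E.
Definition im_charge m & is_complex_measure m : set T -> \bar R :=
  fun E => (Im (m E))%:E.

Section parts.
Variables (m : set T -> C) (mm : is_complex_measure m).

Let re0 : re_charge mm set0 = 0%E.
Proof. by rewrite /re_charge complex_measure0. Qed.

Let re_fin E : measurable E -> re_charge mm E \is a fin_num.
Proof. by []. Qed.

Let re_sigma : semi_sigma_additive (re_charge mm).
Proof.
move=> F mF tF _; rewrite /re_charge.
rewrite (_ : (fun n => _) =
    EFin \o (fun n => Re (\sum_(0 <= i < n) m (F i)))); last first.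
  apply/funext => n /=; rewrite sumEFin; congr EFin.
  by rewrite (big_morph Re ReD erefl).
apply: cvg_EFin; first exact: nearW.
by apply: cvg_Re; exact: complex_measure_sigma_additive.
Qed.

HB.instance Definition _ := isCharge.Build _ _ _ (re_charge mm)
  re0 re_fin re_sigma.

Let im0 : im_charge mm set0 = 0%E.
Proof. by rewrite /im_charge complex_measure0. Qed.

Let im_fin E : measurable E -> im_charge mm E \is a fin_num.
Proof. by []. Qed.

Let im_sigma : semi_sigma_additive (im_charge mm).
Proof.
move=> F mF tF _; rewrite /im_charge.
rewrite (_ : (fun n => _) =
    EFin \o (fun n => Im (\sum_(0 <= i < n) m (F i)))); last first.
  apply/funext => n /=; rewrite sumEFin; congr EFin.
  by rewrite (big_morph Im ImD erefl).
apply: cvg_EFin; first exact: nearW.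
by apply: cvg_Im; exact: complex_measure_sigma_additive.
Qed.

HB.instance Definition _ := isCharge.Build _ _ _ (im_charge mm)
  im0 im_fin im_sigma.

End parts.

Lemma charge_sum_bounded (nu : {charge set T -> \bar R}) :
  exists K : R, forall (F : nat -> set T) n, (forall i, measurable (F i)) ->
    trivIset setT F -> \sum_(0 <= i < n) `|fine (nu (F i))| <= K.
Proof.
have [P [N nuPN]] := Hahn_decomposition nu.
pose mu := [the {measure set T -> \bar R} of charge_variation nuPN].
pose ch := [the {charge set T -> \bar R} of charge_variation nuPN].
have fmu A : measurable A -> mu A \is a fin_num.
  by move=> mA; exact: (@fin_num_measure _ _ _ ch).
exists (fine (mu setT)) => F n mF tF.
rewrite -lee_fin fineK ?fmu// -sumEFin.
apply: (@le_trans _ _ (\sum_(0 <= i < n) mu (F i))%E).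
  apply: lee_sum => i _; rewrite -fine_abse ?fin_num_measure//.
  rewrite fineK ?abse_fin_num ?fin_num_measure//.
  exact: abse_charge_variation.
rewrite big_mkord -measure_bigsetU// le_measure ?inE//.
exact: bigsetU_measurable.
Qed.

Lemma tvariation_lty m E : is_complex_measure m -> (tvariation m E < +oo)%E.
Proof.
move=> mm.
have [K1 K1P] := charge_sum_bounded
  [the {charge set T -> \bar R} of re_charge mm].
have [K2 K2P] := charge_sum_bounded
  [the {charge set T -> \bar R} of im_charge mm].
apply: (@le_lt_trans _ _ (K1 + K2)%:E); last exact: ltry.
apply: ge_ereal_sup => _ [n [F [mF tF FE ->]]]; rewrite lee_fin.
apply: (le_trans _ (lerD (K1P F n mF tF) (K2P F n mF tF))).
by rewrite -big_split /=; apply: ler_sum => i _; exact: norm_le_ReIm.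
Qed.

Lemma tvariation_fin m E : is_complex_measure m -> tvariation m E \is a fin_num.
Proof.
by move=> mm; rewrite ge0_fin_numE ?tvariation_ge0 ?tvariation_lty.
Qed.

Lemma is_complex_measure_cst0 : is_complex_measure (fun=> 0).
Proof.
split => // F _ _.
by rewrite (_ : (fun n => _) = (fun=> 0)) ?funeqE => [|n]; [exact: cvg_cst|rewrite big1].
Qed.

Lemma is_complex_measure_linear (a : R[i]) m1 m2 :
  is_complex_measure m1 -> is_complex_measure m2 ->
  is_complex_measure (fun A => a * m1 A + m2 A)%R.
Proof.
move=> h1 h2; split.
- by move=> E nE; rewrite !complex_measure_out// mulr0 addr0.
- by rewrite !complex_measure0// mulr0 addr0.
- move=> F mF tF.
  rewrite (_ : (fun n => _) = (fun n => a *: (\sum_(0 <= i < n) m1 (F i) : C)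
     + (\sum_(0 <= i < n) m2 (F i) : C))); last first.
    by apply/funext => n; rewrite big_split /= -mulr_sumr.
  apply: cvgD; last exact: complex_measure_sigma_additive.
  by apply: cvgZr; exact: complex_measure_sigma_additive.
Qed.

(* The result does not depend on the chosen Hahn decomposition. *)
Definition charge_integral (nu : {charge set T -> \bar R}) (f : T -> R) : R :=
  let: exist P HP := cid (Hahn_decomposition nu) in
  let: exist N nuPN := cid HP in
  \int[jordan_pos nuPN]_x f x - \int[jordan_neg nuPN]_x f x.

Definition complex_integral m (mm : is_complex_measure m) (f : T -> C) : C :=
  let re := [the {charge set T -> \bar R} of re_charge mm] in
  let im := [the {charge set T -> \bar R} of im_charge mm] in
  (charge_integral re (Re \o f) - charge_integral im (Im \o f))
  +i* (charge_integral im (Re \o f) + charge_integral re (Im \o f)).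

End complex_measure.

Section measure_algebra.
Context (R : realType) (G : topologicalGroupType).
Local Notation C := (R[i]^o).
Implicit Types m : set (borel G) -> C.

(* Regularity of the finite measure |m|. *)
Definition is_regular m := forall E : set G, (measurable : set (set (borel G))) E ->
  forall e : R, 0 < e -> exists K U : set G,
    [/\ compact K, open U, K `<=` E, E `<=` U
      & (tvariation m (U `\` K) < e%:E)%E].

Definition regular_complex_measure : {pred set (borel G) -> C} :=
  mem [set m | is_complex_measure m /\ is_regular m].

Lemma regular_complex_measure_submod : submod_closed regular_complex_measure.
Proof.
split.
  rewrite inE; split; first exact: is_complex_measure_cst0.
  move=> E mE e e0; exists set0, setT; split => //.
  - exact: compact0.
  - exact: openT.
  - apply: (@le_lt_trans _ _ 0%E); last by rewrite lte_fin.
    apply: ge_ereal_sup => _ [n [F [_ _ _ ->]]].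
    by rewrite big1// => i _; rewrite normr0.
move=> a m1 m2; rewrite !inE => -[h1 r1] [h2 r2].
split; first exact: is_complex_measure_linear.
move=> E mE e e0.
have a1 : 0 < Re `|a| + 1 by rewrite ltr_wpDl ?Re_norm_ge0.
have [|K1 [U1 [cK1 oU1 K1E EU1 lt1]]] := r1 E mE (e / 2 / (Re `|a| + 1)).
  by rewrite !divr_gt0.
have [|K2 [U2 [cK2 oU2 K2E EU2 lt2]]] := r2 E mE (e / 2).
  by rewrite divr_gt0.
exists (K1 `|` K2), (U1 `&` U2); split.
- exact: compactU.
- exact: openI.
- by rewrite subUset.
- by rewrite subsetI.
- apply: le_lt_trans (tvariation_linear _ _ _ _) _.
  have l1 : (tvariation m1 ((U1 `&` U2) `\` (K1 `|` K2))
      < (e / 2 / (Re `|a| + 1))%:E)%E.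
    apply: le_lt_trans lt1; apply: tvariation_le.
    by move=> x [[? _] /not_orP[? _]].
  have l2 : (tvariation m2 ((U1 `&` U2) `\` (K1 `|` K2)) < (e / 2)%:E)%E.
    apply: le_lt_trans lt2; apply: tvariation_le.
    by move=> x [[_ ?] /not_orP[_ ?]].
  rewrite [e]splitr EFinD; apply: lee_ltD => //.
    by rewrite fin_numM// tvariation_fin.
  rewrite -(fineK (tvariation_fin _ h1)) -EFinM lee_fin.
  rewrite (@le_trans _ _ ((Re `|a| + 1) * (e / 2 / (Re `|a| + 1))))//; last first.
    by rewrite mulrC divfK// gt_eqF.
  apply: ler_pM; rewrite ?Re_norm_ge0 ?fine_ge0 ?tvariation_ge0 ?lerDl//.
  by rewrite -lee_fin fineK ?tvariation_fin// ltW.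
Qed.

HB.instance Definition _ := GRing.isSubmodClosed.Build _ _
  regular_complex_measure regular_complex_measure_submod.

Record measure_algebra := MeasureAlgebra {
  measure_algebra_val :> set (borel G) -> C ;
  measure_algebraP : measure_algebra_val \in regular_complex_measure }.

HB.instance Definition _ := [isSub for measure_algebra_val].
HB.instance Definition _ := [Choice of measure_algebra by <:].
HB.instance Definition _ := [SubChoice_isSubLmodule of measure_algebra by <:].

Lemma measure_algebra_complex_measure (m : measure_algebra) :
  is_complex_measure m.
Proof. by case: m => m /=; rewrite inE => -[]. Qed.

Definition tvnorm (m : measure_algebra) : R[i] := (fine (tvariation m setT))%:C.

Let tvfin (m : measure_algebra) : tvariation m setT \is a fin_num.
Proof. exact/tvariation_fin/measure_algebra_complex_measure. Qed.

Let tvnorm_linear (a : R[i]) (m1 m2 : measure_algebra) :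
  tvnorm (a *: m1 + m2) <= `|a| * tvnorm m1 + tvnorm m2.
Proof.
rewrite /tvnorm [X in X * _]normCE -rmorphM -rmorphD lecR.
rewrite -lee_fin EFinD EFinM !fineK//.
exact: tvariation_linear.
Qed.

Let tvnormD (m1 m2 : measure_algebra) :
  tvnorm (m1 + m2) <= tvnorm m1 + tvnorm m2.
Proof. by have := tvnorm_linear 1 m1 m2; rewrite scale1r normr1 mul1r. Qed.

Let tvnorm0 : tvnorm 0 = 0.
Proof.
rewrite /tvnorm (_ : tvariation _ _ = 0)%E//; apply/eqP.
rewrite eq_le tvariation_ge0 andbT.
apply: ge_ereal_sup => _ [n [F [_ _ _ ->]]].
by rewrite big1// => i _; rewrite normr0.
Qed.

Let tvnormZ_le (a : R[i]) (m : measure_algebra) :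
  tvnorm (a *: m) <= `|a| * tvnorm m.
Proof. by have := tvnorm_linear a m 0; rewrite !addr0 tvnorm0 addr0. Qed.

Let tvnormZ (a : R[i]) (m : measure_algebra) :
  tvnorm (a *: m) = `|a| * tvnorm m.
Proof.
have [->|a0] := eqVneq a 0; first by rewrite scale0r normr0 mul0r tvnorm0.
apply/le_anti; rewrite tvnormZ_le /=.
have := tvnormZ_le a^-1 (a *: m).
by rewrite scalerA mulVf// scale1r normfV ler_pdivlMl ?normr_gt0.
Qed.

Let tvnorm0_eq0 (m : measure_algebra) : tvnorm m = 0 -> m = 0.
Proof.
move=> m0; apply/val_inj/funext => E /=.
have mm := measure_algebra_complex_measure m.
have [mE|nE] := pselect (measurable E); last exact: complex_measure_out.
have tv0 : tvariation m setT = 0%E.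
  by rewrite -(fineK (tvfin m)); move: m0; rewrite /tvnorm => -[->].
have : ((Re `|measure_algebra_val m E|)%:E <= tvariation m setT)%E.
  apply: ereal_sup_ubound; exists 1%N, (fun i => if i is 0%N then E else set0).
  split => //; [by case| |by rewrite big_nat1].
  by apply/trivIsetP => -[|i] [|j]//= _ _ _; rewrite ?setI0 ?set0I.
rewrite tv0 lee_fin => m_le0.
have Re0 : Re `|measure_algebra_val m E| = 0.
  by apply/le_anti; rewrite m_le0 Re_norm_ge0.
by apply/eqP; rewrite -normr_eq0 [X in X == _]normCE Re0.
Qed.

HB.instance Definition _ := Lmodule_isNormed.Build R[i] measure_algebra
  tvnormD tvnormZ tvnorm0_eq0.

Record C0 := MkC0 {
  C0_val :> G -> C ;
  C0_continuous : continuous C0_val ;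
  C0_vanishing : forall e : R, 0 < e -> exists2 K : set G, compact K &
    forall x, ~ K x -> `|C0_val x| < e%:C }.

Definition C0_pairing (f : C0) (m : measure_algebra) : C :=
  complex_integral (measure_algebra_complex_measure m) f.

(* The convolution of m and n is the measure p such that
   \int f dp = \int\int f(xy) dm(x) dn(y) for all f in C_0(G); its existence and
   uniqueness (G locally compact Hausdorff) is the Riesz representation
   theorem. *)
Definition convolution (m n : measure_algebra) : measure_algebra :=
  xget 0 [set p | forall f : C0, C0_pairing f p =
    complex_integral (measure_algebra_complex_measure n) (fun y =>
      complex_integral (measure_algebra_complex_measure m) (fun x =>
        f (x * y)%g))].

End measure_algebra.

Section amenability.
Context (R : realType) (G : topologicalGroupType).
Local Notation C := (R[i]^o).
Local Notation mG := (measurable : set (set (borel G))).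

(* A left Haar measure, as a nonzero left-invariant Radon measure. *)
Record is_left_Haar (mu : {measure set (borel G) -> \bar R}) : Prop := {
  Haar_neq0 : (0 < mu setT)%E ;
  Haar_compact : forall K : set G, compact K -> (mu K < +oo)%E ;
  Haar_outer : forall E : set G, mG E ->
    mu E = ereal_inf [set mu U | U in [set U : set G | open U /\ E `<=` U]] ;
  Haar_inner : forall U : set G, open U ->
    mu U = ereal_sup [set mu K | K in [set K : set G | compact K /\ K `<=` U]] ;
  Haar_invariant : forall (x : G) (E : set G), mG E ->
    mu [set (x * y)%g | y in E] = mu E }.

Variable mu : {measure set (borel G) -> \bar R}.

(* G need not be sigma-finite for mu: L^\infty(G), the dual of L^1(G), consists of
   locally measurable functions bounded off a locally null set, modulo locally
   null sets. *)
Definition locally_measurable (f : G -> C) : Prop :=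
  forall F : set (borel G), mG F -> (mu F < +oo)%E ->
    measurable_fun F (fun x => Re (f x)) /\ measurable_fun F (fun x => Im (f x)).

Definition locally_null (N : set G) : Prop :=
  forall F : set (borel G), mG F -> (mu F < +oo)%E -> mu.-negligible (F `&` N).

Definition ess_bounded_by (f : G -> C) (K : R) : Prop :=
  locally_null [set x | K%:C < `|f x|].

Definition Linfty : set (G -> C) :=
  [set f | locally_measurable f /\ exists K : R, ess_bounded_by f K].

(* Functionals on L^\infty(G) are given by functions on all of G -> C, of which
   only the restriction to Linfty matters; mean_norm_le1 with K = 0 makes them
   insensitive to locally null sets, and with mean_one it says that the norm of
   m is m 1 = 1. *)
Record is_left_invariant_mean (m : (G -> C) -> C) : Prop := {
  mean_linear : forall (a : R[i]) (f g : G -> C), Linfty f -> Linfty g ->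
    m (a *: f + g) = a *: m f + m g ;
  mean_norm_le1 : forall (f : G -> C) (K : R), Linfty f -> 0 <= K ->
    ess_bounded_by f K -> `|m f| <= K%:C ;
  mean_one : m (fun=> 1) = 1 ;
  mean_left_invariant : forall (x : G) (f : G -> C), Linfty f ->
    m (fun y => f (x * y)%g) = m f }.

End amenability.

Definition amenable (R : realType) (G : topologicalGroupType) : Prop :=
  exists mu : {measure set (borel G) -> \bar R}, is_left_Haar mu /\
  exists m : (G -> R[i]^o) -> R[i]^o, is_left_invariant_mean mu m.

Section dual_Banach_algebra.
Context (R : realType).
Local Notation C := (R[i]^o).

(* The topology of pointwise convergence on E', for a pairing p of E' with E. *)
Definition wstar (E' : Type) (E : choiceType) (p : E' -> E -> C) : Type := E.
HB.instance Definition _ E' E p := Topological.copy (@wstar E' E p)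
  (@initial_topology E {ptws E' -> C} (fun x phi => p phi x)).

(* p identifies E isometrically with the Banach dual of E'. *)
Record is_dual (E' E : normedModType R[i]) (p : E' -> E -> C) : Prop := {
  dual_linearl : forall x, linear (p ^~ x) ;
  dual_linearr : forall phi, linear (p phi) ;
  dual_norm : forall x (K : R[i]), 0 <= K ->
    `|x| <= K <-> (forall phi, `|p phi x| <= K * `|phi|) ;
  dual_surjective : forall u : E' -> C, linear u -> continuous u ->
    exists x, forall phi, u phi = p phi x }.

Section algebra.
(* A dual Banach algebra A enters through its product and the pairing of its
   predual A' with A. *)
Variables (A : normedModType R[i]) (mul : A -> A -> A).
Variables (A' : Type) (pA : A' -> A -> C).

Record is_Banach_bimodule (E : normedModType R[i])
    (l : A -> E -> E) (r : E -> A -> E) : Prop := {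
  bimodule_linearl : forall x, linear (l ^~ x) /\ linear (r x) ;
  bimodule_linearr : forall a, linear (l a) /\ linear (r ^~ a) ;
  bimodule_mull : forall a b x, l (mul a b) x = l a (l b x) ;
  bimodule_mulr : forall a b x, r x (mul a b) = r (r x a) b ;
  bimodule_assoc : forall a b x, l a (r x b) = r (l a x) b ;
  bimodule_bounded : exists K : R[i], forall a x,
    `|l a x| <= K * `|a| * `|x| /\ `|r x a| <= K * `|a| * `|x| }.

Record is_normal (E' : Type) (E : normedModType R[i]) (pE : E' -> E -> C)
    (l : A -> E -> E) (r : E -> A -> E) : Prop := {
  normal_l : forall x, continuous (l ^~ x : wstar pA -> wstar pE) ;
  normal_r : forall x, continuous (r x : wstar pA -> wstar pE) ;
  normal_El : forall a, continuous (l a : wstar pE -> wstar pE) ;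
  normal_Er : forall a, continuous (r ^~ a : wstar pE -> wstar pE) }.

Definition Connes_amenable : Prop :=
  forall (E' E : completeNormedModType R[i]) (pE : E' -> E -> C)
    (l : A -> E -> E) (r : E -> A -> E),
    is_dual pE -> is_Banach_bimodule l r -> is_normal pE l r ->
  forall D : A -> E, linear D ->
    (exists K : R[i], forall a, `|D a| <= K * `|a|) ->
    (forall a b, D (mul a b) = l a (D b) + r (D a) b) ->
    continuous (D : wstar pA -> wstar pE) ->
  exists x, forall a, D a = l a x - r x a.

Definition L2_bounded_by (Phi : A -> A -> C) (K : R[i]) : Prop :=
  forall b c, `|Phi b c| <= K * `|b| * `|c|.

Definition L2_wstar : set (A -> A -> C) := [set Phi |
  [/\ forall b, linear (Phi b), forall c, linear (Phi ^~ c),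
      exists K, L2_bounded_by Phi K,
      forall b, continuous (Phi b : wstar pA -> C)
    & forall c, continuous (Phi ^~ c : wstar pA -> C)]].

(* The Banach dual of L2_wstar: as for means, only the values of M on L2_wstar
   matter. The least K such that L2_bounded_by Phi K is the norm of Phi. *)
Record is_L2_wstar_dual (M : (A -> A -> C) -> C) : Prop := {
  L2_dual_linear : forall (k : R[i]) Phi Psi, L2_wstar Phi -> L2_wstar Psi ->
    M (fun b c => k *: Phi b c + Psi b c) = k *: M Phi + M Psi ;
  L2_dual_bounded : exists L : R[i], forall Phi K, L2_wstar Phi -> 0 <= K ->
    L2_bounded_by Phi K -> `|M Phi| <= L * K }.

Definition L2_actl (a : A) (Phi : A -> A -> C) : A -> A -> C :=
  fun b c => Phi b (mul c a).
Definition L2_actr (Phi : A -> A -> C) (a : A) : A -> A -> C :=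
  fun b c => Phi (mul a b) c.

Definition dual_actl (a : A) (M : (A -> A -> C) -> C) : (A -> A -> C) -> C :=
  fun Phi => M (L2_actr Phi a).
Definition dual_actr (M : (A -> A -> C) -> C) (a : A) : (A -> A -> C) -> C :=
  fun Phi => M (L2_actl a Phi).

(* u is the image of M under Delta, an element of A seen as functional on A'. *)
Definition is_Delta (M : (A -> A -> C) -> C) (u : A) : Prop :=
  forall phi, pA phi u = M (fun b c => pA phi (mul b c)).

Definition is_normal_virtual_diagonal (M : (A -> A -> C) -> C) : Prop :=
  [/\ is_L2_wstar_dual M,
      forall a Phi, L2_wstar Phi -> dual_actl a M Phi = dual_actr M a Phi
    & exists2 u, is_Delta M u & forall a, mul a u = a].

End algebra.
End dual_Banach_algebra.

(* Main.v *)
(* (i) => (iii). Convexity (Day's argument) turns a mean into measures p of bounded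
   norm and mass 1 with delta_x * p close to p for x in a compact set. For q of mass
   1 concentrated near 1, the functionals that map Phi to the integral of
   Phi(delta_z * q, delta_(z^-1)) in dp(z) converge to a normal virtual diagonal
   along an ultrafilter.
   (iii) => (ii). A derivation D is implemented by the x in E with
   <phi, x> = M((b, c) |-> <phi, b D(c)>), up to a correction because M(G) need not
   act unitally on E.
   (ii) => (i). Let E be the dual of the space of bounded uniformly continuous
   functions F on G x G with F(s, r) small unless sr lies in a compact set, and let
   D(a)(F) be the integral of F(x, 1) in da(x). If D is implemented by u, then for
   every left uniformly continuous f
     k |-> f(1) k(1) - u((s, r) |-> (f(s) - f(1)) k(sr))
   is integration against a measure a_f, and delta_x * a_(f(x .)) = a_f * delta_x.
   Thus f |-> a_f(G) is a bounded left invariant functional with value 1 at 1; its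
   positive part, normalised, is a mean on the left uniformly continuous functions,
   and smoothing by a density extends this mean to L^oo(G). *)

From HB Require Import structures.
Require Import Defs.
From mathcomp Require Import all_boot all_order all_algebra.
From mathcomp Require Import complex ring lra.
From mathcomp Require Import all_classical all_reals all_analysis.
From mathcomp Require Import measurable_realfun.

Set Implicit Arguments.
Unset Strict Implicit.
Unset Printing Implicit Defensive.

Import Order.TTheory GRing.Theory Num.Theory.
Import numFieldNormedType.Exports.

Local Open Scope classical_set_scope.
Local Open Scope complex_scope.
Local Open Scope ring_scope.

(** * Urysohn functions and partitions of unity *)

(** A separately w*-continuous bilinear form need not be jointly continuous on pairs of point
    masses, but exchanging integrals requires joint continuity; smoothing one argument by [q]
    provides it. A normal bimodule needs x |-> u(F.x) in C_0(G) for every functional u, which can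
    fail on the space of all bounded uniformly continuous functions; the decay condition makes
    distant translates F.x live on disjoint regions, so that u can be large on few of them only. A
    uniformly continuous f does not itself decay, hence the auxiliary factor k in C_0(G);
    subtracting f(1) makes the actions send functions of this shape to functions of the same shape.
    Measures with norm continuous translates stand for L^1(G). Integrals of vector valued functions
    are handled by finite sums that approximate a whole equicontinuous family of scalar integrals at
    once. Norms are controlled up to constants only: a factor 4 comes from cutting a complex measure
    into four positive ones, and 16 and 64 are powers of it. *)

Definition vanishes_off (X : Type) (V : nmodType) (K : set X) (f : X -> V) :=
  forall x, ~ K x -> f x = 0.

Section bump_functions.
Context {R : realType} {X : ptopologicalType}.
Hypotheses (X_hausdorff : hausdorff_space X) (X_lc : locally_compact [set: X]).

Lemma continuous_prod_seq (I : Type) (s : seq I) (f : I -> X -> R) :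
  (forall i, continuous (f i)) -> continuous (fun x => \prod_(i <- s) f i x).
Proof.
move=> cf; elim: s => [|i s IH].
  rewrite (_ : (fun _ => _) = fun=> 1); first exact: cst_continuous.
  by apply/funext => x; rewrite big_nil.
rewrite (_ : (fun _ => _) = fun x => f i x * \prod_(j <- s) f j x); last first.
  by apply/funext => x; rewrite big_cons.
by move=> x; apply: cvgM; [exact: cf|exact: IH].
Qed.

(* Some is an embedding of X in its one-point compactification, where K and the
   complement of U can be separated because compact Hausdorff spaces are normal. *)
Lemma urysohn_compact_open (K U : set X) : compact K -> open U -> K `<=` U ->
  exists f : X -> R, [/\ continuous f, forall x, 0 <= f x <= 1,
    forall x, K x -> \forall y \near x, f y = 1
    & exists2 K', compact K' /\ K' `<=` U & vanishes_off K' f].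
Proof.
move=> cK oU KU; pose opc := one_point_compactification X.
have nopc : normal_space opc.
  apply: compact_normal.
    exact: one_point_compactification_hausdorff.
  exact: one_point_compactification_compact.
have clK : closed ([set Some x | x in K] : set opc).
  apply: compact_closed; first exact: one_point_compactification_hausdorff.
  apply: continuous_compact => //; apply: continuous_subspaceT.
  exact: one_point_compactification_some_continuous.
have oSU : open ([set Some x | x in U] : set opc).
  exact: one_point_compactification_open_some.
have /(normal_separatorP (R := R)) sep := nopc.
have clU : closed (~` ([set Some x | x in U] : set opc)).
  exact: open_closedC.
have KU0 : ~` ([set Some x | x in U] : set opc) `&` [set Some x | x in K] = set0.
  rewrite -subset0 => z [/= zU [x Kx xz]]; apply: zU.
  by exists x => //; exact: KU.
have := sep _ _ clU clK KU0.
move=> /(uniform_separatorP (R := R))[g [cg g01 gU gK]].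
pose h := fun x : X => g (Some x).
have ch : continuous h.
  move=> x; apply: (@continuous_comp X opc R Some g); last exact: cg.
  exact: one_point_compactification_some_continuous.
have hU x : ~ U x -> h x = 0.
  move=> nUx; apply: gU => /=; exists (Some x) => //= -[y Uy] [yx].
  by apply: nUx; rewrite -yx.
have hK x : K x -> h x = 1.
  by move=> Kx; apply: gK => /=; exists (Some x) => //=; exists x.
(* Cutting 3 h - 1 off to [0, 1] gives 1 wherever h > 2/3, hence near K, and 0 off the set h >= 1/3.
   That set is compact because g vanishes at the point at infinity. *)
exists (fun x => Num.min 1 (Num.max 0 (3 * h x - 1))); split.
- apply: min_fun_continuous; first exact: cst_continuous.
  apply: max_fun_continuous; first exact: cst_continuous.
  move=> x; apply: cvgB; last exact: cvg_cst.
  by apply: cvgM; [exact: cvg_cst|exact: ch].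
- move=> x; rewrite ge_min lexx /= le_min ler01 /=.
  by rewrite le_max lexx.
- move=> x Kx.
  have : \forall y \near x, 2 / 3 < h y.
    by apply: (cvgr_gt (h x)); [exact: ch|rewrite hK//; lra].
  apply: filterS => y hy; rewrite min_l// le_max; apply/orP; right; lra.
- pose K' := [set x | 1 / 3 <= h x].
  exists K'; last first.
    move=> x /= /negP; rewrite -ltNge => hx.
    by rewrite max_l ?min_r//; lra.
  split; last first.
    move=> x hx; apply: contrapT => /hU hx0.
    have : 1 / 3 <= h x by exact: hx.
    by rewrite hx0; lra.
  have g0 : g None = 0.
    by apply: gU => /=; exists None => //= -[].
  have : nbhs (None : opc) [set z | g z < 1 / 3].
    apply: (@cvgr_lt _ opc _ (nbhs_filter (None : opc)) g (g None) (cg None)).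
    by rewrite g0; lra.
  move=> [C [cC _]] Csub; apply: (subclosed_compact _ cC).
    apply: (@preimage_closed _ _ h [set r | 1 / 3 <= r]).
      by move=> x _; exact: ch.
    exact: closed_ge.
  move=> x hx; apply: contrapT => nCx.
  have h1 : g (Some x) < 1 / 3 by apply: Csub; left; exists x.
  have h2 : 1 / 3 <= g (Some x) by exact: hx.
  by move: h1 h2; lra.
Qed.

(** Bumps g_j equal to 1 on open sets covering K are combined as c_i = g_i prod_(j < i) (1 - g_j).
    The sums telescope to 1 - prod_j (1 - g_j), which is at most 1 and equals 1 as soon as one g_j
    does. *)
Lemma partition_of_unity (K : set X) (U : X -> set X) : compact K ->
  (forall x, K x -> open (U x) /\ U x x) ->
  exists (n : nat) (x : nat -> X) (c : nat -> X -> R),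
  [/\ forall i, (i < n)%N -> K (x i),
      forall i, continuous (c i),
      forall i y, 0 <= c i y,
      forall i, (i < n)%N ->
        exists2 K', compact K' /\ K' `<=` U (x i) & vanishes_off K' (c i)
    & (forall y, \sum_(i < n) c i y <= 1) /\
      (forall y, K y -> \sum_(i < n) c i y = 1)].
Proof.
move=> cK KU.
have /choice[g gP] : forall x, exists g : X -> R, [/\ continuous g,
    forall y, 0 <= g y <= 1, K x -> \forall y \near x, g y = 1
    & K x -> exists2 K', compact K' /\ K' `<=` U x & vanishes_off K' g].
  move=> x; have [Kx|nKx] := pselect (K x); last first.
    exists (fun=> 0); split => //; first exact: cst_continuous.
    by move=> y; rewrite lexx ler01.
  have [oU Uxx] := KU _ Kx.
  have [||g [cg g01 g1 gK]] := @urysohn_compact_open [set x] (U x) _ oU _.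
  - exact: compact_set1.
  - by move=> _ ->.
  - by exists g; split => // _; exact: g1.
have cK' : cover_compact K by rewrite -compact_cover.
have [||D DK KD] := cK' X K (fun x => [set y | g x y = 1]°).
- by move=> x _; exact: open_interior.
- by move=> x Kx; exists x => //; have [_ _ /(_ Kx)] := gP x.
pose s := finmap.enum_fset D.
have sK i : (i < size s)%N -> K (nth point s i).
  by move=> si; apply/set_mem/DK; rewrite /s mem_nth.
pose c i y := g (nth point s i) y * \prod_(j < i) (1 - g (nth point s j) y).
have prod01 i y : 0 <= \prod_(j < i) (1 - g (nth point s j) y).
  apply: prodr_ge0 => j _; rewrite subr_ge0.
  by have [_ /(_ y)/andP[]] := gP (nth point s j).
have sumc n y : \sum_(i < n) c i y = 1 - \prod_(j < n) (1 - g (nth point s j) y).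
  elim: n => [|n IH]; first by rewrite !big_ord0 subrr.
  by rewrite !big_ord_recr /= IH /c; ring.
exists (size s), (nth point s), c; split => //.
- move=> i x; apply: cvgM; first by have [+ _ _ _] := gP (nth point s i); exact.
  rewrite (_ : (fun y => _) = fun y => \prod_(j <- index_enum 'I_i)
    (fun k : 'I_i => fun y => 1 - g (nth point s k) y) j y)//.
  apply: continuous_prod_seq => k y; apply: cvgB; first exact: cvg_cst.
  by have [+ _ _ _] := gP (nth point s k); exact.
- move=> i y; apply: mulr_ge0 => //.
  by have [_ /(_ y)/andP[]] := gP (nth point s i).
- move=> i si; have [_ _ _ /(_ (sK _ si))[K' K'U K'g]] := gP (nth point s i).
  by exists K' => // y /K'g gy; rewrite /c gy mul0r.
- split=> y; first by rewrite sumc gerBl.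
  move=> /KD [x /= xD xy]; rewrite sumc.
  have gx : g x y = 1 by exact: (interior_subset xy).
  have xs : (index x s < size s)%N by rewrite index_mem.
  by rewrite (bigD1 (Ordinal xs)) //= nth_index// gx subrr mul0r subr0.
Qed.

End bump_functions.

(** * The Riesz representation theorem for positive functionals *)

Section compactly_supported.
Context {R : realType} {X : ptopologicalType}.
Implicit Types (f g : X -> R) (K U : set X).

Definition Cc : set (X -> R) :=
  [set f | continuous f /\ exists2 K, compact K & vanishes_off K f].

Lemma Cc0 : Cc (fun=> 0).
Proof.
split; first exact: cst_continuous.
by exists set0 => //; exact: compact0.
Qed.

Lemma Cc_linear (a : R) f g : Cc f -> Cc g -> Cc (fun x => a * f x + g x).
Proof.
move=> [cf [K cK fK]] [cg [L cL gL]]; split.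
  move=> x; apply: cvgD; last exact: cg.
  by apply: cvgM; [exact: cvg_cst|exact: cf].
exists (K `|` L); first exact: compactU.
by move=> x /not_orP[/fK -> /gL ->]; rewrite mulr0 addr0.
Qed.

Lemma CcD f g : Cc f -> Cc g -> Cc (fun x => f x + g x).
Proof.
move=> cf cg; have := Cc_linear 1 cf cg.
by under eq_fun do rewrite mul1r.
Qed.

Lemma CcZ (a : R) f : Cc f -> Cc (fun x => a * f x).
Proof.
move=> cf; have := Cc_linear a cf Cc0.
by under eq_fun do rewrite addr0.
Qed.

Lemma CcB f g : Cc f -> Cc g -> Cc (fun x => f x - g x).
Proof.
move=> cf cg; have := CcD cf (CcZ (-1) cg).
by under eq_fun do rewrite mulN1r.
Qed.

Lemma CcM f g : continuous f -> Cc g -> Cc (fun x => f x * g x).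
Proof.
move=> cf [cg [K cK gK]]; split.
  by move=> x; apply: cvgM; [exact: cf|exact: cg].
by exists K => // x /gK ->; rewrite mulr0.
Qed.

Lemma Cc_sum n (F : nat -> X -> R) : (forall i, (i < n)%N -> Cc (F i)) ->
  Cc (fun x => \sum_(i < n) F i x).
Proof.
elim: n => [|n IH] cF.
  by under eq_fun do rewrite big_ord0; exact: Cc0.
under eq_fun do rewrite big_ord_recr /=.
by apply: CcD; [apply: IH => i iltn; apply: cF; exact: ltnW|exact: cF].
Qed.

Lemma Cc_sum_cond n (P : pred nat) (F : nat -> X -> R) :
  (forall i, (i < n)%N -> Cc (F i)) ->
  Cc (fun x => \sum_(i < n | P i) F i x).
Proof.
move=> cF; under eq_fun do rewrite big_mkcond.
apply: (@Cc_sum n (fun i x => if P i then F i x else 0)) => i iltn.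
by case: (P i); [exact: cF|exact: Cc0].
Qed.

Lemma Cc_max0 f : Cc f -> Cc (fun x => Num.max 0 (f x)).
Proof.
move=> [cf [K cK fK]]; split.
  by apply: max_fun_continuous => //; exact: cst_continuous.
by exists K => // x /fK ->; rewrite maxxx.
Qed.

Lemma Cc_norm f : Cc f -> Cc (fun x => `|f x|).
Proof.
move=> [cf [K cK fK]]; split.
  by move=> x; apply: cvg_norm; exact: cf.
by exists K => // x /fK ->; rewrite normr0.
Qed.

Lemma Cc_bounded f : Cc f -> exists2 M : R, 0 <= M & forall x, `|f x| <= M.
Proof.
move=> [cf [K cK fK]].
have : compact ((fun x => `|f x|) @` K).
  apply: continuous_compact => //; apply: continuous_subspaceT.
  by move=> x; apply: cvg_norm; exact: cf.
move/compact_bounded => [M [_ MP]].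
exists (`|M| + 1); first by rewrite addr_ge0.
move=> x; have [Kx|/fK ->] := pselect (K x); last by rewrite normr0 addr_ge0.
have /= := MP (`|M| + 1) _ (`|f x|) (ex_intro2 _ _ x Kx erefl).
rewrite normr_id; apply.
by rewrite (le_lt_trans (ler_norm _))// ltrDl.
Qed.

Record positive_linear (I : (X -> R) -> R) : Prop := {
  pl_linear : forall (a : R) f g, Cc f -> Cc g ->
    I (fun x => a * f x + g x) = a * I f + I g ;
  pl_ge0 : forall f, Cc f -> (forall x, 0 <= f x) -> 0 <= I f }.

Section theory.
Variables (I : (X -> R) -> R) (I_pl : positive_linear I).

Lemma plD f g : Cc f -> Cc g -> I (fun x => f x + g x) = I f + I g.
Proof.
move=> cf cg; have := pl_linear I_pl 1 cf cg.
by under eq_fun do rewrite mul1r; rewrite mul1r.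
Qed.

Lemma pl0 : I (fun=> 0) = 0.
Proof.
have := plD Cc0 Cc0; under eq_fun do rewrite addr0.
by move/eqP; rewrite -subr_eq0 opprD addNKr oppr_eq0 => /eqP.
Qed.

Lemma plZ (a : R) f : Cc f -> I (fun x => a * f x) = a * I f.
Proof.
move=> cf; have := pl_linear I_pl a cf Cc0; rewrite pl0 addr0.
by under eq_fun do rewrite addr0.
Qed.

Lemma plB f g : Cc f -> Cc g -> I (fun x => f x - g x) = I f - I g.
Proof.
move=> cf cg; have := plD cf (CcZ (-1) cg).
by under eq_fun do rewrite mulN1r; rewrite plZ// mulN1r.
Qed.

Lemma pl_sum n (F : nat -> X -> R) : (forall i, (i < n)%N -> Cc (F i)) ->
  I (fun x => \sum_(i < n) F i x) = \sum_(i < n) I (F i).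
Proof.
elim: n => [|n IH] cF.
  by under eq_fun do rewrite big_ord0; rewrite big_ord0 pl0.
under eq_fun do rewrite big_ord_recr /=; rewrite plD/=.
- by rewrite big_ord_recr /= IH// => i iltn; apply: cF; exact: ltnW.
- by apply: Cc_sum => i iltn; apply: cF; exact: ltnW.
- exact: cF.
Qed.

Lemma pl_le f g : Cc f -> Cc g -> (forall x, f x <= g x) -> I f <= I g.
Proof.
move=> cf cg fg; rewrite -subr_ge0 -plB//; apply: (pl_ge0 I_pl).
  exact: CcB.
by move=> x; rewrite subr_ge0.
Qed.

End theory.

(* f < U in the notation of Folland and Rudin. *)
Definition subordinate U : set (X -> R) := [set f | [/\ Cc f,
  forall x, 0 <= f x <= 1 & exists2 K, compact K /\ K `<=` U & vanishes_off K f]].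

Lemma subordinate0 U : subordinate U (fun=> 0).
Proof.
split; [exact: Cc0|by move=> x; rewrite lexx ler01|].
by exists set0 => //; split; [exact: compact0|exact: sub0set].
Qed.

Lemma subordinate_subset U V : U `<=` V -> subordinate U `<=` subordinate V.
Proof.
move=> UV f [cf f01 [K [cK KU] fK]]; split => //.
by exists K => //; split => //; exact: subset_trans UV.
Qed.

End compactly_supported.

Arguments Cc {R X}.
Arguments subordinate {R X}.

(** * The outer measure of a positive functional *)

Section radon_measure.
Context {R : realType} {X : ptopologicalType}.
Hypotheses (X_hausdorff : hausdorff_space X) (X_lc : locally_compact [set: X]).
Variables (I : (X -> R) -> R) (I_pl : positive_linear I).
Implicit Types (f g : X -> R) (K U : set X).
Local Open Scope ereal_scope.

Definition radon_open U : \bar R :=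
  ereal_sup [set (I f)%:E | f in subordinate U].

Lemma radon_open_ge0 U : 0 <= radon_open U.
Proof.
apply: ereal_sup_ubound; exists (fun=> 0%R); last by rewrite (pl0 I_pl).
exact: subordinate0.
Qed.

Lemma le_radon_open U V : U `<=` V -> radon_open U <= radon_open V.
Proof.
move=> UV; apply: le_ereal_sup => _ [f fU <-]; exists f => //.
exact: subordinate_subset UV _ fU.
Qed.

Lemma subordinate_le_radon_open U f : subordinate U f ->
  (I f)%:E <= radon_open U.
Proof. by move=> fU; apply: ereal_sup_ubound; exists f. Qed.

(** A function subordinate to the union is multiplied by a partition of unity on its support, and
    the pieces are sorted by their centres: those centred in U are subordinate to U, the others to
    V. *)
Lemma radon_openU U V : open U -> open V ->
  radon_open (U `|` V) <= radon_open U + radon_open V.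
Proof.
move=> oU oV; apply: ge_ereal_sup => _ [f [cf f01 [K [cK KUV] fK]] <-].
pose W x := if pselect (U x) then U else V.
have [|n [x [c [xK cc c0 cW [csum c1]]]]] :=
    partition_of_unity (R := R) X_hausdorff X_lc (U := W) cK.
  move=> x Kx; rewrite /W; case: pselect => // nUx; split => //.
  by case: (KUV x Kx).
have cfc i : Cc (fun y => c i y * f y)%R by apply: CcM.
pose P i := `[< U (x i) >].
pose g (Q : pred nat) y := (\sum_(i < n | Q i) c i y * f y)%R.
have cg Q : Cc (g Q) by apply: (@Cc_sum_cond _ _ n Q (fun i y => c i y * f y)%R).
have fg : f = (fun y => g P y + g (predC P) y)%R.
  apply/funext => y; transitivity (\sum_(i < n) c i y * f y)%R.
    rewrite -mulr_suml.
    by have [/c1 ->|/fK ->] := pselect (K y); rewrite ?mul1r ?mulr0.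
  by rewrite (bigID (fun i : 'I_n => P i)).
have gsub (Q : pred nat) (T : set X) :
    (forall i, (i < n)%N -> Q i -> W (x i) = T) -> subordinate T (g Q).
  move=> WT; split => //.
    move=> y; have /andP[fy0 fy1] := f01 y; apply/andP; split.
      by apply: sumr_ge0 => i _; apply: mulr_ge0.
    apply: (@le_trans _ _ (\sum_(i < n) c i y)%R) => //.
    rewrite /g big_mkcond; apply: ler_sum => i _; case: (Q i) => //.
    by rewrite ler_piMr.
  have /choice[L LP] : forall i : nat, exists L, (i < n)%N -> Q i ->
      [/\ compact L, L `<=` T & vanishes_off L (c i)].
    move=> i; have [iltn|nin] := boolP (i < n)%N; last by exists set0.
    have [L [cL LW] Lc] := cW i iltn.
    by exists L => _ Qi; split => //; rewrite -(WT i).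
  exists (\big[setU/set0]_(i < n | Q i) L i).
    split.
      by apply: bigsetU_compact => i Qi; have [] := LP i (ltn_ord i) Qi.
    elim/big_ind : _ => [|A B AT BT|i Qi]; first exact: sub0set.
      by rewrite subUset.
    by have [] := LP i (ltn_ord i) Qi.
  move=> y Ly; rewrite /g big1// => i Qi.
  have [_ _ ->] := LP i (ltn_ord i) Qi; first by rewrite mul0r.
  by move=> Liy; apply: Ly; rewrite (bigD1 i)//=; left.
rewrite [in I _]fg (plD I_pl)// EFinD; apply: leeD.
- apply: subordinate_le_radon_open; apply: gsub => i iltn /asboolP Ui.
  by rewrite /W; case: pselect.
- apply: subordinate_le_radon_open; apply: gsub => i iltn /= /asboolP Ui.
  by rewrite /W; case: pselect.
Qed.

Lemma radon_open0 : radon_open set0 = 0.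
Proof.
apply/eqP; rewrite eq_le radon_open_ge0 andbT.
apply: ge_ereal_sup => _ [f [cf f01 fs] <-].
case: fs => K [_]; rewrite subset0 => -> f0; rewrite (_ : f = fun=> 0%R) ?(pl0 I_pl)//.
by apply/funext => x; exact: f0.
Qed.

Lemma radon_open_bigsetU (F : nat -> set X) n : (forall i, open (F i)) ->
  radon_open (\big[setU/set0]_(i < n) F i) <= \sum_(i < n) radon_open (F i).
Proof.
move=> oF; elim: n => [|n IH]; first by rewrite !big_ord0 radon_open0.
rewrite !big_ord_recr /=.
apply: le_trans (leeD IH (lexx _)); apply: radon_openU => //.
by elim/big_ind : _ => //; [exact: open0|exact: openU].
Qed.

(** A subordinate function has compact support, which finitely many of the sets already cover. *)
Lemma radon_open_bigcup (F : nat -> set X) : (forall i, open (F i)) ->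
  radon_open (\bigcup_i F i) <= \sum_(i <oo) radon_open (F i).
Proof.
move=> oF; apply: ge_ereal_sup => _ [f [cf f01 [K [cK KF] fK]] <-].
have cK' : cover_compact K by rewrite -compact_cover.
have [|//|D _ KD] := cK' nat setT F; first by [].
pose n := (\max_(i <- finmap.enum_fset D) i).+1.
have Kn : K `<=` \big[setU/set0]_(i < n) F i.
  move=> x /KD[i /= iD Fix]; rewrite -bigcup_mkord; exists i => //=.
  by rewrite ltnS; apply: leq_bigmax_seq.
have : subordinate (\big[setU/set0]_(i < n) F i) f by split => //; exists K.
move=> /subordinate_le_radon_open/le_trans; apply.
apply: (le_trans (radon_open_bigsetU n oF)).
rewrite -(big_mkord xpredT (fun i => radon_open (F i))).
by apply: nneseries_lim_ge => i _ _; exact: radon_open_ge0.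
Qed.

Definition radon_outer (A : set X) : \bar R :=
  ereal_inf [set radon_open U | U in [set U | open U /\ A `<=` U]].

Lemma radon_outer_ge0 A : 0 <= radon_outer A.
Proof. by apply: le_ereal_inf_tmp => _ [U _ <-]; exact: radon_open_ge0. Qed.

Lemma radon_outer_open U : open U -> radon_outer U = radon_open U.
Proof.
move=> oU; apply/eqP; rewrite eq_le; apply/andP; split.
  by apply: ereal_inf_lbound; exists U => //; split.
by apply: le_ereal_inf_tmp => _ [V [oV UV] <-]; exact: le_radon_open.
Qed.

Lemma radon_outer_le_open A U : open U -> A `<=` U ->
  radon_outer A <= radon_open U.
Proof. by move=> oU AU; apply: ereal_inf_lbound; exists U. Qed.

Let outer0 : radon_outer set0 = 0.
Proof. by rewrite radon_outer_open ?radon_open0//; exact: open0. Qed.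

Let le_outer : {homo radon_outer : A B / A `<=` B >-> A <= B}.
Proof.
move=> A B AB; apply: le_ereal_inf => _ [U [oU BU] <-]; exists U => //.
by split => //; exact: subset_trans BU.
Qed.

Let outer_sigma_subadditive : sigma_subadditive radon_outer.
Proof.
move=> F; apply/lee_addgt0Pr => e e0.
have /choice[U UP] : forall i, exists U, [/\ open U, F i `<=` U &
    radon_open U <= radon_outer (F i) + (e / (2 ^ i.+1)%:R)%:E].
  move=> i; have [Foo|Foo] := eqVneq (radon_outer (F i)) +oo.
    exists setT; split; [exact: openT|exact: subsetT|].
    by rewrite Foo addye// leey.
  have ffin : radon_outer (F i) \is a fin_num.
    by rewrite ge0_fin_numE ?radon_outer_ge0// lt_neqAle Foo leey.
  have [|_ [U [oU FU] <-] /ltW UF] := lb_ereal_inf_adherent _ ffin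
    (e := e / (2 ^ i.+1)%:R).
    by rewrite divr_gt0// ltr0n expn_gt0.
  by exists U.
apply: (@le_trans _ _ (radon_open (\bigcup_i U i))).
  apply: radon_outer_le_open.
    by apply: bigcup_open => i _; have [] := UP i.
  by apply: subset_bigcup => i _; have [] := UP i.
apply: (@le_trans _ _ (\sum_(i <oo) radon_open (U i))).
  by apply: radon_open_bigcup => i; have [] := UP i.
apply: le_trans (epsilon_trick xpredT _ (ltW e0)); last first.
  by move=> i; exact: radon_outer_ge0.
apply: lee_nneseries => [i _ _|i _]; first exact: radon_open_ge0.
by have [] := UP i.
Qed.

HB.instance Definition _ := isOuterMeasure.Build R X radon_outer
  outer0 radon_outer_ge0 le_outer outer_sigma_subadditive.

(** Let f be subordinate to the part of V inside U, with support K. Then V minus K is open and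
    contains V minus U, and f + g is subordinate to V for each g subordinate to V minus K, because
    the supports are disjoint. Suprema over f and g give the inequality. *)
Lemma open_caratheodory U : open U -> radon_outer.-caratheodory U.
Proof.
move=> oU; apply: le_caratheodory_measurable => A.
apply: le_ereal_inf_tmp => _ [V [oV AV] <-].
apply: (@le_trans _ _ (radon_open (V `&` U) + radon_outer (V `&` ~` U))).
  apply: leeD; first by apply: radon_outer_le_open; [exact: openI|exact: setSI].
  by apply: le_outer_measure; exact: setSI.
have [->|Voo] := eqVneq (radon_open V) +oo; first by rewrite leey.
have Vfin : radon_open V \is a fin_num.
  by rewrite ge0_fin_numE ?radon_open_ge0// lt_neqAle Voo leey.
have ofin W : W `<=` V -> radon_outer W \is a fin_num.
  move=> WV; rewrite ge0_fin_numE ?radon_outer_ge0//.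
  apply: (@le_lt_trans _ _ (radon_open V)); first exact: radon_outer_le_open.
  by rewrite -ge0_fin_numE// radon_open_ge0.
rewrite -leeBrDr; last by apply: ofin; exact: subIsetl.
apply: ge_ereal_sup => _ [f [cf f01 [K [cK KVU] fK]] <-].
rewrite leeBrDr; last by apply: ofin; exact: subIsetl.
have oVK : open (V `&` ~` K).
  by apply: openI => //; apply: closed_openC; exact: compact_closed.
apply: (@le_trans _ _ ((I f)%:E + radon_open (V `&` ~` K))).
  apply: leeD => //; apply: radon_outer_le_open => //.
  by move=> x [Vx nUx]; split => // /KVU [].
rewrite addeC -leeBrDr//.
apply: ge_ereal_sup => _ [g [cg g01 [L [cL LVK] gL]] <-].
rewrite leeBrDr// -EFinD -(plD I_pl)//; apply: subordinate_le_radon_open.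
split; first exact: CcD.
  move=> x; have /andP[fx0 fx1] := f01 x; have /andP[gx0 gx1] := g01 x.
  rewrite addr_ge0//=; have [Kx|/fK ->] := pselect (K x); last by rewrite addr0.
  by rewrite (gL x) ?add0r// => /LVK[].
exists (K `|` L).
  split; first exact: compactU.
  by rewrite subUset; split => x; [move=> /KVU[]|move=> /LVK[]].
by move=> x /not_orP[/fK -> /gL ->]; rewrite addr0.
Qed.

Local Notation borel := (g_sigma_algebraType (@open X)).

Lemma borel_caratheodory (A : set borel) : measurable A ->
  radon_outer.-caratheodory A.
Proof.
suff : <<s @open X >> `<=` radon_outer.-cara.-measurable by exact.
apply: smallest_sub => //; last by move=> U; exact: open_caratheodory.
exact: sigma_algebra_measurable.
Qed.

(* The hypotheses are arguments so that the measure structure can be inferred. *)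
Definition radon & hausdorff_space X & locally_compact [set: X]
  & positive_linear I : set borel -> \bar R := radon_outer.

Local Notation mu := (radon X_hausdorff X_lc I_pl).

Lemma le_radon : {homo mu : A B / A `<=` B >-> A <= B}.
Proof. exact: le_outer. Qed.

Lemma radon_subU A B : mu (A `|` B) <= mu A + mu B.
Proof. exact: (outer_measureU2 radon_outer). Qed.

Let radon0 : mu set0 = 0. Proof. exact: outer0. Qed.

Let radon_ge0 A : 0 <= mu A. Proof. exact: radon_outer_ge0. Qed.

Let radon_sigma_additive : semi_sigma_additive mu.
Proof.
move=> F mF tF mUF; apply: (@caratheodory_measure_sigma_additive R X radon_outer) => //.
- by move=> i; exact: borel_caratheodory.
- exact: borel_caratheodory.
Qed.

HB.instance Definition _ := isMeasure.Build _ _ _ mu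
  radon0 radon_ge0 radon_sigma_additive.

End radon_measure.

Section borel_sets.
Context {R : realType} {X : ptopologicalType}.
Local Notation borel := (g_sigma_algebraType (@open X)).

Lemma open_borel (U : set borel) : open (U : set X) -> measurable U.
Proof. by move=> oU; exact: sub_sigma_algebra. Qed.

Lemma closed_borel (F : set borel) : closed (F : set X) -> measurable F.
Proof.
by move=> cF; rewrite -(setCK F); apply: measurableC; apply: open_borel;
  exact: closed_openC.
Qed.

Lemma compact_borel (K : set borel) : hausdorff_space X ->
  compact (K : set X) -> measurable K.
Proof. by move=> hX cK; apply: closed_borel; exact: compact_closed. Qed.

Lemma continuous_borel (f : X -> R) :
  continuous f -> measurable_fun setT (f : borel -> R).
Proof.
move=> cf; apply: (measurability _ (RGenOpens.measurableE R)).
move=> _ [_ [a [b ->] <-]]; rewrite setTI; apply: open_borel.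
by move/continuousP : cf; apply; exact: interval_open.
Qed.

End borel_sets.

(** * Comparison of positive functionals through compact sets *)

Section compatible_functionals.
Context {R : realType} {X : ptopologicalType}.
Hypothesis X_hausdorff : hausdorff_space X.
Implicit Types (f g : X -> R) (K U : set X) (m : set X -> R).

Lemma Cc_comp (p : R -> R) f : continuous p -> p 0 = 0 -> Cc f ->
  Cc (fun x => p (f x)).
Proof.
move=> cp p0 [cf [K cK fK]]; split; last by exists K => // x /fK ->.
by move=> x; apply: continuous_comp; [exact: cf|exact: cp].
Qed.

(** The bounds that integration against [m] satisfies on functions above or below the indicator of a
    compact set. A positive functional and the integral against its Radon measure satisfy them with
    the same [m], which forces the two to agree. *)
Record compatible m (J : (X -> R) -> R) : Prop := {
  compatible_le : forall K f, compact K -> Cc f -> (forall x, 0 <= f x) ->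
    (forall x, K x -> 1 <= f x) -> m K <= J f ;
  compatible_ge : forall K f, compact K -> Cc f -> (forall x, 0 <= f x <= 1) ->
    vanishes_off K f -> J f <= m K }.

(** The part of t between the levels i d and (i + 1) d. *)
Let slice (d : R) (i : nat) (t : R) := Num.min (Num.max 0 (t - i%:R * d)) d.

Let slice_continuous d i : continuous (slice d i).
Proof.
apply: min_fun_continuous; last exact: cst_continuous.
apply: max_fun_continuous; first exact: cst_continuous.
by move=> x; apply: cvgB; [exact: cvg_id|exact: cvg_cst].
Qed.

Let slice0 d i : 0 < d -> slice d i 0 = 0.
Proof.
move=> d0; rewrite /slice sub0r max_l ?min_l ?(ltW d0)// oppr_le0.
by rewrite mulr_ge0// ltW.
Qed.

Let sum_slice d n t : 0 < d -> 0 <= t ->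
  \sum_(i < n) slice d i t = Num.min t (n%:R * d).
Proof.
move=> d0 t0; elim: n => [|n IH].
  by rewrite big_ord0 mul0r min_r.
rewrite big_ord_recr /= IH /slice -natr1 mulrDl mul1r.
have nd0 : 0 <= n%:R * d by rewrite mulr_ge0// ltW.
move: (n%:R * d) nd0 => a a0; have [ta|ta] := leP t a.
  rewrite max_l ?subr_le0// min_l ?(ltW d0)// addr0 min_l//.
  by rewrite (le_trans ta)// lerDl ltW.
rewrite max_r ?subr_ge0 ?(ltW ta)//; have [tad|tad] := leP (t - a) d.
  by rewrite min_l ?subrKC//; lra.
by rewrite min_r//; lra.
Qed.

(* Layer cake: f is a sum of slices, each of which is squeezed, up to the factor d,
   between the indicators of two consecutive superlevel sets. *)
Lemma compatible_le_functional m J1 J2 f :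
  positive_linear J1 -> positive_linear J2 ->
  compatible m J1 -> compatible m J2 ->
  Cc f -> (forall x, 0 <= f x) -> J1 f <= J2 f.
Proof.
move=> p1 p2 c1 c2 cf f0; have [cf' [K cK fK]] := cf.
have m0 L : compact L -> 0 <= m L.
  move=> cL; rewrite -(pl0 p1); apply: (compatible_ge c1) => //.
  - exact: Cc0.
  - by move=> x; rewrite lexx ler01.
have [M M0 fM] := Cc_bounded cf.
suff H d : 0 < d -> J1 f <= J2 f + d * m K.
  apply/ler_addgt0Pr => e e0.
  have mK1 : 0 < m K + 1 by rewrite ltr_wpDl// m0.
  apply: (le_trans (H (e / (m K + 1)) _)); first by rewrite divr_gt0.
  rewrite lerD2l mulrAC ler_pdivrMr//.
  by rewrite ler_pM2l// lerDl.
move=> d0; pose n := (Num.truncn (M / d)).+1.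
have nM : M <= n%:R * d.
  by rewrite -ler_pdivrMr// ltW// /n truncnS_gt.
pose s i x := slice d i (f x).
pose A i := [set x | i%:R * d <= f x] `&` K.
have cA i : compact (A i).
  apply: (subclosed_compact _ cK); last exact: subIsetr.
  apply: closedI; last by exact: compact_closed.
  apply: (@preimage_closed _ _ f [set r | i%:R * d <= r]).
    by move=> x _; exact: cf'.
  exact: closed_ge.
have cs i : Cc (s i) by apply: Cc_comp => //; rewrite slice0.
have fs : f = (fun x => \sum_(i < n) s i x).
  apply/funext => x; rewrite sum_slice// min_l//.
  by rewrite (le_trans _ nM)// (le_trans (ler_norm _)).
have csd i : Cc (fun x => d^-1 * s i x) by exact: CcZ.
have sl J i : positive_linear J -> compatible m J ->
    d * m (A i.+1) <= J (s i) <= d * m (A i).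
  move=> pJ cJ; have -> : J (s i) = d * J (fun x => d^-1 * s i x).
    by rewrite (plZ pJ)// mulrA divff ?mul1r// gt_eqF.
  have s0d x : 0 <= s i x <= d.
    rewrite /s /slice ge_min lexx orbT andbT le_min (ltW d0) andbT.
    by rewrite le_max lexx.
  have s01 x : 0 <= d^-1 * s i x <= 1.
    have /andP[s0 sd] := s0d x.
    by rewrite mulr_ge0 ?invr_ge0 ?(ltW d0)//= ler_pdivrMl// mulr1.
  apply/andP; split; rewrite ler_pM2l//.
    apply: (compatible_le cJ) => // x; first by have /andP[] := s01 x.
    move=> [/= ifx Kx]; rewrite ler_pdivlMl// mulr1 /s /slice.
    rewrite le_min lexx andbT le_max; apply/orP; right.
    by move: ifx; rewrite -natr1 mulrDl mul1r; lra.
  apply: (compatible_ge cJ) => // x.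
  move=> /not_andP[/= /negP|nKx]; last first.
    by rewrite /s (fK x)// slice0// mulr0.
  rewrite -ltNge => fxi; rewrite /s /slice max_l; last by lra.
  by rewrite min_l ?mulr0// ltW.
rewrite [in leLHS]fs [in leRHS]fs (pl_sum p1)// (pl_sum p2)//.
(* The upper sum for [J1] minus the lower sum for [J2] telescopes to at most d m(A 0), and A 0 is
   K. *)
rewrite -lerBlDl -sumrB.
apply: (@le_trans _ _ (\sum_(i < n) (d * m (A i) - d * m (A i.+1)))).
  apply: ler_sum => i _.
  have /andP[_ h1] := sl J1 i p1 c1; have /andP[h2 _] := sl J2 i p2 c2.
  by rewrite lerB.
rewrite -(big_mkord xpredT (fun i => d * m (A i) - d * m (A i.+1))).
under eq_bigr do rewrite -opprB; rewrite sumrN telescope_sumr// opprB.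
rewrite -[leRHS]subr0 lerB//; last by rewrite mulr_ge0 ?m0// ltW.
rewrite (_ : A 0%N = K)//; apply/seteqP; split=> [x []//|x Kx].
by split=> //=; rewrite mul0r.
Qed.

End compatible_functionals.

Section integration.
Context {R : realType} {X : ptopologicalType}.
Hypothesis X_hausdorff : hausdorff_space X.
Local Notation borel := (g_sigma_algebraType (@open X)).
Variable mu : {measure set borel -> \bar R}.
Hypothesis mu_compact : forall K : set X, compact K -> (mu K < +oo)%E.
Implicit Types (f g : X -> R).

Lemma Cc_integrable f : Cc f -> mu.-integrable setT (EFin \o (f : borel -> R)).
Proof.
move=> cf; have [M M0 fM] := Cc_bounded cf; have [cf' [K cK fK]] := cf.
have mK : measurable (K : set borel) by exact: compact_borel.
rewrite (_ : EFin \o f = (EFin \o f) \_ K); last first.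
  apply/funext => x; rewrite /patch; case: ifPn => // /negP; rewrite inE => nKx.
  by rewrite /= fK.
apply/(integrable_mkcond _ mK); apply: measurable_bounded_integrable => //.
- exact: mu_compact.
- by apply: measurable_funTS; exact: continuous_borel.
- exists M; split; first exact: num_real.
  by move=> B MB x _ /=; rewrite (le_trans (fM x))// ltW.
Qed.

Lemma integral_positive_linear :
  positive_linear (fun f => \int[mu]_x (f : borel -> R) x).
Proof.
split=> [a f g cf cg|f cf f0]; last by apply: Rintegral_ge0 => x _; exact: f0.
rewrite RintegralD//; first by rewrite RintegralZl//; exact: Cc_integrable.
- by apply: Cc_integrable; exact: CcZ.
- exact: Cc_integrable.
Qed.

Lemma integral_compatible : compatible (fun K => fine (mu K))
  (fun f => \int[mu]_x (f : borel -> R) x).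
Proof.
have ind K : compact K -> fine (mu K) = \int[mu]_x ((cst 1 : borel -> R) \_ K) x.
  move=> cK; have mK : measurable (K : set borel) by exact: compact_borel.
  by rewrite -Rintegral_mkcond Rintegral_cst// mul1r.
have iind K : compact K -> mu.-integrable setT (EFin \o ((cst 1 : borel -> R) \_ K)).
  move=> cK; have mK : measurable (K : set borel) by exact: compact_borel.
  rewrite (_ : EFin \o _ = (cst 1%E) \_ K); last first.
    by apply/funext => x; rewrite /patch /=; case: ifP.
  apply/(integrable_mkcond _ mK).
  rewrite (_ : cst 1%E = EFin \o cst 1%R)//.
  apply: measurable_bounded_integrable => //; first exact: mu_compact.
  exact: bounded_cst.
split=> K f cK cf.
  move=> f0 f1; rewrite ind//; apply: le_Rintegral => //.
  - exact: iind.
  - exact: Cc_integrable.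
  - by move=> x _; rewrite /patch; case: ifPn => //; rewrite inE => /f1.
move=> f01 fK; rewrite ind//; apply: le_Rintegral => //.
- exact: Cc_integrable.
- exact: iind.
- move=> x _; rewrite /patch; case: ifPn => [|/negP]; rewrite inE.
    by have /andP[] := f01 x.
  by move/fK => ->.
Qed.

End integration.

(** * Regularity of the Radon measure and recovery of the functional *)

Section radon_theory.
Context {R : realType} {X : ptopologicalType}.
Hypotheses (X_hausdorff : hausdorff_space X) (X_lc : locally_compact [set: X]).
Local Notation borel := (g_sigma_algebraType (@open X)).
Variables (I : (X -> R) -> R) (I_pl : positive_linear I).
Implicit Types (f g : X -> R) (K U : set X).

Local Notation mu := (radon X_hausdorff X_lc I_pl).

Lemma radon_open_measure U : open U -> mu U = radon_open I U.
Proof. exact: radon_outer_open. Qed.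

(** For t < 1 the open set where f > t contains K, and every function subordinate to it is below f /
    t. Then t tends to 1. *)
Lemma radon_compact_le K f : compact K -> Cc f -> (forall x, 0 <= f x) ->
  (forall x, K x -> 1 <= f x) -> (mu K <= (I f)%:E)%E.
Proof.
move=> cK cf f0 f1; have If0 : 0 <= I f by exact: (pl_ge0 I_pl).
have H t : 0 < t < 1 -> (mu K <= (t^-1 * I f)%:E)%E.
  move=> /andP[t0 t1]; pose U := [set x | t < f x].
  have oU : open U.
    have [cf' _] := cf; have /continuousP := cf'.
    by move=> /(_ [set r | t < r]); apply; exact: open_gt.
  apply: (@le_trans _ _ (radon_open I U)).
    apply: radon_outer_le_open => // x Kx; rewrite /U /=.
    by rewrite (lt_le_trans t1)// f1.
  apply: ge_ereal_sup => _ [g [cg g01 [L [cL LU] gL]] <-].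
  rewrite lee_fin -(plZ I_pl)//; apply: (pl_le I_pl) => //; first exact: CcZ.
  move=> x; have [Lx|/gL ->] := pselect (L x); last first.
    by rewrite mulr_ge0 ?f0// invr_ge0 ltW.
  have /andP[_ /le_trans] := g01 x; apply.
  by rewrite ler_pdivlMl// mulr1 ltW//; exact: LU.
apply/lee_addgt0Pr => e e0.
(* Chosen below 1 so that I f / t is at most I f + e, also when I f = 0. *)
pose t := (I f + e / 2) / (I f + e).
have Ife : 0 < I f + e by rewrite ltr_wpDl.
have t01 : 0 < t < 1.
  rewrite divr_gt0 ?ltr_wpDl// ?divr_gt0//= ltr_pdivrMr// mul1r ltrD2l.
  by rewrite ltr_pdivrMr// ltr_pMr// ltr1n.
apply: (le_trans (H t t01)); rewrite -EFinD lee_fin /t invf_div.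
rewrite mulrAC ler_pdivrMr ?ltr_wpDl ?divr_gt0//.
by rewrite ler_pM2l// lerDl divr_ge0// ltW.
Qed.

Lemma le_radon_compact K f : compact K -> Cc f -> (forall x, 0 <= f x <= 1) ->
  vanishes_off K f -> ((I f)%:E <= mu K)%E.
Proof.
move=> cK cf f01 fK; apply: le_ereal_inf_tmp => _ [U [oU KU] <-].
by apply: subordinate_le_radon_open; split => //; exists K.
Qed.

Lemma radon_compact K : compact K -> (mu K < +oo)%E.
Proof.
move=> cK; have [|f [cf f01 f1 [L [cL _] fL]]] :=
    urysohn_compact_open (R := R) X_hausdorff X_lc cK openT.
  exact: subsetT.
have cf' : Cc f by split => //; exists L.
apply: (@le_lt_trans _ _ (I f)%:E); last exact: ltry.
apply: radon_compact_le => // x; first by have /andP[] := f01 x.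
by move=> /f1/nbhs_singleton ->.
Qed.

Lemma radon_outer_regular (E : set X) :
  mu E = ereal_inf [set mu U | U in [set U : set X | open U /\ E `<=` U]].
Proof.
rewrite [LHS]/radon /radon_outer; congr ereal_inf; apply/seteqP.
by split=> _ [U [oU EU] <-]; exists U => //; rewrite radon_open_measure.
Qed.

Lemma radon_inner_regular U : open U ->
  mu U = ereal_sup [set mu K | K in [set K : set X | compact K /\ K `<=` U]].
Proof.
move=> oU; apply/eqP; rewrite eq_le; apply/andP; split; last first.
  apply: ge_ereal_sup => _ [K [cK KU] <-].
  exact: le_radon.
rewrite radon_open_measure//; apply: ge_ereal_sup => _ [f [cf f01 [K [cK KU] fK]] <-].
apply: (le_trans (le_radon_compact cK cf f01 fK)).
by apply: ereal_sup_ubound; exists K.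
Qed.

Lemma radon_compatible : compatible (fun K => fine (mu K)) I.
Proof.
have fin K : compact K -> mu K \is a fin_num.
  by move=> cK; rewrite ge0_fin_numE// radon_compact.
split=> K f cK cf f0 f1; rewrite -lee_fin fineK ?fin//.
- exact: radon_compact_le.
- exact: le_radon_compact.
Qed.

Lemma radon_integral f : Cc f -> \int[mu]_x (f : borel -> R) x = I f.
Proof.
move=> cf; have jp := @integral_positive_linear _ _ X_hausdorff mu radon_compact.
have jc := @integral_compatible _ _ X_hausdorff mu radon_compact.
have pos g : Cc g -> (forall x, 0 <= g x) -> \int[mu]_x (g : borel -> R) x = I g.
  move=> cg g0; apply/eqP; rewrite eq_le; apply/andP; split.
    exact: (compatible_le_functional X_hausdorff jp I_pl jc radon_compatible).
  exact: (compatible_le_functional X_hausdorff I_pl jp radon_compatible jc).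
have cNf : Cc (fun x => - f x).
  by have := CcZ (-1) cf; under eq_fun do rewrite mulN1r.
have -> : f = (fun x => Num.max 0 (f x) - Num.max 0 (- f x)).
  apply/funext => x; have [f0|f0] := leP 0 (f x).
    by rewrite max_l ?subr0// oppr_le0.
  by rewrite max_r ?sub0r ?opprK// oppr_ge0 ltW.
rewrite (plB jp) ?(plB I_pl)//; try exact: Cc_max0.
by rewrite !pos//; try exact: Cc_max0; move=> x; rewrite le_max lexx.
Qed.

Lemma radon_setT_le (B : R) :
  (forall f, Cc f -> (forall x, 0 <= f x <= 1) -> I f <= B) -> (mu setT <= B%:E)%E.
Proof.
move=> IB; rewrite radon_open_measure; last exact: openT.
by apply: ge_ereal_sup => _ [f [cf f01 _] <-]; rewrite lee_fin IB.
Qed.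

(** The compact set is L minus V, where L carries all but e/3 of the total mass and V is an open set
    around the complement of E, with excess below e/3; the outer set U has excess below e/3 as well.
    Finiteness of the measure allows passing to complements. *)
Lemma finite_radon_regular (E : set X) (e : R) : (mu setT < +oo)%E ->
  measurable (E : set borel) -> 0 < e ->
  exists K U : set X, [/\ compact K, open U, K `<=` E, E `<=` U
    & (mu (U `\` K) < e%:E)%E].
Proof.
move=> mufin mE e0; have e30 : 0 < e / 3 by rewrite divr_gt0.
have fin (A : set borel) : measurable A -> mu A \is a fin_num.
  move=> mA; rewrite ge0_fin_numE//; apply: le_lt_trans mufin.
  by apply: le_measure; rewrite ?inE.
have diff (A B : set borel) : measurable A -> measurable B -> A `<=` B ->
    (mu B < mu A + (e / 3)%:E)%E -> (mu (B `\` A) < (e / 3)%:E)%E.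
  move=> mA mB AB BA; rewrite measureD//; last by rewrite -ge0_fin_numE// fin.
  by rewrite setIidr// lteBlDl// fin.
have outer (A : set borel) : measurable A -> exists U : set X, [/\ open U, A `<=` U
    & (mu (U `\` A) < (e / 3)%:E)%E].
  move=> mA; have := fin A mA; rewrite {1}radon_outer_regular => Afin.
  have [_ [U [oU AU] <-]] := lb_ereal_inf_adherent e30 Afin.
  rewrite -radon_outer_regular => AUe; exists U; split => //.
  by apply: diff => //; exact: open_borel.
have [U [oU EU Ue]] := outer E mE.
have [V [oV EV Ve]] := outer (~` E) (measurableC mE).
have := fin setT measurableT.
rewrite {1}(radon_inner_regular openT) => Tfin.
have [_ [L [cL _] <-]] := ub_ereal_sup_adherent e30 Tfin.
rewrite -(radon_inner_regular openT) => TLe.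
have mL : measurable (L : set borel) by exact: compact_borel.
have mU : measurable (U : set borel) by exact: open_borel.
have mV : measurable (V : set borel) by exact: open_borel.
exists (L `&` ~` V), U; split => //.
- by apply: compact_closedI => //; exact: open_closedC.
- by move=> x [_ nVx]; apply: contrapT => nEx; apply: nVx; exact: EV.
apply: (@le_lt_trans _ _ (mu (U `\` E) + (mu (V `\` ~` E) + mu (~` L)))%E).
  apply: (@le_trans _ _ (mu ((U `\` E) `|` ((V `\` ~` E) `|` ~` L)))).
    apply: le_radon.
    move=> x [Ux /not_andP H]; have [Ex|nEx] := pselect (E x); last by left.
    right; case: H => [nLx|/contrapT Vx]; first by right.
    by left; split.
  apply: (le_trans (radon_subU _ _ _ _ _)).
  by apply: leeD => //; exact: radon_subU.
have Le : (mu (~` L) < (e / 3)%:E)%E.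
  rewrite -setTD; apply: diff => //.
  by rewrite -lteBlDr.
rewrite (_ : e = e / 3 + (e / 3 + e / 3)); last by lra.
by rewrite !EFinD; apply: lteD => //; apply: lteD.
Qed.

End radon_theory.

(** * Complex integration and functionals on C_0(G) *)

Section complex_modulus.
Context {R : realType}.
Implicit Types (z w : R[i]).

(** The norm of [R[i]] takes values in [R[i]]; estimates are carried out in [R], where the order is
    total. *)
Definition cabs z : R := complex.Re `|z|.

Lemma normr_cabs z : `|z| = (cabs z)%:C.
Proof. by rewrite /cabs normc_def. Qed.

Lemma cabs_ge0 z : 0 <= cabs z.
Proof. exact: Re_norm_ge0. Qed.

Lemma cabsM z w : cabs (z * w) = cabs z * cabs w.
Proof. exact: Re_normM. Qed.

Lemma cabsD z w : cabs (z + w) <= cabs z + cabs w.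
Proof. exact: Re_normD. Qed.

Lemma cabsN z : cabs (- z) = cabs z.
Proof. by rewrite /cabs normrN. Qed.

Lemma cabsBC z w : cabs (z - w) = cabs (w - z).
Proof. by rewrite -cabsN opprB. Qed.

Lemma cabsB z w : cabs (z - w) <= cabs z + cabs w.
Proof. by rewrite -[cabs w]cabsN; exact: cabsD. Qed.

Lemma cabs_dist z w v : cabs (z - v) <= cabs (z - w) + cabs (w - v).
Proof. by rewrite -(subrKA w) cabsD. Qed.

Lemma cabs0 : cabs 0 = 0.
Proof. by rewrite /cabs normr0. Qed.

Lemma cabs1 : cabs 1 = 1.
Proof. by rewrite /cabs normr1. Qed.

Lemma cabs_real (x : R) : cabs x%:C = `|x|.
Proof. by rewrite /cabs normc_def /= expr0n addr0 sqrtr_sqr. Qed.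

Lemma cabs_i : cabs 'i%C = 1.
Proof. by rewrite /cabs normc_def /= expr0n expr1n add0r sqrtr1. Qed.

Lemma cabs_eq0 z : (cabs z == 0) = (z == 0).
Proof.
by rewrite -(normr_eq0 z) normr_cabs -(inj_eq (@complexI R)).
Qed.

Lemma cabs_sum (I : Type) (s : seq I) (P : pred I) (F : I -> R[i]) :
  cabs (\sum_(i <- s | P i) F i) <= \sum_(i <- s | P i) cabs (F i).
Proof.
elim/big_ind2 : _ => [|x1 x2 y1 y2 h1 h2|//]; first by rewrite cabs0.
by rewrite (le_trans (cabsD _ _))// lerD.
Qed.

Lemma Re_le_cabs z : `|complex.Re z| <= cabs z. Proof. exact: Re_le_norm. Qed.

Lemma Im_le_cabs z : `|complex.Im z| <= cabs z. Proof. exact: Im_le_norm. Qed.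

Lemma cabs_le_ReIm z : cabs z <= `|complex.Re z| + `|complex.Im z|.
Proof. exact: norm_le_ReIm. Qed.

Lemma le_normr_cabs z (r : R) : (`|z| <= r%:C) = (cabs z <= r).
Proof. by rewrite normr_cabs lecR. Qed.

Lemma ltr_normr_cabs z (r : R) : (`|z| < r%:C) = (cabs z < r).
Proof. by rewrite normr_cabs ltcR. Qed.

(** Rotating by u reduces a bound on the modulus of a complex linear functional to a bound on its
    real part, without loss in the constant. *)
Lemma cabs_phase z : exists2 u, cabs u = 1 & u * z = (cabs z)%:C.
Proof.
have [->|z0] := eqVneq z 0; first by exists 1; rewrite ?cabs1// mulr0 cabs0.
have nz0 : (cabs z)%:C != 0 by rewrite -normr_cabs normr_eq0.
exists ((cabs z)%:C / z); last by rewrite divfK.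
have : cabs ((cabs z)%:C / z) * cabs z = cabs z.
  by rewrite -cabsM divfK// cabs_real ger0_norm// cabs_ge0.
have cz0 : cabs z != 0 by rewrite cabs_eq0.
by move=> /(congr1 (fun r => r / cabs z)); rewrite mulfK// divff.
Qed.

Lemma ReM z w :
  complex.Re (z * w) = complex.Re z * complex.Re w - complex.Im z * complex.Im w.
Proof. by case: z; case: w. Qed.

Lemma ImM z w :
  complex.Im (z * w) = complex.Re z * complex.Im w + complex.Im z * complex.Re w.
Proof. by case: z => a b; case: w => c d /=; rewrite [b * c]mulrC. Qed.

Lemma complex_ext z w :
  complex.Re z = complex.Re w -> complex.Im z = complex.Im w -> z = w.
Proof. by case: z => a b; case: w => c d /= -> ->. Qed.

End complex_modulus.

(** * Integration of bounded measurable functions against charges *)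

Section bounded_measurable.
Context {R : realType} d {T : measurableType d}.
Local Notation C := (R[i]^o).

Definition Rbm : set (T -> R) :=
  [set f : T -> R | measurable_fun setT f /\ exists M : R, forall x, `|f x| <= M].

Lemma Rbm_integrable (mu : {measure set T -> \bar R}) f :
  (mu setT < +oo)%E -> Rbm f -> mu.-integrable setT (EFin \o f).
Proof.
move=> mufin [mf [M fM]]; apply: measurable_bounded_integrable => //.
exists M; split; first exact: num_real.
by move=> B MB x _ /=; rewrite (le_trans (fM x))// ltW.
Qed.

Lemma Rbm_linear (a b : R) f g : Rbm f -> Rbm g -> Rbm (fun x => a * f x + b * g x).
Proof.
move=> [mf [M fM]] [mg [N gN]]; split.
  by apply: measurable_funD; apply: measurable_funM.
exists (`|a| * M + `|b| * N) => x.
by rewrite (le_trans (ler_normD _ _))// lerD// normrM ler_wpM2l.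
Qed.

Lemma Rintegral_linear (mu : {measure set T -> \bar R}) (a b : R) f g :
  (mu setT < +oo)%E -> Rbm f -> Rbm g ->
  \int[mu]_x (a * f x + b * g x) = a * \int[mu]_x f x + b * \int[mu]_x g x.
Proof.
move=> mufin bf bg.
have Z (c : R) h : Rbm h -> Rbm (fun x => c * h x).
  move=> bh; have := Rbm_linear c 0 bh bh.
  by under eq_fun do rewrite mul0r addr0.
have i c h : Rbm h -> mu.-integrable setT (EFin \o (fun x => c * h x)).
  by move=> bh; apply: Rbm_integrable => //; exact: Z.
rewrite RintegralD//; try exact: i.
by rewrite !RintegralZl//; exact: Rbm_integrable.
Qed.

Lemma Rintegral_le (mu : {measure set T -> \bar R}) f (s : R) (A : set T) :
  (mu setT < +oo)%E -> measurable A -> 0 <= s -> Rbm f ->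
  (forall x, `|f x| <= s) -> (forall x, ~ A x -> f x = 0) ->
  `|\int[mu]_x f x| <= s * fine (mu A).
Proof.
move=> mufin mA s0 bf fs fA.
apply: le_trans (le_normr_Rintegral measurableT (Rbm_integrable mufin bf)) _.
have -> : s * fine (mu A) = \int[mu]_x ((cst s : T -> R) \_ A) x.
  by rewrite -Rintegral_mkcond Rintegral_cst.
have bs : Rbm ((cst s : T -> R) \_ A).
  split; first by apply/(measurable_restrictT _ mA); exact: measurable_cst.
  exists s => x; rewrite /patch; case: ifP => _; last by rewrite normr0.
  by rewrite ger0_norm.
apply: le_Rintegral => //.
- apply: Rbm_integrable => //; case: bf => mf [M fM]; split.
    exact: measurableT_comp.
  by exists M => x; rewrite normr_id.
- exact: Rbm_integrable.
- move=> x _; rewrite /patch; case: ifPn => // /negP; rewrite inE.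
  by move=> /fA ->; rewrite normr0.
Qed.

Lemma charge_integralE (nu : {charge set T -> \bar R}) : exists P N,
  exists nuPN : hahn_decomposition nu P N, forall f,
  charge_integral nu f = \int[jordan_pos nuPN]_x f x - \int[jordan_neg nuPN]_x f x.
Proof.
rewrite /charge_integral; case: cid => P HP; case: cid => N nuPN.
by exists P, N, nuPN.
Qed.

Lemma jordan_finite (nu : {charge set T -> \bar R}) P N
    (nuPN : hahn_decomposition nu P N) :
  (jordan_pos nuPN setT < +oo)%E /\ (jordan_neg nuPN setT < +oo)%E.
Proof.
by split; rewrite -ge0_fin_numE//; exact: fin_num_measure.
Qed.

Lemma charge_integral_linear (nu : {charge set T -> \bar R}) (a b : R) f g :
  Rbm f -> Rbm g ->
  charge_integral nu (fun x => a * f x + b * g x) =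
  a * charge_integral nu f + b * charge_integral nu g.
Proof.
move=> bf bg; have [P [N [nuPN E]]] := charge_integralE nu.
have [p n] := jordan_finite nuPN.
by rewrite !E !Rintegral_linear//; ring.
Qed.

Lemma charge_integral_indic (nu : {charge set T -> \bar R}) (A : set T) :
  measurable A -> charge_integral nu (\1_A) = fine (nu A).
Proof.
move=> mA; have [P [N [nuPN ->]]] := charge_integralE nu.
have [p n] := jordan_finite nuPN.
have ind (mu : {measure set T -> \bar R}) : \int[mu]_x (\1_A x : R) = fine (mu A).
  by rewrite /Rintegral integral_indic// setIT.
rewrite !ind (jordan_decomp nuPN mA) /cadd /= cscaleN1 fineD ?fineN//.
- exact: (fin_num_measure (jordan_pos nuPN)).
- by rewrite fin_numN; exact: (fin_num_measure (jordan_neg nuPN)).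
Qed.

(** P and N form a Hahn decomposition, so the difference on the right is the mass of A for the
    variation of [nu]. In this form it can be compared with the supremum over disjoint families that
    defines [tvariation]. *)
Lemma charge_integral_le (nu : {charge set T -> \bar R}) : exists P N : set T,
  [/\ measurable P, measurable N, P `&` N = set0 & forall f (s : R) (A : set T),
  measurable A -> 0 <= s -> Rbm f ->
  (forall x, `|f x| <= s) -> (forall x, ~ A x -> f x = 0) ->
  `|charge_integral nu f| <= s * (fine (nu (A `&` P)) - fine (nu (A `&` N)))].
Proof.
have [P [N [nuPN E]]] := charge_integralE nu.
have [p n] := jordan_finite nuPN.
have [[mP _] [mN _] _ PN] := nuPN.
exists P, N; split => // f s A mA s0 bf fs fA.
rewrite E (le_trans (ler_normB _ _))// mulrDr; apply: lerD.
  apply: le_trans (Rintegral_le p mA s0 bf fs fA) _.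
  by rewrite -[X in fine X]/(jordan_pos nuPN A) jordan_posE cjordan_posE /crestr0 mem_set.
apply: le_trans (Rintegral_le n mA s0 bf fs fA) _.
by rewrite -[X in fine X]/(jordan_neg nuPN A) jordan_negE cjordan_negE /crestr0 mem_set// fineN.
Qed.

Definition Cbm : set (T -> C) := [set f : T -> C |
  Rbm (fun x => complex.Re (f x)) /\ Rbm (fun x => complex.Im (f x))].

Lemma Cbm_linear (a : R[i]) f g : Cbm f -> Cbm g -> Cbm (fun x => a * f x + g x).
Proof.
move=> [bf1 bf2] [bg1 bg2].
have one h : Rbm h -> h = (fun x => 1 * h x).
  by move=> _; apply/funext => x; rewrite mul1r.
split.
  under eq_fun do rewrite ReD ReM.
  have := Rbm_linear 1 1 (Rbm_linear (complex.Re a) (- complex.Im a) bf1 bf2) bg1.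
  by under eq_fun do rewrite !mul1r mulNr.
under eq_fun do rewrite ImD ImM.
have := Rbm_linear 1 1 (Rbm_linear (complex.Re a) (complex.Im a) bf2 bf1) bg2.
by under eq_fun do rewrite !mul1r.
Qed.

Lemma CbmD f g : Cbm f -> Cbm g -> Cbm (fun x => f x + g x).
Proof.
move=> bf bg; have := Cbm_linear 1 bf bg.
by under eq_fun do rewrite mul1r.
Qed.

Lemma Cbm_cst (c : C) : Cbm (fun=> c).
Proof.
split; split; try exact: measurable_cst.
- by exists (`|complex.Re c|).
- by exists (`|complex.Im c|).
Qed.

Lemma CbmZ (a : C) f : Cbm f -> Cbm (fun x => a * f x).
Proof.
move=> bf; have := Cbm_linear a bf (Cbm_cst 0).
by under eq_fun do rewrite addr0.
Qed.

Lemma CbmB f g : Cbm f -> Cbm g -> Cbm (fun x => f x - g x).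
Proof.
move=> bf bg; have := Cbm_linear (-1) bg bf.
by under eq_fun do rewrite mulN1r addrC.
Qed.

Lemma Cbm_sum n (F : nat -> T -> C) : (forall i, (i < n)%N -> Cbm (F i)) ->
  Cbm (fun x => \sum_(i < n) F i x).
Proof.
elim: n => [|n IH] cF.
  by under eq_fun do rewrite big_ord0; exact: Cbm_cst.
under eq_fun do rewrite big_ord_recr /=.
by apply: CbmD; [apply: IH => i iltn; apply: cF; exact: ltnW|exact: cF].
Qed.

Lemma Cbm_indic (A : set T) : measurable A -> Cbm (fun x => (\1_A x : R)%:C).
Proof.
move=> mA; split; split => //=; last by exists 0 => x; rewrite normr0.
  exact: measurable_indic.
by exists 1 => x; rewrite ger0_norm// indicE; case: (x \in A).
Qed.

Lemma Cbm_Re f : Cbm f -> Cbm (fun x => (complex.Re (f x))%:C).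
Proof.
by move=> [bf _]; split => //=; split; [exact: measurable_cst|exists 0 => x; rewrite normr0].
Qed.

Lemma Cbm_Im f : Cbm f -> Cbm (fun x => (complex.Im (f x))%:C).
Proof.
by move=> [_ bf]; split => //=; split; [exact: measurable_cst|exists 0 => x; rewrite normr0].
Qed.

Section functional.
Variable F : (T -> C) -> C.
Hypothesis F_linear : forall (a : C) f g, Cbm f -> Cbm g ->
  F (fun x => a * f x + g x) = a * F f + F g.
Variable K : R.
Hypothesis F_bounded : forall f (s : R), Cbm f -> (forall x, cabs (f x) <= s) ->
  cabs (F f) <= K * s.

Lemma bm_functional0 : F (fun=> 0) = 0.
Proof.
have := F_linear (-1) (Cbm_cst 0) (Cbm_cst 0).
under eq_fun do rewrite mulr0 addr0.
by rewrite mulN1r addNr.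
Qed.

Lemma bm_functional_sum n (G : nat -> T -> C) : (forall i, (i < n)%N -> Cbm (G i)) ->
  F (fun x => \sum_(i < n) G i x) = \sum_(i < n) F (G i).
Proof.
elim: n => [|n IH] cF.
  by under eq_fun do rewrite big_ord0; rewrite big_ord0 bm_functional0.
under eq_fun do rewrite big_ord_recr /= addrC.
have cG : Cbm (fun x => \sum_(i < n) G i x).
  by apply: Cbm_sum => i iltn; apply: cF; exact: ltnW.
have := F_linear 1 (cF n (leqnn _)) cG; under eq_fun do rewrite mul1r.
move=> ->; rewrite mul1r IH; last by move=> i iltn; apply: cF; exact: ltnW.
by rewrite big_ord_recr addrC.
Qed.

Hypothesis F_indic : forall A, measurable A -> F (fun x => (\1_A x : R)%:C) = 0.

Let F_real f : Rbm f -> F (fun x => (f x)%:C) = 0.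
Proof.
move=> bf; have [mf [M fM]] := bf.
have bfC : Cbm (fun x => (f x)%:C).
  by split => //=; split; [exact: measurable_cst|exists 0 => x; rewrite normr0].
have K0 : 0 <= K.
  have := F_bounded (f := fun=> 1) (s := 1) (Cbm_cst 1).
  rewrite mulr1 => h; apply: le_trans (h _); first exact: cabs_ge0.
  by move=> x; rewrite cabs1.
suff H (e : R) : 0 < e -> cabs (F (fun x => (f x)%:C)) <= K * e.
  apply/eqP; rewrite -cabs_eq0 eq_le cabs_ge0 andbT.
  apply/ler_addgt0Pr => r r0; rewrite add0r.
  have K1 : 0 < K + 1 by rewrite ltr_wpDl.
  apply: (le_trans (H (r / (K + 1)) _)); first by rewrite divr_gt0.
  by rewrite mulrA ler_pdivrMr// mulrC ler_pM2l// lerDl.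
move=> e0; pose n := (Num.truncn ((M + M) / e)).+1.
have M0 x : 0 <= f x + M by have := ler_normlP _ _ (fM x) => -[]; lra.
(* The level bands of width e of f, shifted by M so as to start at 0; the step function g takes the
   lower edge of f on each band, so f - g lies between 0 and e. *)
pose B i := [set x | i%:R * e <= f x + M < i.+1%:R * e].
have mB i : measurable (B i).
  have -> : B i = f @^-1` `[i%:R * e - M, i.+1%:R * e - M[%classic.
    by apply/seteqP; split=> x; rewrite /B /= in_itv /= lerBlDr ltrBrDr.
  by rewrite -[X in measurable X]setTI; apply: mf => //; exact: measurable_itv.
pose g x := \sum_(i < n) (i%:R * e - M)%:C * (\1_(B i) x : R)%:C.
have bg : Cbm g.
  apply: (@Cbm_sum n (fun i x => (i%:R * e - M)%:C * (\1_(B i) x : R)%:C)).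
  by move=> i _; apply: CbmZ; exact: Cbm_indic.
have Fg : F g = 0.
  rewrite (@bm_functional_sum n (fun i x => (i%:R * e - M)%:C * (\1_(B i) x : R)%:C)).
    rewrite big1// => i _.
    have := F_linear (i%:R * e - M)%:C (Cbm_indic (mB i)) (Cbm_cst 0).
    by under eq_fun do rewrite addr0; rewrite F_indic// bm_functional0 mulr0 addr0.
  by move=> i _; apply: CbmZ; exact: Cbm_indic.
have -> : F (fun x => (f x)%:C) = F (fun x => (f x)%:C - g x).
  have := F_linear (-1) bg bfC; rewrite Fg mulr0 add0r => <-.
  by congr F; apply/funext => x; rewrite mulN1r addrC.
apply: F_bounded; first exact: CbmB.
move=> x; pose k := Num.truncn ((f x + M) / e).
have /andP[k1 k2] : k%:R <= (f x + M) / e < k.+1%:R.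
  by apply: truncn_itv; rewrite divr_ge0// ltW.
have kn : (k < n)%N.
  rewrite ltnS; apply: le_truncn; rewrite ler_pM2r ?invr_gt0// lerD2r.
  by rewrite (le_trans (ler_norm _)).
have gx : g x = (k%:R * e - M)%:C.
  rewrite /g (bigD1 (Ordinal kn))//= indicE mem_set; last first.
    by rewrite /B /= -ler_pdivlMr// k1 -ltr_pdivrMr.
  rewrite mulr1 big1 ?addr0// => i /eqP ik.
  rewrite indicE memNset ?mulr0//; rewrite /B /= => /andP[h1 h2].
  apply: ik; apply/val_inj => /=; apply/eqP; rewrite eqn_leq.
  have := h1; rewrite -ler_pdivlMr// => /le_lt_trans/(_ k2).
  rewrite ltr_nat ltnS => ->/=.
  by have := h2; rewrite -ltr_pdivrMr// => /(le_lt_trans k1); rewrite ltr_nat ltnS.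
rewrite gx -rmorphB/= cabs_real ger0_norm.
  move: k2; rewrite ltr_pdivrMr// -natr1 mulrDl mul1r; lra.
by move: k1; rewrite ler_pdivlMr//; lra.
Qed.

(* Step functions are uniformly dense in the bounded measurable functions. *)
Lemma bm_functional_eq0 f : Cbm f -> F f = 0.
Proof.
move=> bf; have [bf1 bf2] := bf.
have -> : f = (fun x => 'i%C * (complex.Im (f x))%:C + (complex.Re (f x))%:C).
  by apply/funext => x; rewrite addrC; exact: complexE.
by rewrite F_linear ?F_real ?mulr0 ?addr0//; [exact: Cbm_Im|exact: Cbm_Re].
Qed.

End functional.

End bounded_measurable.

Section complex_integral_theory.
Context {R : realType} d {T : measurableType d}.
Local Notation C := (R[i]^o).
Variables (m : set T -> C) (mm : is_complex_measure m).

Lemma complex_integral_linear (a : C) (f g : T -> C) : Cbm f -> Cbm g ->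
  complex_integral mm (fun x => a * f x + g x) =
  a * complex_integral mm f + complex_integral mm g.
Proof.
move=> [f1 f2] [g1 g2].
pose re := [the {charge set T -> \bar R} of re_charge mm].
pose im := [the {charge set T -> \bar R} of im_charge mm].
have lin (nu : {charge set T -> \bar R}) (p q r : T -> R) (b c : R) :
    Rbm p -> Rbm q -> Rbm r -> charge_integral nu (fun x => b * p x + c * q x + r x) =
    b * charge_integral nu p + c * charge_integral nu q + charge_integral nu r.
  move=> bp bq br.
  have := charge_integral_linear nu 1 1 (Rbm_linear b c bp bq) br.
  under eq_fun do rewrite !mul1r.
  by rewrite !mul1r => ->; rewrite charge_integral_linear.
have reE : @complex.Re R \o (fun x => a * f x + g x) =
    (fun x => complex.Re a * complex.Re (f x) + (- complex.Im a) * complex.Im (f x)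
       + complex.Re (g x)).
  by apply/funext => x /=; rewrite ReD ReM mulNr.
have imE : @complex.Im R \o (fun x => a * f x + g x) =
    (fun x => complex.Re a * complex.Im (f x) + complex.Im a * complex.Re (f x)
       + complex.Im (g x)).
  by apply/funext => x /=; rewrite ImD ImM.
rewrite /complex_integral /= reE imE !lin//.
by apply: complex_ext; rewrite ?(ReD, ImD, ReM, ImM) /=; ring.
Qed.

Lemma complex_integral_indic (A : set T) : measurable A ->
  complex_integral mm (fun x => (\1_A x : R)%:C) = m A.
Proof.
move=> mA.
have c0 (nu : {charge set T -> \bar R}) : charge_integral nu (fun=> 0) = 0.
  have [mf b0] : @Rbm R d T (fun=> 0).
    by split; [exact: measurable_cst|exists 0 => x; rewrite normr0].
  have := charge_integral_linear nu 0 0 (conj mf b0) (conj mf b0).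
  by under eq_fun do rewrite !mul0r addr0; rewrite !mul0r addr0.
have reE : @complex.Re R \o (fun x => (\1_A x : R)%:C) = \1_A by apply/funext => x.
have imE : @complex.Im R \o (fun x => (\1_A x : R)%:C) = (fun=> 0) by apply/funext => x.
rewrite /complex_integral /= reE imE !c0 !charge_integral_indic// subr0 addr0 /=.
by apply: complex_ext.
Qed.

(** The real and imaginary parts of the measure against those of the function make four charge
    integrals. Each is at most s times the total variation on A, since the two sets of a Hahn
    decomposition form a disjoint family in A; hence the constant 4. *)
Lemma complex_integral_le (f : T -> C) (s : R) (A : set T) :
  measurable A -> 0 <= s -> Cbm f ->
  (forall x, cabs (f x) <= s) -> (forall x, ~ A x -> f x = 0) ->
  cabs (complex_integral mm f) <= 4 * s * fine (tvariation m A).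
Proof.
move=> mA s0 [f1 f2] fs fA.
pose tv := fine (tvariation m A).
have tvE : tvariation m A = tv%:E by rewrite /tv fineK// tvariation_fin.
have two (P N : set T) : measurable P -> measurable N -> P `&` N = set0 ->
    cabs (m (A `&` P)) + cabs (m (A `&` N)) <= tv.
  move=> mP mN PN; rewrite -lee_fin -tvE; apply: ereal_sup_ubound.
  exists 2%N, (fun i => if i is 0%N then A `&` P else
    if i is 1%N then A `&` N else set0); split.
  - by move=> [|[|i]] //; exact: measurableI.
  - apply/trivIsetP => -[|[|i]] [|[|j]] //= _ _ _; rewrite ?setI0 ?set0I//.
      by rewrite setIACA setIid PN setI0.
    by rewrite setIACA setIid setIC [N `&` P]setIC PN set0I.
  - by move=> [|[|i]] //; exact: subIsetl.
  - by rewrite !big_nat_recr//= big_geq// add0r.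
have bound (nu : {charge set T -> \bar R}) (p : R[i] -> R) (g : T -> R) :
    (forall z, `|p z| <= cabs z) -> (forall E, measurable E -> fine (nu E) = p (m E)) ->
    Rbm g -> (forall x, `|g x| <= cabs (f x)) -> `|charge_integral nu g| <= s * tv.
  move=> pc nup bg gf.
  have [P [N [mP mN PN H]]] := charge_integral_le nu.
  apply: (le_trans (H g s A mA s0 bg _ _)).
  - by move=> x; rewrite (le_trans (gf x)).
  - by move=> x /fA fx; apply/normr0_eq0/le_anti; rewrite normr_ge0 (le_trans (gf x))// fx cabs0.
  - rewrite ler_wpM2l//; apply: le_trans (two P N mP mN PN).
    rewrite !nup; [|exact: measurableI|exact: measurableI].
    rewrite lerD//; first by rewrite (le_trans (ler_norm _)).
    by rewrite (le_trans (ler_norm _))// normrN.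
rewrite (le_trans (cabs_le_ReIm _))// /complex_integral /=.
have reb g := bound [the {charge set T -> \bar R} of re_charge mm] (@complex.Re R) g
  (@Re_le_cabs R) (fun _ _ => erefl).
have imb g := bound [the {charge set T -> \bar R} of im_charge mm] (@complex.Im R) g
  (@Im_le_cabs R) (fun _ _ => erefl).
rewrite (_ : 4 * s * tv = (s * tv + s * tv) + (s * tv + s * tv)); last by ring.
apply: lerD.
- rewrite (le_trans (ler_normB _ _))// lerD//.
  + by apply: reb => // x; exact: Re_le_cabs.
  + by apply: imb => // x; exact: Im_le_cabs.
- rewrite (le_trans (ler_normD _ _))// lerD//.
  + by apply: imb => // x; exact: Re_le_cabs.
  + by apply: reb => // x; exact: Im_le_cabs.
Qed.

(** The tool for identifying an integral: a bounded linear functional with the right values on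
    indicators agrees with it, because the difference satisfies [bm_functional_eq0]. *)
Lemma complex_integral_unique (F : (T -> C) -> C) (K : R) :
  (forall (a : C) f g, Cbm f -> Cbm g ->
    F (fun x => a * f x + g x) = a * F f + F g) ->
  (forall f (s : R), Cbm f -> (forall x, cabs (f x) <= s) -> cabs (F f) <= K * s) ->
  (forall A, measurable A -> F (fun x => (\1_A x : R)%:C) = m A) ->
  forall f, Cbm f -> complex_integral mm f = F f.
Proof.
move=> Flin Fb Fm f bf; apply/eqP; rewrite -subr_eq0; apply/eqP.
apply: (@bm_functional_eq0 R d T (fun f => complex_integral mm f - F f) _
  (4 * fine (tvariation m setT) + K)) => //.
- by move=> a p q bp bq; rewrite complex_integral_linear// Flin//; ring.
- move=> g s bg gs; rewrite (le_trans (cabsB _ _))// mulrDl lerD//; last exact: Fb.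
  have s0 : 0 <= s by rewrite (le_trans _ (gs point))// cabs_ge0.
  by rewrite (mulrAC 4); apply: (@complex_integral_le g s setT) => // x /(_ I).
- by move=> A mA; rewrite complex_integral_indic// Fm// subrr.
Qed.

End complex_integral_theory.

Lemma cvg_complex {R : realType} {T : Type} (F : set_system T) {FF : Filter F}
    (u : T -> R[i]^o) (l : R[i]^o) :
  (fun t => complex.Re (u t)) @ F --> complex.Re l ->
  (fun t => complex.Im (u t)) @ F --> complex.Im l -> u @ F --> l.
Proof.
move=> ur ui; apply/cvgrPdist_lt => e.
rewrite ltcE /= => /andP[/eqP e2 e1].
have -> : e = (complex.Re e)%:C by case: e e2 {e1} => a b /= ->.
have e20 : 0 < complex.Re e / 2 by rewrite divr_gt0.
move/cvgrPdist_lt : ur => /(_ _ e20); move/cvgrPdist_lt : ui => /(_ _ e20).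
apply: filterS2 => t ti tr; rewrite ltr_normr_cabs.
apply: (le_lt_trans (cabs_le_ReIm _)).
by rewrite ReB ImB [ltRHS]splitr ltrD.
Qed.

(** * Complex measures assembled from four finite measures *)

Section four_measures.
Context {R : realType} d {T : measurableType d}.
Local Notation C := (R[i]^o).
Variable mu : 'I_4 -> {measure set T -> \bar R}.
Hypothesis mu_fin : forall i, (mu i setT < +oo)%E.

(** The value 0 off the sigma-algebra is the normalisation required by [is_complex_measure]. *)
Definition four_measures (E : set T) : C :=
  if `[< measurable E >] then
    (fine (mu (inord 0) E) - fine (mu (inord 1) E))
    +i* (fine (mu (inord 2) E) - fine (mu (inord 3) E)) else 0.

Lemma four_measuresE E : measurable E -> four_measures E =
  (fine (mu (inord 0) E) - fine (mu (inord 1) E))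
    +i* (fine (mu (inord 2) E) - fine (mu (inord 3) E)).
Proof. by move=> mE; rewrite /four_measures asboolT. Qed.

Let fin i E : measurable E -> mu i E \is a fin_num.
Proof.
move=> mE; rewrite ge0_fin_numE//; apply: le_lt_trans (mu_fin i).
by apply: le_measure; rewrite ?inE.
Qed.

Let cvg_fine i (F : nat -> set T) : (forall j, measurable (F j)) ->
  trivIset setT F ->
  (fun n => \sum_(0 <= j < n) fine (mu i (F j))) @ \oo --> fine (mu i (\bigcup_j F j)).
Proof.
move=> mF tF.
have mU : measurable (\bigcup_j F j) by exact: bigcup_measurable.
have := @measure_semi_sigma_additive _ _ _ (mu i) F mF tF mU.
rewrite -{1}(fineK (fin i mU)) => /fine_cvg; apply: cvg_trans.
apply: near_eq_cvg; apply: nearW => n /=.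
by rewrite sum_fine// => j _; exact: fin.
Qed.

Lemma four_measures_complex : is_complex_measure four_measures.
Proof.
split.
- by move=> E nE; rewrite /four_measures asboolF.
- by rewrite four_measuresE// !measure0 /= !subrr.
- move=> F mF tF.
  have mU : measurable (\bigcup_j F j) by exact: bigcup_measurable.
  have E n : \sum_(0 <= j < n) four_measures (F j) =
     (\sum_(0 <= j < n) fine (mu (inord 0) (F j))
       - \sum_(0 <= j < n) fine (mu (inord 1) (F j)))
     +i* (\sum_(0 <= j < n) fine (mu (inord 2) (F j))
       - \sum_(0 <= j < n) fine (mu (inord 3) (F j))).
    elim: n => [|n IH]; first by rewrite !big_geq// !subr0.
    rewrite !big_nat_recr//= IH four_measuresE//.
    by apply: complex_ext; rewrite ?(ReD, ImD) /=; ring.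
  rewrite four_measuresE//.
  under eq_fun do rewrite E.
  by apply: cvg_complex => /=; apply: cvgB; exact: cvg_fine.
Qed.

Lemma cabs_four_measures E : measurable E ->
  cabs (four_measures E) <= \sum_(i < 4) fine (mu i E).
Proof.
move=> mE; rewrite four_measuresE//.
apply: (le_trans (cabs_le_ReIm _)) => /=.
have ge0 i : 0 <= fine (mu i E) by rewrite fine_ge0.
have -> : \sum_(i < 4) fine (mu i E) = fine (mu (inord 0) E) + fine (mu (inord 1) E)
   + (fine (mu (inord 2) E) + fine (mu (inord 3) E)).
  rewrite !big_ord_recl big_ord0 addr0 !addrA.
  by do !congr (_ + _); congr (fine (mu _ _)); apply/val_inj; rewrite /= inordK.
by apply: lerD; rewrite (le_trans (ler_normB _ _))// !ger0_norm.
Qed.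

Lemma tvariation_four_measures E : measurable E ->
  (tvariation four_measures E <= \sum_(i < 4) mu i E)%E.
Proof.
move=> mE; apply: ge_ereal_sup => _ [n [F [mF tF FE ->]]].
have -> : (\sum_(i < 4) mu i E = (\sum_(i < 4) fine (mu i E))%:E)%E.
  by rewrite -sumEFin; apply: eq_bigr => i _; rewrite fineK// fin.
rewrite lee_fin.
apply: (@le_trans _ _ (\sum_(0 <= j < n) \sum_(i < 4) fine (mu i (F j)))).
  by apply: ler_sum => j _; exact: cabs_four_measures.
rewrite exchange_big /=; apply: ler_sum => i _.
rewrite -lee_fin fineK ?fin// -sumEFin.
apply: (@le_trans _ _ (\sum_(0 <= j < n) mu i (F j))%E).
  by apply: lee_sum => j _; rewrite fineK// fin.
rewrite big_mkord -measure_bigsetU//.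
apply: le_measure; rewrite ?inE//; first exact: bigsetU_measurable.
elim/big_ind : _ => // A B AE BE; by rewrite subUset.
Qed.

Let J i (f : T -> C) : C :=
  (\int[mu i]_x complex.Re (f x)) +i* (\int[mu i]_x complex.Im (f x)).

Lemma four_measures_integral f : Cbm f ->
  complex_integral four_measures_complex f =
  (J (inord 0) f - J (inord 1) f) + 'i%C * (J (inord 2) f - J (inord 3) f).
Proof.
have Jlin i (a : C) (g h : T -> C) : Cbm g -> Cbm h ->
    J i (fun x => a * g x + h x) = a * J i g + J i h.
  move=> [g1 g2] [h1 h2].
  have lin (p q r : T -> R) (b c : R) : Rbm p -> Rbm q -> Rbm r ->
      \int[mu i]_x (b * p x + c * q x + r x) =
      b * \int[mu i]_x p x + c * \int[mu i]_x q x + \int[mu i]_x r x.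
    move=> bp bq br.
    have := Rintegral_linear 1 1 (mu_fin i) (Rbm_linear b c bp bq) br.
    rewrite !mul1r.
    have -> : (fun x => 1 * (b * p x + c * q x) + 1 * r x) =
        (fun x => b * p x + c * q x + r x) by apply/funext => x; rewrite !mul1r.
    by move=> ->; rewrite Rintegral_linear.
  rewrite /J.
  have -> : (fun x => complex.Re (a * g x + h x)) = (fun x => complex.Re a *
      complex.Re (g x) + (- complex.Im a) * complex.Im (g x) + complex.Re (h x)).
    by apply/funext => x; rewrite ReD ReM mulNr.
  have -> : (fun x => complex.Im (a * g x + h x)) = (fun x => complex.Re a *
      complex.Im (g x) + complex.Im a * complex.Re (g x) + complex.Im (h x)).
    by apply/funext => x; rewrite ImD ImM.
  by rewrite !lin//; apply: complex_ext; rewrite ?(ReD, ImD, ReM, ImM) /=; ring.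
have Jb i (g : T -> C) (s : R) : Cbm g -> (forall x, cabs (g x) <= s) ->
    cabs (J i g) <= 2 * fine (mu i setT) * s.
  move=> [g1 g2] gs; have s0 : 0 <= s by rewrite (le_trans _ (gs point))// cabs_ge0.
  apply: (le_trans (cabs_le_ReIm _)) => /=.
  rewrite (_ : 2 * _ * s = s * fine (mu i setT) + s * fine (mu i setT)); last by ring.
  apply: lerD.
    apply: Rintegral_le => // x; first by rewrite (le_trans (Re_le_cabs _)).
    by move=> /(_ I).
  apply: Rintegral_le => // x; first by rewrite (le_trans (Im_le_cabs _)).
  by move=> /(_ I).
pose k n := 2 * fine (mu (inord n) setT).
apply: (@complex_integral_unique _ _ _ _ four_measures_complex
  (fun g => (J (inord 0) g - J (inord 1) g) + 'i%C * (J (inord 2) g - J (inord 3) g))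
  ((k 0 + k 1) + (k 2 + k 3))).
- by move=> a g h bg bh; rewrite !Jlin//; ring.
- move=> g s bg gs; rewrite mulrDl (le_trans (cabsD _ _))// lerD//.
    by rewrite mulrDl (le_trans (cabsB _ _))// lerD//; exact: Jb.
  rewrite cabsM cabs_i mul1r mulrDl (le_trans (cabsB _ _))//.
  by rewrite lerD//; exact: Jb.
- move=> A mA; rewrite four_measuresE//.
  have Ji i : J i (fun x => (\1_A x : R)%:C) = (fine (mu i A))%:C.
    apply: complex_ext => /=; last by rewrite Rintegral_cst// mul0r.
    by rewrite /Rintegral integral_indic// setIT.
  by rewrite !Ji; apply: complex_ext; rewrite ?(ReD, ImD, ReM, ImM) /=; ring.
Qed.

End four_measures.

(** * Positive parts of functionals on function lattices *)

Section function_lattice.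
Context {R : realType} {X : Type}.
Implicit Types (f g h : X -> R).

Record function_lattice (L : set (X -> R)) : Prop := {
  fl_linear : forall (a : R) f g, L f -> L g -> L (fun x => a * f x + g x) ;
  fl_zero : L (fun=> 0) ;
  fl_max0 : forall f, L f -> L (fun x => Num.max 0 (f x)) }.

Variables (L : set (X -> R)) (HL : function_lattice L).

Lemma flD f g : L f -> L g -> L (fun x => f x + g x).
Proof.
move=> lf lg; have := fl_linear HL 1 lf lg.
by under eq_fun do rewrite mul1r.
Qed.

Lemma flZ (a : R) f : L f -> L (fun x => a * f x).
Proof.
move=> lf; have := fl_linear HL a lf (fl_zero HL).
by under eq_fun do rewrite addr0.
Qed.

Lemma flN f : L f -> L (fun x => - f x).
Proof.
move=> lf; have := flZ (-1) lf.
by under eq_fun do rewrite mulN1r.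
Qed.

Lemma flB f g : L f -> L g -> L (fun x => f x - g x).
Proof. by move=> lf lg; apply: flD => //; exact: flN. Qed.

Lemma fl_min f g : L f -> L g -> L (fun x => Num.min (f x) (g x)).
Proof.
move=> lf lg; have := flB lg (fl_max0 HL (flB lg lf)).
rewrite (_ : (fun x => g x - _) = fun x => Num.min (f x) (g x))//.
by apply/funext => x; have [fg|fg] := leP (f x) (g x);
  [rewrite max_r ?subr_ge0//; lra|rewrite max_l ?subr0// subr_le0 ltW].
Qed.

Lemma posneg f : f = (fun x => Num.max 0 (f x) - Num.max 0 (- f x)).
Proof.
apply/funext => x; have [f0|f0] := leP 0 (f x).
  by rewrite max_l ?subr0// oppr_le0.
by rewrite max_r ?sub0r ?opprK// oppr_ge0 ltW.
Qed.

Lemma max0_ge0 f x : 0 <= Num.max 0 (f x).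
Proof. by rewrite le_max lexx. Qed.

Definition linear_on (p : (X -> R) -> R) := forall (a : R) f g, L f -> L g ->
  p (fun x => a * f x + g x) = a * p f + p g.

(* An additive, positively homogeneous functional on the positive cone extends
   linearly through f = f^+ - f^-. *)
Lemma cone_extension (q : (X -> R) -> R) :
  (forall f g, L f -> L g -> (forall x, 0 <= f x) -> (forall x, 0 <= g x) ->
    q (fun x => f x + g x) = q f + q g) ->
  (forall (c : R) f, 0 <= c -> L f -> (forall x, 0 <= f x) ->
    q (fun x => c * f x) = c * q f) ->
  exists2 p, linear_on p & forall f, L f -> (forall x, 0 <= f x) -> p f = q f.
Proof.
move=> qD qZ.
pose p f := q (fun x => Num.max 0 (f x)) - q (fun x => Num.max 0 (- f x)).
have L1 f : L f -> L (fun x => Num.max 0 (f x)) by exact: fl_max0.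
have L2 f : L f -> L (fun x => Num.max 0 (- f x)).
  by move=> lf; apply: (fl_max0 HL); exact: flN.
(* The value of p can be read off any decomposition of f as a difference of nonnegative elements,
   not only from f^+ - f^-; linearity then amounts to writing down a suitable decomposition for each
   sign of the scalar. *)
have pE f g h : L g -> L h -> (forall x, 0 <= g x) -> (forall x, 0 <= h x) ->
    f = (fun x => g x - h x) -> p f = q g - q h.
  move=> lg lh g0 h0 fE; have lf : L f by rewrite fE; exact: flB.
  have : q (fun x => Num.max 0 (f x) + h x) = q (fun x => Num.max 0 (- f x) + g x).
    congr q; apply/funext => x; have := congr1 (@^~ x) (posneg f).
    by rewrite {1}fE /=; lra.
  rewrite !qD//; try (by apply: L1); try (by apply: L2);
    try (by move=> x; rewrite le_max lexx).
  by rewrite /p; lra.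
exists p; last first.
  move=> f lf f0; rewrite (@pE f f (fun=> 0))//.
  - have := qZ 0 f (lexx _) lf f0; under eq_fun do rewrite mul0r.
    by move=> ->; rewrite mul0r subr0.
  - exact: (fl_zero HL).
  - by apply/funext => x; rewrite subr0.
move=> a f g lf lg; have [a0|a0] := leP 0 a.
  rewrite (@pE _ (fun x => a * Num.max 0 (f x) + Num.max 0 (g x))
                 (fun x => a * Num.max 0 (- f x) + Num.max 0 (- g x))).
  - rewrite !qD ?qZ//; try (by apply: L1); try (by apply: L2);
      try (by apply: flZ; apply: L1); try (by apply: flZ; apply: L2);
      try (by move=> x; rewrite ?mulr_ge0 ?le_max ?lexx).
    by rewrite /p; lra.
  - by apply: (fl_linear HL); apply: L1.
  - by apply: (fl_linear HL); apply: L2.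
  - by move=> x; rewrite addr_ge0 ?mulr_ge0 ?le_max ?lexx.
  - by move=> x; rewrite addr_ge0 ?mulr_ge0 ?le_max ?lexx.
  - apply/funext => x; have /= := congr1 (@^~ x) (posneg f).
    have /= := congr1 (@^~ x) (posneg g) => {1}-> {1}->; lra.
have Na0 : 0 <= - a by rewrite oppr_ge0 ltW.
rewrite (@pE _ (fun x => (- a) * Num.max 0 (- f x) + Num.max 0 (g x))
               (fun x => (- a) * Num.max 0 (f x) + Num.max 0 (- g x))).
- rewrite !qD ?qZ//; try (by apply: L1); try (by apply: L2);
    try (by apply: flZ; apply: L1); try (by apply: flZ; apply: L2);
    try (by move=> x; rewrite ?mulr_ge0 ?le_max ?lexx).
  by rewrite /p; lra.
- by apply: (fl_linear HL); [apply: L2|apply: L1].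
- by apply: (fl_linear HL); [apply: L1|apply: L2].
- by move=> x; rewrite addr_ge0 ?mulr_ge0 ?le_max ?lexx.
- by move=> x; rewrite addr_ge0 ?mulr_ge0 ?le_max ?lexx.
- apply/funext => x; have /= := congr1 (@^~ x) (posneg f).
  have /= := congr1 (@^~ x) (posneg g) => {1}-> {1}->; lra.
Qed.

(* The positive part of an order-bounded functional; p is determined by u, so that
   it inherits the symmetries of u. *)
Lemma functional_positive_part (u : (X -> R) -> R) : linear_on u ->
  (forall f, L f -> (forall x, 0 <= f x) ->
    exists M, forall g, L g -> (forall x, 0 <= g x <= f x) -> u g <= M) ->
  exists p, [/\ linear_on p,
    forall f g, L f -> L g -> (forall x, 0 <= g x <= f x) -> u g <= p f
    & forall f (M : R), L f -> (forall x, 0 <= f x) ->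
    (forall g, L g -> (forall x, 0 <= g x <= f x) -> u g <= M) -> p f <= M].
Proof.
move=> ul ub.
pose S f := [set u g | g in [set g | L g /\ forall x, 0 <= g x <= f x]].
pose q f := sup (S f).
have l0 := fl_zero HL.
have u0 : u (fun=> 0) = 0.
  have := ul (-1) _ _ l0 l0; under eq_fun do rewrite mulr0 addr0.
  by rewrite mulN1r addNr.
have uD f g : L f -> L g -> u (fun x => f x + g x) = u f + u g.
  by move=> lf lg; have := ul 1 f g lf lg; under eq_fun do rewrite mul1r; rewrite mul1r.
have uZ (a : R) f : L f -> u (fun x => a * f x) = a * u f.
  by move=> lf; have := ul a f _ lf l0; under eq_fun do rewrite addr0; rewrite u0 addr0.
have supS f : L f -> (forall x, 0 <= f x) -> has_sup (S f).
  move=> lf f0; split; first by exists (u (fun=> 0)), (fun=> 0) => //; split => // x; rewrite lexx f0.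
  by have [M uM] := ub f lf f0; exists M => _ [g [lg gf] <-]; exact: uM.
have q_ge f g : L f -> L g -> (forall x, 0 <= g x <= f x) -> u g <= q f.
  move=> lf lg gf; apply: sup_upper_bound; last by exists g.
  by apply: supS => // x; have /andP[/le_trans] := gf x; exact.
have q_le f (M : R) : L f -> (forall x, 0 <= f x) ->
    (forall g, L g -> (forall x, 0 <= g x <= f x) -> u g <= M) -> q f <= M.
  move=> lf f0 uM; apply: ge_sup; first by have [] := supS f lf f0.
  by move=> _ [g [lg gf] <-]; exact: uM.
have [||p pl pq] := cone_extension (q := q); last first.
- exists p; split => //.
    move=> f g lf lg gf; rewrite pq ?q_ge// => x.
    by have /andP[/le_trans] := gf x; exact.
  by move=> f M lf f0 uM; rewrite pq ?q_le.
- move=> c f c0 lf f0.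
  have Hle (b : R) h : 0 < b -> L h -> (forall x, 0 <= h x) ->
      q (fun x => b * h x) <= b * q h.
    move=> b0 lh h0; apply: (q_le); [exact: flZ|by move=> x; rewrite mulr_ge0 ?(ltW b0)|].
    move=> g lg gh; rewrite -ler_pdivrMl// -uZ//; apply: q_ge => //; first exact: flZ.
    move=> x; have /andP[g0 gbh] := gh x.
    by rewrite mulr_ge0 ?invr_ge0 ?(ltW b0)//= ler_pdivrMl.
  move: c0; rewrite le_eqVlt => /predU1P[<-|c0].
    rewrite mul0r; under eq_fun do rewrite mul0r.
    apply/eqP; rewrite eq_le; apply/andP; split.
      apply: (q_le) => // g lg g0; rewrite (_ : g = fun=> 0) ?u0//.
      by apply/funext => x; apply/le_anti; rewrite andbC; exact: g0.
    by rewrite -{1}u0; apply: q_ge => // x; rewrite lexx.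
  apply/eqP; rewrite eq_le Hle//= -ler_pdivlMl//.
  have := Hle c^-1 (fun x => c * f x).
  have -> : (fun x => c^-1 * (c * f x)) = f.
    by apply/funext => x; rewrite mulrA mulVf ?gt_eqF// mul1r.
  apply; [by rewrite invr_gt0|exact: flZ|by move=> x; rewrite mulr_ge0 ?(ltW c0)].
- move=> f g lf lg f0 g0.
  have lfg := flD lf lg; have fg0 x : 0 <= f x + g x by rewrite addr_ge0.
  apply/eqP; rewrite eq_le; apply/andP; split.
    (* Riesz decomposition: an element h with 0 <= h <= f + g is the sum of min(h, f), which is
       below f, and the rest, which is below g. *)
    apply: (q_le) => // h lh hfg; pose h1 x := Num.min (h x) (f x).
    have lh1 : L h1 by exact: fl_min.
    have -> : h = (fun x => h1 x + (h x - h1 x)) by apply/funext => x; rewrite subrKC.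
    rewrite uD//; last exact: flB.
    apply: lerD; apply: q_ge => //; [|exact: flB|] => x; have /andP[hx0 hx1] := hfg x.
      by rewrite /h1 le_min hx0 f0/= ge_min lexx orbT.
    rewrite /h1; have [hf|hf] := leP (h x) (f x); first by rewrite subrr lexx g0.
    by move: hf hx1; lra.
  rewrite -lerBrDr; apply: (q_le) => // h1 lh1 h1f.
  rewrite lerBrDr addrC -lerBrDr; apply: (q_le) => // h2 lh2 h2g.
  rewrite lerBrDr addrC -uD//; apply: q_ge => //; first exact: flD.
  by move=> x; have /andP[a b] := h1f x; have /andP[a' b'] := h2g x;
    rewrite addr_ge0// lerD.
Qed.

End function_lattice.

Lemma Cc_lattice {R : realType} {X : ptopologicalType} :
  function_lattice (@Cc R X).
Proof. by split; [exact: Cc_linear|exact: Cc0|exact: Cc_max0]. Qed.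

(** * Bounded continuous functions and functions vanishing at infinity *)

Section complex_continuity.
Context {R : realType} {X : topologicalType}.
Local Notation C := (R[i]^o).
Implicit Types (f g : X -> C).

Lemma cvg_cabsP {T : Type} (F : set_system T) {FF : Filter F} (u : T -> C) (l : C) :
  (u @ F --> l) <-> (forall e : R, 0 < e -> \forall t \near F, cabs (l - u t) < e).
Proof.
split=> [/cvgrPdist_lt ul e e0|H].
  have := ul e%:C; rewrite ltcR => /(_ e0).
  by apply: filterS => t; rewrite ltr_normr_cabs.
apply/cvgrPdist_lt => e; rewrite ltcE /= => /andP[/eqP e2 e1].
have -> : e = (complex.Re e)%:C by case: e e2 {e1} => a b /= ->.
by apply: filterS (H _ e1) => t; rewrite ltr_normr_cabs.
Qed.

Lemma continuous_cabsP f : continuous f <->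
  (forall x (e : R), 0 < e -> \forall y \near x, cabs (f x - f y) < e).
Proof.
by split=> H x; [apply/cvg_cabsP; exact: H|apply/cvg_cabsP => e; exact: H].
Qed.

Lemma continuous_Re f : continuous f -> continuous (fun x => complex.Re (f x)).
Proof.
move=> /continuous_cabsP cf x; apply/cvgrPdist_lt => e e0.
apply: filterS (cf x e e0) => y; apply: le_lt_trans.
by rewrite -ReB; exact: Re_le_cabs.
Qed.

Lemma continuous_Im f : continuous f -> continuous (fun x => complex.Im (f x)).
Proof.
move=> /continuous_cabsP cf x; apply/cvgrPdist_lt => e e0.
apply: filterS (cf x e e0) => y; apply: le_lt_trans.
by rewrite -ImB; exact: Im_le_cabs.
Qed.

Lemma continuous_real (g : X -> R) : continuous g -> continuous (fun x => (g x)%:C : C).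
Proof.
move=> cg; apply/continuous_cabsP => x e e0.
have /cvgrPdist_lt/(_ e e0) := cg x.
by apply: filterS => y; rewrite -rmorphB /= cabs_real.
Qed.

Lemma continuous_Clinear (a : C) f g : continuous f -> continuous g ->
  continuous (fun x => a * f x + g x).
Proof.
move=> cf cg x; apply: cvgD; last exact: cg.
by apply: cvgM; [exact: cvg_cst|exact: cf].
Qed.

Lemma continuous_CM f g : continuous f -> continuous g ->
  continuous (fun x => f x * g x).
Proof. by move=> cf cg x; apply: cvgM; [exact: cf|exact: cg]. Qed.

Definition Cb : set (X -> C) :=
  [set f : X -> C | continuous f /\ exists M : R, forall x, cabs (f x) <= M].

Definition isC0 : set (X -> C) := [set f : X -> C | continuous f /\
  forall e : R, 0 < e -> exists2 K : set X, compact K &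
    forall x, ~ K x -> cabs (f x) < e].

Lemma Cb_cst (c : C) : Cb (fun=> c).
Proof. by split; [exact: cst_continuous|exists (cabs c)]. Qed.

Lemma Cb_linear (a : C) f g : Cb f -> Cb g -> Cb (fun x => a * f x + g x).
Proof.
move=> [cf [M fM]] [cg [N gN]]; split; first exact: continuous_Clinear.
exists (cabs a * M + N) => x; rewrite (le_trans (cabsD _ _))// lerD// cabsM.
by rewrite ler_wpM2l// cabs_ge0.
Qed.

Lemma CbB f g : Cb f -> Cb g -> Cb (fun x => f x - g x).
Proof.
move=> bf bg; have := Cb_linear (-1) bg bf.
by under eq_fun do rewrite mulN1r addrC.
Qed.

Lemma CbM f g : Cb f -> Cb g -> Cb (fun x => f x * g x).
Proof.
move=> [cf [M fM]] [cg [N gN]]; split; first exact: continuous_CM.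
exists (M * N) => x; rewrite cabsM.
by rewrite ler_pM// cabs_ge0.
Qed.

Lemma CbZ (a : C) f : Cb f -> Cb (fun x => a * f x).
Proof.
move=> bf; have := Cb_linear a bf (Cb_cst 0).
by under eq_fun do rewrite addr0.
Qed.

Lemma CbD f g : Cb f -> Cb g -> Cb (fun x => f x + g x).
Proof.
move=> bf bg; have := Cb_linear 1 bf bg.
by under eq_fun do rewrite mul1r.
Qed.

Lemma Cb_sum n (F : nat -> X -> C) : (forall i, Cb (F i)) ->
  Cb (fun x => \sum_(i < n) F i x).
Proof.
move=> bF; elim: n => [|n IH].
  by under eq_fun do rewrite big_ord0; exact: Cb_cst.
by under eq_fun do rewrite big_ord_recr /=; exact: CbD.
Qed.

Lemma isC0_linear (a : C) f g : isC0 f -> isC0 g -> isC0 (fun x => a * f x + g x).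
Proof.
move=> [cf f0] [cg g0]; split; first exact: continuous_Clinear.
move=> e e0; have a1 : 0 < cabs a + 1 by rewrite ltr_wpDl// cabs_ge0.
have e2 : 0 < e / 2 by rewrite divr_gt0.
have [K cK fK] := f0 _ (divr_gt0 e2 a1).
have [L cL gL] := g0 _ e2.
exists (K `|` L); first exact: compactU.
move=> x /not_orP[/fK fx /gL gx].
rewrite (le_lt_trans (cabsD _ _))// [ltRHS]splitr ler_ltD// cabsM.
apply: (@le_trans _ _ ((cabs a + 1) * cabs (f x))).
  by rewrite ler_wpM2r ?cabs_ge0// lerDl.
by rewrite mulrC -ler_pdivlMr// ltW.
Qed.

Lemma isC0B f g : isC0 f -> isC0 g -> isC0 (fun x => f x - g x).
Proof.
move=> bf bg; have := isC0_linear (-1) bg bf.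
by under eq_fun do rewrite mulN1r addrC.
Qed.

Lemma isC0_compact f K : continuous f -> compact K -> vanishes_off K f -> isC0 f.
Proof.
move=> cf cK fK; split => // e e0; exists K => // x /fK ->.
by rewrite cabs0.
Qed.

Lemma continuous_cabs f : continuous f -> continuous (fun x => cabs (f x)).
Proof.
move=> /continuous_cabsP cf x; apply/cvgrPdist_lt => e e0.
apply: filterS (cf x e e0) => y; apply: le_lt_trans.
rewrite ler_norml; apply/andP; split.
  by rewrite lerNl opprB lerBlDr cabsBC -[X in cabs X <= _](subrK (f x)) cabsD.
by rewrite lerBlDr -[X in cabs X <= _](subrK (f y)) cabsD.
Qed.

Lemma compact_cabs_bounded f K : continuous f -> compact K ->
  exists2 M : R, 0 <= M & forall x, K x -> cabs (f x) <= M.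
Proof.
move=> cf cK; have : compact ((fun x => cabs (f x)) @` K).
  apply: continuous_compact => //; apply: continuous_subspaceT.
  exact: continuous_cabs.
move/compact_bounded => [M [_ MP]].
exists (`|M| + 1); first by rewrite addr_ge0.
move=> x Kx; have /= := MP (`|M| + 1) _ (cabs (f x)) (ex_intro2 _ _ x Kx erefl).
rewrite (ger0_norm (cabs_ge0 _)); apply.
by rewrite (le_lt_trans (ler_norm _))// ltrDl.
Qed.

Lemma isC0_Cb f : isC0 f -> Cb f.
Proof.
move=> [cf f0]; split => //; have [K cK fK] := f0 _ ltr01.
have [M M0 fM] := compact_cabs_bounded cf cK.
exists (M + 1) => x; have [/fM|/fK/ltW] := pselect (K x) => /le_trans; apply.
  by rewrite lerDl.
by rewrite lerDr.
Qed.

End complex_continuity.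

Arguments Cb {R X}.
Arguments isC0 {R X}.

(** * The pairing of functions with regular measures *)

Section pairing.
Context {R : realType} {G : topologicalGroupType}.
Local Notation C := (R[i]^o).
Local Notation borel := (g_sigma_algebraType (@open G)).
Local Notation M := (measure_algebra R G).
Implicit Types (f g : G -> C) (a b : M).

Lemma Cb_Cbm f : Cb f -> Cbm (f : borel -> C).
Proof.
move=> [cf [N fN]]; split; split.
- by apply: continuous_borel; exact: continuous_Re.
- by exists N => x; rewrite (le_trans (Re_le_cabs _)).
- by apply: continuous_borel; exact: continuous_Im.
- by exists N => x; rewrite (le_trans (Im_le_cabs _)).
Qed.

(** It accepts every function, since masses and the partial integrals of a convolution pair measures
    with bounded continuous functions that need not vanish at infinity. *)
Definition pr (f : G -> C) (a : M) : C :=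
  complex_integral (measure_algebra_complex_measure a) f.

Definition tvR (a : M) : R := fine (tvariation a setT).

Lemma normr_tvR a : `|a| = (tvR a)%:C. Proof. by []. Qed.

Lemma tvR_ge0 a : 0 <= tvR a.
Proof. by rewrite fine_ge0// tvariation_ge0. Qed.

Lemma tvRD a b : tvR (a + b) <= tvR a + tvR b.
Proof. by have := ler_normD a b; rewrite !normr_tvR -rmorphD/= lecR. Qed.

Lemma tvRZ (k : C) a : tvR (k *: a) = cabs k * tvR a.
Proof.
have := normrZ k a; rewrite !normr_tvR normr_cabs -rmorphM /=.
by move=> /complexI.
Qed.

Lemma tvRN a : tvR (- a) = tvR a.
Proof. by rewrite -scaleN1r tvRZ cabsN cabs1 mul1r. Qed.

Lemma tvRBC a b : tvR (a - b) = tvR (b - a).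
Proof. by rewrite -tvRN opprB. Qed.

Lemma pr_linear_bm (k : C) f g a : Cbm (f : borel -> C) -> Cbm (g : borel -> C) ->
  pr (fun x => k * f x + g x) a = k * pr f a + pr g a.
Proof. exact: complex_integral_linear. Qed.

Lemma pr_linear (k : C) f g a : Cb f -> Cb g ->
  pr (fun x => k * f x + g x) a = k * pr f a + pr g a.
Proof. by move=> /Cb_Cbm bf /Cb_Cbm bg; exact: pr_linear_bm. Qed.

Lemma prD f g a : Cb f -> Cb g -> pr (fun x => f x + g x) a = pr f a + pr g a.
Proof.
by move=> bf bg; have := pr_linear 1 a bf bg; under eq_fun do rewrite mul1r;
  rewrite mul1r.
Qed.

Lemma prB f g a : Cb f -> Cb g -> pr (fun x => f x - g x) a = pr f a - pr g a.
Proof.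
move=> bf bg; have := pr_linear (-1) a bg bf; under eq_fun do rewrite mulN1r addrC.
by move=> ->; rewrite mulN1r addrC.
Qed.

Lemma pr0 a : pr (fun=> 0) a = 0.
Proof.
have := prB a (Cb_cst 0) (Cb_cst 0).
by under eq_fun do rewrite subr0; move=> ->; rewrite subrr.
Qed.

Lemma prZ (k : C) f a : Cb f -> pr (fun x => k * f x) a = k * pr f a.
Proof.
move=> bf; have := pr_linear k a bf (Cb_cst 0).
by under eq_fun do rewrite addr0; rewrite pr0 addr0.
Qed.

Lemma pr_sum n (F : nat -> G -> C) a : (forall i, Cb (F i)) ->
  pr (fun x => \sum_(i < n) F i x) a = \sum_(i < n) pr (F i) a.
Proof.
move=> bF; elim: n => [|n IH].
  by under eq_fun do rewrite big_ord0; rewrite big_ord0 pr0.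
under eq_fun do rewrite big_ord_recr /=.
by rewrite prD// ?IH ?big_ord_recr//; exact: Cb_sum.
Qed.

Lemma pr_local f (s : R) (A : set borel) a : measurable A -> 0 <= s ->
  Cbm (f : borel -> C) ->
  (forall x, cabs (f x) <= s) -> (forall x, ~ A x -> f x = 0) ->
  cabs (pr f a) <= 4 * s * fine (tvariation a A).
Proof. exact: complex_integral_le. Qed.

Lemma pr_le f (s : R) a : Cb f -> (forall x, cabs (f x) <= s) ->
  cabs (pr f a) <= 4 * s * tvR a.
Proof.
move=> bf fs; have s0 : 0 <= s by rewrite (le_trans _ (fs point))// cabs_ge0.
by apply: (@pr_local f s setT) => //; [exact: Cb_Cbm|move=> x /(_ I)].
Qed.

Lemma pr_linear_measure (k : C) f a b : Cb f ->
  pr f (k *: a + b) = k * pr f a + pr f b.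
Proof.
move=> bf; apply: (@complex_integral_unique _ _ _ _
  (measure_algebra_complex_measure (k *: a + b)) (fun f => k * pr f a + pr f b)
  (cabs k * (4 * tvR a) + 4 * tvR b)).
- by move=> c g h bg bh; rewrite !pr_linear_bm//; ring.
- move=> g s bg gs; have s0 : 0 <= s by rewrite (le_trans _ (gs point))// cabs_ge0.
  have H d : cabs (pr g d) <= 4 * tvR d * s.
    by rewrite (mulrAC 4); apply: (@pr_local g s setT) => // x /(_ I).
  rewrite (le_trans (cabsD _ _))// mulrDl lerD// cabsM -[leRHS]mulrA.
  by rewrite ler_wpM2l// cabs_ge0.
- move=> A mA; rewrite /pr.
  by rewrite !(complex_integral_indic (measure_algebra_complex_measure _)).
- exact: Cb_Cbm.
Qed.

Lemma pr_measureD f a b : Cb f -> pr f (a + b) = pr f a + pr f b.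
Proof. by move=> bf; have := pr_linear_measure 1 a b bf; rewrite scale1r mul1r. Qed.

Lemma pr_measureZ (k : C) f a : Cb f -> pr f (k *: a) = k * pr f a.
Proof.
move=> bf; have h := pr_linear_measure 0 a a bf.
have := pr_linear_measure (k - 1) a a bf.
by rewrite scalerBl scale1r subrK => ->; ring.
Qed.

Lemma pr_measureB f a b : Cb f -> pr f (a - b) = pr f a - pr f b.
Proof.
by move=> bf; rewrite pr_measureD// -scaleN1r pr_measureZ// mulN1r.
Qed.

Lemma pr_measure0 f : Cb f -> pr f 0 = 0.
Proof. by move=> bf; rewrite -(scale0r 0) pr_measureZ// mul0r. Qed.

Hypotheses (G_hausdorff : hausdorff_space G) (G_lc : locally_compact [set: G]).

(** The difference between f and the indicator of E is bounded by 1 and lives on U minus K. With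
    regularity this shows that a measure is determined by its pairing with C_0(G). *)
Lemma pr_approx_set (E K U : set G) (f : G -> R) a :
  measurable (E : set borel) -> compact K -> open U -> K `<=` E -> E `<=` U ->
  continuous f -> (forall x, 0 <= f x <= 1) -> (forall x, K x -> f x = 1) ->
  vanishes_off U f ->
  cabs (pr (fun x => (f x)%:C) a - a E) <= 4 * fine (tvariation a (U `\` K)).
Proof.
move=> mE cK oU KE EU cf f01 f1 f0.
have bf : Cbm (fun x : borel => (f x)%:C).
  apply: Cb_Cbm; split; first exact: continuous_real.
  by exists 1 => x; rewrite cabs_real ger0_norm; have /andP[] := f01 x.
have bE : Cbm (fun x : borel => (\1_E x : R)%:C) by exact: Cbm_indic.
have -> : a E = pr (fun x => (\1_E x : R)%:C) a.
  by rewrite /pr (complex_integral_indic (measure_algebra_complex_measure a)).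
have -> : pr (fun x => (f x)%:C) a - pr (fun x => (\1_E x : R)%:C) a =
    pr (fun x => (f x - \1_E x)%:C) a.
  have := pr_linear_bm (-1) a bE bf.
  rewrite mulN1r addrC => <-; congr (pr _ a); apply/funext => x.
  by rewrite mulN1r addrC -rmorphB.
rewrite -[4 in leRHS]mulr1; apply: pr_local => //.
- apply: measurableD; first exact: open_borel.
  exact: compact_borel.
- have := CbmB bf bE; rewrite (_ : (fun x => _ - _) = (fun x => (f x - \1_E x)%:C))//.
  by apply/funext => x; rewrite -rmorphB.
- move=> x; rewrite cabs_real indicE; have /andP[h0 h1] := f01 x.
  by case: (x \in E); rewrite ?mulr1n ?mulr0n ler_norml; apply/andP; split; lra.
- move=> x /not_andP[nUx|/contrapT Kx].
    by rewrite (f0 x nUx) indicE memNset ?subrr// => /EU.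
  by rewrite (f1 x Kx) indicE mem_set ?subrr//; exact: KE.
Qed.

Lemma regular_approx a (E : set G) (e : R) : measurable (E : set borel) -> 0 < e ->
  exists K U : set G, [/\ compact K, open U, K `<=` E, E `<=` U
    & fine (tvariation a (U `\` K)) < e].
Proof.
move=> mE e0; have : (a : set borel -> C) \in @regular_complex_measure R G.
  exact: measure_algebraP.
rewrite inE => -[ca ra]; have [K [U [cK oU KE EU lt]]] := ra E mE e e0.
by exists K, U; split => //; rewrite -lte_fin fineK// tvariation_fin.
Qed.

Lemma pr_eq0 a : (forall f, isC0 f -> pr f a = 0) -> a = 0.
Proof.
move=> a0; apply/val_inj/funext => E /=.
have ca := measure_algebra_complex_measure a.
have [mE|nE] := pselect (measurable (E : set borel)); last exact: complex_measure_out.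
apply/eqP; rewrite -cabs_eq0 eq_le cabs_ge0 andbT.
apply/ler_addgt0Pr => e e0; rewrite add0r.
have [K [U [cK oU KE EU lt]]] := regular_approx a mE (divr_gt0 e0 (ltr0n _ 4)).
have [f [cf f01 f1 [L [cL LU] fL]]] := urysohn_compact_open (R := R)
  G_hausdorff G_lc cK oU (subset_trans KE EU).
have := pr_approx_set a mE cK oU KE EU cf f01.
rewrite a0 ?sub0r ?cabsN; last first.
  apply: (@isC0_compact _ _ _ L) => //; first exact: continuous_real.
  by move=> x /fL ->.
move=> h; apply: (le_trans (h _ _)).
- by move=> x /f1/nbhs_singleton.
- by move=> x nUx; apply: fL => /LU.
- by rewrite mulrC -ler_pdivlMr// ltW.
Qed.

Lemma pr_inj a b : (forall f, isC0 f -> pr f a = pr f b) -> a = b.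
Proof.
move=> ab; apply/eqP; rewrite -subr_eq0; apply/eqP; apply: pr_eq0 => f f0.
by rewrite pr_measureB ?ab ?subrr//; exact: isC0_Cb.
Qed.

(** Regularity of the measure on the whole space gives a compact set outside which the variation is
    below e/4, the 4 being that of [pr_local]. Together with estimates uniform on compact sets this
    plays the part of dominated convergence. *)
Lemma tight a (e : R) : 0 < e -> exists2 K : set G, compact K &
  forall f (s : R), Cb f -> 0 <= s -> (forall x, cabs (f x) <= s) ->
  (forall x, K x -> f x = 0) -> cabs (pr f a) <= e * s.
Proof.
move=> e0.
have [K [U [cK oU _ TU lt]]] := regular_approx a measurableT (divr_gt0 e0 (ltr0n _ 4)).
exists K => // f s bf s0 fs fK.
have mA : measurable (U `\` K : set borel).
  by apply: measurableD; [exact: open_borel|exact: compact_borel].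
apply: (le_trans (pr_local a mA s0 (Cb_Cbm bf) fs _)).
  move=> x /not_andP[nUx|/contrapT/fK//].
  by exfalso; apply: nUx; exact: TU.
rewrite mulrAC ler_wpM2r//.
by rewrite mulrC -ler_pdivlMr// ltW.
Qed.

End pairing.

Arguments pr {R G}.

(** * Bounded functionals on C_0(G) as measures *)

Section riesz.
Context {R : realType} {G : topologicalGroupType}.
Local Notation C := (R[i]^o).
Local Notation borel := (g_sigma_algebraType (@open G)).
Local Notation M := (measure_algebra R G).
Hypotheses (G_hausdorff : hausdorff_space G) (G_lc : locally_compact [set: G]).

(** [I1] is the positive part p of w and [I2] is p - w. For f between 0 and 1, p f is a supremum of
    values w g with 0 <= g <= f, and p f - w f one of values w(g - f) with g - f of modulus at most
    1; hence the same bound K for both. *)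
Lemma functional_difference (w : (G -> R) -> R) (K : R) : linear_on Cc w ->
  (forall f (s : R), Cc f -> (forall x, `|f x| <= s) -> w f <= K * s) ->
  exists I1 I2, [/\ positive_linear I1, positive_linear I2,
    forall f, Cc f -> w f = I1 f - I2 f
    & forall f, Cc f -> (forall x, 0 <= f x <= 1) -> I1 f <= K /\ I2 f <= K].
Proof.
move=> wl wK; have c0 := @Cc0 R G.
have w0 : w (fun=> 0) = 0.
  have := wl (-1) _ _ c0 c0; under eq_fun do rewrite mulr0 addr0.
  by rewrite mulN1r addNr.
have [|p [pl p_ge p_le]] := functional_positive_part Cc_lattice wl.
  move=> f cf f0; have [N N0 fN] := Cc_bounded cf; exists (K * N) => g cg gf.
  apply: wK => // x; have /andP[g0 gfx] := gf x.
  by rewrite ger0_norm// (le_trans gfx)// (le_trans (ler_norm _)).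
exists p, (fun f => p f - w f); split.
- split=> // f cf f0; rewrite -w0; apply: p_ge => // x.
  by rewrite lexx f0.
- split=> [a f g cf cg|f cf f0]; first by rewrite pl// wl//; ring.
  by rewrite subr_ge0; apply: p_ge => // x; rewrite f0 lexx.
- by move=> f cf; rewrite opprB addrC subrK.
- move=> f cf f01; have f0 x : 0 <= f x by have /andP[] := f01 x.
  split.
    apply: p_le => // g cg gf; rewrite -[K]mulr1; apply: wK => // x.
    have /andP[g0 gfx] := gf x; have /andP[_ fx1] := f01 x.
    by rewrite ger0_norm// (le_trans gfx).
  rewrite lerBlDr; apply: p_le => // g cg gf; rewrite -lerBlDr.
  have -> : w g - w f = w (fun x => (-1) * f x + g x).
    by rewrite wl// mulN1r addrC.
  rewrite -[K]mulr1; apply: wK; first exact: Cc_linear.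
  move=> x; have /andP[g0 gfx] := gf x; have /andP[_ fx1] := f01 x.
  by rewrite ler_norml; apply/andP; split; lra.
Qed.

Lemma Cc_isC0 (f : G -> R) : Cc f -> isC0 (fun x => (f x)%:C).
Proof.
move=> [cf [K cK fK]]; apply: (@isC0_compact _ _ _ K) => //.
  exact: continuous_real.
by move=> x /fK ->.
Qed.

Lemma cutoff (K : set G) : compact K -> exists2 h : G -> R, Cc h &
  (forall x, 0 <= h x <= 1) /\ (forall x, K x -> h x = 1).
Proof.
move=> cK; have [h [ch h01 h1 [L [cL _] hL]]] := urysohn_compact_open (R := R)
  G_hausdorff G_lc cK openT (@subsetT _ _).
exists h; first by split => //; exists L.
by split => // x /h1/nbhs_singleton.
Qed.

(** The real and imaginary parts of u on real functions are differences of positive functionals, so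
    u comes from four Radon measures of mass at most K each. The constant 4 counts these
    measures. *)
Lemma riesz_representation (u : (G -> C) -> C) (K : R) : 0 <= K ->
  (forall (k : C) f g, isC0 f -> isC0 g -> u (fun x => k * f x + g x) = k * u f + u g) ->
  (forall f (s : R), isC0 f -> (forall x, cabs (f x) <= s) -> cabs (u f) <= K * s) ->
  exists a : M, (forall f, isC0 f -> pr f a = u f) /\ tvR a <= 4 * K.
Proof.
move=> K0 ul uK.
have uRl : linear_on Cc (fun f : G -> R => complex.Re (u (fun x => (f x)%:C))).
  move=> k f g /Cc_isC0 cf /Cc_isC0 cg.
  have := ul k%:C _ _ cf cg.
  under eq_fun do rewrite -rmorphM -rmorphD /=.
  by move=> ->; rewrite ReD ReM mul0r subr0.
have uIl : linear_on Cc (fun f : G -> R => complex.Im (u (fun x => (f x)%:C))).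
  move=> k f g /Cc_isC0 cf /Cc_isC0 cg.
  have := ul k%:C _ _ cf cg.
  under eq_fun do rewrite -rmorphM -rmorphD /=.
  by move=> ->; rewrite ImD ImM mul0r addr0.
have uRK (f : G -> R) (s : R) : Cc f -> (forall x, `|f x| <= s) ->
    complex.Re (u (fun x => (f x)%:C)) <= K * s.
  move=> /Cc_isC0 cf fs; rewrite (le_trans (ler_norm _))//.
  by rewrite (le_trans (Re_le_cabs _))// uK// => x; rewrite cabs_real.
have uIK (f : G -> R) (s : R) : Cc f -> (forall x, `|f x| <= s) ->
    complex.Im (u (fun x => (f x)%:C)) <= K * s.
  move=> /Cc_isC0 cf fs; rewrite (le_trans (ler_norm _))//.
  by rewrite (le_trans (Im_le_cabs _))// uK// => x; rewrite cabs_real.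
have [I1 [I2 [p1 p2 E12 b12]]] := functional_difference uRl uRK.
have [I3 [I4 [p3 p4 E34 b34]]] := functional_difference uIl uIK.
pose I (i : 'I_4) : (G -> R) -> R :=
  match val i with 0%N => I1 | 1%N => I2 | 2%N => I3 | _ => I4 end.
have pI i : positive_linear (I i) by case: i => -[|[|[|i]]] ilt.
have bI i f : Cc f -> (forall x, 0 <= f x <= 1) -> I i f <= K.
  move=> cf f01; have [? ?] := b12 f cf f01; have [? ?] := b34 f cf f01.
  by case: i => -[|[|[|i]]] ilt.
have In0 : I (inord 0) = I1 by rewrite /I /= inordK.
have In1 : I (inord 1) = I2 by rewrite /I /= inordK.
have In2 : I (inord 2) = I3 by rewrite /I /= inordK.
have In3 : I (inord 3) = I4 by rewrite /I /= inordK.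
pose mu i := [the {measure set borel -> \bar R} of radon G_hausdorff G_lc (pI i)].
have muK i : (mu i setT <= K%:E)%E by apply: radon_setT_le => f; exact: bI.
have mufin i : (mu i setT < +oo)%E by rewrite (le_lt_trans (muK i))// ltry.
have tvle E : measurable E -> (tvariation (four_measures mu) E <= \sum_(i < 4) mu i E)%E.
  exact: tvariation_four_measures.
have reg : four_measures mu \in @regular_complex_measure R G.
  rewrite inE; split; first exact: four_measures_complex.
  move=> E mE e e0; have e4 : 0 < e / 4 by rewrite divr_gt0.
  have /choice[KU KUP] : forall i, exists KU : set G * set G,
      [/\ compact KU.1, open KU.2, KU.1 `<=` E, E `<=` KU.2
      & (mu i (KU.2 `\` KU.1) < (e / 4)%:E)%E].
    move=> i; have [L [U [cL oU LE EU lt]]] :=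
      finite_radon_regular (mufin i) mE e4.
    by exists (L, U).
  (* The union of the compact sets and the intersection of the open sets serve the four measures at
     once. *)
  pose L := \big[setU/set0]_i (KU i).1; pose U := \big[setI/setT]_i (KU i).2.
  have cL : compact L by apply: bigsetU_compact => i _; have [] := KUP i.
  have oU : open U.
    rewrite /U; elim/big_ind : _ => [|A B|i _]; [exact: openT|exact: openI|].
    by have [] := KUP i.
  have LE : L `<=` E.
    rewrite /L; elim/big_ind : _ => [|A B AE BE|i _]; first exact: sub0set.
      by rewrite subUset.
    by have [] := KUP i.
  have EU : E `<=` U.
    rewrite /U; elim/big_ind : _ => [|A B AE BE|i _]; first exact: subsetT.
      by rewrite subsetI.
    by have [] := KUP i.
  exists L, U; split => //.
  have mUL : measurable (U `\` L : set borel).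
    by apply: measurableD; [exact: open_borel|exact: compact_borel].
  apply: (le_lt_trans (tvle _ mUL)).
  apply: (@lt_le_trans _ _ (\sum_(i < 4) (e / 4)%:E)%E).
    have lt i : (mu i (U `\` L) < (e / 4)%:E)%E.
      have [_ _ _ _] := KUP i; apply: le_lt_trans; apply: le_radon.
      move=> x [Ux nLx]; split.
        by move: Ux; rewrite /U (bigD1 i)//= => -[].
      by move=> Kx; apply: nLx; rewrite /L (bigD1 i)//=; left.
    rewrite !big_ord_recl !big_ord0 !adde0.
    by do ?apply: lteD.
  by rewrite sumEFin lee_fin !big_ord_recl big_ord0; lra.
pose a := MeasureAlgebra reg.
have tva : tvR a <= 4 * K.
  rewrite /tvR -lee_fin fineK; last by apply: tvariation_fin; exact: four_measures_complex.
  apply: (le_trans (tvle _ measurableT)).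
  apply: (@le_trans _ _ (\sum_(i < 4) K%:E)%E); first by apply: lee_sum => i _.
  by rewrite sumEFin lee_fin !big_ord_recl big_ord0; lra.
exists a; split => //.
have ReCc (f : G -> C) (L : set G) : continuous f -> compact L -> vanishes_off L f ->
    Cc (fun x => complex.Re (f x)) /\ Cc (fun x => complex.Im (f x)).
  move=> cf cL fL; split; split.
  - exact: continuous_Re.
  - by exists L => // x /fL ->.
  - exact: continuous_Im.
  - by exists L => // x /fL ->.
have fromCc (f : G -> C) (L : set G) : continuous f -> compact L ->
    vanishes_off L f -> pr f a = u f.
  move=> cf cL fL; have [cR cI] := ReCc f L cf cL fL.
  have bf : Cbm (f : borel -> C) by apply/Cb_Cbm/isC0_Cb; exact: isC0_compact cL fL.
  have -> : pr f a = complex_integral (four_measures_complex mufin) f.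
    by rewrite /pr (_ : measure_algebra_complex_measure a =
      four_measures_complex mufin)//; exact: Prop_irrelevance.
  rewrite four_measures_integral//.
  have int i (g : G -> R) : Cc g -> \int[mu i]_x (g : borel -> R) x = I i g.
    exact: radon_integral.
  rewrite !int// In0 In1 In2 In3.
  have -> : u f = 'i%C * u (fun x => (complex.Im (f x))%:C)
      + u (fun x => (complex.Re (f x))%:C).
    rewrite -ul; [|exact: Cc_isC0|exact: Cc_isC0].
    by congr u; apply/funext => x; rewrite addrC; exact: complexE.
  apply: complex_ext; rewrite ?(ReD, ImD, ReM, ImM) /=.
    by rewrite (E12 _ cR) (E34 _ cI); ring.
  by rewrite (E12 _ cI) (E34 _ cR); ring.
(* From compact support to C_0: f is multiplied by a cutoff that is 1 on a compact set outside which
   f is below e / B. Both functionals are bounded, with constants that add up to less than B. *)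
move=> f f0; apply/eqP; rewrite -subr_eq0 -cabs_eq0 eq_le cabs_ge0 andbT.
apply/ler_addgt0Pr => e e0; rewrite add0r.
pose B := 4 * tvR a + K + 1.
have B0 : 0 < B by rewrite /B ltr_wpDl// addr_ge0// mulr_ge0// tvR_ge0.
have eB : 0 < e / B by rewrite divr_gt0.
have [cf f0'] := f0; have [L cL fL] := f0' _ eB.
have [h [ch [Lh cLh hLh]] [h01 h1]] := cutoff cL.
pose g : G -> C := fun x => f x * (h x)%:C.
have cg : continuous g := continuous_CM cf (continuous_real ch).
have gL : vanishes_off Lh g by move=> x /hLh; rewrite /g => ->; rewrite mulr0.
have g0 : isC0 g by exact: isC0_compact cLh gL.
have fg x : cabs (f x - g x) <= e / B.
  have [Lx|/fL/ltW fx] := pselect (L x).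
    by rewrite /g h1// mulr1 subrr cabs0 ltW.
  rewrite /g -{1}[f x]mulr1 -mulrBr cabsM (le_trans _ fx)// ler_piMr ?cabs_ge0//.
  rewrite -[1]/(1%:C) -rmorphB /= cabs_real.
  by have /andP[hx0 hx1] := h01 x; rewrite ger0_norm ?subr_ge0// gerBl.
have -> : pr f a - u f = pr (fun x => f x - g x) a - u (fun x => f x - g x).
  rewrite prB; [|exact: isC0_Cb|exact: isC0_Cb].
  have := ul (-1) g f g0 f0; under eq_fun do rewrite mulN1r addrC.
  by move=> ->; rewrite (fromCc g Lh)//; ring.
rewrite (le_trans (cabsB _ _))//.
have fg0 := isC0B f0 g0.
apply: (@le_trans _ _ (4 * (e / B) * tvR a + K * (e / B))).
  by apply: lerD; [exact: (pr_le a (isC0_Cb fg0) fg)|exact: (uK _ _ fg0 fg)].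
rewrite (_ : _ + _ = (4 * tvR a + K) * (e / B)); last by ring.
rewrite mulrA ler_pdivrMr// mulrC ler_pM2l//.
by rewrite /B lerDl.
Qed.

(** The measure that [riesz_representation] attaches to the functional of [a] is [a] itself by
    [pr_inj]. Thus the norm as a functional on C_0(G) controls the total variation up to a factor
    4. *)
Lemma tvR_le (a : M) (K : R) : 0 <= K ->
  (forall f (s : R), isC0 f -> (forall x, cabs (f x) <= s) -> cabs (pr f a) <= K * s) ->
  tvR a <= 4 * K.
Proof.
move=> K0 aK; have [||b [bE b4]] := @riesz_representation (pr^~ a) K K0.
- by move=> k f g f0 g0; apply: pr_linear; exact: isC0_Cb.
- exact: aK.
- by rewrite (_ : a = b)//; apply: pr_inj => // f f0; rewrite bE.
Qed.

End riesz.

(** * Integrals of uniformly continuous families *)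

Section uniform_continuity.
Context {R : realType} {G : topologicalGroupType}.
Local Notation C := (R[i]^o).
Implicit Types (f g : G -> C).

Lemma continuous_mul (X : topologicalType) (p q : X -> G) :
  continuous p -> continuous q -> continuous (fun x => (p x * q x)%g).
Proof.
move=> cp cq x.
apply: (@cvg_comp _ _ _ (fun x => (p x, q x)) (fun z : G * G => (z.1 * z.2)%g) _
  (nbhs (p x, q x))); first by apply: cvg_pair; [exact: cp|exact: cq].
exact: (@mulg_continuous G (p x, q x)).
Qed.

Lemma continuous_inv (X : topologicalType) (p : X -> G) :
  continuous p -> continuous (fun x => (p x)^-1%g).
Proof.
move=> cp x; apply: (@cvg_comp _ _ _ p (fun z : G => z^-1%g) _ (nbhs (p x))).
  exact: cp.
exact: (@invg_continuous G (p x)).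
Qed.

Lemma continuous_id' (X : topologicalType) : continuous (fun x : X => x).
Proof. by move=> x; exact: cvg_id. Qed.

Lemma continuous_fst (X Y : topologicalType) : continuous (fun p : X * Y => p.1).
Proof. by move=> p; exact: cvg_fst. Qed.

Lemma continuous_snd (X Y : topologicalType) : continuous (fun p : X * Y => p.2).
Proof. by move=> p; exact: cvg_snd. Qed.

Lemma continuous_lmul (x : G) : continuous (fun y => (x * y)%g).
Proof. by apply: continuous_mul; [exact: cst_continuous|exact: continuous_id']. Qed.

Lemma continuous_rmul (x : G) : continuous (fun y => (y * x)%g).
Proof. by apply: continuous_mul; [exact: continuous_id'|exact: cst_continuous]. Qed.

Lemma continuous_compose (X Y Z : topologicalType) (p : X -> Y) (q : Y -> Z) :
  continuous p -> continuous q -> continuous (fun x => q (p x)).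
Proof. by move=> cp cq x; apply: continuous_comp; [exact: cp|exact: cq]. Qed.

Lemma tube (X Y : topologicalType) (F : X -> Y -> C) (K : set Y) (x : X) (e : R) :
  continuous (fun p : X * Y => F p.1 p.2) -> compact K -> 0 < e ->
  \forall x' \near x, forall y, K y -> cabs (F x' y - F x y) < e.
Proof.
move=> cF cK e0.
have [+ _] := compact_near_coveringP K.
move=> /(_ cK X (nbhs x) (fun x' y => cabs (F x' y - F x y) < e) _).
apply=> y Ky.
have e2 : 0 < e / 2 by rewrite divr_gt0.
have /cvg_cabsP/(_ _ e2) := cF (x, y).
move=> [[A B] /= [Ax By] AB].
exists (B, A) => //= -[y' x'] /= [By' Ax'].
have h1 := AB (x', y') (conj Ax' By').
have h2 := AB (x, y') (conj (nbhs_singleton Ax) By').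
rewrite (le_lt_trans (cabs_dist _ (F x y) _))// [ltRHS]splitr ltrD//.
by rewrite cabsBC.
Qed.

(* The action p below is left or right translation. *)
Lemma isC0_uniform (p q : G -> G -> G) f (e : R) :
  continuous (fun z : G * G => p z.1 z.2) -> continuous (fun z : G * G => q z.1 z.2) ->
  (forall s, p 1%g s = s) -> (forall s, q 1%g s = s) ->
  (forall u s, q u (p u s) = s) -> isC0 f -> 0 < e ->
  \forall u \near 1%g, forall s, cabs (f (p u s) - f s) < e.
Proof.
move=> cp cq p1 q1 qp [cf f0] e0.
have e2 : 0 < e / 2 by rewrite divr_gt0.
have [K cK fK] := f0 _ e2.
have H (r : G -> G -> G) : continuous (fun z : G * G => r z.1 z.2) ->
    (forall s, r 1%g s = s) ->
    \forall u \near 1%g, forall s, K s -> cabs (f (r u s) - f s) < e.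
  move=> cr r1.
  have := @tube _ _ (fun u s => f (r u s)) K 1%g e
    (continuous_compose cr cf) cK e0.
  by apply: filterS => u H s /H; rewrite r1.
apply: filterS2 (H p cp p1) (H q cq q1) => u Hp Hq s.
have [/Hp//|/fK h1] := pselect (K s).
have [/Hq|/fK h2] := pselect (K (p u s)); first by rewrite qp cabsBC.
by rewrite (le_lt_trans (cabsB _ _))// [ltRHS]splitr ltrD.
Qed.

Lemma isC0_left_uniform f (e : R) : isC0 f -> 0 < e ->
  \forall u \near 1%g, forall s, cabs (f (u * s)%g - f s) < e.
Proof.
apply: (@isC0_uniform (fun u s => u * s)%g (fun u s => u^-1 * s)%g).
- by apply: continuous_mul; [exact: continuous_fst|exact: continuous_snd].
- apply: continuous_mul; last exact: continuous_snd.
  by apply: continuous_inv; exact: continuous_fst.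
- by move=> s; rewrite mul1g.
- by move=> s; rewrite invg1 mul1g.
- by move=> u s; rewrite mulKg.
Qed.

Lemma isC0_right_uniform f (e : R) : isC0 f -> 0 < e ->
  \forall u \near 1%g, forall s, cabs (f (s * u)%g - f s) < e.
Proof.
apply: (@isC0_uniform (fun u s => s * u)%g (fun u s => s * u^-1)%g).
- by apply: continuous_mul; [exact: continuous_snd|exact: continuous_fst].
- apply: continuous_mul; first exact: continuous_snd.
  by apply: continuous_inv; exact: continuous_fst.
- by move=> s; rewrite mulg1.
- by move=> s; rewrite invg1 mulg1.
- by move=> u s; rewrite mulgK.
Qed.

Lemma near_of_lmul (x : G) (P : set G) :
  (\forall u \near 1%g, P (u * x)%g) -> \forall y \near x, P y.
Proof.
move=> H; have : (y * x^-1)%g @[y --> x] --> (x * x^-1)%g by exact: continuous_rmul.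
rewrite mulgV => /(_ _ H) Hx.
have {}Hx : \forall y \near x, P (y * x^-1 * x)%g by exact: Hx.
by apply: filterS Hx => y; rewrite mulgVK.
Qed.

Lemma near_of_rmul (x : G) (P : set G) :
  (\forall u \near 1%g, P (x * u)%g) -> \forall y \near x, P y.
Proof.
move=> H; have : (x^-1 * y)%g @[y --> x] --> (x^-1 * x)%g by exact: continuous_lmul.
rewrite mulVg => /(_ _ H) Hx.
have {}Hx : \forall y \near x, P (x * (x^-1 * y))%g by exact: Hx.
by apply: filterS Hx => y; rewrite mulVKg.
Qed.

End uniform_continuity.

(** * Finite approximation and exchange of integrals *)

Section approximation.
Context {R : realType} {G : topologicalGroupType}.
Local Notation C := (R[i]^o).
Local Notation M := (measure_algebra R G).
Hypotheses (G_hausdorff : hausdorff_space G) (G_lc : locally_compact [set: G]).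
Implicit Types (f g : G -> C) (a b : M).

(** The reason for the many constants of the form e / (t + 1): they make t times the constant less
    than e and also cover t = 0. *)
Lemma mul_divD1_lt (e t : R) : 0 < e -> 0 <= t -> e / (t + 1) * t < e.
Proof.
move=> e0 t0; rewrite mulrAC ltr_pdivrMr ?ltr_wpDl//.
by rewrite ltr_pM2l// ltrDl.
Qed.

(** f is cut radially to modulus at most r by the factor r / max(r, |f|). The remainder vanishes on
    K, where |f| <= r already, so [tight] applies to it. *)
Lemma tight_bound b (d : R) : 0 < d -> exists2 K : set G, compact K &
  forall f (r s : R), Cb f -> 0 < r -> (forall x, K x -> cabs (f x) <= r) ->
  (forall x, cabs (f x) <= s) -> cabs (pr f b) <= 4 * r * tvR b + d * s.
Proof.
move=> d0; have [K cK HK] := tight G_hausdorff b d0.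
exists K => // f r s bf r0 fr fs; have [cf _] := bf.
have s0 : 0 <= s by rewrite (le_trans _ (fs point))// cabs_ge0.
pose t x := r / Num.max r (cabs (f x)).
have m0 x : 0 < Num.max r (cabs (f x)) by rewrite lt_max r0.
have t01 x : 0 <= t x <= 1.
  by rewrite divr_ge0 ?(ltW r0) ?(ltW (m0 x))//= ler_pdivrMr// mul1r le_max lexx.
have ct : continuous t.
  move=> x; apply: cvgM; first exact: cvg_cst.
  apply: cvgV; first by rewrite gt_eqF.
  apply: (@max_fun_continuous _ _ _ (fun=> r) (fun x => cabs (f x))).
    exact: cst_continuous.
  exact: continuous_cabs.
pose h : G -> C := fun x => f x * (t x)%:C.
have hr x : cabs (h x) <= r.
  rewrite /h cabsM cabs_real ger0_norm; last by have /andP[] := t01 x.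
  by rewrite /t mulrA ler_pdivrMr// mulrC ler_pM2l// le_max lexx orbT.
have bh : Cb h.
  split; first exact: continuous_CM cf (continuous_real ct).
  by exists r.
have fhs x : cabs (f x - h x) <= s.
  rewrite /h -{1}[f x]mulr1 -mulrBr cabsM (le_trans _ (fs x))// ler_piMr ?cabs_ge0//.
  rewrite -[1]/(1%:C) -rmorphB /= cabs_real.
  by have /andP[h0 h1] := t01 x; rewrite ger0_norm ?subr_ge0// gerBl.
have -> : pr f b = pr h b + pr (fun x => f x - h x) b by rewrite prB// subrKC.
rewrite (le_trans (cabsD _ _))//; apply: lerD; first exact: pr_le.
apply: (HK _ _ (CbB bf bh) s0 fhs) => x Kx.
rewrite /h /t max_l ?(fr _ Kx)// divff ?gt_eqF//.
by rewrite mulr1 subrr.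
Qed.

(** The weights are the integrals against [a] of a partition of unity on a compact set carrying [a],
    fine enough that each [g j] varies by less than d on each piece. Neither weights nor points
    depend on j; this uniformity is what replaces vector valued integration. *)
Lemma approximation (J : Type) (g : J -> G -> C) (B e : R) a : 0 < e ->
  (forall j, Cb (g j)) -> (forall j x, cabs (g j x) <= B) ->
  (forall x (d : R), 0 < d ->
    \forall y \near x, forall j, cabs (g j y - g j x) < d) ->
  exists (n : nat) (x : nat -> G) (c : nat -> C),
    \sum_(i < n) cabs (c i) <= 4 * tvR a /\
    forall j, cabs (pr (g j) a - \sum_(i < n) c i * g j (x i)) <= e.
Proof.
move=> e0 bg gB geq.
have [B0|B0] := leP 0 B; last first.
  have J0 (j : J) : False.
    by have := le_lt_trans (gB j point) B0; rewrite ltNge cabs_ge0.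
  exists 0%N, (fun=> point), (fun=> 0); split=> [|j]; last by have := J0 j.
  by rewrite big_ord0 mulr_ge0// tvR_ge0.
have e2 : 0 < e / 2 by rewrite divr_gt0.
have B1 : 0 < B + 1 by rewrite ltr_wpDl.
have t1 : 0 < 4 * tvR a + 1 by rewrite ltr_wpDl// mulr_ge0// tvR_ge0.
have [K cK HK] := tight G_hausdorff a (divr_gt0 e2 B1).
pose d := e / 2 / (4 * tvR a + 1); have d0 : 0 < d by rewrite divr_gt0.
pose U x := [set y | forall j, cabs (g j y - g j x) < d]°.
have [|n [x [c [xK cc c0 cU [cs c1]]]]] :=
    partition_of_unity (R := R) G_hausdorff G_lc (U := U) cK.
  by move=> x Kx; split; [exact: open_interior|exact: geq].
have c01 i y : (i < n)%N -> c i y <= 1.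
  move=> iltn; apply: le_trans (cs y); rewrite (bigD1 (Ordinal iltn))//=.
  by rewrite lerDl sumr_ge0.
pose k i : G -> C := fun y => if (i < n)%N then (c i y)%:C else 0.
have bk i : Cb (k i).
  have [iltn|/negPf nin] := boolP (i < n)%N; last first.
    by rewrite (_ : k i = fun=> 0) ?/k ?nin//; exact: Cb_cst.
  have -> : k i = fun y => (c i y)%:C by rewrite /k iltn.
  split; first exact: continuous_real.
  by exists 1 => y; rewrite cabs_real ger0_norm// c01.
have kE (F : nat -> C) y : \sum_(i < n) F i * k i y = \sum_(i < n) F i * (c i y)%:C.
  by apply: eq_bigr => i _; rewrite /k ltn_ord.
have sumk (F : nat -> C) (s : R) y : 0 <= s ->
    (forall i, (i < n)%N -> c i y != 0 -> cabs (F i) <= s) ->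
    cabs (\sum_(i < n) F i * k i y) <= s.
  move=> s0 Fs; rewrite kE (le_trans (cabs_sum _ _ _))//.
  apply: (@le_trans _ _ (\sum_(i < n) s * c i y)); last first.
    by rewrite -mulr_sumr ler_piMr.
  apply: ler_sum => i _; rewrite cabsM cabs_real ger0_norm//.
  have [->|ci0] := eqVneq (c i y) 0; first by rewrite !mulr0.
  by rewrite ler_wpM2r// Fs.
exists n, x, (fun i => pr (k i) a); split.
  (* With these phases the sum of the moduli of the weights becomes the integral of one function,
     the sum of the s_i k_i, which is bounded by 1. *)
  have /choice[s sP] : forall i : nat, exists s : C,
      cabs s = 1 /\ s * pr (k i) a = (cabs (pr (k i) a))%:C.
    by move=> i; have [s s1 s2] := cabs_phase (pr (k i) a); exists s.
  have -> : \sum_(i < n) cabs (pr (k i) a) =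
      cabs (pr (fun y => \sum_(i < n) s i * k i y) a).
    rewrite (@pr_sum _ _ n (fun i y => s i * k i y)); last first.
      move=> i; have := Cb_linear (s i) (bk i) (Cb_cst 0).
      by under eq_fun do rewrite addr0.
    rewrite (_ : \sum_(i < n) pr _ a = (\sum_(i < n) cabs (pr (k i) a))%:C).
      by rewrite cabs_real ger0_norm// sumr_ge0// => i _; exact: cabs_ge0.
    rewrite rmorph_sum; apply: eq_bigr => i _.
    by rewrite prZ//; have [_ ->] := sP i.
  rewrite -[leRHS]mulr1 mulrAC; apply: pr_le.
    by apply: (@Cb_sum _ _ n (fun i y => s i * k i y)) => i; exact: CbZ.
  move=> y; apply: sumk => // i _ _.
  by have [-> _] := sP i.
move=> j.
have bgk i : Cb (fun y => g j y * k i y) by exact: CbM.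
have bS1 : Cb (fun y => \sum_(i < n) g j y * k i y).
  exact: (@Cb_sum _ _ n (fun i y => g j y * k i y)).
have bgc i : Cb (fun y => (g j y - g j (x i)) * k i y).
  by apply: CbM => //; apply: CbB => //; exact: Cb_cst.
have bS2 : Cb (fun y => \sum_(i < n) (g j y - g j (x i)) * k i y).
  exact: (@Cb_sum _ _ n (fun i y => (g j y - g j (x i)) * k i y)).
pose r : G -> C := fun y => g j y - \sum_(i < n) g j y * k i y.
have br : Cb r by exact: CbB.
have -> : pr (g j) a - \sum_(i < n) pr (k i) a * g j (x i) =
    pr r a + pr (fun y => \sum_(i < n) (g j y - g j (x i)) * k i y) a.
  rewrite /r prB//.
  rewrite -addrA; congr (_ + _).
  rewrite (@pr_sum _ _ n (fun i y => g j y * k i y))//.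
  rewrite (@pr_sum _ _ n (fun i y => (g j y - g j (x i)) * k i y))//.
  rewrite -!sumrN -big_split /=; apply: eq_bigr => i _.
  have -> : pr (fun y => (g j y - g j (x i)) * k i y) a =
      pr (fun y => g j y * k i y) a - g j (x i) * pr (k i) a.
    have := pr_linear (- g j (x i)) a (bk i) (bgk i).
    rewrite mulNr addrC => <-; congr (pr _ a); apply/funext => y.
    by rewrite mulrBl mulNr addrC.
  by rewrite mulrC; ring.
rewrite (le_trans (cabsD _ _))// [leRHS]splitr; apply: lerD.
  apply: (@le_trans _ _ (e / 2 / (B + 1) * B)); last first.
    by apply/ltW/mul_divD1_lt.
  have rE y : r y = g j y * (1 - \sum_(i < n) c i y)%:C.
    rewrite /r (kE (fun=> g j y)) -mulr_sumr rmorphB rmorph_sum rmorph1.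
    by rewrite mulrBr mulr1.
  apply: HK => // y; rewrite rE; last by move=> /c1 ->; rewrite subrr mulr0.
  rewrite cabsM cabs_real (le_trans _ (gB j y))// ler_piMr ?cabs_ge0//.
  rewrite ger0_norm ?subr_ge0 ?cs// gerBl; exact: sumr_ge0.
apply: (@le_trans _ _ (4 * d * tvR a)); last first.
  rewrite (mulrC 4) -mulrA; apply/ltW/mul_divD1_lt => //.
  by rewrite mulr_ge0// tvR_ge0.
apply: pr_le; first exact: bS2.
move=> y; apply: (sumk (fun i => g j y - g j (x i))); first exact: ltW.
move=> i iltn ciy0; have [L [cL LU] Lc] := cU i iltn; apply/ltW.
have Ly : L y by apply: contrapT => /Lc cy; move: ciy0; rewrite cy eqxx.
exact: (interior_subset (LU _ Ly)).
Qed.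

(** On a compact set carrying [b] the functions F x' approach F x uniformly by [tube]; elsewhere the
    difference is at most B + B and [b] is small. *)
Lemma continuous_pr_param (X : topologicalType) (F : X -> G -> C) (B : R) b :
  continuous (fun p : X * G => F p.1 p.2) -> (forall x y, cabs (F x y) <= B) ->
  continuous (fun x => pr (F x) b).
Proof.
move=> cF FB; apply/continuous_cabsP => x e e0.
have bF x' : Cb (F x').
  split; last by exists B.
  apply: (@continuous_compose _ _ _ (fun y => (x', y)) (fun p => F p.1 p.2)) => //.
  by move=> y; apply: cvg_pair; [exact: cvg_cst|exact: cvg_id].
have B0 : 0 <= B by rewrite (le_trans _ (FB x point))// cabs_ge0.
have e2 : 0 < e / 2 by rewrite divr_gt0.
have B1 : 0 < B + B + 1 by rewrite ltr_wpDl// addr_ge0.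
have [K cK HK] := tight_bound b (divr_gt0 e2 B1).
have t1 : 0 < 4 * tvR b + 1 by rewrite ltr_wpDl// mulr_ge0// tvR_ge0.
have r0 := divr_gt0 e2 t1.
apply: filterS (tube x cF cK r0) => x' Hx'.
rewrite -prB//; apply: (@le_lt_trans _ _ (4 * (e / 2 / (4 * tvR b + 1)) * tvR b +
  e / 2 / (B + B + 1) * (B + B))).
  apply: HK => //; first exact: CbB.
  - by move=> y /Hx' /ltW; rewrite cabsBC.
  - by move=> y; rewrite (le_trans (cabsB _ _))// lerD.
rewrite [ltRHS]splitr; apply: ltrD.
  rewrite (_ : 4 * _ * _ = e / 2 / (4 * tvR b + 1) * (4 * tvR b)); last by ring.
  by apply: mul_divD1_lt => //; rewrite mulr_ge0// tvR_ge0.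
by apply: mul_divD1_lt => //; rewrite addr_ge0.
Qed.

Lemma Cb_section (F : G -> G -> C) (B : R) x :
  continuous (fun p : G * G => F p.1 p.2) -> (forall x y, cabs (F x y) <= B) ->
  Cb (F x) /\ Cb (F^~ x).
Proof.
move=> cF FB; split; (split; last by exists B).
  apply: (@continuous_compose _ _ _ (fun y => (x, y)) (fun p => F p.1 p.2)) => //.
  by move=> y; apply: cvg_pair; [exact: cvg_cst|exact: cvg_id].
apply: (@continuous_compose _ _ _ (fun y => (y, x)) (fun p => F p.1 p.2)) => //.
by move=> y; apply: cvg_pair; [exact: cvg_id|exact: cvg_cst].
Qed.

Lemma continuous_swap (F : G -> G -> C) : continuous (fun p : G * G => F p.1 p.2) ->
  continuous (fun p : G * G => F p.2 p.1).
Proof.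
move=> cF.
apply: (@continuous_compose _ _ _ (fun p : G * G => (p.2, p.1)) (fun p => F p.1 p.2)) => //.
by move=> p; apply: cvg_pair; [exact: cvg_snd|exact: cvg_fst].
Qed.

Lemma Cb_pr_param (F : G -> G -> C) (B : R) b :
  continuous (fun p : G * G => F p.1 p.2) -> (forall x y, cabs (F x y) <= B) ->
  Cb (fun x => pr (F x) b).
Proof.
move=> cF FB; split; first exact: continuous_pr_param cF FB.
exists (4 * B * tvR b) => x; apply: pr_le => //.
by have [] := Cb_section x cF FB.
Qed.

(** For a finite combination of point masses in place of [a] the exchange is linearity. One such
    combination approximates, within d, the integrals against [a] of the sections F(., y) for all y
    in a compact set carrying [b], and that of the partial integral over [b], which is the index
    [None]. *)
Lemma fubini (F : G -> G -> C) (B : R) a b :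
  continuous (fun p : G * G => F p.1 p.2) -> (forall x y, cabs (F x y) <= B) ->
  pr (fun x => pr (F x) b) a = pr (fun y => pr (F^~ y) a) b.
Proof.
move=> cF FB; apply/eqP; rewrite -subr_eq0 -cabs_eq0 eq_le cabs_ge0 andbT.
have B0 : 0 <= B by rewrite (le_trans _ (FB point point))// cabs_ge0.
have bF x := (Cb_section x cF FB).1; have bF' x := (Cb_section x cF FB).2.
have cF' : continuous (fun p : G * G => (fun y x => F x y) p.1 p.2).
  exact: continuous_swap.
have FB' y x : cabs (F x y) <= B by [].
pose D := 4 * tvR b + 1 + 8 * B * tvR a.
suff H (d : R) : 0 < d ->
    cabs (pr (fun x => pr (F x) b) a - pr (fun y => pr (F^~ y) a) b) <= D * d.
  apply/ler_addgt0Pr => e e0; rewrite add0r.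
  have D0 : 0 < D.
    by rewrite /D ltr_wpDr ?mulr_ge0 ?tvR_ge0// ltr_wpDl// mulr_ge0 ?tvR_ge0.
  apply: (le_trans (H (e / D) _)); first by rewrite divr_gt0.
  by rewrite mulrCA divff ?mulr1// gt_eqF.
move=> d0; have [K cK HK] := tight_bound b d0.
pose g (j : option {y : G | K y}) x :=
  if j is Some y then F x (sval y) else pr (F x) b.
have [|||n [x [c [cs cg]]]] := @approximation _ g (B + 4 * B * tvR b) d a d0.
- by case=> [y|]; [exact: bF'|exact: Cb_pr_param cF FB].
- case=> [y|] x /=.
    by rewrite (le_trans (FB _ _))// lerDl !mulr_ge0// tvR_ge0.
  apply: (@le_trans _ _ (4 * B * tvR b)); last by rewrite lerDr.
  exact: pr_le.
- move=> x r r0.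
  have /continuous_cabsP/(_ x r r0) := @continuous_pr_param _ F B b cF FB.
  apply: filterS2 (tube x cF cK r0) => y h1 h2 [z|] /=.
    by apply: h1; exact: (svalP z).
  by rewrite cabsBC.
have h1 := cg None.
pose h y := pr (F^~ y) a - \sum_(i < n) c i * F (x i) y.
have bsum : Cb (fun y => \sum_(i < n) c i * F (x i) y).
  by apply: (@Cb_sum _ _ n (fun i y => c i * F (x i) y)) => i; exact: CbZ.
have bh : Cb h by apply: CbB => //; exact: Cb_pr_param cF' FB'.
have h2 : cabs (pr h b) <= 4 * d * tvR b + d * (8 * B * tvR a).
  apply: HK => //.
    by move=> y Ky; exact: (cg (Some (exist _ y Ky))).
  move=> y; rewrite (le_trans (cabsB _ _))//.
  rewrite (_ : 8 * B * tvR a = 4 * B * tvR a + 4 * tvR a * B); last by ring.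
  apply: lerD; first exact: pr_le.
  rewrite (le_trans (cabs_sum _ _ _))//.
  apply: (@le_trans _ _ (\sum_(i < n) cabs (c i) * B)).
    by apply: ler_sum => i _; rewrite cabsM ler_wpM2l// cabs_ge0.
  by rewrite -mulr_suml ler_wpM2r.
have hE : pr h b = pr (fun y => pr (F^~ y) a) b - \sum_(i < n) c i * pr (F (x i)) b.
  rewrite /h prB//; last exact: Cb_pr_param cF' FB'.
  congr (_ - _); rewrite (@pr_sum _ _ n (fun i y => c i * F (x i) y)); last first.
    move=> i; have := Cb_linear (c i) (bF (x i)) (Cb_cst 0).
    by under eq_fun do rewrite addr0.
  by apply: eq_bigr => i _; rewrite prZ.
rewrite (le_trans (cabs_dist _ (\sum_(i < n) c i * pr (F (x i)) b) _))//.
rewrite (_ : D * d = d + (4 * d * tvR b + d * (8 * B * tvR a))); last by rewrite /D; ring.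
by apply: lerD; [exact: h1|rewrite cabsBC -hE].
Qed.

End approximation.

(** * Convolution *)

(* Sealed because unification otherwise unfolds the choice operator in it. *)
HB.lock Definition conv (R : realType) (G : topologicalGroupType)
  (a b : measure_algebra R G) : measure_algebra R G := convolution a b.

Section convolution_theory.
Context {R : realType} {G : topologicalGroupType}.
Local Notation C := (R[i]^o).
Local Notation M := (measure_algebra R G).
Hypotheses (G_hausdorff : hausdorff_space G) (G_lc : locally_compact [set: G]).
Implicit Types (f g : G -> C) (a b c : M) (x y : G).

Lemma C0_isC0 (f : C0 R G) : isC0 (f : G -> C).
Proof.
case: f => f cf f0 /=; split => // e e0; have [K cK fK] := f0 e e0.
by exists K => // x /fK; rewrite ltr_normr_cabs.
Qed.

Lemma isC0_vanishing f : isC0 f -> forall e : R, 0 < e ->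
  exists2 K : set G, compact K & forall x, ~ K x -> `|f x| < e%:C.
Proof.
move=> [_ f0] e e0; have [K cK fK] := f0 e e0.
by exists K => // x /fK; rewrite ltr_normr_cabs.
Qed.

Definition C0_of f (f0 : isC0 f) : C0 R G := MkC0 f0.1 (isC0_vanishing f0).

Lemma compact_mul (p : G -> G -> G) (K L : set G) :
  continuous (fun z : G * G => p z.1 z.2) -> compact K -> compact L ->
  compact [set p z.1 z.2 | z in K `*` L].
Proof.
move=> cp cK cL; apply: continuous_compact; last exact: compact_setX.
exact: continuous_subspaceT.
Qed.

Lemma continuous_mulg : continuous (fun z : G * G => (z.1 * z.2)%g).
Proof. exact: mulg_continuous. Qed.

Lemma isC0_pr_param (F : G -> G -> C) (B : R) b :
  continuous (fun p : G * G => F p.1 p.2) -> (forall x y, cabs (F x y) <= B) ->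
  (forall (K : set G) (e : R), compact K -> 0 < e -> exists2 L : set G, compact L &
    forall x y, ~ L x -> K y -> cabs (F x y) < e) ->
  isC0 (fun x => pr (F x) b).
Proof.
move=> cF FB FL; split; first exact: continuous_pr_param cF FB.
move=> e e0; have B0 : 0 <= B by rewrite (le_trans _ (FB point point))// cabs_ge0.
have e2 : 0 < e / 2 by rewrite divr_gt0.
have B1 : 0 < B + 1 by rewrite ltr_wpDl.
have [K cK HK] := tight_bound G_hausdorff b (divr_gt0 e2 B1).
have t0 : 0 <= 4 * tvR b by rewrite mulr_ge0// tvR_ge0.
have t1 : 0 < 4 * tvR b + 1 by rewrite ltr_wpDl.
have r0 := divr_gt0 e2 t1.
have [L cL LF] := FL K _ cK r0; exists L => // x nLx.
apply: (@le_lt_trans _ _ (4 * (e / 2 / (4 * tvR b + 1)) * tvR b +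
  e / 2 / (B + 1) * B)).
  apply: (HK _ _ _ (Cb_section x cF FB).1 r0 _ (FB x)) => y Ky.
  exact/ltW/LF.
rewrite [ltRHS]splitr; apply: ltrD; last exact: mul_divD1_lt.
rewrite (_ : 4 * _ * _ = e / 2 / (4 * tvR b + 1) * (4 * tvR b)); last by ring.
exact: mul_divD1_lt.
Qed.

(** The adjoints of convolution: [lact a f] integrated against b, and [ract b f] against a, both
    give the integral of f against [conv a b]. *)
Definition lact a f : G -> C := fun y => pr (fun x => f (x * y)%g) a.
Definition ract b f : G -> C := fun x => pr (fun y => f (x * y)%g) b.

Lemma continuous_fmul f : continuous f -> continuous (fun p : G * G => f (p.1 * p.2)%g).
Proof. by move=> cf; exact: continuous_compose continuous_mulg cf. Qed.

Lemma continuous_fmul_swap f :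
  continuous f -> continuous (fun p : G * G => f (p.2 * p.1)%g).
Proof.
move=> cf; apply: (@continuous_compose _ _ _ (fun p : G * G => (p.2 * p.1)%g) f) => //.
by apply: continuous_mul; [exact: continuous_snd|exact: continuous_fst].
Qed.

Lemma Cb_lact a f : Cb f -> Cb (lact a f).
Proof.
move=> [cf [B fB]]; apply: (@Cb_pr_param _ _ _ (fun y x => f (x * y)%g) B) => //.
exact: continuous_fmul_swap.
Qed.

Lemma Cb_ract a f : Cb f -> Cb (ract a f).
Proof.
move=> [cf [B fB]]; apply: (@Cb_pr_param _ _ _ (fun x y => f (x * y)%g) B) => //.
exact: continuous_fmul.
Qed.

Lemma Cb_lmul x f : Cb f -> Cb (fun y => f (x * y)%g).
Proof.
move=> [cf [B fB]]; split; last by exists B.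
exact: continuous_compose (@continuous_lmul G x) cf.
Qed.

Lemma Cb_rmul x f : Cb f -> Cb (fun y => f (y * x)%g).
Proof.
move=> [cf [B fB]]; split; last by exists B.
exact: continuous_compose (@continuous_rmul G x) cf.
Qed.

Lemma isC0_lact a f : isC0 f -> isC0 (lact a f).
Proof.
move=> f0; have [cf [B fB]] := isC0_Cb f0.
apply: (@isC0_pr_param (fun y x => f (x * y)%g) B) => //.
  exact: continuous_fmul_swap.
move=> K e cK e0; have [_ /(_ e e0)[L cL fL]] := f0.
exists [set (z.1^-1 * z.2)%g | z in K `*` L].
  apply: (@compact_mul (fun x y => x^-1 * y)%g) => //.
  apply: continuous_mul; last exact: continuous_snd.
  by apply: continuous_inv; exact: continuous_fst.
move=> y x nLy Kx; apply: fL => Lxy; apply: nLy.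
by exists (x, (x * y)%g) => //=; rewrite mulKg.
Qed.

Lemma isC0_ract a f : isC0 f -> isC0 (ract a f).
Proof.
move=> f0; have [cf [B fB]] := isC0_Cb f0.
apply: (@isC0_pr_param (fun x y => f (x * y)%g) B) => //.
  exact: continuous_fmul.
move=> K e cK e0; have [_ /(_ e e0)[L cL fL]] := f0.
exists [set (z.2 * z.1^-1)%g | z in K `*` L].
  apply: (@compact_mul (fun x y => y * x^-1)%g) => //.
  apply: continuous_mul; first exact: continuous_snd.
  by apply: continuous_inv; exact: continuous_fst.
move=> x y nLy Kx; apply: fL => Lxy; apply: nLy.
by exists (y, (x * y)%g) => //=; rewrite mulgK.
Qed.

Lemma lact_le a f (s : R) y : Cb f -> (forall x, cabs (f x) <= s) ->
  cabs (lact a f y) <= 4 * s * tvR a.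
Proof. by move=> bf fs; apply: pr_le => //; exact: Cb_rmul. Qed.

Lemma lact_linear (k : C) a b f y : Cb f ->
  lact (k *: a + b) f y = k * lact a f y + lact b f y.
Proof. by move=> bf; apply: pr_linear_measure; exact: Cb_rmul. Qed.

Local Notation "a '**' b" := (conv a b) (at level 40, left associativity).

(** The constant 64 is 4^3: a factor 4 for each of the two integrals and one from
    [riesz_representation]. *)
Lemma convolution_exists a b : exists p : M,
  (forall f, isC0 f -> pr f p = pr (lact a f) b) /\ tvR p <= 64 * tvR a * tvR b.
Proof.
have K0 : 0 <= 4 * (4 * tvR a) * tvR b by rewrite !mulr_ge0// tvR_ge0.
have [||p [pE p4]] := @riesz_representation R G G_hausdorff G_lc
  (fun f => pr (lact a f) b) _ K0.
- move=> k f g f0 g0; rewrite -pr_linear; try by apply/isC0_Cb/isC0_lact.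
  congr (pr _ b); apply/funext => y; rewrite /lact -pr_linear//.
    by apply: Cb_rmul; exact: isC0_Cb.
  by apply: Cb_rmul; exact: isC0_Cb.
- move=> f s f0 fs; have bf := isC0_Cb f0.
  have := pr_le b (Cb_lact a bf) (fun y => lact_le a y bf fs).
  by rewrite (_ : 4 * _ * _ = 4 * (4 * tvR a) * tvR b * s)//; ring.
- exists p; split => //; apply: le_trans p4 _.
  by rewrite (_ : 4 * _ = 64 * tvR a * tvR b)//; ring.
Qed.

Lemma pr_conv_C0 a b f : isC0 f -> pr f (a ** b) = pr (lact a f) b.
Proof.
move=> f0; rewrite conv.unlock /convolution; case: xgetP => [p _ /(_ (C0_of f0))//|].
have [p [pE _]] := convolution_exists a b.
by move=> /(_ p); case => g; rewrite /C0_pairing -[LHS]/(pr g p) pE//; exact: C0_isC0.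
Qed.

Lemma tvR_conv a b : tvR (a ** b) <= 64 * tvR a * tvR b.
Proof.
have [p [pE pt]] := convolution_exists a b.
rewrite (_ : a ** b = p)//; apply: (pr_inj G_hausdorff G_lc) => f f0.
by rewrite pr_conv_C0// pE.
Qed.

Lemma conv_defect a b f g : Cb f -> isC0 g ->
  pr f (a ** b) - pr (lact a f) b =
  pr (fun x => f x - g x) (a ** b) - pr (lact a (fun x => f x - g x)) b.
Proof.
move=> bf g0; have bg := isC0_Cb g0.
have -> : lact a (fun x => f x - g x) = fun y => lact a f y - lact a g y.
  by apply/funext => y; exact: (prB a (Cb_rmul y bf) (Cb_rmul y bg)).
rewrite (prB _ bf bg) (prB _ (Cb_lact a bf) (Cb_lact a bg)) (pr_conv_C0 _ _ g0).
by rewrite opprB addrA subrK.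
Qed.

(** On C_0 this is the definition of convolution. In general let g be f times a cutoff equal to 1 on
    K and on the product Ka Kb, where K, Ka, Kb carry the convolution, a and b. By [conv_defect]
    only f - g contributes. It vanishes on K, and its inner integral is small for y in Kb because it
    vanishes at xy for x in Ka. *)
Lemma pr_conv a b f : Cb f -> pr f (a ** b) = pr (lact a f) b.
Proof.
move=> bf; have [cf [B fB]] := bf.
have B0 : 0 <= B by rewrite (le_trans _ (fB point))// cabs_ge0.
apply/eqP; rewrite -subr_eq0 -cabs_eq0 eq_le cabs_ge0 andbT.
pose D := B + (4 * B * tvR b + 4 * B * tvR a).
have D0 : 0 <= D by rewrite /D !addr_ge0// ?mulr_ge0// tvR_ge0.
have D1 : 0 < D + 1 by rewrite ltr_wpDl.
apply/ler_addgt0Pr => e e0; rewrite add0r.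
have d0 := divr_gt0 e0 D1; set d := e / (D + 1) in d0.
apply: (@le_trans _ _ (d * D)); last exact/ltW/mul_divD1_lt.
have [K cK HK] := tight G_hausdorff (a ** b) d0.
have [Ka cKa HKa] := tight G_hausdorff a d0.
have [Kb cKb HKb] := tight_bound G_hausdorff b d0.
pose L := K `|` [set (z.1 * z.2)%g | z in Ka `*` Kb].
have cL : compact L by apply: compactU => //; apply: compact_mul => //; exact: continuous_mulg.
have [h [ch [Lh cLh hLh]] [h01 h1]] := @cutoff R G G_hausdorff G_lc _ cL.
pose g : G -> C := fun x => f x * (h x)%:C.
have cg : continuous g := continuous_CM cf (continuous_real ch).
have g0 : isC0 g.
  by apply: (isC0_compact cg cLh) => x /hLh; rewrite /g => ->; rewrite mulr0.
have bg := isC0_Cb g0.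
have bfg := CbB bf bg.
have fg x : cabs (f x - g x) <= B.
  rewrite /g -{1}[f x]mulr1 -mulrBr cabsM (le_trans _ (fB x))// ler_piMr ?cabs_ge0//.
  rewrite -[1]/(1%:C) -rmorphB /= cabs_real.
  by have /andP[hx0 hx1] := h01 x; rewrite ger0_norm ?subr_ge0// gerBl.
have fgL x : L x -> f x - g x = 0 by move=> /h1; rewrite /g => ->; rewrite mulr1 subrr.
rewrite (conv_defect a b bf g0).
rewrite (le_trans (cabsB _ _))// /D mulrDr; apply: lerD.
  by apply: (HK _ _ bfg B0 fg) => x Kx; apply: fgL; left.
have r0 : 0 <= d * B by rewrite mulr_ge0// ltW.
apply: (@le_trans _ _ (4 * (d * B) * tvR b + d * (4 * B * tvR a))); last first.
  by rewrite mulrDr lerD2r (_ : 4 * _ * _ = d * (4 * B * tvR b))//; ring.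
apply/ler_addgt0Pr => r rgt0.
have t1 : 0 < 4 * tvR b + 1 by rewrite ltr_wpDl// mulr_ge0// tvR_ge0.
have q0 := divr_gt0 rgt0 t1.
apply: (@le_trans _ _ (4 * (d * B + r / (4 * tvR b + 1)) * tvR b + d * (4 * B * tvR a))).
  apply: (HKb _ _ _ (Cb_lact a bfg)).
  - by rewrite ltr_wpDl.
  - move=> y Kby; apply: (@le_trans _ _ (d * B)); last by rewrite lerDl ltW.
    apply: (HKa _ _ (Cb_rmul y bfg) B0) => x; first exact: fg.
    by move=> Kax; apply: fgL; right; exists (x, y).
  - by move=> y; exact: lact_le.
rewrite (_ : 4 * _ * _ + _ = 4 * (d * B) * tvR b + d * (4 * B * tvR a) +
  r / (4 * tvR b + 1) * (4 * tvR b)); last by ring.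
rewrite lerD2l.
by apply/ltW/mul_divD1_lt => //; rewrite mulr_ge0// tvR_ge0.
Qed.

Lemma pr_conv_ract a b f : Cb f -> pr f (a ** b) = pr (ract b f) a.
Proof.
move=> bf; rewrite pr_conv//; have [cf [B fB]] := bf.
rewrite /lact /ract.
apply: (@fubini _ _ _ _ (fun y x => f (x * y)%g) B) => //.
exact: continuous_fmul_swap.
Qed.

Lemma convA a b c : a ** (b ** c) = a ** b ** c.
Proof.
apply: (pr_inj G_hausdorff G_lc) => f /isC0_Cb bf.
rewrite !pr_conv//; last exact: Cb_lact.
congr (pr _ c); apply/funext => z; rewrite /lact pr_conv; last exact: Cb_rmul.
congr (pr _ b); apply/funext => y; rewrite /lact; congr (pr _ a).
by apply/funext => x; rewrite mulgA.
Qed.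

Lemma convDl (k : C) a b c : (k *: a + b) ** c = k *: (a ** c) + b ** c.
Proof.
apply: (pr_inj G_hausdorff G_lc) => f /isC0_Cb bf.
rewrite (pr_linear_measure k _ _ bf).
rewrite (pr_conv (k *: a + b) c bf) (pr_conv a c bf) (pr_conv b c bf).
rewrite -(pr_linear k c (Cb_lact a bf) (Cb_lact b bf)).
by congr (pr _ c); apply/funext => y; exact: lact_linear.
Qed.

Lemma convDr (k : C) a b c : c ** (k *: a + b) = k *: (c ** a) + c ** b.
Proof.
apply: (pr_inj G_hausdorff G_lc) => f /isC0_Cb bf.
rewrite pr_linear_measure// !pr_conv//.
by rewrite pr_linear_measure//; exact: Cb_lact.
Qed.

Lemma convBl a b c : (a - b) ** c = a ** c - b ** c.
Proof. by have := convDl (-1) b a c; rewrite !scaleN1r addrC => ->; rewrite addrC. Qed.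

Lemma convBr a b c : c ** (a - b) = c ** a - c ** b.
Proof. by have := convDr (-1) b a c; rewrite !scaleN1r addrC => ->; rewrite addrC. Qed.

Lemma point_mass_exists x : exists p : M,
  (forall f, isC0 f -> pr f p = f x) /\ tvR p <= 4.
Proof.
have [//|||p [pE p4]] := @riesz_representation R G G_hausdorff G_lc (@^~ x) 1.
- by [].
- by move=> f s _ fs; rewrite mul1r.
- by exists p; split => //; rewrite -[4]mulr1.
Qed.

Definition point_mass x : M := xget 0 [set p | forall f, isC0 f -> pr f p = f x].

Local Notation dl := point_mass.

Lemma pr_point_mass_C0 x f : isC0 f -> pr f (dl x) = f x.
Proof.
move=> f0; rewrite /point_mass; case: xgetP => [p _ /(_ _ f0)//|].
have [p [pE _]] := point_mass_exists x.
by move=> /(_ p); case.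
Qed.

Lemma tvR_point_mass x : tvR (dl x) <= 4.
Proof.
have [p [pE pt]] := point_mass_exists x.
rewrite (_ : dl x = p)//; apply: (pr_inj G_hausdorff G_lc) => f f0.
by rewrite pr_point_mass_C0// pE.
Qed.

Lemma pr_point_mass x f : Cb f -> pr f (dl x) = f x.
Proof.
move=> bf; have [cf [B fB]] := bf.
have B0 : 0 <= B by rewrite (le_trans _ (fB point))// cabs_ge0.
apply/eqP; rewrite -subr_eq0 -cabs_eq0 eq_le cabs_ge0 andbT.
have B1 : 0 < B + 1 by rewrite ltr_wpDl.
apply/ler_addgt0Pr => e e0; rewrite add0r.
have d0 := divr_gt0 e0 B1.
apply: (@le_trans _ _ (e / (B + 1) * B)); last exact/ltW/mul_divD1_lt.
have [K cK HK] := tight G_hausdorff (dl x) d0.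
have cL : compact (K `|` [set x]) by apply: compactU => //; exact: compact_set1.
have [h [ch [Lh cLh hLh]] [h01 h1]] := @cutoff R G G_hausdorff G_lc _ cL.
pose g : G -> C := fun x => f x * (h x)%:C.
have cg : continuous g := continuous_CM cf (continuous_real ch).
have g0 : isC0 g.
  by apply: (isC0_compact cg cLh) => z /hLh; rewrite /g => ->; rewrite mulr0.
have bg := isC0_Cb g0.
have gx : g x = f x by rewrite /g h1 ?mulr1//; right.
rewrite -gx -(pr_point_mass_C0 x g0) -prB//.
apply: (HK _ _ (CbB bf bg) B0) => z.
  rewrite /g -{1}[f z]mulr1 -mulrBr cabsM (le_trans _ (fB z))// ler_piMr ?cabs_ge0//.
  rewrite -[1]/(1%:C) -rmorphB /= cabs_real.
  by have /andP[hx0 hx1] := h01 z; rewrite ger0_norm ?subr_ge0// gerBl.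
by move=> Kz; rewrite /g h1 ?mulr1 ?subrr//; left.
Qed.

Lemma pr_lmul x a f : Cb f -> pr f (dl x ** a) = pr (fun y => f (x * y)%g) a.
Proof.
move=> bf; rewrite pr_conv//; congr (pr _ a); apply/funext => y.
by rewrite /lact pr_point_mass//; exact: Cb_rmul.
Qed.

Lemma pr_rmul x a f : Cb f -> pr f (a ** dl x) = pr (fun y => f (y * x)%g) a.
Proof. by move=> bf; rewrite pr_conv// pr_point_mass//; exact: Cb_lact. Qed.

Lemma point_massM x y : dl (x * y)%g = dl x ** dl y.
Proof.
apply: (pr_inj G_hausdorff G_lc) => f /isC0_Cb bf.
by rewrite pr_lmul// !pr_point_mass//; exact: Cb_lmul.
Qed.

Lemma conv1l a : dl 1%g ** a = a.
Proof.
apply: (pr_inj G_hausdorff G_lc) => f /isC0_Cb bf.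
by rewrite pr_lmul//; congr (pr _ a); apply/funext => y; rewrite mul1g.
Qed.

Lemma conv1r a : a ** dl 1%g = a.
Proof.
apply: (pr_inj G_hausdorff G_lc) => f /isC0_Cb bf.
by rewrite pr_rmul//; congr (pr _ a); apply/funext => y; rewrite mulg1.
Qed.

Lemma tvR_lmul x a : tvR (dl x ** a) <= 16 * tvR a.
Proof.
rewrite (_ : 16 * _ = 4 * (4 * tvR a)); last by ring.
apply: (tvR_le G_hausdorff G_lc); first by rewrite mulr_ge0// tvR_ge0.
move=> f s f0 fs; have bf := isC0_Cb f0; rewrite (pr_lmul _ _ bf) mulrAC.
exact: (pr_le a (Cb_lmul x bf)).
Qed.

Lemma tvR_rmul x a : tvR (a ** dl x) <= 16 * tvR a.
Proof.
rewrite (_ : 16 * _ = 4 * (4 * tvR a)); last by ring.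
apply: (tvR_le G_hausdorff G_lc); first by rewrite mulr_ge0// tvR_ge0.
move=> f s f0 fs; have bf := isC0_Cb f0; rewrite (pr_rmul _ _ bf) mulrAC.
exact: (pr_le a (Cb_rmul x bf)).
Qed.

Definition mass a : C := pr (fun=> 1) a.

Lemma mass_conv a b : mass (a ** b) = mass a * mass b.
Proof.
rewrite /mass pr_conv; last exact: Cb_cst.
have := prZ (mass a) b (Cb_cst 1); rewrite mulr1 => <-.
by congr (pr _ b).
Qed.

Lemma mass_point_mass x : mass (dl x) = 1.
Proof. by rewrite /mass pr_point_mass//; exact: Cb_cst. Qed.

(* The measures with norm continuous left (right) translates; they play the role
   of the absolutely continuous ones. *)
Definition lcont a := forall e : R, 0 < e ->
  \forall x \near 1%g, tvR (dl x ** a - a) < e.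
Definition rcont a := forall e : R, 0 < e ->
  \forall x \near 1%g, tvR (a ** dl x - a) < e.

Lemma conv_small (t e : R) : 0 <= t -> 0 < e -> forall c : R, 0 <= c ->
  c < e / (64 * t + 1) -> 64 * c * t < e.
Proof.
move=> t0 e0 c c0 ce; have t640 : 0 <= 64 * t by rewrite mulr_ge0.
apply: le_lt_trans (mul_divD1_lt e0 t640).
rewrite (_ : 64 * c * t = c * (64 * t)); last by ring.
by rewrite ler_wpM2r// ltW.
Qed.

Lemma lcont_conv a b : lcont a -> lcont (a ** b).
Proof.
move=> la e e0; have t1 : 0 < 64 * tvR b + 1.
  by rewrite ltr_wpDl// mulr_ge0// tvR_ge0.
apply: filterS (la _ (divr_gt0 e0 t1)) => x Hx.
rewrite convA -convBl (le_lt_trans (tvR_conv _ _))//.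
by apply: conv_small => //; exact: tvR_ge0.
Qed.

Lemma rcont_conv a b : rcont b -> rcont (a ** b).
Proof.
move=> rb e e0; have t1 : 0 < 64 * tvR a + 1.
  by rewrite ltr_wpDl// mulr_ge0// tvR_ge0.
apply: filterS (rb _ (divr_gt0 e0 t1)) => x Hx.
rewrite -convA -convBr (le_lt_trans (tvR_conv _ _))//.
by rewrite mulrAC; apply: conv_small => //; exact: tvR_ge0.
Qed.

Lemma near_conj x (P : set G) :
  (\forall u \near 1%g, P u) -> \forall u \near 1%g, P (x^-1 * u * x)%g.
Proof.
move=> HP; have : (x^-1 * u * x)%g @[u --> 1%g] --> (x^-1 * 1 * x)%g.
  apply: (@continuous_compose _ _ _ (fun u => x^-1 * u)%g (fun u => u * x)%g).
    exact: continuous_lmul.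
  exact: continuous_rmul.
by rewrite mulg1 mulVg; apply.
Qed.

Lemma lcont_lmul x a : lcont a -> lcont (dl x ** a).
Proof.
move=> la e e0; have e16 : 0 < e / 16 by rewrite divr_gt0.
apply: filterS (near_conj x (la _ e16)) => u Hu.
have -> : dl u ** (dl x ** a) - dl x ** a =
    dl x ** (dl (x^-1 * u * x)%g ** a - a).
  by rewrite convBr !convA -!point_massM !mulgA mulgV mul1g.
by rewrite (le_lt_trans (tvR_lmul _ _))// mulrC -ltr_pdivlMr.
Qed.

Lemma rcont_rmul x a : rcont a -> rcont (a ** dl x).
Proof.
move=> ra e e0; have e16 : 0 < e / 16 by rewrite divr_gt0.
apply: filterS (near_conj x^-1%g (ra _ e16)) => u; rewrite invgK => Hu.
have -> : a ** dl x ** dl u - a ** dl x = (a ** dl (x * u * x^-1)%g - a) ** dl x.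
  by rewrite convBl -!convA -!point_massM mulgVK.
by rewrite (le_lt_trans (tvR_rmul _ _))// mulrC -ltr_pdivlMr.
Qed.

Lemma lcont_continuous a x (e : R) : lcont a -> 0 < e ->
  \forall y \near x, tvR (dl y ** a - dl x ** a) < e.
Proof.
move=> la e0; apply: near_of_lmul.
apply: filterS (lcont_lmul x la e0) => u.
by rewrite convA -point_massM.
Qed.

Lemma rcont_continuous a x (e : R) : rcont a -> 0 < e ->
  \forall y \near x, tvR (a ** dl y - a ** dl x) < e.
Proof.
move=> ra e0; apply: near_of_rmul.
apply: filterS (rcont_rmul x ra e0) => u.
by rewrite -convA -point_massM.
Qed.

End convolution_theory.

Arguments lact {R G}.
Arguments ract {R G}.
Arguments point_mass {R G}.
Arguments mass {R G}.
Arguments lcont {R G}.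
Arguments rcont {R G}.

(** * From a virtual diagonal to Connes-amenability *)

Section linear_functions.
Context {K : ringType} {U V : lmodType K} {f : U -> V} (fl : linear f).

Lemma linear_fun0 : f 0 = 0.
Proof. by have := fl (-1) 0 0; rewrite scaler0 addr0 scaleN1r addNr. Qed.

Lemma linear_funD x y : f (x + y) = f x + f y.
Proof. by have := fl 1 x y; rewrite !scale1r. Qed.

Lemma linear_funZ k x : f (k *: x) = k *: f x.
Proof. by have := fl k x 0; rewrite !addr0 linear_fun0 addr0. Qed.

Lemma linear_funB x y : f (x - y) = f x - f y.
Proof. by rewrite addrC -scaleN1r fl scaleN1r addrC. Qed.

End linear_functions.

(** * Functionals continuous for a w*-topology *)

Section wstar_topology.
Context {R : realType}.
Local Notation C := (R[i]^o).

Lemma cvg_wstarP (E' : Type) (E : choiceType) (p : E' -> E -> C)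
    (F : set_system E) (x : E) : Filter F ->
  (F --> (x : wstar p)) <-> forall phi, p phi @ F --> p phi x.
Proof.
move=> FF; pose ev (x : E) : {ptws E' -> C} := fun phi => p phi x.
have evP : ev @ F --> ev x <-> forall phi, p phi @ F --> p phi x.
  apply: (iff_trans (cvg_sup _ _ _)); split=> H phi.
    move=> U Ux; have := H phi ((fun f : E' -> C => f phi) @^-1` U); apply.
    exact: (@initial_continuous _ _ (fun f : E' -> C => f phi) (ev x)).
  move=> B [_ [[U oU <-] /= Ux] UB]; apply: filterS UB _.
  by apply: (H phi U); apply: open_nbhs_nbhs.
split=> [Fx|/evP Fx].
  apply/evP => U Ux; have := Fx (ev @^-1` U); apply.
  exact: (@initial_continuous E {ptws E' -> C} ev x).
move=> B [_ [[U oU <-] /= Ux] UB]; apply: filterS UB _.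
by apply: (Fx U); apply: open_nbhs_nbhs.
Qed.

Lemma continuous_wstar_pairing (E' : Type) (E : choiceType) (p : E' -> E -> C) phi :
  continuous (p phi : wstar p -> C).
Proof.
move=> x; apply: (iffLR (@cvg_wstarP _ _ p (nbhs (x : wstar p)) x _)).
exact: cvg_id.
Qed.

Lemma continuous_to_wstar (T : topologicalType) (E' : Type) (E : choiceType)
    (p : E' -> E -> C) (f : T -> E) :
  (forall phi, continuous (fun t => p phi (f t))) -> continuous (f : T -> wstar p).
Proof. by move=> cf t; apply/cvg_wstarP => phi; exact: (cf phi t). Qed.

Lemma continuous_pairing_comp (T : topologicalType) (E' : Type) (E : choiceType)
    (p : E' -> E -> C) (f : T -> E) phi :
  continuous (f : T -> wstar p) -> continuous (fun t => p phi (f t)).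
Proof. by move=> cf; exact: continuous_compose cf (@continuous_wstar_pairing _ _ p phi). Qed.

(** Induction on the list. If u does not vanish on the common kernel of the tail, take x0 there with
    u x0 nonzero. Then p phi x0 is nonzero too, and u minus (u x0 / p phi x0) times p phi vanishes
    on that kernel. *)
Lemma linear_combination (E' : Type) (E : lmodType R[i]) (p : E' -> E -> C)
    (s : seq E') (u : E -> C) :
  (forall phi, linear (p phi)) -> linear u ->
  (forall x, (forall phi, List.In phi s -> p phi x = 0) -> u x = 0) ->
  exists l : seq (C * E'), forall x, u x = \sum_(z <- l) z.1 * p z.2 x.
Proof.
move=> pl; elim: s u => [|phi s IH] u ul us.
  by exists [::] => x; rewrite big_nil us.
have [H|] := pselect (forall x, (forall psi, List.In psi s -> p psi x = 0) -> u x = 0).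
  exact: IH.
move=> /existsNP[x0 /not_implyP[x0s ux0]].
have px0 : p phi x0 != 0.
  by apply/eqP => px0; apply: ux0; apply: us => psi [<-|/x0s].
pose k := u x0 / p phi x0.
have [|x xs|l ul'] := IH (fun x => u x - k * p phi x).
- move=> c x y; rewrite ul pl mulrDr opprD addrACA scalerBr; congr (_ - _ + _).
  by rewrite -[_ *: p phi x]/(c * p phi x) -[RHS]/(c * _) mulrCA.
- have : u (- (p phi x / p phi x0) *: x0 + x) = 0.
    apply: us => psi [<-|spsi].
      by rewrite pl -[_ *: _]/(_ * p phi x0) mulNr divfK// addNr.
    by rewrite pl (x0s _ spsi) (xs _ spsi) scaler0 addr0.
  rewrite ul -[_ *: u x0]/(_ * u x0) mulNr addrC => <-.
  by congr (_ - _); rewrite /k mulrAC [RHS]mulrAC (mulrC (u x0)).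
- exists ((k, phi) :: l) => x; rewrite big_cons /= -ul'.
  by rewrite addrC subrK.
Qed.

(** Continuity at 0 bounds u by 1 on a basic neighbourhood, given by finitely many phi and a radius.
    By scaling, u vanishes on the common kernel of these phi. *)
Lemma wstar_functional (E' : Type) (E : lmodType R[i]) (p : E' -> E -> C)
    (u : E -> C) :
  (forall phi, linear (p phi)) -> linear u -> continuous (u : wstar p -> C) ->
  exists l : seq (C * E'), forall x, u x = \sum_(z <- l) z.1 * p z.2 x.
Proof.
move=> pl ul uc.
pose B (se : seq E' * R) : set E :=
  [set x | forall phi, List.In phi se.1 -> cabs (p phi x) < se.2].
pose F := filter_from [set se : seq E' * R | 0 < se.2] B.
have FF : Filter F.
  apply: filter_from_filter; first by exists ([::], 1) => /=.
  move=> [s d] [t e] /= d0 e0; exists (s ++ t, Order.min d e).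
    by rewrite /= lt_min d0.
  move=> x /= Bx; split=> phi /= phis.
    by have := Bx phi (List.in_or_app _ _ _ (or_introl phis)); rewrite lt_min => /andP[].
  by have := Bx phi (List.in_or_app _ _ _ (or_intror phis)); rewrite lt_min => /andP[].
have F0 : F --> (0 : wstar p).
  apply/cvg_wstarP => phi; rewrite (linear_fun0 (pl phi)).
  apply/cvg_cabsP => e e0; exists ([:: phi], e) => //= x Bx.
  by rewrite cabsBC subr0; apply: Bx; left.
have := uc 0 : u x @[x --> (0 : wstar p)] --> u 0.
rewrite (linear_fun0 ul) => uc0.
have /cvg_cabsP/(_ 1 ltr01)[[s d] /= d0 sd] : u @ F --> (0 : C).
  exact: cvg_trans (cvg_app _ F0) uc0.
apply: (linear_combination (s := s) pl ul) => x xs.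
apply/eqP; rewrite -cabs_eq0; apply: contraT => ux.
have : cabs (u ((2 / cabs (u x))%:C *: x)) < 1.
  rewrite -cabsN -sub0r; apply: sd => phi sphi.
  by rewrite (linear_funZ (pl phi)) xs// scaler0 cabs0.
rewrite (linear_funZ ul) -[_ *: u x]/(_ * u x) cabsM cabs_real ger0_norm ?divr_ge0 ?cabs_ge0//.
by rewrite divfK// ltNge ler1n.
Qed.

End wstar_topology.

(** * Derivations implemented through a diagonal *)

Section diagonal_Connes_amenable.
Context {R : realType}.
Local Notation C := (R[i]^o).
Variables (A : normedModType R[i]) (mul : A -> A -> A) (A' : Type) (pA : A' -> A -> C).
Hypotheses (mul_linearl : forall c, linear (mul^~ c)) (mul_linearr : forall b, linear (mul b)).
Hypothesis mul_bounded : exists K : R[i], forall a b, `|mul a b| <= K * `|a| * `|b|.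
Hypotheses (pA_linear : forall phi, linear (pA phi))
  (pA_bounded : forall phi, exists K : R[i], forall a, `|pA phi a| <= K * `|a|).
Hypotheses (mul_wstarl : forall c, continuous (mul^~ c : wstar pA -> wstar pA))
  (mul_wstarr : forall b, continuous (mul b : wstar pA -> wstar pA)).
Variable e : A.
Hypothesis mul1l : forall a, mul e a = a.

(** The constants in the definitions of boundedness are arbitrary elements of [R[i]]; this makes
    them nonnegative. *)
Lemma le_normM (y k t : R[i]) : 0 <= y -> 0 <= t -> y <= k * t -> y <= `|k| * t.
Proof.
move=> y0 t0 yk; rewrite -[t in leRHS](ger0_norm t0) -normrM ger0_norm//.
exact: le_trans yk.
Qed.

Lemma L2_wstar_linear (k : C) Phi Psi : L2_wstar pA Phi -> L2_wstar pA Psi ->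
  L2_wstar pA (fun b c => k *: Phi b c + Psi b c).
Proof.
move=> [P1 P2 [KP PK] P4 P5] [Q1 Q2 [KQ QK] Q4 Q5].
have clin f g : continuous (f : wstar pA -> C) -> continuous (g : wstar pA -> C) ->
    continuous ((fun b => k *: f b + g b) : wstar pA -> C).
  by move=> cf cg; exact: (@continuous_Clinear _ (wstar pA) k _ _ cf cg).
split.
- by move=> b j x y; rewrite P1 Q1 !scalerDr !scalerA (mulrC j) addrACA.
- by move=> c j x y; rewrite P2 Q2 !scalerDr !scalerA (mulrC j) addrACA.
- exists (`|k| * `|KP| + `|KQ|) => b c; apply: (le_trans (ler_normD _ _)).
  rewrite -mulrA mulrDl; apply: lerD.
    rewrite normrZ -mulrA; apply: ler_wpM2l => //.
    by apply: le_normM; rewrite ?mulr_ge0// mulrA; exact: PK.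
  by apply: le_normM; rewrite ?mulr_ge0// mulrA; exact: QK.
- by move=> b; exact: clin.
- by move=> c; exact: clin.
Qed.

Lemma bounded_continuous (V W : normedModType R[i]) (f : V -> W) (K : R[i]) :
  linear f -> (forall x, `|f x| <= K * `|x|) -> continuous f.
Proof.
move=> fl fK x; apply/cvgrPdist_lt => d d0.
have K1 : 0 < `|K| + 1 by rewrite ltr_wpDl.
have dK := divr_gt0 d0 K1.
have : \forall y \near x, `|x - y| < d / (`|K| + 1) by apply: cvgr_dist_lt => //; exact: cvg_id.
apply: filterS => y; rewrite ltr_pdivlMr// => xy; rewrite -(linear_funB fl).
apply: (le_lt_trans (le_normM (normr_ge0 _) (normr_ge0 _) (fK _))).
by apply: le_lt_trans xy; rewrite mulrC ler_wpM2l// lerDl.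
Qed.

Lemma L2_wstar_pairing_mul phi : L2_wstar pA (fun b c => pA phi (mul b c)).
Proof.
split.
- by move=> b k x y; rewrite mul_linearr pA_linear.
- by move=> c k x y; rewrite mul_linearl pA_linear.
- have [K1 K1P] := mul_bounded; have [K2 K2P] := pA_bounded phi.
  exists (`|K2| * `|K1|) => b c.
  apply: (le_trans (le_normM (normr_ge0 _) (normr_ge0 _) (K2P _))).
  rewrite -!mulrA; apply: ler_wpM2l => //.
  apply: le_normM; rewrite ?mulr_ge0// mulrA; exact: K1P.
- by move=> b; exact: (@continuous_pairing_comp R (wstar pA) _ _ _ _ phi (mul_wstarr (b := b))).
- by move=> c; exact: (@continuous_pairing_comp R (wstar pA) _ _ _ _ phi (mul_wstarl (c := c))).
Qed.

(** Commutation of M with a turns <phi, a.x> into M((b, c) |-> <phi, b.D(ca)>). Expanding D(ca)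
    gives <phi, x.a> plus M((b, c) |-> <phi, bc.D(a)>), and the last term is <phi, u.D(a)> with u
    the image of M under Delta, which is the unit e. Hence a.x - x.a = e.D(a). *)
Lemma normal_virtual_diagonal_Connes_amenable M :
  is_normal_virtual_diagonal mul pA M -> Connes_amenable mul pA.
Proof.
move=> [[Ml [L Lb]] Mc [u uD ue]] E' E pE l r dE bE nE D Dl [KD DK] Dder Dc.
have ue1 : u = e by rewrite -[u]mul1l ue.
have pl := dual_linearr dE.
have [K0 KP] := bimodule_bounded bE.
have lK a x : `|l a x| <= `|K0| * (`|a| * `|x|).
  by apply: le_normM; rewrite ?mulr_ge0// mulrA; have [] := KP a x.
have rK a x : `|r x a| <= `|K0| * (`|a| * `|x|).
  by apply: le_normM; rewrite ?mulr_ge0// mulrA; have [] := KP a x.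
have pEb phi x : `|pE phi x| <= `|x| * `|phi|.
  by apply: (iffLR (dual_norm dE _ _)).
pose Phi phi : A -> A -> C := fun b c => pE phi (l b (D c)).
have PhiK phi : L2_bounded_by (Phi phi) (`|K0| * `|KD| * `|phi|).
  move=> b c; apply: (le_trans (pEb _ _)).
  rewrite [leRHS](_ : _ = (`|K0| * (`|b| * (`|KD| * `|c|))) * `|phi|); last by ring.
  apply: ler_wpM2r => //; apply: (le_trans (lK _ _)).
  apply: ler_wpM2l => //; apply: ler_wpM2l => //.
  exact: (le_normM (normr_ge0 _) (normr_ge0 _) (DK _)).
have PhiL2 phi : L2_wstar pA (Phi phi).
  split.
  - by move=> b k x y; rewrite /Phi Dl (bimodule_linearr bE b).1 pl.
  - by move=> c k x y; rewrite /Phi (bimodule_linearl bE _).1 pl.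
  - by eexists; exact: PhiK.
  - move=> b; have cl := continuous_pairing_comp (phi := phi) (normal_El nE (a := b)).
    exact: (continuous_compose Dc cl).
  - by move=> c; exact: (continuous_pairing_comp (phi := phi)) (normal_l nE (x := D c)).
have Philin : linear (fun phi => M (Phi phi)).
  move=> k phi psi; rewrite -(Ml _ _ _ (PhiL2 phi) (PhiL2 psi)); congr M.
  by apply/funext => b; apply/funext => c; rewrite /Phi (dual_linearl dE).
have Phicont : continuous (fun phi => M (Phi phi)).
  apply: (bounded_continuous Philin (K := L * (`|K0| * `|KD|))) => phi.
  rewrite -mulrA; apply: Lb => //; exact: PhiK.
have [x xP] := dual_surjective dE Philin Phicont.
(* A w*-continuous functional on E is a finite combination of elements of E', hence a single one. So
   y |-> <phi, a.y> and y |-> <phi, y.a> are again elements psi and chi of the predual, to which the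
   definition of x applies. *)
have funE (v : E -> C) : linear v -> continuous (v : wstar pE -> C) ->
    exists psi, forall y, v y = pE psi y.
  move=> vl vc; have [s sP] := wstar_functional pl vl vc.
  exists (\sum_(z <- s) z.1 *: z.2) => y; rewrite sP.
  have lin := dual_linearl dE y.
  elim: s {sP} => [|z s IH]; first by rewrite !big_nil (linear_fun0 lin).
  by rewrite !big_cons IH lin.
have key a phi : pE phi (l a x - r x a) = pE phi (l u (D a)).
  have [psi psiE] : exists psi, forall y, pE phi (l a y) = pE psi y.
    apply: funE; first by move=> k y z; rewrite (bimodule_linearr bE a).1 pl.
    exact: (continuous_pairing_comp (phi := phi)) (normal_El nE (a := a)).
  have [chi chiE] : exists chi, forall y, pE phi (r y a) = pE chi y.
    apply: funE; first by move=> k y z; rewrite (bimodule_linearr bE a).2 pl.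
    exact: (continuous_pairing_comp (phi := phi)) (normal_Er nE (a := a)).
  rewrite (linear_funB (pl phi)) psiE chiE -!xP.
  have -> : M (Phi psi) = M (L2_actl mul a (Phi phi)).
    transitivity (dual_actl mul a M (Phi phi)); last exact: Mc (PhiL2 phi).
    rewrite /dual_actl; congr M.
    by apply/funext => b; apply/funext => c; rewrite /Phi /L2_actr -psiE (bimodule_mull bE).
  (* As b |-> <phi, b.D(a)> is w*-continuous, (b, c) |-> <phi, bc.D(a)> is a finite combination of
     the forms on which [is_Delta] prescribes the value of M. *)
  have [s sP] : exists s : seq (C * A'), forall b, pE phi (l b (D a)) = \sum_(z <- s) z.1 * pA z.2 b.
    apply: wstar_functional => //.
      by move=> k y z; rewrite (bimodule_linearl bE _).1 pl.
    exact: (continuous_pairing_comp (phi := phi)) (normal_l nE (x := D a)).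
  pose Psi (s : seq (C * A')) : A -> A -> C := fun b c => \sum_(z <- s) z.1 * pA z.2 (mul b c).
  have [PsiL2 PsiM] : L2_wstar pA (Psi s) /\ M (Psi s) = \sum_(z <- s) z.1 * pA z.2 u.
    have L20 : L2_wstar pA (fun _ _ => 0 : C).
      split.
      - by move=> b k y z; rewrite scaler0 addr0.
      - by move=> b k y z; rewrite scaler0 addr0.
      - by exists 0 => b c; rewrite normr0 !mul0r.
      - by move=> b; exact: cst_continuous.
      - by move=> b; exact: cst_continuous.
    elim: (s) => [|z t [IH1 IH2]].
      rewrite /Psi (_ : (fun b c => _) = fun _ _ => 0); last first.
        by apply/funext => b; apply/funext => c; rewrite big_nil.
      split => //; rewrite big_nil.
      have := Ml (-1) _ _ L20 L20; rewrite scaler0 addr0 => ->.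
      by rewrite scaleN1r addNr.
    rewrite /Psi (_ : (fun b c => _) = fun b c => z.1 *: pA z.2 (mul b c) + Psi t b c); last first.
      by apply/funext => b; apply/funext => c; rewrite big_cons.
    have L2z := L2_wstar_pairing_mul z.2.
    split; last by rewrite (Ml _ _ _ L2z IH1) IH2 big_cons -uD.
    exact: L2_wstar_linear.
  have -> : L2_actl mul a (Phi phi) = fun b c => 1 *: Phi chi b c + Psi s b c.
    apply/funext => b; apply/funext => c; rewrite /L2_actl /Phi Dder -chiE scale1r.
    rewrite (linear_funD (bimodule_linearr bE b).1) (linear_funD (pl phi)).
    by rewrite -(bimodule_assoc bE) -(bimodule_mull bE) sP addrC.
  by rewrite (Ml _ _ _ (PhiL2 chi) PsiL2) scale1r addrAC subrr add0r PsiM -sP.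
have sep y z : (forall phi, pE phi y = pE phi z) -> y = z.
  move=> yz; apply/eqP; rewrite -subr_eq0 -normr_le0.
  apply/(iffRL (dual_norm dE _ _)) => // phi.
  by rewrite (linear_funB (pl phi)) yz subrr normr0 mul0r.
have {}key a : l a x - r x a = l e (D a) by apply: sep => phi; rewrite key ue1.
(* D(a) = e.D(a) + w.a. Replacing x by x - w produces the term w.a, and adding e.w restores the term
   a.w lost on the left without effect on the right, where (e.w).a = 0. *)
pose w := D e.
have Da a : D a = l e (D a) + r w a by rewrite -Dder mul1l.
have ewe : r (l e w) e = 0.
  have /(congr1 (l e)) : w = l e w + r w e by rewrite -Dder mul1l.
  rewrite (linear_funD (bimodule_linearr bE e).1) -(bimodule_mull bE) mul1l.
  by rewrite (bimodule_assoc bE) => /(congr1 (fun y => y - l e w)); rewrite subrr addrAC subrr add0r.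
have ewa a : r (l e w) a = 0.
  rewrite -[a]mul1l (bimodule_mulr bE) ewe.
  exact: (linear_fun0 (bimodule_linearr bE a).2).
have ae a : mul a e = a by rewrite -ue1 ue.
exists (x - w + l e w) => a.
rewrite (linear_funD (bimodule_linearr bE a).1) (linear_funD (bimodule_linearr bE a).2).
rewrite (linear_funB (bimodule_linearr bE a).1) (linear_funB (bimodule_linearr bE a).2).
by rewrite ewa addr0 -(bimodule_mull bE) ae subrK [LHS]Da -key opprB addrA addrAC.
Qed.

End diagonal_Connes_amenable.

Section measure_algebra_dual.
Context {R : realType} {G : topologicalGroupType}.
Local Notation C := (R[i]^o).
Local Notation M := (measure_algebra R G).
Hypotheses (G_hausdorff : hausdorff_space G) (G_lc : locally_compact [set: G]).

Lemma C0_pairing_linear (phi : C0 R G) : linear (C0_pairing phi).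
Proof. by move=> k a b; exact: (pr_linear_measure k a b (isC0_Cb (C0_isC0 phi))). Qed.

Lemma C0_pairing_bounded (phi : C0 R G) :
  exists K : R[i], forall a : M, `|C0_pairing phi a| <= K * `|a|.
Proof.
have bf := isC0_Cb (C0_isC0 phi); have [_ [B fB]] := bf.
exists (4 * B)%:C => a; rewrite normr_tvR -rmorphM /= le_normr_cabs.
exact: (pr_le a bf fB).
Qed.

Lemma convolution_wstarl (c : M) :
  continuous ((fun a => conv a c) : wstar (@C0_pairing R G) -> wstar (@C0_pairing R G)).
Proof.
apply: continuous_to_wstar => phi; have f0 := C0_isC0 phi.
rewrite (_ : (fun t => _) = C0_pairing (C0_of (isC0_ract G_hausdorff c f0))).
  exact: continuous_wstar_pairing.
by apply/funext => a; exact: (pr_conv_ract G_hausdorff G_lc a c (isC0_Cb f0)).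
Qed.

Lemma convolution_wstarr (b : M) :
  continuous (conv b : wstar (@C0_pairing R G) -> wstar (@C0_pairing R G)).
Proof.
apply: continuous_to_wstar => phi; have f0 := C0_isC0 phi.
rewrite (_ : (fun t => _) = C0_pairing (C0_of (isC0_lact G_hausdorff b f0))).
  exact: continuous_wstar_pairing.
by apply/funext => a; exact: (pr_conv G_hausdorff G_lc b a (isC0_Cb f0)).
Qed.

Lemma convolution_bounded :
  exists K : R[i], forall a b : M, `|conv a b| <= K * `|a| * `|b|.
Proof.
exists 64%:C => a b; rewrite !normr_tvR -!rmorphM lecR.
exact: tvR_conv.
Qed.

Lemma virtual_diagonal_Connes_amenable Md :
  is_normal_virtual_diagonal (@convolution R G) (@C0_pairing R G) Md ->
  Connes_amenable (@convolution R G) (@C0_pairing R G).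
Proof.
have -> : @convolution R G = @conv R G by rewrite conv.unlock.
apply: (@normal_virtual_diagonal_Connes_amenable _ _ _ _ _ _ _ _ _ _ _ _ (point_mass 1%g)).
- by move=> c k a b; exact: convDl.
- by move=> c k a b; exact: convDr.
- exact: convolution_bounded.
- exact: C0_pairing_linear.
- exact: C0_pairing_bounded.
- exact: convolution_wstarl.
- exact: convolution_wstarr.
- exact: conv1l.
Qed.

End measure_algebra_dual.

(** * Haar functionals and smooth measures *)

Section Haar_functionals.
Context {R : realType} {G : topologicalGroupType}.
Local Notation C := (R[i]^o).
Local Notation M := (measure_algebra R G).
Hypotheses (G_hausdorff : hausdorff_space G) (G_lc : locally_compact [set: G]).
Local Notation Re := (@complex.Re R).
Local Notation Im := (@complex.Im R).
Local Notation dl := (@point_mass R G).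
Local Notation "a '**' b" := (conv a b) (at level 40, left associativity).
Implicit Types (k : G -> R) (f g : G -> C) (a b : M).

Record Haar_functional (I : (G -> R) -> R) : Prop := {
  hf_positive : positive_linear I ;
  hf_invariant : forall x k, Cc k -> I (fun y => k (x * y)%g) = I k ;
  hf_neq0 : exists2 k, Cc k & I k != 0 }.

Lemma Cc_lmul x k : Cc k -> Cc (fun y => k (x * y)%g).
Proof.
move=> [ck [K cK kK]]; split; first exact: continuous_compose (@continuous_lmul G x) ck.
exists [set (x^-1 * y)%g | y in K].
  by apply: continuous_compact => //; apply: continuous_subspaceT; exact: continuous_lmul.
by move=> y nKy; apply: kK => Kxy; apply: nKy; exists (x * y)%g => //; rewrite mulKg.
Qed.

(** The open sets k(z y^-1 w) > k(z) / 2, with y in the support of f, cover that support; a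
    partition of unity selects finitely many translates. The lemma yields the strict positivity of
    Haar functionals and the existence of covers for the covering numbers. *)
Lemma translates_cover (f k : G -> R) z : Cc f -> Cc k -> (forall y, 0 <= k y) ->
  0 < k z -> exists n (c : R) (x : nat -> G), 0 <= c /\
    forall w, `|f w| <= \sum_(i < n) c * k (x i * w)%g.
Proof.
move=> cf ck k0 kz.
have [B B0 fB] := Cc_bounded cf; have [_ [L cL fL]] := cf.
pose U y := [set w | k z / 2 < k (z * y^-1 * w)%g].
have kz2 : 0 < k z / 2 by rewrite divr_gt0.
have [|n [x [c [xL cc c0 cU [cs c1]]]]] :=
    partition_of_unity (R := R) G_hausdorff G_lc (U := U) cL.
  move=> y Ly; split; last by rewrite /U /= mulgVK ltr_pdivrMr// ltr_pMr// ltr1n.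
  have cky : continuous (fun w => k (z * y^-1 * w)%g).
    exact: continuous_compose (@continuous_lmul G (z * y^-1)%g) ck.1.
  by move/continuousP : cky => /(_ [set r | k z / 2 < r]); apply; exact: open_gt.
exists n, (B * (2 / k z)), (fun i => z * (x i)^-1)%g.
split=> [|w]; first by rewrite mulr_ge0// divr_ge0// ltW.
apply: (@le_trans _ _ (B * \sum_(i < n) c i w)).
  have [Lw|/fL ->] := pselect (L w); first by rewrite c1// mulr1.
  by rewrite normr0 mulr_ge0// sumr_ge0// => i _; apply: c0.
rewrite mulr_sumr; apply: ler_sum => i _; rewrite -mulrA ler_wpM2l//.
have [Uw|nUw] := pselect (U (x i) w).
  apply: (@le_trans _ _ 1).
    apply: le_trans (cs w); rewrite (bigD1 i)//= lerDl sumr_ge0// => j _; exact: c0.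
  by rewrite -ler_pdivrMl ?divr_gt0// mulr1 invf_div ltW.
rewrite (_ : c i w = 0); first by rewrite !mulr_ge0// invr_ge0 ltW.
have [K [_ KU] cK] := cU _ (ltn_ord i).
by apply: cK => /KU.
Qed.

Variable I : (G -> R) -> R.
Hypothesis HI : Haar_functional I.
Local Notation Ip := (hf_positive HI).

Lemma pl_norm_le k k' : Cc k -> Cc k' -> (forall y, `|k y| <= k' y) -> `|I k| <= I k'.
Proof.
move=> ck ck' kk; rewrite ler_norml -[X in X <= _]mulN1r -(plZ Ip _ ck').
apply/andP; split; apply: (pl_le Ip) => //.
- exact: CcZ.
- by move=> y; rewrite mulN1r; have := kk y; rewrite ler_norml => /andP[].
- by move=> y; apply: le_trans (kk y); exact: ler_norm.
Qed.

(** If I k were 0, every f in [Cc], being dominated by translates of k, would have I f = 0, against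
    [hf_neq0]. *)
Lemma Haar_gt0 k z : Cc k -> (forall y, 0 <= k y) -> 0 < k z -> 0 < I k.
Proof.
move=> ck k0 kz; have Ik0 : 0 <= I k by apply: (pl_ge0 Ip).
rewrite lt_neqAle Ik0 andbT eq_sym; apply/eqP => Ik.
have [f cf /eqP] := hf_neq0 HI; apply.
have [n [c [x [c0 fF]]]] := translates_cover cf ck k0 kz.
pose F (i : nat) w := c * k (x i * w)%g.
have cF i : (i < n)%N -> Cc (F i) by move=> _; apply: CcZ; exact: Cc_lmul.
apply/eqP; rewrite -normr_eq0 eq_le normr_ge0 andbT.
apply: (le_trans (pl_norm_le cf (Cc_sum cF) fF)).
rewrite (pl_sum Ip cF) big1// => i _; rewrite /F (plZ Ip) ?(hf_invariant HI)// ?Ik ?mulr0//.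
exact: Cc_lmul.
Qed.

(** Integration of f against the image under s of the measure with density k. The map s will be the
    identity or the inversion. *)
Definition weighted (s : G -> G) k f : C :=
  I (fun y => Re (f (s y)) * k y) +i* I (fun y => Im (f (s y)) * k y).

Lemma Cc_Re_weighted (s : G -> G) k f : continuous s -> Cc k -> continuous f ->
  Cc (fun y => Re (f (s y)) * k y).
Proof.
move=> cs ck cf; apply: CcM => //.
exact: continuous_Re (continuous_compose cs cf).
Qed.

Lemma Cc_Im_weighted (s : G -> G) k f : continuous s -> Cc k -> continuous f ->
  Cc (fun y => Im (f (s y)) * k y).
Proof.
move=> cs ck cf; apply: CcM => //.
exact: continuous_Im (continuous_compose cs cf).
Qed.

Lemma weighted_linear (s : G -> G) k (c : C) f g : continuous s -> Cc k ->
  continuous f -> continuous g ->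
  weighted s k (fun x => c * f x + g x) = c * weighted s k f + weighted s k g.
Proof.
move=> cs ck cf cg; have Rf := Cc_Re_weighted cs ck cf; have If := Cc_Im_weighted cs ck cf.
have Rg := Cc_Re_weighted cs ck cg; have Ig := Cc_Im_weighted cs ck cg.
have cZ (r : R) (h : G -> R) : Cc h -> Cc (fun y => r * h y) by exact: CcZ.
apply: complex_ext; rewrite /weighted ?ReD ?ImD ?ReM ?ImM /=.
  rewrite -(plZ Ip _ Rf) -(plZ Ip _ If) -(plB Ip (cZ _ _ Rf) (cZ _ _ If)).
  rewrite -(plD Ip (CcB (cZ _ _ Rf) (cZ _ _ If)) Rg).
  by congr I; apply/funext => y; rewrite ReD ReM mulrDl mulrBl !mulrA.
rewrite -(plZ Ip _ Rf) -(plZ Ip _ If) -(plD Ip (cZ _ _ If) (cZ _ _ Rf)).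
rewrite -(plD Ip (CcD (cZ _ _ If) (cZ _ _ Rf)) Ig).
by congr I; apply/funext => y; rewrite ImD ImM mulrDl mulrDl !mulrA.
Qed.

Lemma weightedB (s : G -> G) k k' f : continuous s -> Cc k -> Cc k' -> continuous f ->
  weighted s k f - weighted s k' f = weighted s (fun y => k y - k' y) f.
Proof.
move=> cs ck ck' cf.
apply: complex_ext; rewrite /weighted ?ReB ?ImB /=.
  rewrite -(plB Ip (Cc_Re_weighted cs ck cf) (Cc_Re_weighted cs ck' cf)).
  by congr I; apply/funext => y; rewrite mulrBr.
rewrite -(plB Ip (Cc_Im_weighted cs ck cf) (Cc_Im_weighted cs ck' cf)).
by congr I; apply/funext => y; rewrite mulrBr.
Qed.

Lemma weighted_le (s : G -> G) k f (r : R) : continuous s -> Cc k -> continuous f ->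
  (forall y, k y != 0 -> cabs (f (s y)) <= r) ->
  cabs (weighted s k f) <= 2 * I (fun y => `|k y|) * r.
Proof.
move=> cs ck cf fr; have cn := Cc_norm ck.
have le (p : C -> R) : (forall z, `|p z| <= cabs z) -> Cc (fun y => p (f (s y)) * k y) ->
    `|I (fun y => p (f (s y)) * k y)| <= r * I (fun y => `|k y|).
  move=> pc cp; rewrite -(plZ Ip _ cn); apply: pl_norm_le => //; first exact: CcZ.
  move=> y; rewrite normrM; have [->|ky] := eqVneq (k y) 0; first by rewrite normr0 !mulr0.
  by rewrite ler_wpM2r// (le_trans (pc _))// fr.
apply: (le_trans (cabs_le_ReIm _)).
rewrite (_ : _ * r = r * I (fun y => `|k y|) + r * I (fun y => `|k y|)); last by ring.
apply: lerD; apply: le.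
- exact: Re_le_cabs.
- exact: Cc_Re_weighted.
- exact: Im_le_cabs.
- exact: Cc_Im_weighted.
Qed.

(** Rotating the value onto the positive axis gives the constant 1 in place of the 2 of
    [weighted_le]. Through [smooth_bump] this precision reaches the mean on L^oo(G), whose norm must
    be exactly 1. *)
Lemma weighted_ge0_le (s : G -> G) k f (r : R) : continuous s -> Cc k ->
  (forall y, 0 <= k y) -> continuous f ->
  (forall y, k y != 0 -> cabs (f (s y)) <= r) -> cabs (weighted s k f) <= I k * r.
Proof.
move=> cs ck k0 cf fr; have [u u1 uw] := cabs_phase (weighted s k f).
have c0 : continuous (fun _ : G => 0 : C) by exact: cst_continuous.
have cuf := continuous_Clinear (a := u) cf c0.
have E : u * weighted s k f = weighted s k (fun x => u * f x + 0).
  rewrite (weighted_linear u cs ck cf c0) [weighted s k (fun=> 0)](_ : _ = 0) ?addr0//.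
  by rewrite /weighted /=; under eq_fun do rewrite mul0r; rewrite (pl0 Ip).
have -> : cabs (weighted s k f) = Re (weighted s k (fun x => u * f x + 0)).
  by rewrite -E uw.
rewrite mulrC -(plZ Ip _ ck); apply: (pl_le Ip) (Cc_Re_weighted cs ck cuf) (CcZ r ck) _ => y.
have [->|ky] := eqVneq (k y) 0; first by rewrite !mulr0.
rewrite ler_wpM2r// addr0 (le_trans (ler_norm _))// (le_trans (Re_le_cabs _))//.
by rewrite cabsM u1 mul1r fr.
Qed.

Lemma pr_vanishing a (L : set G) :
  (forall f, isC0 f -> (forall x, L x -> f x = 0) -> pr f a = 0) ->
  forall f, Cb f -> (forall x, L x -> f x = 0) -> pr f a = 0.
Proof.
move=> aL f bf fL; have [cf [B fB]] := bf.
have B0 : 0 <= B by rewrite (le_trans _ (fB point))// cabs_ge0.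
apply/eqP; rewrite -cabs_eq0 eq_le cabs_ge0 andbT.
have B1 : 0 < B + 1 by rewrite ltr_wpDl.
apply/ler_addgt0Pr => e e0; rewrite add0r.
have d0 := divr_gt0 e0 B1.
apply: (@le_trans _ _ (e / (B + 1) * B)); last exact/ltW/mul_divD1_lt.
have [K cK HK] := tight G_hausdorff a d0.
have [h [ch [Lh cLh hLh]] [h01 h1]] := @cutoff R G G_hausdorff G_lc _ cK.
pose g : G -> C := fun x => f x * (h x)%:C.
have cg : continuous g := continuous_CM cf (continuous_real ch).
have g0 : isC0 g.
  by apply: (isC0_compact cg cLh) => x /hLh; rewrite /g => ->; rewrite mulr0.
have -> : pr f a = pr (fun x => f x - g x) a.
  by rewrite (prB _ bf (isC0_Cb g0)) (aL g)// ?subr0// => x Lx; rewrite /g fL// mul0r.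
apply: (HK _ _ (CbB bf (isC0_Cb g0)) B0) => x.
  rewrite /g -{1}[f x]mulr1 -mulrBr cabsM (le_trans _ (fB x))// ler_piMr ?cabs_ge0//.
  rewrite -[1]/(1%:C) -rmorphB /= cabs_real.
  by have /andP[hx0 hx1] := h01 x; rewrite ger0_norm ?subr_ge0// gerBl.
by move=> Kx; rewrite /g h1 ?mulr1 ?subrr.
Qed.

(** [riesz_representation] gives the identity on C_0. For f in [Cb], neither side changes when f is
    multiplied by a cutoff equal to 1 on s(L), with L the support of k. *)
Lemma weighted_measure (s : G -> G) k : continuous s -> Cc k ->
  exists a, tvR a <= 8 * I (fun y => `|k y|) /\
    forall f, Cb f -> pr f a = weighted s k f.
Proof.
move=> cs ck; have [_ [L cL kL]] := ck.
have Ik0 : 0 <= 2 * I (fun y => `|k y|).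
  by rewrite mulr_ge0//; apply: (pl_ge0 Ip) => //; exact: Cc_norm.
have [||a [aE at8]] := @riesz_representation R G G_hausdorff G_lc (weighted s k) _ Ik0.
- by move=> c f g [cf _] [cg _]; exact: (weighted_linear c cs ck cf cg).
- by move=> f r [cf _] fr; exact: weighted_le.
exists a; split; first by apply: (le_trans at8); rewrite mulrA -natrM.
move=> f bf; have cf := bf.1.
have csL : compact [set s y | y in L].
  by apply: continuous_compact => //; exact: continuous_subspaceT.
have [h [ch [Lh cLh hLh]] [h01 h1]] := @cutoff R G G_hausdorff G_lc _ csL.
pose g : G -> C := fun x => f x * (h x)%:C.
have cg : continuous g := continuous_CM cf (continuous_real ch).
have g0 : isC0 g.
  by apply: (isC0_compact cg cLh) => x /hLh; rewrite /g => ->; rewrite mulr0.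
have gE y : k y != 0 -> g (s y) = f (s y).
  move=> ky; rewrite /g h1 ?mulr1//; exists y => //.
  by apply: contra_notP (elimN eqP ky) => /kL.
have -> : pr f a = pr g a.
  apply/eqP; rewrite -subr_eq0 -(prB _ bf (isC0_Cb g0)); apply/eqP.
  apply: (@pr_vanishing a [set s y | y in L]) => [f' f'0 f'L||x Lx].
  - rewrite aE//; apply/eqP; rewrite -cabs_eq0 eq_le cabs_ge0 andbT.
    rewrite -[leRHS](mulr0 (2 * I (fun y => `|k y|))).
    apply: (weighted_le cs ck f'0.1) => y ky; rewrite f'L ?cabs0//; exists y => //.
    by apply: contra_notP (elimN eqP ky) => /kL.
  - exact: CbB bf (isC0_Cb g0).
  - by rewrite /g h1 ?mulr1 ?subrr.
rewrite aE//; apply: complex_ext => /=; congr I; apply/funext => y.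
  by have [->|/gE ->//] := eqVneq (k y) 0; rewrite !mulr0.
by have [->|/gE ->//] := eqVneq (k y) 0; rewrite !mulr0.
Qed.

(** For x in a compact neighbourhood N of 1, the difference of k(x .) and k lives on the union of
    N^-1 L and L, where a fixed cutoff h is 1. Uniform continuity of k then bounds the integral by a
    small multiple of I h. *)
Lemma translation_continuous k (e : R) : Cc k -> 0 < e ->
  \forall x \near 1%g, I (fun y => `|k (x * y)%g - k y|) < e.
Proof.
move=> ck e0; have [_ [L cL kL]] := ck.
have [N N1 [cN _]] := @G_lc (1%g : G) Logic.I.
have {}N1 : \forall x \near 1%g, N x.
  exact: (@filterS G (nbhs (1%g : G)) _ (fun x => True -> N x) N (fun x H => H Logic.I) N1).
have cNL : compact ([set (z.1^-1 * z.2)%g | z in N `*` L] `|` L).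
  apply: compactU => //; apply: (@compact_mul _ (fun x y => x^-1 * y)%g) => //.
  apply: continuous_mul; last exact: continuous_snd.
  by apply: continuous_inv; exact: continuous_fst.
have [h ch [h01 h1]] := @cutoff R G G_hausdorff G_lc _ cNL.
have Ih0 : 0 <= I h by apply: (pl_ge0 Ip) => // y; have /andP[] := h01 y.
have Ih1 : 0 < I h + 1 by rewrite ltr_wpDl.
have := isC0_left_uniform (Cc_isC0 ck) (divr_gt0 e0 Ih1).
apply: filterS2 N1 => x Nx kx; apply: le_lt_trans (mul_divD1_lt e0 Ih0).
rewrite -(plZ Ip _ ch); apply: (pl_le Ip).
- by apply: Cc_norm; apply: CcB => //; exact: Cc_lmul.
- exact: CcZ.
move=> y; have := ltW (kx y); rewrite -rmorphB /= cabs_real => kxy.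
have [NLy|nNL] := pselect (([set (z.1^-1 * z.2)%g | z in N `*` L] `|` L) y).
  by rewrite h1// mulr1.
have Lxy : ~ L (x * y)%g.
  by move=> Lxy; apply: nNL; left; exists (x, (x * y)%g) => //=; rewrite mulKg.
have Ly : ~ L y by move=> Ly; apply: nNL; right.
rewrite (kL _ Lxy) (kL _ Ly) subrr normr0; apply: mulr_ge0.
  by rewrite ltW// divr_gt0.
by have /andP[] := h01 y.
Qed.

Lemma near_inv (P : set G) :
  (\forall x \near 1%g, P x) -> \forall x \near 1%g, P (x^-1)%g.
Proof.
move=> P1; have : (x^-1)%g @[x --> (1 : G)%g] --> (1^-1 : G)%g by exact: invg_continuous.
by rewrite invg1; apply.
Qed.

Lemma weighted_lcont k a : Cc k -> (forall f, Cb f -> pr f a = weighted id k f) -> lcont a.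
Proof.
move=> ck aE e e0; have e8 : 0 < e / 8 by rewrite divr_gt0.
have := near_inv (translation_continuous ck e8); apply: filterS => x kx.
rewrite (_ : e = 4 * (2 * (e / 8))); last by field.
have ckx := Cc_lmul x^-1%g ck.
apply: (@le_lt_trans _ _ (4 * (2 * I (fun y => `|k (x^-1 * y)%g - k y|)))); last first.
  by rewrite !ltr_pM2l.
apply: (tvR_le G_hausdorff G_lc) => [|f s f0 fs].
  by rewrite mulr_ge0//; apply: (pl_ge0 Ip) => //; apply/Cc_norm/CcB.
have bf := isC0_Cb f0; have cf := bf.1.
rewrite (pr_measureB _ _ bf) (pr_lmul G_hausdorff G_lc _ _ bf) (aE _ (Cb_lmul x bf)) (aE _ bf).
have -> : weighted id k (fun y => f (x * y)%g) = weighted id (fun y => k (x^-1 * y)%g) f.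
  apply: complex_ext => /=.
    rewrite -[RHS](hf_invariant HI x); last exact: (Cc_Re_weighted (@continuous_id' G) ckx cf).
    by congr I; apply/funext => y; rewrite mulKg.
  rewrite -[RHS](hf_invariant HI x); last exact: (Cc_Im_weighted (@continuous_id' G) ckx cf).
  by congr I; apply/funext => y; rewrite mulKg.
rewrite (weightedB (@continuous_id' G) ckx ck cf).
by apply: (weighted_le (@continuous_id' G) (CcB ckx ck) cf) => y _; exact: fs.
Qed.

(** Inversion turns a right translate of the measure into a left translate of k, to which the left
    invariance of I applies. *)
Lemma weighted_rcont k a : Cc k ->
  (forall f, Cb f -> pr f a = weighted (fun y => y^-1)%g k f) -> rcont a.
Proof.
move=> ck aE e e0; have e8 : 0 < e / 8 by rewrite divr_gt0.
have := translation_continuous ck e8; apply: filterS => x kx.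
rewrite (_ : e = 4 * (2 * (e / 8))); last by field.
have ckx := Cc_lmul x ck; have ci : continuous (fun y : G => y^-1%g) by exact: invg_continuous.
apply: (@le_lt_trans _ _ (4 * (2 * I (fun y => `|k (x * y)%g - k y|)))); last first.
  by rewrite !ltr_pM2l.
apply: (tvR_le G_hausdorff G_lc) => [|f s f0 fs].
  by rewrite mulr_ge0//; apply: (pl_ge0 Ip) => //; apply/Cc_norm/CcB.
have bf := isC0_Cb f0; have cf := bf.1.
rewrite (pr_measureB _ _ bf) (pr_rmul G_hausdorff G_lc _ _ bf) (aE _ (Cb_rmul x bf)) (aE _ bf).
have -> : weighted (fun y => y^-1)%g k (fun y => f (y * x)%g) =
    weighted (fun y => y^-1)%g (fun y => k (x * y)%g) f.
  have cfx := (Cb_rmul x bf).1.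
  apply: complex_ext => /=.
    rewrite -[LHS](hf_invariant HI x); last exact: (Cc_Re_weighted ci ck cfx).
    by congr I; apply/funext => y; rewrite invgM mulgVK.
  rewrite -[LHS](hf_invariant HI x); last exact: (Cc_Im_weighted ci ck cfx).
  by congr I; apply/funext => y; rewrite invgM mulgVK.
rewrite (weightedB ci ckx ck cf).
by apply: (weighted_le ci (CcB ckx ck) cf) => y _; exact: fs.
Qed.

(** [a] has density k, and [b] is the image of that measure under inversion: the convolution gets
    its left continuity from a and its right continuity from b. With k supported in W and W W^-1
    inside V it stays concentrated on V. Each factor has norm at most 8, and [tvR_conv] contributes
    64. *)
Lemma smooth_bump (V : set G) : nbhs 1%g V ->
  exists a, [/\ lcont a, rcont a, mass a = 1, tvR a <= 64 * 8 * 8 &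
    forall f s, Cb f -> (forall x, V x -> cabs (f x) <= s) -> cabs (pr f a) <= s].
Proof.
move=> V1.
have [W W1 WV] : exists2 W : set G, nbhs 1%g W & forall x y, W x -> W y -> V (x * y^-1)%g.
  have c : continuous (fun z : G * G => z.1 * z.2^-1)%g.
    apply: continuous_mul; first exact: continuous_fst.
    by apply: continuous_inv; exact: continuous_snd.
  have : nbhs ((1 : G) * 1^-1)%g V by rewrite mulgV.
  move=> /(c (1, 1)%g)[[A B] /= [A1 B1] AB]; exists (A `&` B); first exact: filterI.
  by move=> x y [Ax _] [_ By]; exact: (AB (x, y)).
have c1 : compact [set (1 : G)%g] by exact: compact_set1.
have [|k0 [ck0 k01 k1 [L [cL LW] kL]]] :=
    urysohn_compact_open (R := R) G_hausdorff G_lc c1 (@open_interior _ W).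
  by move=> _ ->; exact: W1.
have Ck0 : Cc k0 by split => //; exists L.
have I0 : 0 < I k0.
  apply: (@Haar_gt0 _ 1%g Ck0) => [y|]; first by have /andP[] := k01 y.
  by rewrite (nbhs_singleton (k1 1%g erefl)).
pose k y := (I k0)^-1 * k0 y.
have Ck : Cc k by exact: CcZ.
have kge0 y : 0 <= k y.
  by rewrite mulr_ge0//; [rewrite invr_ge0 ltW|have /andP[] := k01 y].
have Ik : I k = 1 by rewrite (plZ Ip _ Ck0) mulVf// gt_eqF.
have nk : (fun y => `|k y|) = k by apply/funext => y; rewrite ger0_norm.
have kW y : k y != 0 -> W y.
  move=> ky; apply: interior_subset; apply: LW; apply: contra_notP (elimN eqP ky) => /kL.
  by rewrite /k => ->; rewrite mulr0.
have ci : continuous (fun y : G => y^-1%g) by exact: invg_continuous.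
have cid := @continuous_id' G.
have [a [at8 aE]] := weighted_measure cid Ck.
have [b [bt8 bE]] := weighted_measure ci Ck.
rewrite nk Ik mulr1 in at8 bt8.
have m1 s c : (forall f, Cb f -> pr f c = weighted s k f) -> mass c = 1.
  move=> cE; rewrite /mass (cE _ (Cb_cst 1)); apply: complex_ext => /=.
    by rewrite -[RHS]Ik; congr I; apply/funext => y; rewrite mul1r.
  by rewrite -[RHS](pl0 Ip); congr I; apply/funext => y; rewrite mul0r.
exists (a ** b); split.
- exact/lcont_conv/(weighted_lcont Ck aE).
- exact/rcont_conv/(weighted_rcont Ck bE).
- by rewrite mass_conv// (m1 _ _ aE) (m1 _ _ bE) mulr1.
- apply: (le_trans (tvR_conv G_hausdorff G_lc _ _)).
  by rewrite -!mulrA ler_pM2l//; apply: ler_pM => //; exact: tvR_ge0.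
- move=> f s bf fs; rewrite (pr_conv G_hausdorff G_lc _ _ bf).
  have bl := Cb_lact G_hausdorff a bf.
  rewrite (bE _ bl) -[s]mul1r -Ik.
  apply: (weighted_ge0_le ci Ck kge0 bl.1) => y ky; rewrite /lact (aE _ (Cb_rmul _ bf)).
  rewrite -[s]mul1r -Ik; apply: (weighted_ge0_le cid Ck kge0 (Cb_rmul _ bf).1) => x kx.
  by apply: fs; apply: WV; exact: kW.
Qed.

End Haar_functionals.

(** * From a mean to a virtual diagonal *)

Section sublinear_functionals.
Context {R : realType} {V : lmodType R[i]}.
Implicit Types (p q N : V -> R) (x y c : V) (S : set V) (s t : R).

Record sublinear p : Prop := {
  sublinearD : forall x y, p (x + y) <= p x + p y ;
  sublinearZ : forall t x, 0 <= t -> p (t%:C *: x) = t * p x }.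

Definition convex_set S := forall c c' t, S c -> S c' -> 0 <= t <= 1 ->
  S (t%:C *: c + (1 - t)%:C *: c').

Lemma sublinear0 p : sublinear p -> p 0 = 0.
Proof. by move=> sp; have := sublinearZ sp 0 (lexx 0); rewrite scale0r mul0r. Qed.

Lemma sublinear_ge p x : sublinear p -> - p (- x) <= p x.
Proof.
move=> sp; rewrite -subr_ge0 opprK -(sublinear0 sp) -[X in p X <= _](subrr x).
exact: sublinearD.
Qed.

(** q(x) is the infimum of p(x + t c) - t e over t >= 0 and c in S, finite because it is at least -
    p(- x). A linear functional below q is at least e on S, since q(- c) <= p(0) - e. *)
Lemma sublinear_shift p S (e : R) : sublinear p -> convex_set S -> S !=set0 ->
  (forall c, S c -> e <= p c) ->
  exists q, [/\ sublinear q, forall x, q x <= p x &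
    forall x c t, S c -> 0 <= t -> q x <= p (x + t%:C *: c) - t * e].
Proof.
move=> sp cS [c0 Sc0] pS.
pose A x := [set r | exists t c, [/\ 0 <= t, S c & r = p (x + t%:C *: c) - t * e]].
have lbA x : lbound (A x) (- p (- x)).
  move=> _ [t [c [t0 Sc ->]]]; rewrite lerBrDr.
  apply: (@le_trans _ _ (- p (- x) + t * p c)); first by rewrite lerD2l ler_wpM2l// pS.
  rewrite -(sublinearZ sp _ t0) addrC lerBlDr.
  have := sublinearD sp (x + t%:C *: c) (- x).
  by rewrite (addrAC x) subrr add0r.
have hlb x : has_lbound (A x) by exists (- p (- x)); exact: lbA.
have A0 x : A x !=set0 by exists (p x - 0 * e); exists 0, c0; rewrite scale0r addr0.
pose q x := inf (A x).
have qA x c t : S c -> 0 <= t -> q x <= p (x + t%:C *: c) - t * e.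
  by move=> Sc t0; apply: ge_inf => //; exists t, c.
have qp x : q x <= p x.
  by have := qA x c0 0 Sc0 (lexx 0); rewrite scale0r addr0 mul0r subr0.
have qD x y : q (x + y) <= q x + q y.
  rewrite -lerBlDr; apply: lb_le_inf => // _ [t [c [t0 Sc ->]]].
  rewrite lerBlDr -lerBlDl; apply: lb_le_inf => // _ [t' [c' [t'0 Sc' ->]]].
  rewrite lerBlDl.
  have : exists2 d, S d & t%:C *: c + t'%:C *: c' = (t + t')%:C *: d.
    have [tt0|tt0] := eqVneq (t + t') 0.
      exists c => //; move/eqP: tt0; rewrite paddr_eq0// => /andP[/eqP-> /eqP->].
      by rewrite addr0 !scale0r addr0.
    have tt : 0 < t + t' by rewrite lt_neqAle eq_sym tt0 addr_ge0.
    exists ((t / (t + t'))%:C *: c + (1 - t / (t + t'))%:C *: c').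
      apply: cS => //; rewrite divr_ge0 ?(ltW tt)//=.
      by rewrite ler_pdivrMr// mul1r lerDl.
    rewrite scalerDr !scalerA -!rmorphM; congr (_%:C *: _ + _%:C *: _); field => //.
  move=> [d Sd dE].
  apply: (le_trans (qA (x + y) d (t + t') Sd (addr_ge0 t0 t'0))).
  rewrite -dE (addrACA x) mulrDl opprD [leRHS]addrACA lerD2r.
  exact: sublinearD.
have q0 : q 0 = 0.
  apply/eqP; rewrite eq_le -{1}(sublinear0 sp) qp /=; apply: lb_le_inf => // r Ar.
  by have := lbA _ _ Ar; rewrite oppr0 (sublinear0 sp) oppr0.
have qZ_le t x : 0 < t -> q (t%:C *: x) <= t * q x.
  move=> t0; rewrite -ler_pdivrMl//; apply: lb_le_inf => // _ [s [c [s0 Sc ->]]].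
  rewrite ler_pdivrMl// mulrBr -(sublinearZ sp _ (ltW t0)) scalerDr scalerA -rmorphM mulrA.
  by apply: qA => //; rewrite mulr_ge0// ltW.
exists q; split => //; split => // t x; rewrite le_eqVlt => /orP[/eqP<-|t0].
  by rewrite scale0r q0 mul0r.
apply/eqP; rewrite eq_le qZ_le//= -ler_pdivlMl//.
have := @qZ_le t^-1 (t%:C *: x); rewrite scalerA -rmorphM mulVf ?gt_eqF// scale1r.
by apply; rewrite invr_gt0.
Qed.

(** Zorn's lemma. The infimum of a chain is finite because a sublinear p below p0 satisfies p(x) >=
    - p0(- x), and it is subadditive because two members of a chain are comparable. *)
Lemma minimal_sublinear p0 : sublinear p0 ->
  exists p, [/\ sublinear p, forall x, p x <= p0 x &
    forall q, sublinear q -> (forall x, q x <= p x) -> forall x, p x <= q x].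
Proof.
move=> sp0; pose T := {p | sublinear p /\ forall x, p x <= p0 x}.
pose t0 : T := exist _ p0 (conj sp0 (fun x => lexx (p0 x))).
pose r (s t : T) := `[< forall x, sval t x <= sval s x >].
have [||A rA|[p [sp pp0]] pmin] := @ZL_preorder T t0 r.
- by move=> t; apply/asboolP.
- by move=> s t u /asboolP st /asboolP tu; apply/asboolP => x; exact: le_trans (tu x) (st x).
- have [[t1 At1]|nA] := pselect (exists t : T, A t); last first.
    by exists t0 => s As; exfalso; apply: nA; exists s.
  pose B x := [set sval t x | t in A].
  have lbB x : lbound (B x) (- p0 (- x)).
    move=> _ [[p [sp pp]] _ <-] /=; apply: le_trans (sublinear_ge x sp).
    by rewrite lerN2.
  have hlb x : has_lbound (B x) by exists (- p0 (- x)); exact: lbB.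
  have B0 x : B x !=set0 by exists (sval t1 x); exists t1.
  pose q x := inf (B x).
  have qA x (t : T) : A t -> q x <= sval t x by move=> At; apply: ge_inf => //; exists t.
  have qD x y : q (x + y) <= q x + q y.
    rewrite -lerBlDr; apply: lb_le_inf => // _ [s As <-].
    rewrite lerBlDr -lerBlDl; apply: lb_le_inf => // _ [t At <-]; rewrite lerBlDl.
    have [/asboolP st|/asboolP ts] := rA _ _ As At.
      apply: (le_trans (qA _ _ At)); apply: (le_trans (sublinearD (svalP t).1 _ _)).
      by rewrite lerD2r.
    apply: (le_trans (qA _ _ As)); apply: (le_trans (sublinearD (svalP s).1 _ _)).
    by rewrite lerD2l.
  have qZ t x : 0 <= t -> q (t%:C *: x) = t * q x.
    move=> tge0; apply/eqP; rewrite eq_le; apply/andP; split.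
      have [->|tn0] := eqVneq t 0.
        rewrite scale0r mul0r -[leRHS](sublinear0 sp0).
        by apply: (le_trans (qA _ _ At1)); exact: (svalP t1).2.
      have t_gt0 : 0 < t by rewrite lt_neqAle eq_sym tn0.
      rewrite -ler_pdivrMl//; apply: lb_le_inf => // _ [s As <-].
      by rewrite ler_pdivrMl// -(sublinearZ (svalP s).1)//; exact: qA.
    apply: lb_le_inf => // _ [s As <-]; rewrite (sublinearZ (svalP s).1)//.
    by rewrite ler_wpM2l// qA.
  have qp0 x : q x <= p0 x by apply: (le_trans (qA x _ At1)); exact: (svalP t1).2.
  exists (exist _ q (conj (Build_sublinear qD qZ) qp0)) => s As; apply/asboolP => x /=.
  exact: qA.
exists p; split => // q sq qp x.
have qp0 y : q y <= p0 y by exact: le_trans (qp y) (pp0 y).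
have rpq : r (exist _ p (conj sp pp0)) (exist _ q (conj sq qp0)) by exact/asboolP.
by have /asboolP/(_ x) := pmin _ rpq.
Qed.

(** A minimal sublinear p is additive: shifting p along the single vector y with e = p(y) gives some
    q below p, so p(x) <= q(x) <= p(x + y) - p(y). Taking p below the functional obtained by
    shifting N along S forces the lower bound on S. *)
Lemma separation N S (e : R) : sublinear N -> convex_set S -> S !=set0 ->
  (forall c, S c -> e <= N c) ->
  exists p : V -> R, [/\ forall x y, p (x + y) = p x + p y,
    forall t x, p (t%:C *: x) = t * p x, forall x, p x <= N x &
    forall c, S c -> e <= p c].
Proof.
move=> sN cS S0 NS; have [p0 [sp0 p0N p0S]] := sublinear_shift sN cS S0 NS.
have [p [sp pp0 pmin]] := minimal_sublinear sp0.
have pD x y : p (x + y) = p x + p y.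
  apply/eqP; rewrite eq_le (sublinearD sp)/=.
  have c1 : convex_set [set y].
    by move=> _ _ t -> -> _; rewrite /= -scalerDl -rmorphD addrC subrK scale1r.
  have [|q [sq qp qy]] := sublinear_shift sp c1 (ex_intro _ y erefl) (e := p y).
    by move=> _ ->.
  have := le_trans (pmin _ sq qp x) (qy x y 1 erefl ler01).
  by rewrite scale1r mul1r lerBrDr.
have pN x : p (- x) = - p x.
  by apply/eqP; rewrite -addr_eq0 -pD addNr (sublinear0 sp).
exists p; split => //.
- move=> t x; have [t0|t0] := leP 0 t; first exact: sublinearZ.
  rewrite -[t]opprK rmorphN scaleNr pN (sublinearZ sp); last by rewrite oppr_ge0 ltW.
  by rewrite !mulNr.
- by move=> x; exact: le_trans (pp0 x) (p0N x).
- move=> c Sc; have := p0S (- c) c 1 Sc ler01.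
  rewrite scale1r addNr mul1r (sublinear0 sN) sub0r => pc.
  by have := le_trans (pp0 _) pc; rewrite pN lerN2.
Qed.

End sublinear_functionals.

(** * Limits along ultrafilters *)

Section ultralimits.
Context {R : realType} {T : Type} (U : set_system T) {UU : UltraFilter U}.
Local Notation C := (R[i]^o).

Lemma ultra_fmap (V : Type) (u : T -> V) : UltraFilter (u @ U).
Proof.
split=> [|H PH uH]; first exact: fmap_proper_filter.
apply/seteqP; split=> // A HA; have [//|UA] := in_ultra_setVsetC (u @^-1` A) UU.
have /(@filter_ex _ _ PH)[x []//] : H (A `&` ~` A) by apply: filterI => //; exact: uH.
Qed.

Lemma ultra_cvg_real (u : T -> R) (B : R) :
  (\forall t \near U, `|u t| <= B) -> cvg (u @ U).
Proof.
move=> uB; have := @segment_compact R (- B) B.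
rewrite compact_ultra => /(_ (u @ U) _)[].
- exact: ultra_fmap.
- by apply: filterS uB => t; rewrite /= in_itv/= ler_norml.
- by move=> l [_ ul]; apply/cvg_ex; exists l.
Qed.

Lemma ultra_cvg_complex (u : T -> C) (B : R) :
  (\forall t \near U, cabs (u t) <= B) -> cvg (u @ U).
Proof.
move=> uB; have /cvg_ex[a ua] : cvg ((fun t => complex.Re (u t)) @ U).
  apply: (@ultra_cvg_real _ B); apply: filterS uB => t; apply: le_trans.
  exact: Re_le_cabs.
have /cvg_ex[b ub] : cvg ((fun t => complex.Im (u t)) @ U).
  apply: (@ultra_cvg_real _ B); apply: filterS uB => t; apply: le_trans.
  exact: Im_le_cabs.
apply/cvg_ex; exists (a +i* b); apply/cvg_cabsP => e e0.
have e2 : 0 < e / 2 by rewrite divr_gt0.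
move/cvgrPdist_lt : ua => /(_ _ e2) ua; move/cvgrPdist_lt : ub => /(_ _ e2).
apply: filterS2 ua => t ta tb; apply: (le_lt_trans (cabs_le_ReIm _)).
by rewrite ReB ImB /= [ltRHS]splitr ltrD.
Qed.

End ultralimits.

(** * Almost invariant measures *)

Section Reiter.
Context {R : realType} {G : topologicalGroupType}.
Local Notation C := (R[i]^o).
Local Notation M := (measure_algebra R G).
Hypotheses (G_hausdorff : hausdorff_space G) (G_lc : locally_compact [set: G]).
Local Notation Re := (@complex.Re R).
Local Notation Im := (@complex.Im R).
Local Notation dl := (@point_mass R G).
Local Notation "a '**' b" := (conv a b) (at level 40, left associativity).
Implicit Types (f g : G -> C) (a b c h k : M) (x y : G).

Record Cb_mean (m : (G -> C) -> C) : Prop := {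
  cbm_linear : forall (z : C) f g, Cb f -> Cb g ->
    m (fun x => z * f x + g x) = z * m f + m g ;
  cbm_le : forall f (s : R), Cb f -> (forall x, cabs (f x) <= s) -> cabs (m f) <= s ;
  cbm_one : m (fun=> 1) = 1 ;
  cbm_invariant : forall x f, Cb f -> m (fun y => f (x * y)%g) = m f }.

(** The finite convex combinations of point masses; generating them by binary mixtures gives an
    induction principle for norm estimates. *)
Inductive conv_deltas : set M :=
| conv_deltas_pt x : conv_deltas (dl x)
| conv_deltas_mix a b (t : R) : conv_deltas a -> conv_deltas b -> 0 <= t <= 1 ->
    conv_deltas (t%:C *: a + (1 - t)%:C *: b).

Lemma mass_linear (z : C) a b : mass (z *: a + b) = z * mass a + mass b.
Proof. exact: pr_linear_measure (Cb_cst 1). Qed.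

Lemma convZl (z : C) a b : (z *: a) ** b = z *: (a ** b).
Proof.
by have := convDl G_hausdorff G_lc z a 0 b; rewrite addr0 => ->;
  have := convBl G_hausdorff G_lc 0 0 b; rewrite !subrr => ->; rewrite addr0.
Qed.

Lemma convZr (z : C) a b : b ** (z *: a) = z *: (b ** a).
Proof.
by have := convDr G_hausdorff G_lc z a 0 b; rewrite addr0 => ->;
  have := convBr G_hausdorff G_lc 0 0 b; rewrite !subrr => ->; rewrite addr0.
Qed.

Lemma conv_deltasM a b : conv_deltas a -> conv_deltas b -> conv_deltas (a ** b).
Proof.
move=> ca cb; elim: ca => [x|a1 a2 t _ IH1 _ IH2 t01]; last first.
  by rewrite (convDl G_hausdorff G_lc) convZl; exact: conv_deltas_mix.
elim: cb => [y|b1 b2 t _ IH1 _ IH2 t01]; last first.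
  by rewrite (convDr G_hausdorff G_lc) convZr; exact: conv_deltas_mix.
by rewrite -(point_massM G_hausdorff G_lc); exact: conv_deltas_pt.
Qed.

Lemma mass_conv_deltas c : conv_deltas c -> mass c = 1.
Proof.
elim=> [x|a b t _ a1 _ b1 _]; first exact: mass_point_mass.
have bz : mass ((1 - t)%:C *: b) = (1 - t)%:C.
  by have := pr_measureZ (1 - t)%:C b (Cb_cst 1); rewrite /mass => ->; rewrite [X in _ * X]b1 mulr1.
by rewrite mass_linear a1 bz mulr1 -rmorphD addrC subrK.
Qed.

Lemma tvR_conv_deltas a c : conv_deltas c -> tvR (a ** c) <= 16 * tvR a.
Proof.
elim=> [x|c1 c2 t _ IH1 _ IH2 /andP[t0 t1]]; first exact: tvR_rmul.
rewrite (convDr G_hausdorff G_lc) convZr (le_trans (tvRD _ _))// !tvRZ !cabs_real.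
rewrite !ger0_norm ?subr_ge0//.
have -> : 16 * tvR a = t * (16 * tvR a) + (1 - t) * (16 * tvR a) by ring.
by apply: lerD; apply: ler_wpM2l; rewrite ?subr_ge0.
Qed.

Lemma rcont_linear (z : C) a b : rcont a -> rcont b -> rcont (z *: a + b).
Proof.
move=> ra rb e e0; have z1 : 0 < cabs z + 1 by rewrite ltr_wpDl// cabs_ge0.
have e2 : 0 < e / 2 by rewrite divr_gt0.
apply: filterS2 (ra _ (divr_gt0 e2 z1)) (rb _ e2) => x ax bx.
rewrite (convDl G_hausdorff G_lc) opprD addrACA -scalerBr (le_lt_trans (tvRD _ _))//.
rewrite [ltRHS]splitr; apply: ltrD => //; rewrite tvRZ.
apply: le_lt_trans (mul_divD1_lt e2 (cabs_ge0 z)).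
by rewrite mulrC; apply: ler_wpM2r; [exact: cabs_ge0|exact: ltW].
Qed.

Lemma rcont_conv_deltas a c : conv_deltas c -> rcont a -> rcont (a ** c).
Proof.
move=> cc ra; elim: cc => [x|c1 c2 t _ IH1 _ IH2 _]; first exact: rcont_rmul.
rewrite (convDr G_hausdorff G_lc) convZr; apply: rcont_linear => //.
rewrite -[_ *: _]addr0; apply: rcont_linear => // e e0; apply: nearW => x.
by rewrite -(scale0r (0 : M)) convZl !scale0r subrr -(scale0r (0 : M)) tvRZ cabs0 mul0r.
Qed.

Lemma pr_measure_sum f n (a : nat -> M) : Cb f ->
  pr f (\sum_(i < n) a i) = \sum_(i < n) pr f (a i).
Proof.
move=> bf; elim: n => [|n IH]; first by rewrite !big_ord0 pr_measure0.
by rewrite !big_ord_recr /= (pr_measureD _ _ bf) IH.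
Qed.

(* A measure with norm continuous right translates is the vector valued integral
   of its translates. *)
Lemma rcont_approximation k b (e : R) : rcont k -> 0 < e ->
  exists (n : nat) (x : nat -> G) (z : nat -> C),
    tvR (k ** b - \sum_(i < n) z i *: (k ** dl (x i))) <= e /\
    cabs (mass k * mass b - (\sum_(i < n) z i) * mass k) <= e.
Proof.
move=> rk e0; pose J := {f : G -> C | Cb f /\ forall x, cabs (f x) <= 1}.
pose g (j : J) := lact k (sval j).
have bg j : Cb (g j) by apply: Cb_lact => //; exact: (svalP j).1.
have gB j x : cabs (g j x) <= 4 * 1 * tvR k by apply: lact_le; have [] := svalP j.
have gE j x : g j x = pr (sval j) (k ** dl x).
  by rewrite (pr_rmul G_hausdorff G_lc _ _ (svalP j).1).
have e4 : 0 < e / 4 by rewrite divr_gt0.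
have [|n [x [z [_ zP]]]] := @approximation R G G_hausdorff G_lc J g _ (e / 4) b e4 bg gB.
  move=> x d d0; have d4 : 0 < d / 4 by rewrite divr_gt0.
  apply: filterS (rcont_continuous G_hausdorff G_lc x rk d4) => y xy j.
  rewrite !gE -(pr_measureB _ _ (svalP j).1).
  apply: (le_lt_trans (pr_le _ (svalP j).1 (svalP j).2)).
  by rewrite mulr1 mulrC -ltr_pdivlMr.
have E f (bf : Cb f) : pr f (k ** b - \sum_(i < n) z i *: (k ** dl (x i))) =
    pr (lact k f) b - \sum_(i < n) z i * lact k f (x i).
  rewrite (pr_measureB _ _ bf) (pr_conv G_hausdorff G_lc _ _ bf); congr (_ - _).
  rewrite (pr_measure_sum n (fun i => z i *: (k ** dl (x i))) bf); apply: eq_bigr => i _.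
  by rewrite (pr_measureZ _ _ bf) (pr_rmul G_hausdorff G_lc _ _ bf).
exists n, x, z; split.
  rewrite (_ : e = 4 * (e / 4)); last by field.
  apply: (tvR_le G_hausdorff G_lc) => [|f s f0 fs]; first exact: ltW.
  have bf := isC0_Cb f0.
  have s0 : 0 <= s by rewrite (le_trans _ (fs point))// cabs_ge0.
  have [s_eq0|sn0] := eqVneq s 0.
    rewrite (_ : f = fun=> 0); last first.
      apply/funext => y; apply/eqP; rewrite -cabs_eq0 eq_le cabs_ge0 andbT.
      by rewrite -s_eq0.
    by rewrite pr0 cabs0 mulr_ge0// ltW.
  have sgt0 : 0 < s by rewrite lt_neqAle eq_sym sn0.
  have sc : (s%:C : R[i]) != 0 by rewrite eq_complex /= eqxx andbT.
  have f1 : Cb (fun x => (s^-1)%:C * f x) /\ forall x, cabs ((s^-1)%:C * f x) <= 1.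
    split=> [|y]; first exact: CbZ.
    by rewrite cabsM cabs_real ger0_norm ?invr_ge0// ler_pdivrMl// mulr1.
  have := zP (exist _ _ f1); rewrite /g /= -(E _ f1.1) (prZ _ _ bf) cabsM cabs_real.
  by rewrite ger0_norm ?invr_ge0// ler_pdivrMl// mulrC.
have f1 : Cb (fun _ : G => 1 : C) /\ forall x : G, cabs (1 : C) <= 1.
  by split=> [|_]; [exact: Cb_cst|rewrite cabs1].
apply: (@le_trans _ _ (e / 4)); last by rewrite ler_pdivrMr// ler_pMr// ler1n.
have := zP (exist _ _ f1); rewrite /g /=.
rewrite (_ : lact k (fun=> 1) = fun=> mass k)// -mulr_suml.
by have := prZ (mass k) b (Cb_cst 1); rewrite mulr1 => ->.
Qed.

Lemma rcont0 : rcont (0 : M).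
Proof.
move=> e e0; apply: nearW => x.
by rewrite -(scale0r (0 : M)) convZl !scale0r subrr -(scale0r (0 : M)) tvRZ cabs0 mul0r.
Qed.

Lemma rcontB k k' : rcont k -> rcont k' -> rcont (k - k').
Proof. by move=> rk rk'; have := rcont_linear (-1) rk' rk; rewrite scaleN1r addrC. Qed.

(** [k ** h - h] is the average over k of [dl x ** h - h], which is small for x in V, where k is
    concentrated. The factor 16 is 4 from [tvR_le] times 4 from [pr_le]. *)
Lemma approximate_unit h (V : set G) (e : R) k : lcont h -> 0 <= e ->
  (forall x, V x -> tvR (dl x ** h - h) <= e) -> mass k = 1 ->
  (forall f s, Cb f -> (forall x, V x -> cabs (f x) <= s) -> cabs (pr f k) <= s) ->
  tvR (k ** h - h) <= 16 * e.
Proof.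
move=> lh e0 Vh k1 kV; rewrite (_ : 16 * e = 4 * (4 * e)); last by ring.
apply: (tvR_le G_hausdorff G_lc) => [|f s f0 fs]; first by rewrite mulr_ge0.
have bf := isC0_Cb f0.
have br : Cb (ract h f) by exact: Cb_ract.
have -> : pr f (k ** h - h) = pr (fun x => ract h f x - pr f h) k.
  rewrite (pr_measureB _ _ bf) (pr_conv_ract G_hausdorff G_lc _ _ bf).
  rewrite (prB _ br (Cb_cst (pr f h))); congr (_ - _).
  have := prZ (pr f h) k (Cb_cst 1); rewrite mulr1 => ->.
  by rewrite -/(mass k) k1 mulr1.
rewrite (_ : 4 * e * s = 4 * s * e); last by ring.
apply: kV; first exact: CbB br (Cb_cst _).
move=> x Vx; rewrite /ract -(pr_lmul G_hausdorff G_lc _ _ bf) -(pr_measureB _ _ bf).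
apply: (le_trans (pr_le _ bf fs)); rewrite ler_wpM2l// ?Vh// mulr_ge0//.
by rewrite (le_trans _ (fs point))// cabs_ge0.
Qed.

Section right_invariant_functional.
Variables (lam : M -> C) (N : R).
Hypotheses (N_ge0 : 0 <= N)
  (lam_linear : forall (z : C) k k', rcont k -> rcont k' ->
    lam (z *: k + k') = z * lam k + lam k')
  (lam_le : forall k, rcont k -> cabs (lam k) <= N * tvR k)
  (lam_rmul : forall k x, rcont k -> lam (k ** dl x) = lam k).

Lemma lam_sum k n (x : nat -> G) (z : nat -> C) : rcont k ->
  rcont (\sum_(i < n) z i *: (k ** dl (x i))) /\
  lam (\sum_(i < n) z i *: (k ** dl (x i))) = (\sum_(i < n) z i) * lam k.
Proof.
move=> rk; elim: n => [|n [IH1 IH2]].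
  rewrite !big_ord0 mul0r; split; first exact: rcont0.
  have := lam_linear (-1) rcont0 rcont0; rewrite scaler0 addr0 mulN1r addNr.
  by [].
have rkx : rcont (k ** dl (x n)) by exact: rcont_rmul.
rewrite !big_ord_recr /= addrC; split; first exact: rcont_linear.
by rewrite (lam_linear _ rkx IH1) IH2 lam_rmul// addrC mulrDl.
Qed.

Lemma lamB k k' : rcont k -> rcont k' -> lam (k - k') = lam k - lam k'.
Proof.
move=> rk rk'; have := lam_linear (-1) rk' rk.
by rewrite scaleN1r addrC => ->; rewrite mulN1r addrC.
Qed.

(** By [rcont_approximation], [k ** h] is close to a combination of right translates of k. On it lam
    is lam k times the sum of the coefficients, and that sum is close to the mass of h. *)
Lemma lam_conv k h : rcont k -> mass k = 1 -> rcont h -> lam (k ** h) = lam k * mass h.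
Proof.
move=> rk k1 rh; apply/eqP; rewrite -subr_eq0 -cabs_eq0 eq_le cabs_ge0 andbT.
have N0 : 0 <= N + cabs (lam k) by rewrite addr_ge0// cabs_ge0.
have N1 : 0 < N + cabs (lam k) + 1 by rewrite ltr_wpDl.
apply/ler_addgt0Pr => e e0; rewrite add0r.
have [n [x [z [kz hz]]]] := rcont_approximation h rk (divr_gt0 e0 N1).
rewrite k1 mul1r mulr1 in hz.
have [rS lS] := lam_sum n x z rk.
have rkh : rcont (k ** h) by exact: rcont_conv.
have -> : lam (k ** h) - lam k * mass h =
    lam (k ** h - \sum_(i < n) z i *: (k ** dl (x i))) -
    lam k * (mass h - \sum_(i < n) z i).
  rewrite (lamB rkh rS) lS mulrBr opprB (mulrC (lam k) (\sum_(i < n) z i)).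
  by rewrite addrA subrK.
apply: (le_trans (cabsB _ _)); apply: (le_trans _ (ltW (mul_divD1_lt e0 N0))).
rewrite [leRHS]mulrDr; apply: lerD.
  apply: (le_trans (lam_le (rcontB rkh rS))).
  by rewrite [leRHS]mulrC ler_wpM2l.
by rewrite cabsM mulrC ler_wpM2r ?cabs_ge0.
Qed.

Variable I : (G -> R) -> R.
Hypothesis HI : Haar_functional I.

(** For k concentrated near 1, [k ** h] is close to h, whereas its value under lam is that of k by
    [lam_conv]. The same holds for h', so both values are close to lam k. *)
Lemma lam_mass1 h h' : lcont h -> rcont h -> mass h = 1 ->
  lcont h' -> rcont h' -> mass h' = 1 -> lam h = lam h'.
Proof.
move=> lh rh h1 lh' rh' h'1.
apply/eqP; rewrite -subr_eq0 -cabs_eq0 eq_le cabs_ge0 andbT.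
have N0 : 0 <= 2 * (N * 16) by rewrite !mulr_ge0.
have N1 : 0 < 2 * (N * 16) + 1 by rewrite ltr_wpDl.
apply/ler_addgt0Pr => e e0; rewrite add0r.
have d0 := divr_gt0 e0 N1; set d := e / _ in d0.
have V1 : nbhs (1%g : G) [set x | tvR (dl x ** h - h) < d /\ tvR (dl x ** h' - h') < d].
  exact: filterI (lh _ d0) (lh' _ d0).
have [k [lk rk k1 _ kV]] := smooth_bump G_hausdorff G_lc HI V1.
have bound (g : M) : lcont g -> rcont g -> mass g = 1 ->
    (forall x, tvR (dl x ** h - h) < d /\ tvR (dl x ** h' - h') < d -> tvR (dl x ** g - g) <= d) ->
    cabs (lam k - lam g) <= N * (16 * d).
  move=> lg rg g1 gd; have rkg : rcont (k ** g) by exact: rcont_conv.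
  rewrite -[lam k]mulr1 -g1 -lam_conv// -lamB//.
  apply: (le_trans (lam_le (rcontB rkg rg))); apply: ler_wpM2l => //.
  exact: (approximate_unit lg (ltW d0) gd k1 kV).
apply: (le_trans _ (ltW (mul_divD1_lt e0 N0))).
apply: (le_trans (cabs_dist (lam h) (lam k) (lam h'))); rewrite (cabsBC (lam h)).
rewrite (_ : e / _ * _ = N * (16 * d) + N * (16 * d)); last by rewrite /d; ring.
by apply: lerD; apply: bound => // x []; [move=> H _|move=> _ H]; exact: ltW.
Qed.

End right_invariant_functional.

Section mean.
Variable m : (G -> C) -> C.
Hypothesis mm : Cb_mean m.

(** Positivity from norm 1 and m(1) = 1. The values of f lie in the region where the real part is at
    least e and the modulus at most B; a disc with far real centre t contains this region, and would
    exclude m f if its real part r were below e. *)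
Lemma cbm_ge f (e : R) : Cb f -> (forall x, e <= Re (f x)) -> e <= Re (m f).
Proof.
move=> bf ef; have [_ [B fB]] := bf.
have B0 : 0 <= B by rewrite (le_trans _ (fB point))// cabs_ge0.
rewrite leNgt; apply/negP => re; set r := Re (m f) in re.
(* So large that (t - r)^2 exceeds (t - e)^2 + B^2, that is, (e - r) (2 t - r - e) > B^2. *)
pose t := B + `|e| + `|r| + B ^+ 2 / (e - r).
have er : 0 < e - r by rewrite subr_gt0.
have q0 : 0 <= B ^+ 2 / (e - r) by rewrite divr_ge0 ?sqr_ge0// ltW.
have te : 0 <= t - e.
  by rewrite subr_ge0 /t; have := ler_norm e; have := normr_ge0 r; nra.
pose s := Num.sqrt ((t - e) ^+ 2 + B ^+ 2).
have sx x : cabs (f x - t%:C) <= s.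
  rewrite /s /cabs normc_def /= ler_wsqrtr//.
  have Rf : `|Re (f x)| <= B := le_trans (Re_le_cabs _) (fB x).
  have If : `|Im (f x)| <= B := le_trans (Im_le_cabs _) (fB x).
  rewrite ReB ImB /= subr0; apply: lerD.
    rewrite -sqrrN opprB ler_sqr ?nnegrE//; first by rewrite lerD2l lerN2.
    rewrite subr_ge0 (le_trans (ler_norm _))// (le_trans Rf)// /t.
    by have := normr_ge0 e; have := normr_ge0 r; lra.
  by rewrite -(ger0_norm (sqr_ge0 (Im _))) normrX ler_sqr ?nnegrE.
have := cbm_le mm (CbB bf (Cb_cst t%:C)) sx.
have -> : m (fun x => f x - t%:C) = m f - t%:C.
  have := cbm_linear mm (- t%:C) (Cb_cst 1) bf; rewrite (cbm_one mm) mulr1 addrC => <-.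
  by congr m; apply/funext => x; rewrite addrC.
move=> /(le_trans (Re_le_cabs _)); rewrite ReB /= -/r distrC.
move=> /(le_trans (ler_norm _)) trs.
have tr : 0 <= t - r by rewrite subr_ge0 /t; have := ler_norm r; have := normr_ge0 e; lra.
have : (t - r) ^+ 2 <= (t - e) ^+ 2 + B ^+ 2.
  rewrite -[leRHS]sqr_sqrtr; last by rewrite addr_ge0 ?sqr_ge0.
  by rewrite ler_sqr ?nnegrE ?sqrtr_ge0.
rewrite -lerBlDl (_ : _ - _ = (e - r) * (2 * t - r - e)); last by ring.
rewrite -ler_pdivlMl// mulrC => H.
have : 2 * t - r - e <= t - `|e| - `|r| - B by move: H; rewrite /t; lra.
by have := ler_norm e; have := ler_norm r; have := normr_ge0 r; have := normr_ge0 e; rewrite /t in te *; nra.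
Qed.

Section translates.
Variables (u : M -> C) (L : R).
Hypotheses (ul : linear u) (L0 : 0 <= L) (uL : forall a, cabs (u a) <= L * tvR a).

(** Left invariance of m makes this invariant under right translation of k, because delta_x delta_y
    = delta_(xy). *)
Definition mean_of_translates k : C := m (fun y => u (k ** dl y)).
Local Notation lam := mean_of_translates.

Lemma translate_le k y : cabs (u (k ** dl y)) <= L * (16 * tvR k).
Proof. by rewrite (le_trans (uL _))// ler_wpM2l//; exact: tvR_rmul. Qed.

Lemma Cb_translates k : rcont k -> Cb (fun y => u (k ** dl y)).
Proof.
move=> rk; split; last by eexists=> y; exact: translate_le.
apply/continuous_cabsP => x e e0.
have L1 : 0 < L + 1 by rewrite ltr_wpDl.
apply: filterS (rcont_continuous G_hausdorff G_lc x rk (divr_gt0 e0 L1)) => y xy.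
rewrite -(linear_funB ul) (le_lt_trans (uL _))// tvRBC.
apply: le_lt_trans (mul_divD1_lt e0 L0).
by rewrite mulrC ler_wpM2r// ltW.
Qed.

Lemma lam_le k : rcont k -> cabs (lam k) <= L * 16 * tvR k.
Proof.
by move=> rk; rewrite -mulrA; apply: (cbm_le mm (Cb_translates rk)) => y; exact: translate_le.
Qed.

Lemma lam_linear (z : C) k k' : rcont k -> rcont k' ->
  lam (z *: k + k') = z * lam k + lam k'.
Proof.
move=> rk rk'; rewrite -(cbm_linear mm _ (Cb_translates rk) (Cb_translates rk')).
by congr m; apply/funext => y; rewrite (convDl G_hausdorff G_lc) ul.
Qed.

Lemma lam_rmul k x : rcont k -> lam (k ** dl x) = lam k.
Proof.
move=> rk; rewrite /mean_of_translates -(cbm_invariant mm x (Cb_translates rk)).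
congr m; apply/funext => y.
by rewrite (point_massM G_hausdorff G_lc) (convA G_hausdorff G_lc).
Qed.

End translates.

Variable I : (G -> R) -> R.
Hypothesis HI : Haar_functional I.

(** If no c works, the convex set of all g h c - h c keeps distance e from 0, and a functional u has
    real part at least e on it. The mean over y of the values at c = delta_y is lam(g h) - lam(h),
    which is 0 by [lam_mass1]. *)
Lemma day_step (g : M) h (e : R) : lcont g -> rcont g -> mass g = 1 ->
  lcont h -> rcont h -> mass h = 1 -> 0 < e ->
  exists2 c, conv_deltas c & tvR (g ** h ** c - h ** c) < e.
Proof.
move=> lg rg g1 lh rh h1 e0; apply: contrapT => nex.
pose S := [set g ** h ** c - h ** c | c in conv_deltas].
have sN : sublinear (@tvR R G).
  by split=> [a b|t a t0]; [exact: tvRD|rewrite tvRZ cabs_real ger0_norm].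
have cS : convex_set S.
  move=> _ _ t [a ca <-] [b cb <-] t01.
  exists (t%:C *: a + (1 - t)%:C *: b); first exact: conv_deltas_mix.
  by rewrite !(convDr G_hausdorff G_lc) !convZr opprD addrACA !scalerBr.
have S0 : S !=set0.
  by exists (g ** h ** dl 1%g - h ** dl 1%g); exists (dl 1%g) => //; exact: conv_deltas_pt.
have [|p [pD pZ pN pS]] := @separation _ _ _ S e sN cS S0.
  by move=> _ [c cc <-]; rewrite leNgt; apply/negP => lt; apply: nex; exists c.
(* The complex linear functional whose real part is p. *)
pose u (a : M) : C := p a +i* (- p ('i%C *: a)).
have pl z a b : p (z *: a + b) = Re z * p a + Im z * p ('i%C *: a) + p b.
  by rewrite pD {1}(complexE z) scalerDl pD pZ (mulrC 'i%C) -scalerA pZ.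
have p0 : p 0 = 0 by have := pZ 0 0; rewrite scaler0 mul0r.
have pN' a : p (- a) = - p a by apply/eqP; rewrite -addr_eq0 -pD addNr p0.
have ul : linear u.
  move=> z a b; apply: complex_ext; rewrite /u ?ReD ?ImD ?ReM ?ImM /=.
    by rewrite pl; ring.
  rewrite scalerDr scalerA (mulrC 'i%C) -scalerA pl scalerA -expr2 sqr_i scaleN1r pN'.
  by ring.
have pabs a : `|p a| <= tvR a by rewrite ler_norml lerNl -pN' -{1}(tvRN a) !pN.
have uL a : cabs (u a) <= 2 * tvR a.
  apply: (le_trans (cabs_le_ReIm _)); rewrite /= normrN.
  rewrite (_ : 2 * tvR a = tvR a + tvR ('i%C *: a)); last by rewrite tvRZ cabs_i; ring.
  by apply: lerD.
have rgh : rcont (g ** h) by exact: rcont_conv.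
have lgh : lcont (g ** h) by exact: lcont_conv.
have gh1 : mass (g ** h) = 1 by rewrite mass_conv// g1 h1 mulr1.
have b1 := Cb_translates ul (ler0n _ 2) uL rgh; have b2 := Cb_translates ul (ler0n _ 2) uL rh.
have : e <= Re (m (fun y => u (g ** h ** dl y) - u (h ** dl y))).
  apply: (cbm_ge (CbB b1 b2)) => y.
  rewrite -(linear_funB ul) /=; apply: pS; exists (dl y) => //; exact: conv_deltas_pt.
have -> : m (fun y => u (g ** h ** dl y) - u (h ** dl y)) = 0.
  have := cbm_linear mm (-1) b2 b1.
  rewrite -/(mean_of_translates u h) -/(mean_of_translates u (g ** h)).
  rewrite (lam_mass1 _ (lam_linear ul (ler0n _ 2) uL) (lam_le ul (ler0n _ 2) uL)
    (lam_rmul ul (ler0n _ 2) uL) HI lgh rgh gh1 lh rh h1) ?mulr_ge0// mulN1r addNr => E.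
  by rewrite -[RHS]E; congr m; apply/funext => y; rewrite mulN1r addrC.
by rewrite leNgt e0.
Qed.

Lemma day (n : nat) (g : nat -> M) h (e : R) :
  (forall i, [/\ lcont (g i), rcont (g i) & mass (g i) = 1]) ->
  lcont h -> rcont h -> mass h = 1 -> 0 < e ->
  exists2 c, conv_deltas c & forall i, (i < n)%N -> tvR (g i ** h ** c - h ** c) < e.
Proof.
move=> gP lh rh h1; elim: n e => [|n IH] e e0.
  by exists (dl 1%g) => //; exact: conv_deltas_pt.
(* The next factor c' is convolved on the right and multiplies the errors obtained so far by at most
   16. *)
have e16 : 0 < e / 16 by rewrite divr_gt0.
have [c cc cP] := IH _ e16; have [lg rg g1] := gP n.
have [|||c' cc' c'P] := @day_step (g n) (h ** c) e lg rg g1 _ _ _ e0.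
- exact: lcont_conv.
- exact: rcont_conv_deltas.
- by rewrite mass_conv// h1 (mass_conv_deltas cc) mulr1.
exists (c ** c'); first exact: conv_deltasM.
move=> i; rewrite ltnS leq_eqVlt => /orP[/eqP->|/cP {}cP].
  by move: c'P; rewrite !(convA G_hausdorff G_lc).
rewrite !(convA G_hausdorff G_lc) -(convBl G_hausdorff G_lc).
rewrite (le_lt_trans (tvR_conv_deltas _ cc'))// mulrC -ltr_pdivlMr//.
Qed.

(** The measure is h h q. Its left factor makes delta_x h norm continuous in x, so finitely many
    points x_i stand for all of K, and [day] finds a q for all delta_(x_i) h and h. The norm bound
    depends on h alone because q is a convex combination of point masses. *)
Lemma reiter : exists B : R, 0 <= B /\ forall (K : set G) (e : R), compact K -> 0 < e ->
  exists p, [/\ mass p = 1, tvR p <= B & forall x, K x -> tvR (dl x ** p - p) < e].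
Proof.
have [h [lh rh h1 _ _]] := smooth_bump G_hausdorff G_lc HI (@filterT _ (nbhs (1%g : G)) _).
have t0 : 0 <= tvR h := tvR_ge0 h.
exists (64 * tvR h * (16 * tvR h)); split; first by rewrite !mulr_ge0.
move=> K e cK e0.
have e3 : 0 < e / 3 by rewrite divr_gt0.
have T0 : 0 <= 64 * (16 * tvR h) by rewrite !mulr_ge0.
have T1 : 0 < 64 * (16 * tvR h) + 1 by rewrite ltr_wpDl.
have d0 := divr_gt0 e3 T1; set d := e / 3 / _ in d0.
pose U x := [set y | tvR (dl y ** h - dl x ** h) < d]°.
have [|n [x [c [xK _ c0 cU [_ c1]]]]] :=
    partition_of_unity (R := R) G_hausdorff G_lc (U := U) cK.
  by move=> x Kx; split; [exact: open_interior|exact: lcont_continuous].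
(* Index 0 carries h itself. The difference delta_y h h q - h h q splits into (delta_y h -
   delta_(x_i) h) h q, then g_(i+1) h q - h q, then h q - g_0 h q. *)
pose g i := if i is i'.+1 then dl (x i') ** h else h.
have gP i : [/\ lcont (g i), rcont (g i) & mass (g i) = 1].
  case: i => [|i]; first exact: And3 lh rh h1.
  apply: And3.
  - exact: (lcont_lmul G_hausdorff G_lc (x i) lh).
  - exact: (rcont_conv G_hausdorff G_lc (dl (x i)) rh).
  - by rewrite (mass_conv G_hausdorff G_lc) (mass_point_mass G_hausdorff G_lc) h1 mulr1.
have [q cq qP] := @day n.+1 g h _ gP lh rh h1 e3.
exists (h ** (h ** q)); split.
- by rewrite !mass_conv// h1 (mass_conv_deltas cq) !mulr1.
- apply: (le_trans (tvR_conv G_hausdorff G_lc _ _)).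
  by rewrite ler_wpM2l ?mulr_ge0// tvR_conv_deltas.
move=> y Ky.
have [i [ni Uy]] : exists i, (i < n)%N /\ U (x i) y.
  apply: contrapT => nU; have := c1 y Ky; rewrite big1 => [/eqP|i _].
    by rewrite eq_sym oner_eq0.
  have [L [_ LU] Lc] := cU _ (ltn_ord i); apply: Lc => /LU Uy.
  by apply: nU; exists i; split.
have {}Uy : tvR (dl y ** h - dl (x i) ** h) < d := interior_subset Uy.
have -> : dl y ** (h ** (h ** q)) - h ** (h ** q) =
    ((dl y ** h - dl (x i) ** h) ** (h ** q) + (g i.+1 ** h ** q - h ** q)) +
    (h ** q - g 0%N ** h ** q).
  rewrite (convBl G_hausdorff G_lc) /= !(convA G_hausdorff G_lc).
  by rewrite (addrA _ _ (- (h ** q))) subrK addrA subrK.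
rewrite (le_lt_trans (tvRD _ _))//.
have -> : e = e / 3 + e / 3 + e / 3 by field.
apply: ltrD; last by rewrite tvRBC; exact: qP.
rewrite (le_lt_trans (tvRD _ _))//; apply: ltrD; last exact: qP.
apply: (le_lt_trans (tvR_conv G_hausdorff G_lc _ _)).
apply: le_lt_trans (mul_divD1_lt e3 T0); rewrite -/d.
rewrite (_ : d * _ = 64 * d * (16 * tvR h)); last by ring.
apply: ler_pM; rewrite ?mulr_ge0 ?tvR_ge0//; first by rewrite ler_wpM2l// ltW.
exact: tvR_conv_deltas.
Qed.

End mean.
End Reiter.

(** * The diagonal as an ultralimit *)

Section diagonal.
Context {R : realType} {G : topologicalGroupType}.
Local Notation C := (R[i]^o).
Local Notation M := (measure_algebra R G).
Local Notation P := (@C0_pairing R G).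
Hypotheses (G_hausdorff : hausdorff_space G) (G_lc : locally_compact [set: G]).
Local Notation dl := (@point_mass R G).
Local Notation "a '**' b" := (conv a b) (at level 40, left associativity).
Implicit Types (f g : G -> C) (a b c p q : M) (x y : G) (Phi : M -> M -> C).

(** Such a functional is a finite combination of pairings with elements of C_0(G), hence integration
    against its own values on point masses. This turns separate w*-continuity of a bilinear form
    into an integral formula in each variable. *)
Lemma wstar_integral (w : M -> C) : linear w -> continuous (w : wstar P -> C) ->
  Cb (fun x => w (dl x)) /\ forall a, w a = pr (fun x => w (dl x)) a.
Proof.
move=> wl wc; have [l lE] := wstar_functional (@C0_pairing_linear R G) wl wc.
elim: l w {wl wc} lE => [|z l IH] w lE.
  have w0 : w = fun=> 0 by apply/funext => a; rewrite lE big_nil.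
  by rewrite w0; split=> [|a]; [exact: Cb_cst|rewrite pr0].
have [bl lP] := IH (fun a => \sum_(z <- l) z.1 * P z.2 a) (fun a => erefl).
have bz : Cb (z.2 : G -> C) := isC0_Cb (C0_isC0 z.2).
have wE : (fun x => w (dl x)) = fun x => z.1 * z.2 x + \sum_(z <- l) z.1 * P z.2 (dl x).
  apply/funext => x; rewrite lE big_cons; congr (_ * _ + _).
  exact: (pr_point_mass G_hausdorff G_lc x bz).
rewrite wE; split; first exact: Cb_linear.
by move=> a; rewrite lE big_cons (pr_linear _ _ bz bl) -lP.
Qed.

Lemma L2_wstar_bound Phi : L2_wstar P Phi ->
  exists2 K : R, 0 <= K & forall b c, cabs (Phi b c) <= K * tvR b * tvR c.
Proof.
move=> [_ _ [K PK] _ _]; exists (cabs K) => [|b c]; first exact: cabs_ge0.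
rewrite -le_normr_cabs !rmorphM /= -!normr_tvR -normr_cabs -mulrA.
by apply: le_normM; rewrite ?mulr_ge0// mulrA; exact: PK.
Qed.

Lemma L2_wstar_actr Phi a : L2_wstar P Phi -> L2_wstar P (L2_actr (@conv R G) Phi a).
Proof.
move=> L2P; have [K K0 KP] := L2_wstar_bound L2P; have [P1 P2 _ P4 P5] := L2P.
split.
- by move=> b; exact: P1.
- by move=> c k b b'; rewrite /L2_actr (convDr G_hausdorff G_lc) P2.
- exists (K * (64 * tvR a))%:C => b c; rewrite !normr_tvR -!rmorphM /= le_normr_cabs.
  apply: (le_trans (KP _ _)); apply: ler_wpM2r; first exact: tvR_ge0.
  by rewrite -(mulrA K); apply: ler_wpM2l => //; exact: tvR_conv.
- by move=> b; exact: P4.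
- by move=> c; exact: (@continuous_compose (wstar P) (wstar P) C _ _ (convolution_wstarr G_hausdorff G_lc (b := a)) (P5 c)).
Qed.

Lemma L2_wstar_actl Phi a : L2_wstar P Phi -> L2_wstar P (L2_actl (@conv R G) a Phi).
Proof.
move=> L2P; have [K K0 KP] := L2_wstar_bound L2P; have [P1 P2 _ P4 P5] := L2P.
split.
- by move=> b k c c'; rewrite /L2_actl (convDl G_hausdorff G_lc) P1.
- by move=> c; exact: P2.
- exists (K * (64 * tvR a))%:C => b c; rewrite !normr_tvR -!rmorphM /= le_normr_cabs.
  apply: (le_trans (KP _ _)).
  rewrite [leRHS](_ : _ = K * tvR b * (64 * tvR c * tvR a)); last by ring.
  by apply: ler_wpM2l; [rewrite mulr_ge0// tvR_ge0|exact: tvR_conv].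
- by move=> b; exact: (@continuous_compose (wstar P) (wstar P) C _ _ (convolution_wstarl G_hausdorff G_lc (c := a)) (P4 b)).
- by move=> c; exact: P5.
Qed.

Lemma L2_convl Phi a b c : L2_wstar P Phi -> Phi (a ** b) c = pr (fun x => Phi (dl x ** b) c) a.
Proof.
move=> [_ P2 _ _ P5].
have wl : linear (fun a => Phi (a ** b) c).
  by move=> k a1 a2; rewrite (convDl G_hausdorff G_lc) P2.
exact: (wstar_integral wl (@continuous_compose (wstar P) (wstar P) C _ _ (convolution_wstarl G_hausdorff G_lc (c := b)) (P5 c))).2.
Qed.

Lemma L2_convr Phi a b c : L2_wstar P Phi -> Phi b (c ** a) = pr (fun x => Phi b (c ** dl x)) a.
Proof.
move=> [P1 _ _ P4 _].
have wl : linear (fun a => Phi b (c ** a)).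
  by move=> k a1 a2; rewrite (convDr G_hausdorff G_lc) P1.
exact: (wstar_integral wl (@continuous_compose (wstar P) (wstar P) C _ _ (convolution_wstarr G_hausdorff G_lc (b := c)) (P4 b))).2.
Qed.

Section joint_continuity.
Variables (Phi : M -> M -> C) (q : M).
Hypotheses (L2P : L2_wstar P Phi) (lq : lcont q).

(** The first argument moves continuously in norm because left translates of q do, uniformly against
    the bounded point masses in the second; at a fixed first argument, w*-continuity handles the
    second. Together these give the joint continuity on which the exchange of integrals relies. *)
Lemma L2_continuous (X : topologicalType) (u v : X -> G) :
  continuous u -> continuous v -> continuous (fun t => Phi (dl (u t) ** q) (dl (v t))).
Proof.
move=> cu cv; have [K K0 KP] := L2_wstar_bound L2P; have [P1 P2 _ P4 _] := L2P.
apply/continuous_cabsP => t e e0; have e2 : 0 < e / 2 by rewrite divr_gt0.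
have K1 : 0 < K * 4 + 1 by rewrite ltr_wpDl// mulr_ge0.
have [bw _] := wstar_integral (P1 (dl (u t) ** q)) (P4 (dl (u t) ** q)).
have /continuous_cabsP/(_ t _ e2) nv := continuous_compose cv bw.1.
have nu : \forall s \near t, tvR (dl (u s) ** q - dl (u t) ** q) < e / 2 / (K * 4 + 1).
  exact: (cu t _ (lcont_continuous G_hausdorff G_lc (u t) lq (divr_gt0 e2 K1))).
apply: filterS2 nu nv => s us vs.
apply: (le_lt_trans (cabs_dist _ (Phi (dl (u t) ** q) (dl (v s))) _)).
rewrite [ltRHS]splitr addrC; apply: ltrD => //.
rewrite -(linear_funB (P2 (dl (v s)))); apply: (le_lt_trans (KP _ _)).
apply: le_lt_trans (mul_divD1_lt e2 (mulr_ge0 K0 (ler0n _ 4))).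
rewrite mulrC (mulrA (tvR _)) mulrC; apply: ler_pM; rewrite ?mulr_ge0 ?tvR_ge0//.
  by rewrite tvRBC ltW.
by rewrite mulrC ler_wpM2l// tvR_point_mass.
Qed.

End joint_continuity.

Lemma cvg_Clinear (T : Type) (F : set_system T) {FF : Filter F} (z : C) (u v : T -> C)
    (l l' : C) : u @ F --> l -> v @ F --> l' ->
  (fun t => z * u t + v t) @ F --> (z * l + l' : C).
Proof.
by move=> ul vl; apply: cvgD; [apply: cvgM; [exact: cvg_cst|exact: ul]|exact: vl].
Qed.

Lemma ulim_unique (T : Type) (F : set_system T) {FF : ProperFilter F} (u v : T -> C)
    (l l' : C) : u @ F --> l -> v @ F --> l' ->
  (forall e : R, 0 < e -> \forall t \near F, cabs (u t - v t) <= e) -> l = l'.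
Proof.
move=> /cvg_cabsP ul /cvg_cabsP vl uv; apply/eqP.
rewrite -subr_eq0 -cabs_eq0 eq_le cabs_ge0 andbT; apply/ler_addgt0Pr => e e0.
have e3 : 0 < e / 3 by rewrite divr_gt0.
have [t [lu [lv luv]]] := @filter_ex _ _ FF _
  (@filterI _ _ FF _ _ (ul _ e3) (@filterI _ _ FF _ _ (vl _ e3) (uv _ e3))).
rewrite add0r.
rewrite (_ : l - l' = (l - u t) + (u t - v t) - (l' - v t)); last by ring.
have -> : e = e / 3 + e / 3 + e / 3 by field.
apply: (le_trans (cabsB _ _)); apply: lerD; last exact: ltW.
by apply: (le_trans (cabsD _ _)); apply: lerD => //; exact: ltW.
Qed.

Lemma ulim_le (T : Type) (F : set_system T) {FF : ProperFilter F} (u : T -> C)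
    (l : C) (s : R) : u @ F --> l -> (\forall t \near F, cabs (u t) <= s) -> cabs l <= s.
Proof.
move=> /cvg_cabsP ul us; apply/ler_addgt0Pr => e e0.
have [t [lu tu]] := @filter_ex _ _ FF _ (@filterI _ _ FF _ _ (ul _ e0) us).
by rewrite -(subrK (u t) l) (le_trans (cabsD _ _))// addrC lerD// ltW.
Qed.

Variables N B : R.
Hypotheses (N0 : 0 <= N) (HN : forall V : set G, nbhs 1%g V -> exists q,
  [/\ lcont q, mass q = 1, tvR q <= N & forall f (s : R), Cb f ->
    (forall x, V x -> cabs (f x) <= s) -> cabs (pr f q) <= 4 * s]).
Hypotheses (B0 : 0 <= B) (HB : forall (K : set G) (e : R), compact K -> 0 < e ->
  exists p, [/\ mass p = 1, tvR p <= B & forall x, K x -> tvR (dl x ** p - p) < e]).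

(** The pairing of f with delta_z q delta_(z^-1), the image under Delta of the tensor of delta_z q
    and delta_(z^-1). *)
Definition conj_pr q f : G -> C := fun z => pr (fun y => f (z * y * z^-1)%g) q.

Lemma continuous_conj f : continuous f -> continuous (fun p : G * G => f (p.1 * p.2 * p.1^-1)%g).
Proof.
move=> cf; apply: (@continuous_compose _ _ _ (fun p : G * G => (p.1 * p.2 * p.1^-1)%g) f) => //.
apply: continuous_mul; last by apply: continuous_inv; exact: continuous_fst.
by apply: continuous_mul; [exact: continuous_fst|exact: continuous_snd].
Qed.

Lemma Cb_conj_pr q f : Cb f -> Cb (conj_pr q f).
Proof.
move=> [cf [s fs]].
apply: (@Cb_pr_param _ _ _ (fun z y => f (z * y * z^-1)%g) s) => //.
exact: continuous_conj.
Qed.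

Lemma pr_conj_pr q f z : Cb f -> pr f (dl z ** q ** dl z^-1%g) = conj_pr q f z.
Proof.
move=> bf; rewrite (pr_rmul G_hausdorff G_lc _ _ bf).
by rewrite (pr_lmul G_hausdorff G_lc _ _ (Cb_rmul _ bf)).
Qed.

(* (K, e, U)-invariant pairs: p is e-invariant under K and q is concentrated so close
   to 1 that it is conjugated into U by the bulk of p. *)
Definition invariant_pair (k : set G * R * set G) (t : M * M) :=
  [/\ mass t.1 = 1, tvR t.1 <= B, forall x, k.1.1 x -> tvR (dl x ** t.1 - t.1) < k.1.2,
      lcont t.2 /\ tvR t.2 <= N &
      forall f (s d : R), Cb f -> 0 < d -> (forall x, cabs (f x) <= s) ->
        (forall x, k.2 x -> cabs (f x - f 1%g) <= d) ->
        cabs (pr (conj_pr t.2 f) t.1 - f 1%g) <= 16 * d * B + k.1.2 * s].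

Definition pair_filter := filter_from
  [set k : set G * R * set G | [/\ compact k.1.1, 0 < k.1.2 & nbhs 1%g k.2]]
  invariant_pair.

(** For nonemptiness, p comes first; then W, so small that its conjugates by the compact set Kp
    carrying p stay in U; then q, concentrated on W. Off Kp only the bound 8 N s is available, and
    Kp is chosen so as to absorb it. *)
Lemma pair_filter_proper : ProperFilter pair_filter.
Proof.
apply: filter_from_proper.
  apply: filter_from_filter.
    exists (set0, 1, setT); split => //=; [exact: compact0|exact: filterT].
  move=> [[K e] U] [[K' e'] U'] [/= cK e0 U1] [/= cK' e'0 U'1].
  exists ((K `|` K'), Order.min e e', U `&` U').
    split => /=; [exact: compactU|by rewrite lt_min e0|exact: filterI].
  move=> [p q] [/= p1 pB pK lq cq].
  have s0 f (s : R) : (forall x, cabs (f x) <= s) -> 0 <= s.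
    by move=> fs; rewrite (le_trans _ (fs point))// cabs_ge0.
  split; split => //=.
  - by move=> x Kx; have := pK x (or_introl Kx); rewrite lt_min => /andP[].
  - move=> f s d bf d0 fs fU; apply: (le_trans (cq f s d bf d0 fs _)).
      by move=> x [Ux _]; exact: fU.
    by rewrite lerD2l ler_wpM2r ?(s0 _ _ fs)// ge_min lexx.
  - by move=> x Kx; have := pK x (or_intror Kx); rewrite lt_min => /andP[].
  - move=> f s d bf d0 fs fU; apply: (le_trans (cq f s d bf d0 fs _)).
      by move=> x [_ Ux]; exact: fU.
    by rewrite lerD2l ler_wpM2r ?(s0 _ _ fs)// ge_min lexx orbT.
move=> [[K e] U] [/= cK e0 U1].
have [p [p1 pB pK]] := HB cK e0.
have N1 : 0 < 8 * N + 1 by rewrite ltr_wpDl// mulr_ge0.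
have [Kp cKp HKp] := tight_bound G_hausdorff p (divr_gt0 e0 N1).
have [W W1 WU] : exists2 W : set G, nbhs 1%g W & forall z y, Kp z -> W y -> U (z * y * z^-1)%g.
  exists [set y | forall z, Kp z -> U (z * y * z^-1)%g] => [|z y Kz]; last exact.
  have cc : continuous (fun p : G * G => (p.2 * p.1 * p.2^-1)%g).
    apply: continuous_mul; last by apply: continuous_inv; exact: continuous_snd.
    by apply: continuous_mul; [exact: continuous_snd|exact: continuous_fst].
  have [+ _] := compact_near_coveringP Kp.
  move=> /(_ cKp G (nbhs (1%g : G)) (fun y z => U (z * y * z^-1)%g) _); apply=> z Kz.
  have Uz : nbhs (z * 1 * z^-1)%g U by rewrite mulg1 mulgV.
  have [[A D] /= [A1 Dz] AD] := cc (1%g, z) _ Uz.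
  by exists (D, A) => // -[z' y'] /= [Dz' Ay']; exact: (AD (y', z')).
have [q [lq q1 q4 qW]] := HN W1.
exists (p, q); split => //= f s d bf d0 fs fU.
have bc := Cb_conj_pr q bf.
have s0 : 0 <= s by rewrite (le_trans _ (fs point))// cabs_ge0.
have -> : pr (conj_pr q f) p - f 1%g = pr (fun z => conj_pr q f z - f 1%g) p.
  rewrite (prB _ bc (Cb_cst (f 1%g))); congr (_ - _).
  have := prZ (f 1%g) p (Cb_cst 1); rewrite mulr1 => ->.
  by rewrite -/(mass p) p1 mulr1.
have bz z : Cb (fun y => f (z * y * z^-1)%g).
  exact: Cb_lmul (Cb_rmul _ bf).
have zE z : conj_pr q f z - f 1%g = pr (fun y => f (z * y * z^-1)%g - f 1%g) q.
  rewrite (prB _ (bz z) (Cb_cst (f 1%g))); congr (_ - _).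
  have := prZ (f 1%g) q (Cb_cst 1); rewrite mulr1 => ->.
  by rewrite -/(mass q) q1 mulr1.
apply: (le_trans (HKp _ (4 * d) (8 * N * s) (CbB bc (Cb_cst _)) _ _ _)).
- by rewrite mulr_gt0.
- move=> z Kz; rewrite zE; apply: qW; first exact: CbB (bz z) (Cb_cst _).
  by move=> y Wy; apply: fU; exact: WU.
- move=> z; rewrite zE.
  apply: (le_trans (pr_le (s := 2 * s) _ (CbB (bz z) (Cb_cst _)) _)).
    move=> y; apply: (le_trans (cabsB _ _)).
    by rewrite (_ : 2 * s = s + s); [rewrite lerD|ring].
  rewrite (_ : 8 * N * s = 4 * (2 * s) * N); last by ring.
  by rewrite ler_wpM2l// !mulr_ge0.
- apply: lerD.
    rewrite (_ : 4 * (4 * d) = 16 * d); last by ring.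
    by rewrite ler_wpM2l// mulr_ge0// ltW.
  rewrite mulrA ler_wpM2r//; apply/ltW/mul_divD1_lt => //.
  by rewrite mulr_ge0.
Qed.

Definition diagonal_value Phi (t : M * M) : C :=
  pr (fun z => Phi (dl z ** t.2) (dl z^-1%g)) t.1.

Lemma diagonal_value_le Phi (K : R) (t : M * M) : L2_wstar P Phi -> 0 <= K ->
  (forall b c, cabs (Phi b c) <= K * tvR b * tvR c) ->
  tvR t.1 <= B -> lcont t.2 -> tvR t.2 <= N ->
  [/\ forall x y, cabs (Phi (dl x ** t.2) (dl y)) <= K * (16 * N) * 4,
      Cb (fun z => Phi (dl z ** t.2) (dl z^-1%g)) &
      cabs (diagonal_value Phi t) <= 4 * (16 * N * 4) * B * K].
Proof.
move=> L2P K0 KP tB lt tq.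
have le x y : cabs (Phi (dl x ** t.2) (dl y)) <= K * (16 * N) * 4.
  apply: (le_trans (KP _ _)); apply: ler_pM; rewrite ?mulr_ge0 ?tvR_ge0//.
    rewrite ler_wpM2l// (le_trans (tvR_lmul G_hausdorff G_lc _ _))//.
    by rewrite ler_wpM2l.
  exact: tvR_point_mass.
have bz : Cb (fun z => Phi (dl z ** t.2) (dl z^-1%g)).
  split; last by eexists=> z; exact: le.
  exact: (L2_continuous L2P lt (@continuous_id' G) (@invg_continuous G)).
split => //; apply: (le_trans (pr_le (s := K * (16 * N) * 4) _ bz _)).
  by move=> z; exact: le.
rewrite [leRHS](_ : _ = 4 * (K * (16 * N) * 4) * B); last by ring.
by rewrite ler_wpM2l// !mulr_ge0.
Qed.

(** Put F_x(w) = Phi(delta_w q, delta_(w^-1 x)). After substituting w = xz on one side, the two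
    values are integrals over x against [a] of F_x against delta_x p and against p. On a compact set
    carrying [a] these are close by the invariance of p. *)
Lemma diagonal_value_commute Phi a (e : R) : L2_wstar P Phi -> 0 < e ->
  exists k, [/\ compact k.1.1, 0 < k.1.2 & nbhs 1%g k.2] /\
    forall t, invariant_pair k t ->
      cabs (diagonal_value (L2_actr (@conv R G) Phi a) t -
            diagonal_value (L2_actl (@conv R G) a Phi) t) <= e.
Proof.
move=> L2P e0; have [K K0 KP] := L2_wstar_bound L2P.
have tB0 := tvR_ge0 a.
pose S := K * (16 * N) * 4; have S0 : 0 <= S by rewrite !mulr_ge0.
have e2 : 0 < e / 2 by rewrite divr_gt0.
(* 17 B bounds the norm of delta_x p - p for every x: 16 B from [tvR_lmul] and B from p. *)
have Q0 : 0 <= 4 * S * (17 * B) by rewrite !mulr_ge0.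
have Q1 : 0 < 4 * S * (17 * B) + 1 by rewrite ltr_wpDl.
have [L cL HL] := tight_bound G_hausdorff a (divr_gt0 e2 Q1).
have T0 : 0 <= 4 * (4 * S + 1) * tvR a by rewrite !mulr_ge0// addr_ge0// mulr_ge0.
have T1 : 0 < 4 * (4 * S + 1) * tvR a + 1 by rewrite ltr_wpDl.
pose d := e / 2 / (4 * (4 * S + 1) * tvR a + 1).
have d0 : 0 < d by rewrite divr_gt0.
exists (L, d, setT); split; first by split => //=; exact: filterT.
move=> [p q] [/= p1 pB pL [lq q4] _].
have [Sle _ _] := @diagonal_value_le Phi K (p, q) L2P K0 KP pB lq q4; rewrite /= in Sle.
pose F x w : C := Phi (dl w ** q) (dl (w^-1 * x)%g).
have cF (X : topologicalType) (u v : X -> G) : continuous u -> continuous v ->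
    continuous (fun t => Phi (dl (u t) ** q) (dl (v t))).
  exact: L2_continuous.
have bF x : Cb (F x).
  split; last by exists S => w; exact: Sle.
  apply: cF; first exact: continuous_id'.
  by apply: continuous_mul; [exact: invg_continuous|exact: cst_continuous].
have FS x w : cabs (F x w) <= S by exact: Sle.
have c1 : continuous (fun t : G * G => t.1) := @continuous_fst G G.
have c2 : continuous (fun t : G * G => t.2) := @continuous_snd G G.
have c1i := continuous_inv c1; have c2i := continuous_inv c2.
have cF12 : continuous (fun t : G * G => F t.1 t.2).
  by apply: cF => //; exact: continuous_mul.
have cF12' : continuous (fun t : G * G => F t.2 (t.2 * t.1)%g).
  apply: cF; first exact: continuous_mul.
  by apply: continuous_mul => //; apply: continuous_inv; exact: continuous_mul.
have E1 : diagonal_value (L2_actr (@conv R G) Phi a) (p, q) =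
    pr (fun x => pr (F x) (dl x ** p)) a.
  rewrite /diagonal_value /L2_actr /=.
  rewrite (_ : (fun z => _) = fun z => pr (fun x => F x (x * z)%g) a).
    rewrite (fubini G_hausdorff G_lc (B := S) p a cF12') //.
    by congr (pr _ a); apply/funext => x; rewrite (pr_lmul G_hausdorff G_lc _ _ (bF x)).
  apply/funext => z; rewrite (L2_convl _ _ _ L2P); congr (pr _ a); apply/funext => x.
  rewrite /F (point_massM G_hausdorff G_lc) (convA G_hausdorff G_lc).
  by rewrite invgM mulgVK.
have E2 : diagonal_value (L2_actl (@conv R G) a Phi) (p, q) = pr (fun x => pr (F x) p) a.
  rewrite /diagonal_value /L2_actl /=.
  rewrite -(fubini G_hausdorff G_lc (B := S) p a (continuous_swap cF12)) //.
  congr (pr _ p); apply/funext => z; rewrite (L2_convr _ _ _ L2P); congr (pr _ a).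
  by apply/funext => x; rewrite /F (point_massM G_hausdorff G_lc).
have bE2 : Cb (fun x => pr (F x) p) by exact: Cb_pr_param cF12 FS.
have bE1 : Cb (fun x => pr (F x) (dl x ** p)).
  rewrite (_ : (fun x => _) = fun x => pr (fun z => F x (x * z)%g) p).
    have cF21 := @continuous_swap R G (fun z x => F x (x * z)%g) cF12'.
    exact: (@Cb_pr_param _ _ G_hausdorff (fun x z => F x (x * z)%g) S p cF21 (fun x z => FS x _)).
  by apply/funext => x; rewrite (pr_lmul G_hausdorff G_lc _ _ (bF x)).
rewrite E1 E2 -(prB _ bE1 bE2).
have Hx x : pr (F x) (dl x ** p) - pr (F x) p = pr (F x) (dl x ** p - p).
  by rewrite (pr_measureB _ _ (bF x)).
apply: (le_trans (HL _ ((4 * S + 1) * d) (4 * S * (17 * B)) (CbB bE1 bE2) _ _ _)).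
- by rewrite mulr_gt0// ltr_wpDl// mulr_ge0.
- move=> x Lx; rewrite Hx; apply: (le_trans (pr_le _ (bF x) (FS x))).
  apply: ler_pM; rewrite ?mulr_ge0 ?tvR_ge0//; first by rewrite lerDl.
  exact/ltW/pL.
- move=> x; rewrite Hx; apply: (le_trans (pr_le _ (bF x) (FS x))).
  rewrite ler_wpM2l ?mulr_ge0// (le_trans (tvRD _ _))// tvRN.
  rewrite (_ : 17 * B = 16 * B + B); last by ring.
  by apply: lerD => //; apply: (le_trans (tvR_lmul G_hausdorff G_lc _ _)); rewrite ler_wpM2l.
- rewrite [leRHS]splitr; apply: lerD; last exact/ltW/mul_divD1_lt.
  rewrite (_ : 4 * _ * _ = d * (4 * (4 * S + 1) * tvR a)); last by ring.
  exact/ltW/mul_divD1_lt.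
Qed.

Lemma normal_virtual_diagonal_exists :
  exists Md, is_normal_virtual_diagonal (@conv R G) P Md.
Proof.
have FF := pair_filter_proper.
have [Ul [UU FU]] := ultraFilterLemma FF.
have PU : ProperFilter Ul := ultra_proper.
have near k : [/\ compact k.1.1, 0 < k.1.2 & nbhs 1%g k.2] -> \forall t \near Ul, invariant_pair k t.
  by move=> Hk; apply: FU; exists k.
have k0 : [/\ compact (set0 : set G), 0 < 1 :> R & nbhs 1%g (setT : set G)].
  by split; [exact: compact0|exact: ltr01|exact: filterT].
have good := near (set0, 1, setT) k0.
pose Md Phi : C := lim (diagonal_value Phi @ Ul).
have bound Phi (K : R) : L2_wstar P Phi -> 0 <= K ->
    (forall b c, cabs (Phi b c) <= K * tvR b * tvR c) ->
    \forall t \near Ul, cabs (diagonal_value Phi t) <= 4 * (16 * N * 4) * B * K.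
  move=> L2P K0 KP; apply: filterS good => t [_ tB _ [lq q4] _].
  by have [] := diagonal_value_le L2P K0 KP tB lq q4.
have Mdcvg Phi : L2_wstar P Phi -> diagonal_value Phi @ Ul --> Md Phi.
  move=> L2P; have [K K0 KP] := L2_wstar_bound L2P.
  exact: (ultra_cvg_complex (bound _ _ L2P K0 KP)).
exists Md; split.
- split.
    move=> k Phi Psi L2P L2Q.
    have L2PQ := L2_wstar_linear k L2P L2Q.
    have lim2 : (fun t => k * diagonal_value Phi t + diagonal_value Psi t) @ Ul -->
        (k * Md Phi + Md Psi : C).
      exact: cvg_Clinear (Mdcvg _ L2P) (Mdcvg _ L2Q).
    apply: (ulim_unique (Mdcvg _ L2PQ) lim2).
    move=> e e0; apply: filterS good => t [_ tB _ [lq q4] _].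
    have [K K0 KP] := L2_wstar_bound L2P; have [K' K'0 KP'] := L2_wstar_bound L2Q.
    have [_ bP _] := diagonal_value_le L2P K0 KP tB lq q4.
    have [_ bQ _] := diagonal_value_le L2Q K'0 KP' tB lq q4.
    rewrite (_ : diagonal_value _ t = k * diagonal_value Phi t + diagonal_value Psi t).
      by rewrite subrr cabs0 ltW.
    by rewrite -(pr_linear _ _ bP bQ).
  exists (4 * (16 * N * 4) * B)%:C => Phi K L2P K0 PK.
  have [k k0' KE] : exists2 k : R, 0 <= k & K = k%:C.
    by exists (cabs K); [exact: cabs_ge0|rewrite -normr_cabs ger0_norm].
  rewrite KE -rmorphM /= le_normr_cabs; apply: (ulim_le (Mdcvg _ L2P)).
  apply: bound => // b c; have := PK b c.
  by rewrite KE !normr_tvR -!rmorphM /= le_normr_cabs.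
- move=> a Phi L2P; rewrite /dual_actl /dual_actr.
  apply: (ulim_unique (Mdcvg _ (L2_wstar_actr a L2P)) (Mdcvg _ (L2_wstar_actl a L2P))).
  move=> e e0; have [k [kP kE]] := diagonal_value_commute a L2P e0.
  by apply: filterS (near _ kP) => t; exact: kE.
(* For the form (b, c) |-> <phi, bc> the value at (p, q) is the integral of [conj_pr q phi] against
   p. The last clause of [invariant_pair] makes it tend to phi(1), so the image under Delta is the
   unit. *)
- exists (dl 1%g); last by move=> a; exact: conv1r.
  move=> phi; have bphi : Cb (phi : G -> C) := isC0_Cb (C0_isC0 phi).
  have L2phi : L2_wstar P (fun b c => P phi (b ** c)).
    apply: L2_wstar_pairing_mul.
    + by move=> c k a b; exact: convDl.
    + by move=> c k a b; exact: convDr.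
    + exact: convolution_bounded.
    + exact: C0_pairing_linear.
    + exact: C0_pairing_bounded.
    + exact: convolution_wstarl.
    + exact: convolution_wstarr.
  apply/esym; rewrite [RHS](pr_point_mass G_hausdorff G_lc _ bphi).
  apply: (ulim_unique (Mdcvg _ L2phi) (cvg_cst _)) => e e0.
  have [s fs] := bphi.2.
  have s0 : 0 <= s by rewrite (le_trans _ (fs point))// cabs_ge0.
  have e2 : 0 < e / 2 by rewrite divr_gt0.
  have B16 : 0 <= 16 * B by rewrite mulr_ge0.
  have d0 : 0 < e / 2 / (16 * B + 1) by rewrite divr_gt0// ltr_wpDl.
  have s1 : 0 < e / 2 / (s + 1) by rewrite divr_gt0// ltr_wpDl.
  have /continuous_cabsP/(_ 1%g _ d0) U1 := bphi.1.
  have Hk : [/\ compact (set0 : set G), 0 < e / 2 / (s + 1) &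
      nbhs 1%g [set x | cabs (phi 1%g - phi x) < e / 2 / (16 * B + 1)]].
    by split => //; exact: compact0.
  apply: filterS (near (_, _, _) Hk) => -[p q] [/= p1 pB _ [lq q4] cq].
  have -> : diagonal_value (fun b c => P phi (b ** c)) (p, q) = pr (conj_pr q phi) p.
    rewrite /diagonal_value /=; congr (pr _ p); apply/funext => z.
    exact: (pr_conj_pr q z bphi).
  apply: (le_trans (cq phi s _ bphi d0 fs _)).
    by move=> x /ltW; rewrite cabsBC.
  rewrite [leRHS]splitr; apply: lerD; last exact/ltW/mul_divD1_lt.
  rewrite (_ : 16 * _ * B = e / 2 / (16 * B + 1) * (16 * B)); last by ring.
  exact/ltW/mul_divD1_lt.
Qed.

End diagonal.

Section amenable_diagonal.
Context {R : realType} {G : topologicalGroupType}.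
Local Notation C := (R[i]^o).
Local Notation borel := (g_sigma_algebraType (@open G)).
Hypotheses (G_hausdorff : hausdorff_space G) (G_lc : locally_compact [set: G]).
Variable mu : {measure set borel -> \bar R}.
Hypothesis mu_Haar : is_left_Haar mu.

Lemma integral_lmul x (g : G -> R) : mu.-integrable [set: borel] (EFin \o (g : borel -> R)) ->
  \int[mu]_y ((fun y => g (x * y)%g) : borel -> R) y = \int[mu]_y (g : borel -> R) y.
Proof.
move=> ig.
have mt z : measurable_fun [set: borel] ((fun y : G => (z * y)%g) : borel -> borel).
  apply: (@measurability _ _ borel borel setT _ (@open G) erefl) => _ [U oU <-]; rewrite setTI.
  by apply: open_borel; have /continuousP := @continuous_lmul G z; apply.
have mgx : measurable_fun [set: borel] (EFin \o (fun y : borel => g (x * y)%g)).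
  have mg : measurable_fun [set: borel] (EFin \o (g : borel -> R)).
    by have /integrableP[] := ig.
  exact: measurableT_comp mg (mt x).
have E0 : (EFin \o (fun y : borel => g (x * y)%g)) \o (fun y : borel => (x^-1 * y)%g : borel) =
    EFin \o (g : borel -> R).
  by apply/funext => y /=; rewrite mulVKg.
have := integral_pushforward (mt x^-1%g) mgx _ measurableT.
rewrite E0 preimage_setT => /(_ mu ig) E.
rewrite /Rintegral; congr fine; rewrite -[RHS]E.
apply: eq_measure_integral => A mA _.
rewrite -[LHS](Haar_invariant mu_Haar x mA) /pushforward; congr (mu _).
apply/seteqP; split=> [_ [y Ay <-]|y Ay] /=; first by rewrite mulKg.
by exists (x^-1 * y)%g => //; rewrite mulVKg.
Qed.

Lemma Haar_measure_functional :
  Haar_functional (fun f : G -> R => \int[mu]_x (f : borel -> R) x).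
Proof.
split=> //.
- exact: (integral_positive_linear G_hausdorff (Haar_compact mu_Haar)).
- by move=> x k ck; exact: integral_lmul (Cc_integrable G_hausdorff (Haar_compact mu_Haar) ck).
- have [K cK K0] : exists2 K : set G, compact K & (0 < mu K)%E.
    apply: contrapT => nK; have := Haar_neq0 mu_Haar.
    rewrite (Haar_inner mu_Haar openT) ltNge => /negP; apply.
    apply: ge_ereal_sup => _ [K [cK _] <-]; rewrite leNgt; apply/negP => K0.
    by apply: nK; exists K.
  have [h ch [h01 h1]] := @cutoff R G G_hausdorff G_lc _ cK; exists h => //.
  have mK : measurable (K : set borel) by exact: compact_borel.
  have comp := integral_compatible G_hausdorff (Haar_compact mu_Haar).
  rewrite gt_eqF//; apply: (lt_le_trans _ (compatible_le comp cK ch _ _)).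
  - by rewrite fine_gt0// K0; exact: Haar_compact.
  - by move=> x; have /andP[] := h01 x.
  - by move=> x /h1 ->.
Qed.

Lemma Cb_Linfty (f : G -> C) : Cb f -> Linfty mu f.
Proof.
move=> [cf [B fB]]; split.
  move=> F mF _; split; apply: measurable_funTS; apply: continuous_borel.
    exact: continuous_Re.
  exact: continuous_Im.
exists B => F mF _; rewrite (_ : [set x | _] = set0) ?setI0; first exact: negligible_set0.
apply/seteqP; split=> // x /= Bx; have := fB x.
by rewrite -le_normr_cabs => /(lt_le_trans Bx); rewrite ltxx.
Qed.

Lemma left_invariant_mean_Cb (m : (G -> C) -> C) :
  is_left_invariant_mean mu m -> Cb_mean m.
Proof.
move=> mm; split.
- by move=> z f g bf bg; exact: (mean_linear mm z (Cb_Linfty bf) (Cb_Linfty bg)).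
- move=> f s bf fs; have s0 : 0 <= s by rewrite (le_trans _ (fs point))// cabs_ge0.
  rewrite -le_normr_cabs; apply: (mean_norm_le1 mm (Cb_Linfty bf) s0) => F mF _.
  rewrite (_ : [set x | _] = set0) ?setI0; first exact: negligible_set0.
  apply/seteqP; split=> // x /= Bx; have := fs x.
  by rewrite -le_normr_cabs => /(lt_le_trans Bx); rewrite ltxx.
- exact: (mean_one mm).
- by move=> x f bf; exact: (mean_left_invariant mm x (Cb_Linfty bf)).
Qed.

End amenable_diagonal.

Lemma amenable_virtual_diagonal (R : realType) (G : topologicalGroupType) :
  hausdorff_space G -> locally_compact [set: G] -> amenable R G ->
  exists M, is_normal_virtual_diagonal (@convolution R G) (@C0_pairing R G) M.
Proof.
move=> G_hausdorff G_lc [mu [mu_Haar [m mm]]].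
have HI := Haar_measure_functional G_hausdorff G_lc mu_Haar.
have [B [B0 HB]] := reiter G_hausdorff G_lc (left_invariant_mean_Cb mm) HI.
have -> : @convolution R G = @conv R G by rewrite conv.unlock.
have N0 : 0 <= 64 * 8 * 8 :> R by rewrite !mulr_ge0.
apply: (normal_virtual_diagonal_exists G_hausdorff G_lc N0 _ B0 HB) => V V1.
have [q [lq _ q1 qN qV]] := smooth_bump G_hausdorff G_lc HI V1; exists q; split => //.
move=> f s bf fs; have s0 : 0 <= s.
  by rewrite (le_trans _ (fs _ (nbhs_singleton V1)))// cabs_ge0.
by rewrite (le_trans (qV f s bf fs))// ler_peMl// ler1n.
Qed.

(** * Existence of a Haar measure *)

Section covering_numbers.
Context {R : realType} {G : topologicalGroupType}.
Hypotheses (G_hausdorff : hausdorff_space G) (G_lc : locally_compact [set: G]).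
Implicit Types (f g phi : G -> R) (s : seq (R * G)).

(** The coefficients enter through their absolute values, so that every sequence of pairs is an
    admissible cover. *)
Definition cover phi s : G -> R := fun y => \sum_(z <- s) `|z.1| * phi (z.2 * y)%g.
Definition cost s : R := \sum_(z <- s) `|z.1|.

(* The covering number (f : phi). *)
Definition ratio f phi : R :=
  inf [set cost s | s in [set s | forall y, f y <= cover phi s y]].

Definition bump phi := [/\ Cc phi, forall y, 0 <= phi y & exists z, 0 < phi z].

Lemma cost_ge0 s : 0 <= cost s.
Proof. exact: sumr_ge0. Qed.

Lemma ratio_le f phi s : (forall y, f y <= cover phi s y) -> ratio f phi <= cost s.
Proof.
move=> fs; apply: ge_inf; last by exists s.
by exists 0 => _ [t _ <-]; exact: cost_ge0.
Qed.

Lemma le_ratio f phi (r : R) : Cc f -> bump phi ->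
  (forall s, (forall y, f y <= cover phi s y) -> r <= cost s) -> r <= ratio f phi.
Proof.
move=> cf [cphi phi0 [z phiz]] H; apply: lb_le_inf; last by move=> _ [s fs <-]; exact: H.
have [n [c [x [c0 fx]]]] := translates_cover G_hausdorff G_lc cf cphi phi0 phiz.
pose s := [seq (c, x i) | i <- index_iota 0 n]; exists (cost s); exists s => // y.
apply: (le_trans (ler_norm _)); apply: (le_trans (fx y)).
by rewrite /cover big_map big_mkord /= ger0_norm.
Qed.

Lemma ratio_ge0 f phi : Cc f -> bump phi -> 0 <= ratio f phi.
Proof. by move=> cf bphi; apply: le_ratio => // s _; exact: cost_ge0. Qed.

Lemma ratio_translate_le f phi x : Cc f -> bump phi ->
  ratio (fun y => f (x * y)%g) phi <= ratio f phi.
Proof.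
move=> cf bphi; apply: le_ratio => // s fs.
pose t := [seq (z.1, z.2 * x)%g | z <- s].
have -> : cost s = cost t by rewrite /cost big_map.
apply: ratio_le => y; apply: (le_trans (fs _)).
by rewrite /cover big_map ler_sum//= => z _; rewrite mulgA.
Qed.

Lemma ratio_translate f phi x : Cc f -> bump phi ->
  ratio (fun y => f (x * y)%g) phi = ratio f phi.
Proof.
move=> cf bphi; apply/eqP; rewrite eq_le ratio_translate_le//=.
have := ratio_translate_le x^-1%g (Cc_lmul x cf) bphi.
by under [X in ratio X _ <= _]eq_fun do rewrite mulVKg.
Qed.

Lemma ratioD f g phi : Cc f -> Cc g -> bump phi ->
  ratio (fun y => f y + g y) phi <= ratio f phi + ratio g phi.
Proof.
move=> cf cg bphi; rewrite -lerBlDr; apply: le_ratio => // s fs.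
rewrite lerBlDr -lerBlDl; apply: le_ratio => // t gt; rewrite lerBlDl.
rewrite /cost -big_cat; apply: ratio_le => y.
by rewrite /cover big_cat; apply: lerD; [exact: fs|exact: gt].
Qed.

Lemma ratioZ_le f phi (c : R) : Cc f -> bump phi -> 0 < c ->
  ratio (fun y => c * f y) phi <= c * ratio f phi.
Proof.
move=> cf bphi c0; rewrite -ler_pdivrMl//; apply: le_ratio => // s fs.
rewrite ler_pdivrMl//.
have -> : c * cost s = cost [seq (c * z.1, z.2) | z <- s].
  rewrite /cost big_map mulr_sumr; apply: eq_bigr => z _.
  by rewrite normrM gtr0_norm.
apply: ratio_le => y.
rewrite /cover big_map (_ : \sum_(_ <- _) _ = c * cover phi s y); first by rewrite ler_pM2l.
by rewrite mulr_sumr; apply: eq_bigr => z _; rewrite normrM gtr0_norm// mulrA.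
Qed.

Lemma ratio0 phi : bump phi -> ratio (fun=> 0) phi = 0.
Proof.
move=> bphi; apply/eqP; rewrite eq_le (ratio_ge0 (@Cc0 R G) bphi) andbT.
have := @ratio_le (fun=> 0) phi [::]; rewrite /cost big_nil; apply => y.
by rewrite /cover big_nil.
Qed.

Lemma ratioZ f phi (c : R) : Cc f -> bump phi -> 0 <= c ->
  ratio (fun y => c * f y) phi = c * ratio f phi.
Proof.
move=> cf bphi; rewrite le_eqVlt => /orP[/eqP<-|c0].
  rewrite mul0r; under [X in ratio X _]eq_fun do rewrite mul0r.
  exact: ratio0.
apply/eqP; rewrite eq_le ratioZ_le//= -ler_pdivlMl//.
have c1 : 0 < c^-1 by rewrite invr_gt0.
have := ratioZ_le (CcZ c cf) bphi c1.
by under [X in ratio X _ <= _]eq_fun do rewrite mulKf ?gt_eqF//.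
Qed.

(** In a cover of f by translates of g, each g is replaced by a cover by translates of phi; the
    costs multiply. *)
Lemma ratio_trans f g phi : Cc f -> bump g -> bump phi ->
  ratio f phi <= ratio f g * ratio g phi.
Proof.
move=> cf bg bphi; have [cg g0 _] := bg.
have rg0 := ratio_ge0 cg bphi.
have H s : (forall y, f y <= cover g s y) -> ratio f phi <= cost s * ratio g phi.
  move=> fs; apply/ler_addgt0Pr => e e0.
  have s0 := cost_ge0 s; have s1 : 0 < cost s + 1 by rewrite ltr_wpDl.
  have : exists2 t, (forall y, g y <= cover phi t y) & cost t < ratio g phi + e / (cost s + 1).
    apply: contrapT => nt; have : ratio g phi + e / (cost s + 1) <= ratio g phi.
      apply: le_ratio => // t gt; rewrite leNgt; apply/negP => lt; apply: nt.
      by exists t.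
    by rewrite gerDl leNgt divr_gt0.
  move=> [t gt ct].
  pose u := [seq (z.1 * w.1, (w.2 * z.2)%g) | z <- s, w <- t].
  have cu : cost u = cost s * cost t.
    rewrite /cost /u big_allpairs_dep mulr_suml; apply: eq_bigr => z _.
    by rewrite mulr_sumr; apply: eq_bigr => w _; rewrite normrM.
  apply: (@le_trans _ _ (cost u)).
    apply: ratio_le => y; apply: (le_trans (fs y)).
    rewrite /cover /u big_allpairs_dep; apply: ler_sum => z _.
    apply: (@le_trans _ _ (`|z.1| * cover phi t (z.2 * y)%g)); first exact: ler_wpM2l.
    rewrite mulr_sumr; apply: ler_sum => w _ /=.
    by rewrite normrM -mulrA mulgA.
  rewrite cu; apply: (@le_trans _ _ (cost s * (ratio g phi + e / (cost s + 1)))).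
    by rewrite ler_wpM2l// ltW.
  by rewrite mulrDr lerD2l mulrC ltW// mul_divD1_lt.
have [rg|rg] := eqVneq (ratio g phi) 0.
  have [n [c [x [c0 fx]]]] : exists n (c : R) (x : nat -> G), 0 <= c /\
      forall w, `|f w| <= \sum_(i < n) c * g (x i * w)%g.
    by have [? ? [z gz]] := bg; exact: translates_cover gz.
  rewrite rg mulr0; apply: le_trans (H [seq (c, x i) | i <- index_iota 0 n] _) _.
    move=> y; apply: (le_trans (ler_norm _)); apply: (le_trans (fx y)).
    by rewrite /cover big_map big_mkord /= ger0_norm.
  by rewrite rg mulr0.
have rgt : 0 < ratio g phi by rewrite lt_neqAle eq_sym rg.
by rewrite -ler_pdivrMr//; apply: le_ratio => // s fs; rewrite ler_pdivrMr// H.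
Qed.

Lemma ratio_gt0 f phi z : Cc f -> bump phi -> 0 < f z -> 0 < ratio f phi.
Proof.
move=> cf bphi fz; have [cphi phi0 [z0 phiz0]] := bphi.
have [B B0 phiB] := Cc_bounded cphi.
have B1 : 0 < B + 1 by rewrite ltr_wpDl.
apply: (@lt_le_trans _ _ (f z / (B + 1))); first by rewrite divr_gt0.
apply: le_ratio => // s fs; rewrite ler_pdivrMr//; apply: (le_trans (fs z)).
rewrite /cover /cost mulr_suml; apply: ler_sum => w _; apply: ler_wpM2l => //.
by rewrite (le_trans (ler_norm _))// (le_trans (phiB _))// lerDl.
Qed.

(* For phi supported near 1, f i / h is nearly constant on the translates of the
   support of phi, so an optimal cover of h splits into covers of f1 and f2. *)
Lemma ratio_almost_additive f1 f2 : Cc f1 -> Cc f2 ->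
  (forall y, 0 <= f1 y) -> (forall y, 0 <= f2 y) ->
  exists2 f' : G -> R, Cc f' & forall e : R, 0 < e ->
  exists2 V : set G, nbhs 1%g V & forall phi, bump phi ->
    (forall y, phi y != 0 -> V y) ->
    ratio f1 phi + ratio f2 phi <=
      (ratio (fun y => f1 y + f2 y) phi + e * ratio f' phi) * (1 + e).
Proof.
move=> c1 c2 f10 f20.
have [_ [L1 cL1 L1f]] := c1; have [_ [L2 cL2 L2f]] := c2.
have cL : compact (L1 `|` L2) by exact: compactU.
have [h' ch' [h01 h1]] := @cutoff R G G_hausdorff G_lc _ cL.
exists h' => // e e0; have ce' := CcZ e ch'.
(* The term e h', with h' = 1 on both supports, keeps h positive there, so that the quotients f_i /
   h are continuous with compact support and therefore uniformly continuous. *)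
pose h y := (f1 y + f2 y) + e * h' y.
have ch : Cc h by apply: CcD => //; exact: CcD.
have h0 y : 0 <= h y.
  by rewrite /h !addr_ge0// mulr_ge0 ?(ltW e0)//; have /andP[] := h01 y.
have hL y : (L1 `|` L2) y -> 0 < h y.
  by move=> Ly; rewrite /h h1// mulr1 ltr_wpDl// addr_ge0.
have quot f : Cc f -> (forall y, 0 <= f y) -> vanishes_off (L1 `|` L2) f ->
    isC0 (fun y => (f y / h y)%:C : R[i]^o).
  move=> cf f0 fL; apply: (isC0_compact _ cL); last first.
    by move=> y /fL ->; rewrite mul0r.
  apply: continuous_real => y.
  have [Ly|nLy] := pselect ((L1 `|` L2) y).
    apply: cvgM; first exact: cf.1.
    by apply: cvgV; [rewrite gt_eqF// hL|exact: ch.1].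
  have cLc : closed (L1 `|` L2) := compact_closed G_hausdorff cL.
  have nb : \forall z \near y, ~ (L1 `|` L2) z.
    by apply: open_nbhs_nbhs; split; [exact: closed_openC|].
  rewrite /continuous_at fL// mul0r; apply: cvg_near_cst.
  by apply: filterS nb => z nLz; rewrite fL// mul0r.
have q1 : isC0 (fun y => (f1 y / h y)%:C : R[i]^o).
  by apply: quot => // y nL; apply: L1f => L; apply: nL; left.
have q2 : isC0 (fun y => (f2 y / h y)%:C : R[i]^o).
  by apply: quot => // y nL; apply: L2f => L; apply: nL; right.
have e2 : 0 < e / 2 by rewrite divr_gt0.
exists [set u | (forall w : G, cabs ((f1 (w * u)%g / h (w * u)%g)%:C - (f1 w / h w)%:C) < e / 2) /\
  (forall w : G, cabs ((f2 (w * u)%g / h (w * u)%g)%:C - (f2 w / h w)%:C) < e / 2)].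
  exact: filterI (isC0_right_uniform q1 e2) (isC0_right_uniform q2 e2).
move=> phi bphi phiV; have [cphi phi0 _] := bphi.
have e1 : 0 < 1 + e by rewrite ltr_wpDr// ltW.
apply: (@le_trans _ _ (ratio h phi * (1 + e))); last first.
  apply: ler_wpM2r; first exact: ltW.
  rewrite -(ratioZ ch' bphi (ltW e0)).
  exact: (ratioD (CcD c1 c2) ce' bphi).
rewrite -ler_pdivrMr//; apply: le_ratio => // s hs; rewrite ler_pdivrMr//.
have split f : (forall y, 0 <= f y) -> vanishes_off (L1 `|` L2) f ->
    (forall y t, phi (t * y)%g != 0 -> `|f y / h y - f t^-1%g / h t^-1%g| < e / 2) ->
    ratio f phi <= \sum_(z <- s) `|z.1| * (f z.2^-1%g / h z.2^-1%g + e / 2).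
  move=> f0 fL fV.
  have q0 y : 0 <= f y / h y by rewrite divr_ge0.
  rewrite (_ : \sum_(_ <- _) _ = cost [seq (z.1 * (f z.2^-1%g / h z.2^-1%g + e / 2), z.2) | z <- s]); last first.
    rewrite /cost big_map; apply: eq_bigr => z _.
    by rewrite normrM [X in _ = _ * X]ger0_norm// addr_ge0// ltW.
  apply: ratio_le => y; have [Ly|/fL ->] := pselect ((L1 `|` L2) y); last first.
    by rewrite /cover sumr_ge0// => z _; rewrite mulr_ge0.
  have -> : f y = f y / h y * h y by rewrite divfK// gt_eqF// hL.
  apply: (@le_trans _ _ (f y / h y * cover phi s y)); first by rewrite ler_wpM2l.
  rewrite /cover big_map mulr_sumr; apply: ler_sum => z _ /=.
  rewrite normrM [X in _ <= _ * X * _]ger0_norm; last by rewrite addr_ge0// ltW.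
  rewrite mulrCA -mulrA ler_wpM2l//.
  have [->|pz] := eqVneq (phi (z.2 * y)%g) 0; first by rewrite !mulr0.
  rewrite ler_wpM2r// -lerBlDl; apply: (le_trans (ler_norm _)).
  exact/ltW/fV.
have tr f y t : (forall w : G, cabs ((f (w * (t * y))%g / h (w * (t * y))%g)%:C - (f w / h w)%:C) < e / 2) ->
    `|f y / h y - f t^-1%g / h t^-1%g| < e / 2.
  by move=> /(_ t^-1%g); rewrite -rmorphB /= cabs_real mulKg.
apply: (le_trans (lerD (split f1 f10 _ _) (split f2 f20 _ _))).
- by move=> y nL; apply: L1f => L; apply: nL; left.
- by move=> y t /phiV[H _]; exact: tr.
- by move=> y nL; apply: L2f => L; apply: nL; right.
- by move=> y t /phiV[_ H]; exact: tr.
(* The two families of coefficients are those of the cover of h times f_i / h + e/2; as (f1 + f2) /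
   h <= 1, the factors add up to at most 1 + e. *)
rewrite -big_split /= /cost mulr_suml; apply: ler_sum => z _.
rewrite -mulrDr ler_wpM2l// addrACA -splitr lerD2r -mulrDl.
have [hz|hz] := eqVneq (h z.2^-1%g) 0; first by rewrite hz invr0 mulr0.
have hz0 : 0 < h z.2^-1%g by rewrite lt_neqAle eq_sym hz h0.
rewrite ler_pdivrMr// mul1r /h lerDl mulr_ge0 ?(ltW e0)//.
by have /andP[] := h01 z.2^-1%g.
Qed.

Definition bump_filter := filter_from (nbhs (1%g : G))
  (fun V => [set phi | bump phi /\ forall y, phi y != 0 -> V y]).

Lemma bump_filter_proper : ProperFilter bump_filter.
Proof.
apply: filter_from_proper.
  apply: filter_from_filter; first by exists setT; exact: filterT.
  move=> V W V1 W1; exists (V `&` W); first exact: filterI.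
  move=> phi [bphi H]; split; split => // y /H[] //.
move=> V V1; have c1 : compact [set (1 : G)%g] by exact: compact_set1.
have [|k [ck k01 k1 [L [cL LV] kL]]] :=
    urysohn_compact_open (R := R) G_hausdorff G_lc c1 (@open_interior _ V).
  by move=> _ ->.
exists k; split; last first.
  move=> y ky; apply: interior_subset; apply: LV.
  by apply: contra_notP (elimN eqP ky) => /kL.
split; first by split => //; exists L.
  by move=> y; have /andP[] := k01 y.
by exists 1%g; rewrite (nbhs_singleton (k1 1%g erefl)).
Qed.

(** The quotients (f : phi) / (f0 : phi) are bounded by (f : f0), by [ratio_trans], and their limit
    along an ultrafilter of bumps shrinking to 1 is the functional on the positive cone.
    Subadditivity holds before the limit, the converse only in the limit, through
    [ratio_almost_additive]. *)
Lemma Haar_functional_exists : exists I : (G -> R) -> R, Haar_functional I.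
Proof.
have FF := bump_filter_proper.
have Fbump : bump_filter bump by exists setT; [exact: filterT|move=> phi []].
have [f0 bf0] := @filter_ex _ _ FF _ Fbump.
have [cf0 f00 [z0 fz0]] := bf0.
have [U [UU FU]] := ultraFilterLemma FF.
have PU : ProperFilter U := @ultra_proper _ _ UU.
have near_bump : \forall phi \near U, bump phi.
  exact: FU.
pose q f (phi : G -> R) := ratio f phi / ratio f0 phi.
pose J f : R := lim (q f @ U).
have r0 phi : bump phi -> 0 < ratio f0 phi by move=> bphi; exact: ratio_gt0 fz0.
have qb f : Cc f -> \forall phi \near U, 0 <= q f phi <= ratio f f0.
  move=> cf; apply: filterS near_bump => phi bphi; have r := r0 _ bphi.
  apply/andP; split; first by apply: divr_ge0; [exact: ratio_ge0|exact: ltW].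
  by rewrite /q ler_pdivrMr//; exact: ratio_trans.
have qcvg f : Cc f -> cvg (q f @ U).
  move=> cf; apply: (@ultra_cvg_real _ _ _ _ _ (ratio f f0)).
  by apply: filterS (qb f cf) => phi /andP[q1 q2]; rewrite ger0_norm.
have J_ge0 f : Cc f -> 0 <= J f.
  move=> cf; apply: limr_ge; first exact: qcvg.
  by apply: filterS (qb f cf) => phi /andP[].
have Jcst f (l : R) : (\forall phi \near U, q f phi = l) -> J f = l.
  move=> H; apply: cvg_lim; first exact: Rhausdorff.
  exact: cvg_near_cst.
have Jlim f (u : (G -> R) -> R) (l : R) : (\forall phi \near U, q f phi = u phi) ->
    u @ U --> l -> J f = l.
  move=> fu ul; apply: cvg_lim; first exact: Rhausdorff.
  apply: cvg_trans ul; apply: near_eq_cvg.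
  by apply: filterS fu => phi ->.
have JD f g : Cc f -> Cc g -> (forall y, 0 <= f y) -> (forall y, 0 <= g y) ->
    J (fun y => f y + g y) = J f + J g.
  move=> cf cg f_ge0 g_ge0; have cfg := CcD cf cg.
  pose v phi := q f phi + q g phi - q (fun y => f y + g y) phi.
  have vl : v @ U --> J f + J g - J (fun y => f y + g y).
    by apply: cvgB; [apply: cvgD; exact: qcvg|exact: qcvg].
  have vlim : lim (v @ U) = J f + J g - J (fun y => f y + g y).
    by apply: cvg_lim vl; exact: Rhausdorff.
  have vc : cvg (v @ U) by apply/cvg_ex; eexists; exact: vl.
  apply/eqP; rewrite eq_sym -subr_eq0 -vlim eq_le; apply/andP; split; last first.
    apply: limr_ge => //; apply: filterS near_bump => phi bphi.
    rewrite /v /q subr_ge0 -mulrDl ler_pM2r ?invr_gt0 ?r0//.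
    exact: ratioD.
  have A0 : 0 <= ratio (fun y => f y + g y) f0 by exact: ratio_ge0.
  have [f' cf' fV] := ratio_almost_additive cf cg f_ge0 g_ge0.
  have A'0 : 0 <= ratio f' f0 by exact: ratio_ge0.
  apply/ler_addgt0Pr => e e0; rewrite add0r.
  (* The excess is d (s + (1 + d) t), where s and t are the quotients of f + g and f'. With d <= 1
     it is at most d N, and d N <= e. *)
  pose N := ratio (fun y => f y + g y) f0 + 2 * ratio f' f0.
  have N0 : 0 <= N by rewrite addr_ge0// mulr_ge0.
  have Ne : 0 < N + e by rewrite ltr_wpDl.
  pose d := e / (N + e).
  have d0 : 0 < d by rewrite divr_gt0.
  have d1 : d <= 1 by rewrite ler_pdivrMr// mul1r lerDr.
  have dN : d * N <= e by rewrite mulrAC ler_pdivrMr// ler_pM2l// lerDl ltW.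
  have [V V1 HV] := fV d d0.
  have nV : \forall phi \near U, forall y, phi y != 0 -> V y.
    by apply: FU; exists V => // phi [].
  apply: limr_le => //.
  have nearq := @filterI _ U PU _ _ (qb _ cfg) (qb _ cf').
  apply: filterS3 near_bump nV nearq => phi bphi phiV [/andP[s0 sA] /andP[t0 tA]].
  have := HV phi bphi phiV; rewrite -(ler_pM2r (x := (ratio f0 phi)^-1)) ?invr_gt0 ?r0//.
  rewrite mulrDl -/(q f phi) -/(q g phi) (mulrAC _ (1 + d)) mulrDl -mulrA.
  rewrite -/(q _ phi) -/(q _ phi) => H; apply: le_trans dN.
  rewrite /v lerBlDr; apply: (le_trans H); rewrite /N.
  set s := q _ phi in s0 sA *; set t := q f' phi in t0 tA *.
  rewrite (_ : (s + d * t) * (1 + d) = d * (s + (1 + d) * t) + s); last by ring.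
  rewrite lerD2r ler_pM2l//; apply: lerD => //; apply: ler_pM => //; first by rewrite addr_ge0// ltW.
  by rewrite (_ : 2 = 1 + 1 :> R) ?lerD2l// -natrD.
have JZ (c : R) f : 0 <= c -> Cc f -> (forall y, 0 <= f y) -> J (fun y => c * f y) = c * J f.
  move=> c0 cf _; apply: (Jlim _ (fun phi => c * q f phi)).
    by apply: filterS near_bump => phi bphi; rewrite /q ratioZ// mulrA.
  by apply: cvgM; [exact: cvg_cst|exact: qcvg].
have [I Il IJ] := cone_extension Cc_lattice JD JZ.
have IJ0 f : Cc f -> (forall y, 0 <= f y) -> 0 <= I f.
  by move=> cf f_ge0; rewrite IJ// J_ge0.
have Ipl : positive_linear I by split.
exists I; split => //.
- move=> x f cf.
  have cp := Cc_max0 cf; have cm := Cc_max0 (CcZ (-1) cf).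
  have E g : Cc g -> (forall y, 0 <= g y) -> I (fun y => g (x * y)%g) = I g.
    move=> cg g0; rewrite !IJ//; last exact: Cc_lmul.
    apply: (Jlim _ (q g)); last exact: qcvg.
    by apply: filterS near_bump => phi bphi; rewrite /q ratio_translate.
  have fE : f = fun y => Num.max 0 (f y) - Num.max 0 (-1 * f y).
    apply/funext => y; rewrite mulN1r.
    by case: (leP 0 (f y)) => fy; [rewrite max_l ?oppr_le0// subr0|rewrite max_r ?oppr_ge0 ?ltW// sub0r opprK].
  rewrite fE (plB Ipl cp cm) -(E _ cp) -?(E _ cm); try by move=> y; rewrite le_max lexx.
  exact: (plB Ipl (Cc_lmul x cp) (Cc_lmul x cm)).
- exists f0 => //; rewrite IJ//.
  rewrite (Jcst _ 1) ?oner_eq0//.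
  by apply: filterS near_bump => phi bphi; rewrite /q divff// gt_eqF// r0.
Qed.

End covering_numbers.

(** * From the Haar functional to the Haar measure *)

Section Haar_measure.
Context {R : realType} {G : topologicalGroupType}.
Hypotheses (G_hausdorff : hausdorff_space G) (G_lc : locally_compact [set: G]).
Local Notation borel := (g_sigma_algebraType (@open G)).
Variable I : (G -> R) -> R.
Hypothesis HI : Haar_functional I.
Local Notation mu := (radon G_hausdorff G_lc (hf_positive HI)).
Implicit Types (E U : set G) (x : G).

Lemma lmul_image x E : [set (x * y)%g | y in E] = [set y | E (x^-1 * y)%g].
Proof.
apply/seteqP; split=> [_ [y Ey <-]|y Ey] /=; first by rewrite mulKg.
by exists (x^-1 * y)%g => //; rewrite mulVKg.
Qed.

Lemma open_lmul x U : open U -> open [set (x * y)%g | y in U].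
Proof.
move=> oU; rewrite lmul_image.
by have /continuousP := @continuous_lmul G x^-1%g; apply.
Qed.

Lemma radon_open_lmul_le x U :
  (radon_open I [set (x * y)%g | y in U] <= radon_open I U)%E.
Proof.
apply: ge_ereal_sup => _ [f [cf f01 [K [cK KU] fK]] <-].
rewrite -(hf_invariant HI x cf); apply: ereal_sup_ubound.
exists (fun y => f (x * y)%g) => //; split=> //; first exact: Cc_lmul.
exists [set (x^-1 * y)%g | y in K]; last first.
  by move=> y nKy; apply: fK => Kxy; apply: nKy; exists (x * y)%g => //; rewrite mulKg.
split.
  by apply: continuous_compact => //; apply: continuous_subspaceT; exact: continuous_lmul.
by move=> _ [y /KU[z Uz <-] <-]; rewrite mulKg.
Qed.

Lemma radon_lmul_le x E : (mu [set (x * y)%g | y in E] <= mu E)%E.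
Proof.
rewrite [leRHS]radon_outer_regular; apply: le_ereal_inf_tmp => _ [U [oU EU] <-].
apply: (@le_trans _ _ (mu [set (x * y)%g | y in U])).
  by apply: le_radon => _ [y /EU Uy <-]; exists y.
rewrite !radon_open_measure//; first exact: radon_open_lmul_le.
exact: open_lmul.
Qed.

Lemma radon_is_left_Haar : is_left_Haar mu.
Proof.
split.
- have c1 : compact [set (1 : G)%g] by exact: compact_set1.
  have [f cf [f01 f1]] := @cutoff R G G_hausdorff G_lc _ c1.
  have f0 y : 0 <= f y by have /andP[] := f01 y.
  have If : 0 < I f.
    by apply: (Haar_gt0 G_hausdorff G_lc HI (z := 1%g) cf f0); rewrite f1.
  suff : (0 < radon_open I [set: G])%E.
    by rewrite -(radon_open_measure G_hausdorff G_lc (hf_positive HI) openT).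
  apply: (@lt_le_trans _ _ (I f)%:E); first by rewrite lte_fin.
  apply: ereal_sup_ubound; exists f => //; split => //.
  by have [_ [K cK fK]] := cf; exists K.
- exact: radon_compact.
- by move=> E _; exact: radon_outer_regular.
- exact: radon_inner_regular.
- move=> x E _; apply/eqP; rewrite eq_le radon_lmul_le/=.
  have := radon_lmul_le x^-1%g [set (x * y)%g | y in E].
  rewrite (_ : [set (x^-1 * y)%g | y in [set (x * y)%g | y in E]] = E)//.
  apply/seteqP; split=> [_ [_ [y Ey <-] <-]|y Ey]; first by rewrite mulKg.
  by exists (x * y)%g; [exists y|rewrite mulKg].
Qed.

End Haar_measure.

(** * Means on uniformly continuous functions *)

Section LUC.
Context {R : realType} {G : topologicalGroupType}.
Local Notation C := (R[i]^o).
Implicit Types (f g : G -> C) (x : G).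

(* Called the left, or by other authors the right, uniformly continuous functions. *)
Definition LUC : set (G -> C) := [set f | Cb f /\ forall e : R, 0 < e ->
  \forall x \near 1%g, forall s, cabs (f (x * s)%g - f s) < e].

Lemma LUC_linear (z : C) f g : LUC f -> LUC g -> LUC (fun x => z * f x + g x).
Proof.
move=> [bf uf] [bg ug]; split; first exact: Cb_linear.
move=> e e0; have e2 : 0 < e / 2 by rewrite divr_gt0.
have d0 := divr_gt0 e2 (ltr_wpDl (cabs_ge0 z) ltr01).
apply: filterS2 (uf _ d0) (ug _ e2) => x fx gx s.
rewrite (_ : _ - _ = z * (f (x * s)%g - f s) + (g (x * s)%g - g s)); last by ring.
apply: (le_lt_trans (cabsD _ _)); rewrite [ltRHS]splitr cabsM; apply: ler_ltD => //.
apply: (le_trans (ler_wpM2l (cabs_ge0 z) (ltW (fx s)))).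
by rewrite mulrC; exact/ltW/mul_divD1_lt/cabs_ge0.
Qed.

Lemma LUC_cst (z : C) : LUC (fun=> z).
Proof.
by split; [exact: Cb_cst|move=> e e0; apply: nearW => x s; rewrite subrr cabs0].
Qed.

Lemma LUC_lmul x f : LUC f -> LUC (fun s => f (x * s)%g).
Proof.
move=> [bf uf]; split; first exact: Cb_lmul.
move=> e e0; have := near_conj x^-1%g (uf _ e0); apply: filterS => u fu s.
by have := fu (x * s)%g; rewrite !mulgA invgK mulgVK.
Qed.

Record LUC_mean (n : (G -> C) -> C) : Prop := {
  LUC_mean_linear : forall (z : C) f g, LUC f -> LUC g ->
    n (fun x => z * f x + g x) = z * n f + n g ;
  LUC_mean_le : forall f (s : R), LUC f -> (forall x, cabs (f x) <= s) -> cabs (n f) <= s ;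
  LUC_mean1 : n (fun=> 1) = 1 ;
  LUC_mean_invariant : forall x f, LUC f -> n (fun s => f (x * s)%g) = n f }.

End LUC.

(** * Extending a mean to L^oo(G) *)

Section Linfty_averages.
Context {R : realType} {G : topologicalGroupType}.
Local Notation C := (R[i]^o).
Local Notation borel := (g_sigma_algebraType (@open G)).
Hypotheses (G_hausdorff : hausdorff_space G) (G_lc : locally_compact [set: G]).
Local Notation Re := (@complex.Re R).
Local Notation Im := (@complex.Im R).
Variable mu : {measure set borel -> \bar R}.
Hypothesis mu_Haar : is_left_Haar mu.
Implicit Types (k g : G -> R) (f : G -> C) (x s : G) (K : R).
Local Notation HI := (Haar_measure_functional G_hausdorff G_lc mu_Haar).
Local Notation int g := (\int[mu]_x (g : borel -> R) x).

Definition real_locally_measurable g : Prop := forall F : set borel,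
  measurable F -> (mu F < +oo)%E -> measurable_fun F (g : borel -> R).

(** The support of k has finite measure, so there local measurability becomes measurability and the
    locally null exceptional set is covered by a null set N. Replacing g k by 0 on N makes the bound
    hold everywhere. *)
Lemma ess_bounded_Cc_integral g k K : real_locally_measurable g ->
  locally_null mu [set x | K < `|g x|] -> 0 <= K -> Cc k ->
  mu.-integrable [set: borel] (EFin \o (fun x => g x * k x)) /\
  `|int (fun x => g x * k x)| <= K * int (fun x => `|k x|).
Proof.
move=> mg gK K0 ck; have [ck' [L cL kL]] := ck.
have mL : measurable (L : set borel) by exact: compact_borel.
have muL := Haar_compact mu_Haar cL.
have [N [mN N0 LN]] := gK _ mL muL.
pose h : borel -> R := fun x => g x * k x.
have mh : measurable_fun [set: borel] h.
  rewrite (_ : h = h \_ L); last first.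
    apply/funext => x; rewrite /patch; case: ifPn => // /negP; rewrite inE => nLx.
    by rewrite /h kL ?mulr0.
  apply/(measurable_restrictT _ mL); apply: measurable_funM; first exact: mg.
  by apply: measurable_funTS; exact: continuous_borel.
pose h' : borel -> R := h \_ (~` N).
have mh' : measurable_fun [set: borel] h'.
  by apply/(measurable_restrictT _ (measurableC mN)); exact: measurable_funTS.
have ik := Cc_integrable G_hausdorff (Haar_compact mu_Haar) (CcZ K (Cc_norm ck)).
have h'k x : `|h' x| <= K * `|k x|.
  rewrite /h' /patch; case: ifPn => [|_]; last by rewrite normr0 mulr_ge0.
  rewrite inE => nNx; rewrite /h normrM.
  have [Lx|/kL ->] := pselect (L x); last by rewrite normr0 !mulr0.
  rewrite ler_wpM2r// leNgt; apply/negP => Kg; apply: nNx; exact: LN.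
have ih' : mu.-integrable [set: borel] (EFin \o h').
  apply: (le_integrable measurableT) ik; first exact/measurable_EFinP.
  move=> x _ /=; rewrite lee_fin (le_trans (h'k x))//.
  by rewrite ler_norm.
have hh' : ae_eq mu setT (EFin \o h) (EFin \o h').
  exists N; split => // x /= /not_implyP[_ hx]; apply: contrapT => nNx; apply: hx.
  by rewrite /h' /patch mem_set.
have ih : mu.-integrable [set: borel] (EFin \o h).
  apply/integrableP; split; first exact/measurable_EFinP.
  have /integrableP[_] := ih'.
  rewrite (@ae_eq_integral _ _ _ mu _ (fun x => `|(EFin \o h) x|)%E (fun x => `|(EFin \o h') x|)%E)//.
  - by apply: measurableT_comp => //; exact/measurable_EFinP.
  - by apply: measurableT_comp => //; exact/measurable_EFinP.
  - by apply: filterS hh' => x H /H ->.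
split => //.
have -> : int h = int h'.
  rewrite /Rintegral; congr fine.
  have mEh : measurable_fun [set: borel] (EFin \o h) by exact/measurable_EFinP.
  have mEh' : measurable_fun [set: borel] (EFin \o h') by exact/measurable_EFinP.
  exact: (@ae_eq_integral _ _ _ mu setT (EFin \o h') (EFin \o h) measurableT mEh mEh' hh').
apply: (le_trans (le_normr_Rintegral measurableT ih')).
rewrite -RintegralZl//; first last.
  exact: (Cc_integrable G_hausdorff (Haar_compact mu_Haar) (Cc_norm ck)).
by apply: le_Rintegral => //; exact: integrable_norm.
Qed.

Definition average k f : C :=
  int (fun y => Re (f y) * k y) +i* int (fun y => Im (f y) * k y).

Lemma Linfty_bound f : Linfty mu f -> exists K, 0 <= K /\ ess_bounded_by mu f K.
Proof.
move=> [_ [K fK]]; exists (Num.max 0 K); split; first by rewrite le_max lexx.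
move=> F mF Foo; have [N [mN N0 FN]] := fK F mF Foo; exists N; split => //.
move=> x [Fx /=]; rewrite normr_cabs ltcR gt_max => /andP[_ Kx].
by apply: FN; split => //=; rewrite normr_cabs ltcR.
Qed.

Lemma Linfty_Cc_integrable f k (p : C -> R) : (forall z, `|p z| <= cabs z) ->
  real_locally_measurable (p \o f) -> Linfty mu f -> Cc k ->
  mu.-integrable [set: borel] (EFin \o (fun y => p (f y) * k y)).
Proof.
move=> pc mp /Linfty_bound[K [K0 fK]] ck.
apply: (ess_bounded_Cc_integral mp _ K0 ck).1.
move=> F mF Foo; have [N [mN N0 FN]] := fK F mF Foo; exists N; split => //.
move=> x [Fx /= Kx]; apply: FN; split => //=.
by rewrite normr_cabs ltcR; exact: lt_le_trans Kx (pc _).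
Qed.

Lemma integrable_Re f k : Linfty mu f -> Cc k ->
  mu.-integrable [set: borel] (EFin \o (fun y => Re (f y) * k y)).
Proof.
move=> lf; apply: (Linfty_Cc_integrable (@Re_le_cabs R)) => //.
by move=> F mF Foo; have [] := lf.1 F mF Foo.
Qed.

Lemma integrable_Im f k : Linfty mu f -> Cc k ->
  mu.-integrable [set: borel] (EFin \o (fun y => Im (f y) * k y)).
Proof.
move=> lf; apply: (Linfty_Cc_integrable (@Im_le_cabs R)) => //.
by move=> F mF Foo; have [] := lf.1 F mF Foo.
Qed.

Let int_linear3 (a b : R) (u v w : G -> R) :
  mu.-integrable [set: borel] (EFin \o (u : borel -> R)) ->
  mu.-integrable [set: borel] (EFin \o (v : borel -> R)) ->
  mu.-integrable [set: borel] (EFin \o (w : borel -> R)) ->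
  int (fun y => a * u y + b * v y + w y) = a * int u + b * int v + int w.
Proof.
move=> iu iv iw.
have z1 := integrableZl measurableT a iu; have z2 := integrableZl measurableT b iv.
rewrite -RintegralZl// -RintegralZl// -RintegralD// -RintegralD//.
exact: (integrableD measurableT z1 z2).
Qed.

Lemma average_linear (z : C) k f (g : G -> C) : Linfty mu f -> Linfty mu g -> Cc k ->
  average k (fun x => z * f x + g x) = z * average k f + average k g.
Proof.
move=> lf lg ck; have rf := integrable_Re lf ck; have jf := integrable_Im lf ck.
apply: complex_ext; rewrite /average ?ReD ?ImD ?ReM ?ImM /=.
  rewrite -mulNr -(int_linear3 _ _ rf jf (integrable_Re lg ck)).
  by apply: eq_Rintegral => y _; rewrite ReD ReM; ring.
rewrite -(int_linear3 _ _ jf rf (integrable_Im lg ck)).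
by apply: eq_Rintegral => y _; rewrite ImD ImM; ring.
Qed.

Lemma averageB k k' f : Linfty mu f -> Cc k -> Cc k' ->
  average k f - average k' f = average (fun y => k y - k' y) f.
Proof.
move=> lf ck ck'; apply: complex_ext; rewrite /average ?ReB ?ImB /=.
  rewrite -(RintegralB measurableT (integrable_Re lf ck) (integrable_Re lf ck')).
  by apply: eq_Rintegral => y _; rewrite mulrBr.
rewrite -(RintegralB measurableT (integrable_Im lf ck) (integrable_Im lf ck')).
by apply: eq_Rintegral => y _; rewrite mulrBr.
Qed.

Lemma LinftyZ (z : C) f : Linfty mu f -> Linfty mu (fun x => z * f x).
Proof.
move=> [mf [K fK]]; split.
  move=> F mF Foo; have [mR mI] := mf F mF Foo; split.
    under eq_fun do rewrite ReM.
    by apply: measurable_funB; apply: measurable_funM => //; exact: measurable_cst.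
  under eq_fun do rewrite ImM.
  by apply: measurable_funD; apply: measurable_funM => //; exact: measurable_cst.
exists (cabs z * K) => F mF Foo; have [N [mN N0 FN]] := fK F mF Foo; exists N; split => //.
move=> x [Fx /=]; rewrite normr_cabs ltcR cabsM => Kx; apply: FN; split => //=.
rewrite normr_cabs ltcR ltNge; apply/negP => /(ler_wpM2l (cabs_ge0 z)).
by rewrite leNgt Kx.
Qed.

(** The rotation by u yields the bound without an extra factor, as [mean_norm_le1] demands of the
    mean built from these averages. *)
Lemma average_le k f K : Linfty mu f -> ess_bounded_by mu f K -> 0 <= K -> Cc k ->
  cabs (average k f) <= K * int (fun y => `|k y|).
Proof.
move=> lf fK K0 ck; have [u u1 uw] := cabs_phase (average k f).
have luf := LinftyZ u lf.
have l0 : Linfty mu (fun=> 0 : C) by apply: (Cb_Linfty mu); exact: Cb_cst.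
have E : u * average k f = average k (fun x => u * f x).
  have a0 : average k (fun=> 0) = 0.
    apply/(@addIr _ (average k (fun=> 0))); rewrite add0r.
    rewrite -{1}[average k _]mul1r -average_linear//.
    by congr average; apply/funext => x; rewrite mulr0 addr0.
  rewrite -[LHS]addr0 -a0 -average_linear//.
  by congr average; apply/funext => x; rewrite addr0.
have -> : cabs (average k f) = Re (average k (fun x => u * f x)) by rewrite -E uw.
apply: le_trans (ler_norm _) _.
have mR : real_locally_measurable (fun x => Re (u * f x)).
  by move=> F mF Foo; have [] := luf.1 F mF Foo.
apply: (ess_bounded_Cc_integral mR _ K0 ck).2.
move=> F mF Foo; have [N [mN N0 FN]] := fK F mF Foo; exists N; split => //.
move=> x [Fx /= Kx]; apply: FN; split => //=; rewrite normr_cabs ltcR.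
by have := lt_le_trans Kx (Re_le_cabs _); rewrite cabsM u1 mul1r.
Qed.

Lemma average_lmul x k f : Linfty mu f -> Cc k ->
  average k (fun y => f (x * y)%g) = average (fun y => k (x^-1 * y)%g) f.
Proof.
move=> lf ck; have ckx := Cc_lmul x^-1%g ck.
have E (p : C -> R) : mu.-integrable [set: borel] (EFin \o (fun y => p (f y) * k (x^-1 * y)%g)) ->
    int (fun y => p (f (x * y)%g) * k y) = int (fun y => p (f y) * k (x^-1 * y)%g).
  move=> ip; rewrite -(integral_lmul mu_Haar x ip).
  by apply: eq_Rintegral => y _; rewrite mulKg.
by apply: complex_ext => /=; apply: E; [exact: integrable_Re|exact: integrable_Im].
Qed.

Lemma continuous_average k f : Linfty mu f -> Cc k ->
  continuous (fun s => average (fun y => k (s^-1 * y)%g) f).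
Proof.
move=> lf ck; have [K [K0 fK]] := Linfty_bound lf.
apply/continuous_cabsP => s e e0.
have d0 := divr_gt0 e0 (ltr_wpDl K0 ltr01).
apply: near_of_rmul; apply: filterS (near_inv (translation_continuous G_hausdorff G_lc HI ck d0)).
move=> u ku; have cks := Cc_lmul s^-1%g ck; have ckt := Cc_lmul (s * u)^-1%g ck.
rewrite averageB//; apply: (le_lt_trans (average_le lf fK K0 (CcB cks ckt))).
apply: le_lt_trans (mul_divD1_lt e0 K0); rewrite mulrC; apply: ler_wpM2r => //.
apply: le_trans (ltW ku).
have E := hf_invariant HI s^-1%g (Cc_norm (CcB (Cc_lmul u^-1%g ck) ck)).
rewrite -[leRHS]E le_eqVlt; apply/orP; left; apply/eqP/eq_Rintegral => y _ /=.
by rewrite distrC invgM mulgA.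
Qed.

Variable n : (G -> C) -> C.
Hypothesis n_mean : LUC_mean n.

Lemma lact_lmul r f x s : Cb f ->
  lact r f (x * s)%g = pr (fun z => f (z * s)%g) (conv r (point_mass x)).
Proof.
move=> bf; rewrite (pr_rmul G_hausdorff G_lc _ _ (Cb_rmul s bf)).
by congr (pr _ r); apply/funext => z; rewrite mulgA.
Qed.

(** Left translation of [lact r f] by x amounts to right translation of r by x, which is norm
    continuous. *)
Lemma LUC_lact r f : rcont r -> Cb f -> LUC (lact r f).
Proof.
move=> rr bf; split; first exact: Cb_lact.
have [cf [B fB]] := bf; have B0 : 0 <= B by rewrite (le_trans _ (fB point))// cabs_ge0.
have B4 : 0 <= 4 * B by rewrite mulr_ge0.
move=> e e0; have d0 := divr_gt0 e0 (ltr_wpDl B4 ltr01).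
apply: filterS (rr _ d0) => x rx s.
have bfs := Cb_rmul s bf.
rewrite lact_lmul// /lact -(pr_measureB _ _ bfs).
apply: (le_lt_trans (pr_le _ bfs (fun y => fB (y * s)%g))).
apply: le_lt_trans (mul_divD1_lt e0 B4); rewrite [leRHS]mulrC.
by apply: ler_wpM2l => //; exact: ltW.
Qed.

(** For fixed f the functional a |-> n(lact a f) is invariant under right translation of a, because
    n is left invariant; so by [lam_mass1] it takes equal values at r and delta_x r. The translate
    f(x .) may be merely continuous, which is why n cannot be applied to it directly. *)
Lemma LUC_mean_lact_lmul r x f : lcont r -> rcont r -> mass r = 1 -> Cb f ->
  n (lact r (fun y => f (x * y)%g)) = n (lact r f).
Proof.
move=> lr rr r1 bf; have [cf [B fB]] := bf.
have B0 : 0 <= B by rewrite (le_trans _ (fB point))// cabs_ge0.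
pose lam (a : measure_algebra R G) : C := n (lact a f).
have B4 : 0 <= 4 * B by rewrite mulr_ge0.
have -> : lact r (fun y => f (x * y)%g) = lact (conv (point_mass x) r) f.
  apply/funext => s; rewrite /lact (pr_lmul G_hausdorff G_lc _ _ (Cb_rmul s bf)).
  by congr (pr _ r); apply/funext => z; rewrite mulgA.
apply: (@lam_mass1 _ _ G_hausdorff G_lc lam (4 * B) B4 _ _ _ _ HI).
- move=> z a b ra rb; rewrite /lam -(LUC_mean_linear n_mean z (LUC_lact ra bf) (LUC_lact rb bf)).
  by congr n; apply/funext => y; rewrite lact_linear.
- move=> a ra; apply: (LUC_mean_le n_mean (LUC_lact ra bf)) => y; exact: lact_le.
- move=> a y ra; rewrite /lam -[RHS](LUC_mean_invariant n_mean y (LUC_lact ra bf)).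
  by congr n; apply/funext => s; rewrite lact_lmul.
- exact: lcont_lmul.
- exact: rcont_conv.
- by rewrite mass_conv// mass_point_mass// mul1r.
- exact: lr.
- exact: rr.
- exact: r1.
Qed.

(** The mean is f |-> n(lact r (av f)). Averaging against translates of a density k turns f into a
    bounded continuous function and commutes with left translations; [lact r] then makes it
    uniformly continuous, and [LUC_mean_lact_lmul] gives the invariance. *)
Lemma LUC_mean_left_invariant_mean : exists m, is_left_invariant_mean mu m.
Proof.
have c1 : compact [set (1 : G)%g] by exact: compact_set1.
have [k0 ck0 [k01 k1]] := @cutoff R G G_hausdorff G_lc _ c1.
have k0_ge0 y : 0 <= k0 y by have /andP[] := k01 y.
have I0 : 0 < int k0.
  by apply: (Haar_gt0 G_hausdorff G_lc HI (z := 1%g) ck0 k0_ge0); rewrite k1.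
pose k y := (int k0)^-1 * k0 y.
have ck : Cc k by exact: CcZ.
have k_ge0 y : 0 <= k y by rewrite mulr_ge0// invr_ge0 ltW.
have Ik : int (fun y => `|k y|) = 1.
  have -> : (fun y => `|k y|) = k by apply/funext => y; rewrite ger0_norm.
  by rewrite (plZ (hf_positive HI) _ ck0) mulVf// gt_eqF.
have Iks s : int (fun y => `|k (s^-1 * y)%g|) = 1.
  by rewrite (hf_invariant HI s^-1%g (Cc_norm ck)).
pose av f s : C := average (fun y => k (s^-1 * y)%g) f.
have avK f K s : Linfty mu f -> ess_bounded_by mu f K -> 0 <= K -> cabs (av f s) <= K.
  move=> lf fK K0; have := average_le lf fK K0 (Cc_lmul s^-1%g ck).
  by rewrite Iks mulr1.
have bav f : Linfty mu f -> Cb (av f).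
  move=> lf; split; first exact: continuous_average.
  have [K [K0 fK]] := Linfty_bound lf.
  by exists K => s; exact: avK.
have [r [lr rr r1 _ rV]] := smooth_bump G_hausdorff G_lc HI (@filterT _ (nbhs (1%g : G)) _).
have {}rV f K : Cb f -> (forall x, cabs (f x) <= K) -> cabs (pr f r) <= K.
  by move=> bf fK; apply: rV bf _ => x _; exact: fK.
exists (fun f => n (lact r (av f))); split.
- move=> z f g lf lg.
  rewrite -[RHS](LUC_mean_linear n_mean z (LUC_lact rr (bav _ lf)) (LUC_lact rr (bav _ lg))).
  congr n; apply/funext => y; rewrite /lact.
  rewrite -(pr_linear _ _ (Cb_rmul y (bav _ lf)) (Cb_rmul y (bav _ lg))).
  congr (pr _ r); apply/funext => x; apply: average_linear lf lg _; exact: Cc_lmul.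
- move=> f K lf K0 fK; rewrite le_normr_cabs.
  apply: (LUC_mean_le n_mean (LUC_lact rr (bav _ lf))) => y.
  by apply: (rV _ _ (Cb_rmul y (bav _ lf))) => x; exact: avK.
- rewrite -[RHS](LUC_mean1 n_mean); congr n; apply/funext => y.
  have av1 : av (fun=> 1) = fun=> 1.
    apply/funext => s; rewrite /av /average; apply: complex_ext => /=.
      rewrite -[RHS](Iks s); apply: eq_Rintegral => x _; rewrite mul1r ger0_norm//.
    by rewrite -[RHS](pl0 (hf_positive HI)); apply: eq_Rintegral => x _; rewrite mul0r.
  by rewrite /lact av1 -[RHS]r1.
- move=> x f lf.
  have -> : av (fun y => f (x * y)%g) = fun s => av f (x * s)%g.
    apply/funext => s; rewrite /av (average_lmul x lf (Cc_lmul s^-1%g ck)).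
    by congr average; apply/funext => y; rewrite invgM mulgA.
  exact: (LUC_mean_lact_lmul x lr rr r1 (bav f lf)).
Qed.

End Linfty_averages.

Lemma LUC_mean_amenable (R : realType) (G : topologicalGroupType) (n : (G -> R[i]^o) -> R[i]^o) :
  hausdorff_space G -> locally_compact [set: G] -> LUC_mean n -> amenable R G.
Proof.
move=> G_hausdorff G_lc n_mean.
have [I HI] := @Haar_functional_exists R G G_hausdorff G_lc.
have mu_Haar := radon_is_left_Haar G_hausdorff G_lc HI.
exists (radon G_hausdorff G_lc (hf_positive HI)); split; first exact: mu_Haar.
exact: (LUC_mean_left_invariant_mean G_hausdorff G_lc mu_Haar n_mean).
Qed.

(** * Positive parts of invariant functionals *)

Section LUC_positive_part.
Context {R : realType} {G : topologicalGroupType}.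
Local Notation C := (R[i]^o).
Local Notation Re := (@complex.Re R).
Local Notation Im := (@complex.Im R).
Local Notation rLUC := [set f : G -> R | LUC (fun x => (f x)%:C : C)].
Implicit Types (f g : G -> C).

Lemma LUC_comp (p : C -> C) f (B : R) : LUC f -> (forall z, cabs (p z) <= B * cabs z) ->
  (forall z w, cabs (p z - p w) <= cabs (z - w)) -> LUC (fun x => p (f x)).
Proof.
move=> [[cf [K fK]] uf] pB pd; have B0 : 0 <= B.
  by have := pB 1; rewrite cabs1 mulr1; apply: le_trans; exact: cabs_ge0.
split.
  split; last by exists (B * K) => x; rewrite (le_trans (pB _))// ler_wpM2l.
  apply/continuous_cabsP => x e e0; move/continuous_cabsP : cf => /(_ x e e0).
  by apply: filterS => y; apply: le_lt_trans.
move=> e e0; apply: filterS (uf e e0) => x fx s.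
exact: le_lt_trans (fx s).
Qed.

Lemma LUC_Re f : LUC f -> rLUC (fun x => Re (f x)).
Proof.
move=> lf /=; apply: (LUC_comp (p := fun z => (Re z)%:C) (B := 1) lf) => [z|z w].
  by rewrite mul1r cabs_real Re_le_cabs.
by rewrite -rmorphB /= cabs_real -ReB Re_le_cabs.
Qed.

Lemma LUC_Im f : LUC f -> rLUC (fun x => Im (f x)).
Proof.
move=> lf /=; apply: (LUC_comp (p := fun z => (Im z)%:C) (B := 1) lf) => [z|z w].
  by rewrite mul1r cabs_real Im_le_cabs.
by rewrite -rmorphB /= cabs_real -ImB Im_le_cabs.
Qed.

Lemma rLUC_lattice : function_lattice rLUC.
Proof.
split=> [a f g lf lg||f lf] /=.
- by have := LUC_linear a%:C lf lg; under eq_fun do rewrite -rmorphM -rmorphD.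
- exact: LUC_cst.
- apply: (LUC_comp (p := fun z => (Num.max 0 (Re z))%:C) (B := 1) lf) => [z|z w].
    rewrite mul1r cabs_real; apply: le_trans (Re_le_cabs z).
    by have [z0|z0] := leP 0 (Re z); rewrite ?normr0.
  rewrite -rmorphB /= cabs_real; apply: le_trans (Re_le_cabs _); rewrite ReB.
  have [z0|z0] := leP 0 (Re z); have [w0|w0] := leP 0 (Re w) => //.
  + rewrite subr0 ger0_norm//; apply: le_trans (ler_norm _).
    by rewrite lerDl oppr_ge0 ltW.
  + rewrite sub0r normrN ger0_norm// distrC; apply: le_trans (ler_norm _).
    by rewrite lerDl oppr_ge0 ltW.
  + by rewrite subr0 normr0.
Qed.

Lemma rLUC_lmul (f : G -> R) x : rLUC f -> rLUC (fun s => f (x * s)%g).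
Proof. exact: (@LUC_lmul R G x (fun y => (f y)%:C)). Qed.

Variables (m : (G -> C) -> C) (N : R).
Hypotheses (m_linear : forall (z : C) f g, LUC f -> LUC g ->
    m (fun x => z * f x + g x) = z * m f + m g)
  (m_le : forall f (s : R), LUC f -> (forall x, cabs (f x) <= s) -> cabs (m f) <= N * s)
  (m1 : m (fun=> 1) = 1)
  (m_invariant : forall x f, LUC f -> m (fun s => f (x * s)%g) = m f).

(** Translation maps the functions between 0 and f onto those between 0 and its translate, so the
    supremum defining the positive part inherits the invariance of u. As p dominates u on positive
    functions, p(1) >= 1, which permits normalisation. *)
Lemma invariant_positive_part : exists p : (G -> R) -> R, [/\ linear_on rLUC p,
  forall f g : G -> R, rLUC f -> rLUC g -> (forall x, f x <= g x) -> p f <= p g,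
  1 <= p (fun=> 1) & forall x (f : G -> R), rLUC f -> p (fun s => f (x * s)%g) = p f].
Proof.
pose u (f : G -> R) := Re (m (fun x => (f x)%:C)).
have ul : linear_on rLUC u.
  move=> a f g lf lg; rewrite /u; under eq_fun do rewrite rmorphD rmorphM.
  by rewrite m_linear// ReD ReM /= mul0r subr0.
have [|p [pl up pM]] := functional_positive_part rLUC_lattice ul.
  move=> f [[cf [B fB]] uf] f0; exists (N * B) => g lg gf.
  apply: (le_trans (ler_norm _)); apply: (le_trans (Re_le_cabs _)).
  apply: m_le => // x; apply: le_trans (fB x).
  by have /andP[g0 gfx] := gf x; rewrite !cabs_real !ger0_norm.
have l0 : rLUC (fun=> 0) := fl_zero rLUC_lattice.
have u0 : u (fun=> 0) = 0.
  have := ul (-1) _ _ l0 l0; under eq_fun do rewrite mulr0 addr0.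
  by rewrite mulN1r addNr.
have p_ge0 (f : G -> R) : rLUC f -> (forall x, 0 <= f x) -> 0 <= p f.
  by move=> lf f0; rewrite -u0; apply: up => // x; rewrite lexx f0.
have pB (f g : G -> R) : rLUC f -> rLUC g -> p (fun x => f x - g x) = p f - p g.
  move=> lf lg; rewrite addrC -mulN1r -pl//; congr p; apply/funext => x.
  by rewrite mulN1r addrC.
have p_lmul_le x (f : G -> R) : rLUC f -> (forall y, 0 <= f y) -> p (fun s => f (x * s)%g) <= p f.
  move=> lf f0; apply: pM => [||g lg gf]; [exact: rLUC_lmul|by move=> y; exact: f0|].
  have <- : u (fun s => g (x^-1 * s)%g) = u g.
    by rewrite /u (m_invariant x^-1%g lg).
  apply: up => //; first exact: rLUC_lmul.
  by move=> s; have := gf (x^-1 * s)%g; rewrite mulVKg.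
have p_lmul x (f : G -> R) : rLUC f -> (forall y, 0 <= f y) -> p (fun s => f (x * s)%g) = p f.
  move=> lf f0; apply/eqP; rewrite eq_le p_lmul_le//=.
  have := p_lmul_le x^-1%g _ (rLUC_lmul x lf) (fun y => f0 (x * y)%g).
  by under eq_fun do rewrite mulVKg.
exists p; split => //.
- move=> f g lf lg fg; rewrite -subr_ge0 -pB//; apply: p_ge0; first exact: (flB rLUC_lattice).
  by move=> x; rewrite subr_ge0.
- have u1 : u (fun=> 1) = 1 by rewrite /u [X in Re (m X)](_ : _ = fun=> 1) ?m1.
  have := up (fun=> 1) (fun=> 1) (LUC_cst _) (LUC_cst _).
  by rewrite u1; apply => x; rewrite ler01 lexx.
- move=> x f lf; have lp := fl_max0 rLUC_lattice lf.
  have ln := fl_max0 rLUC_lattice (flN rLUC_lattice lf).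
  rewrite (posneg f) (pB _ _ lp ln) -(p_lmul x _ lp (max0_ge0 f)).
  rewrite -(p_lmul x _ ln (max0_ge0 (fun y => - f y))).
  by rewrite -(pB _ _ (rLUC_lmul x lp) (rLUC_lmul x ln)).
Qed.

Lemma LUC_mean_of_invariant : exists n : (G -> C) -> C, LUC_mean n.
Proof.
have [p [pl p_le p1 p_lmul]] := invariant_positive_part.
have p0 : 0 < p (fun=> 1) by exact: lt_le_trans p1.
have l0 : rLUC (fun=> 0) := fl_zero rLUC_lattice.
have pl0 : p (fun=> 0) = 0.
  have := pl (-1) _ _ l0 l0; under eq_fun do rewrite mulr0 addr0.
  by rewrite mulN1r addNr.
have pZ a (f : G -> R) : rLUC f -> p (fun x => a * f x) = a * p f.
  by move=> lf; have := pl a f _ lf l0; under eq_fun do rewrite addr0; rewrite pl0 addr0.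
pose q (f : G -> C) : C := p (fun x => Re (f x)) +i* p (fun x => Im (f x)).
have q_linear (z : C) f g : LUC f -> LUC g -> q (fun x => z * f x + g x) = z * q f + q g.
  move=> lf lg; have rf := LUC_Re lf; have jf := LUC_Im lf.
  apply: complex_ext; rewrite ?ReD ?ImD ?ReM ?ImM /=.
    rewrite -mulNr -addrA -(pl (- Im z) _ _ jf (LUC_Re lg)).
    rewrite -(pl (Re z) _ _ rf (fl_linear rLUC_lattice (- Im z) jf (LUC_Re lg))).
    by congr p; apply/funext => x; rewrite ReD ReM; ring.
  rewrite -addrA -(pl (Im z) _ _ rf (LUC_Im lg)).
  rewrite -(pl (Re z) _ _ jf (fl_linear rLUC_lattice (Im z) rf (LUC_Im lg))).
  by congr p; apply/funext => x; rewrite ImD ImM; ring.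
have q_lt f (s : R) : LUC f -> (forall x, cabs (f x) <= s) -> cabs (q f) <= s * p (fun=> 1).
  move=> lf fs; have [w w1 wE] := cabs_phase (q f).
  have lwf := LUC_linear w lf (LUC_cst 0).
  have E : w * q f = q (fun x => w * f x + 0).
    by rewrite (q_linear w _ _ lf (LUC_cst 0)) [q (fun=> 0)]/q /= pl0 addr0.
  have -> : cabs (q f) = Re (q (fun x => w * f x + 0)) by rewrite -E wE.
  rewrite -pZ; last exact: LUC_cst.
  apply: p_le; [exact: LUC_Re lwf|exact: LUC_cst|].
  move=> x; rewrite mulr1 addr0; apply: le_trans (fs x).
  by rewrite (le_trans (ler_norm _))// (le_trans (Re_le_cabs _))// cabsM w1 mul1r.
exists (fun f => (p (fun=> 1))^-1%:C * q f); split.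
- by move=> z f g lf lg; rewrite q_linear//; ring.
- move=> f s lf fs; rewrite cabsM cabs_real ger0_norm; last by rewrite invr_ge0 ltW.
  by rewrite ler_pdivrMl// mulrC q_lt.
- rewrite /q /= pl0; apply: complex_ext; rewrite ?ReM ?ImM /=.
    by rewrite mul0r subr0 mulVf// gt_eqF.
  by rewrite mulr0 mul0r addr0.
- by move=> x f lf; rewrite /q (p_lmul x _ (LUC_Re lf)) (p_lmul x _ (LUC_Im lf)).
Qed.

End LUC_positive_part.

(** * Spaces of bounded functions and their duals *)

Section weighted_function_spaces.
Context {R : realType}.
Local Notation C := (R[i]^o).

(* A space of functions that are bounded relative to a weight: the constant weight
   gives spaces of bounded functions, the norm gives spaces of functionals. *)
Record weighted_space (T : Type) := WeightedSpace {
  ws_weight : T -> R ;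
  ws_set : set (T -> C) ;
  ws_weight_ge0 : forall t, 0 <= ws_weight t ;
  ws_zero : ws_set (fun=> 0) ;
  ws_linear : forall (a : C) f g, ws_set f -> ws_set g -> ws_set (fun t => a * f t + g t) ;
  ws_bounded : forall f, ws_set f -> exists K, forall t, cabs (f t) <= K * ws_weight t ;
  ws_closed : forall f, (forall e : R, 0 < e -> exists2 g, ws_set g &
    forall t, cabs (f t - g t) <= e * ws_weight t) -> ws_set f }.

Variables (T : Type) (X : weighted_space T).
Local Notation w := (ws_weight X).
Let w0 := ws_weight_ge0 X.

Definition ws_pred : {pred T -> C} := mem (ws_set X).

Lemma ws_pred_submod : submod_closed ws_pred.
Proof.
split; first by rewrite inE; exact: ws_zero.
by move=> a f g; rewrite !inE; exact: ws_linear.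
Qed.

HB.instance Definition _ := GRing.isSubmodClosed.Build _ _ ws_pred ws_pred_submod.

Record ws_type := WsType { ws_val :> T -> C ; ws_valP : ws_val \in ws_pred }.

HB.instance Definition _ := [isSub for ws_val].
HB.instance Definition _ := [Choice of ws_type by <:].
HB.instance Definition _ := [SubChoice_isSubLmodule of ws_type by <:].
Implicit Types f g : ws_type.

Lemma ws_inE f : ws_set X f. Proof. by have := ws_valP f; rewrite inE. Qed.

Definition ws_of (F : T -> C) (HF : ws_set X F) : ws_type := WsType (mem_set HF).

Definition wnorm f : R := inf [set K | 0 <= K /\ forall t, cabs (f t) <= K * w t].

Let wset_inf f : has_inf [set K | 0 <= K /\ forall t, cabs (f t) <= K * w t].
Proof.
split; last by exists 0 => K [].
have [K fK] := ws_bounded (ws_inE f); exists (Num.max 0 K); split.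
  by rewrite le_max lexx.
by move=> t; rewrite (le_trans (fK t))// ler_wpM2r// le_max lexx orbT.
Qed.

Lemma wnorm_ge0 f : 0 <= wnorm f.
Proof. by apply: lb_le_inf; [exact: (wset_inf f).1|move=> K []]. Qed.

Lemma wnorm_le f (K : R) : 0 <= K -> (forall t, cabs (f t) <= K * w t) -> wnorm f <= K.
Proof. by move=> K0 fK; apply: ge_inf; [exact: (wset_inf f).2|split]. Qed.

Lemma le_wnorm f t : cabs (f t) <= wnorm f * w t.
Proof.
have := w0 t; rewrite le_eqVlt => /predU1P[wt|wt].
  by have [K fK] := ws_bounded (ws_inE f); have := fK t; rewrite -wt !mulr0.
rewrite -ler_pdivrMr//; apply: lb_le_inf; first exact: (wset_inf f).1.
by move=> K [_ fK]; rewrite ler_pdivrMr.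
Qed.

Let wnD f g : (wnorm (f + g))%:C <= (wnorm f)%:C + (wnorm g)%:C.
Proof.
rewrite -rmorphD lecR; apply: wnorm_le => [|t]; first by rewrite addr_ge0// wnorm_ge0.
by rewrite (le_trans (cabsD _ _))// mulrDl lerD// le_wnorm.
Qed.

Let wn0 : wnorm 0 = 0.
Proof.
by apply/le_anti; rewrite wnorm_ge0 wnorm_le// => t; rewrite mul0r cabs0.
Qed.

Let wnZ_le (a : C) f : wnorm (a *: f) <= cabs a * wnorm f.
Proof.
apply: wnorm_le => [|t]; first by rewrite mulr_ge0// ?cabs_ge0 ?wnorm_ge0.
by rewrite cabsM -mulrA ler_wpM2l ?cabs_ge0// le_wnorm.
Qed.

Let wnZ (a : R[i]) f : (wnorm (a *: f))%:C = `|a| * (wnorm f)%:C.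
Proof.
rewrite normr_cabs -rmorphM; congr (_%:C); have [->|a0] := eqVneq a 0.
  by rewrite scale0r cabs0 mul0r wn0.
apply/le_anti; rewrite wnZ_le /=; have := wnZ_le a^-1 (a *: f).
rewrite scalerA mulVf// scale1r => H.
have E : cabs a * cabs a^-1 = 1 by rewrite -cabsM mulfV// cabs1.
by have := ler_wpM2l (cabs_ge0 a) H; rewrite mulrA E mul1r.
Qed.

Let wn0_eq0 f : (wnorm f)%:C = 0 -> f = 0.
Proof.
move=> [f0]; apply/val_inj/funext => t /=.
have := le_wnorm f t; rewrite f0 mul0r => ft.
by apply/eqP; rewrite -cabs_eq0 eq_le ft cabs_ge0.
Qed.

HB.instance Definition _ := Lmodule_isNormed.Build R[i] ws_type wnD wnZ wn0_eq0.

Lemma normr_wnorm f : `|f| = (wnorm f)%:C. Proof. by []. Qed.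

(** Pointwise limits exist along an ultrafilter finer than F, where values are eventually bounded.
    The Cauchy property makes F converge to this limit in norm, and [ws_closed] puts the limit in
    the space. *)
Lemma ws_complete (F : set_system ws_type) : ProperFilter F -> cauchy F -> cvg F.
Proof.
move=> FF /cauchyP cF.
have [U [UU FU]] := ultraFilterLemma FF.
have near_ball e : 0 < e -> exists f : ws_type, \forall g \near U, forall t, cabs (f t - (g : ws_type) t) <= e * w t.
  move=> e0; have [|f Ff] := cF e%:C; first by rewrite ltcR.
  exists f; apply: (@filterS _ U _ _ _ _ (FU _ Ff)) => g.
  rewrite -ball_normE /= normr_wnorm ltcR => fg t.
  by rewrite (le_trans (le_wnorm (f - g) t))// ler_wpM2r// ltW.
have lim t : {l : C | (fun g : ws_type => g t) @ U --> l}.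
  apply/cid/cvg_ex; have [f fU] := near_ball _ ltr01.
  apply: (@ultra_cvg_complex _ _ U UU _ (cabs (f t) + 1 * w t)).
  apply: (@filterS _ U _ _ _ _ fU) => g /(_ t) fg.
  rewrite -[g t](subrK (f t)) (le_trans (cabsD _ _))// addrC lerD2l.
  by rewrite cabsBC.
pose l t := projT1 (lim t).
have l_dist e : 0 < e -> exists f : ws_type, (forall t, cabs (l t - f t) <= e * w t) /\
    \forall g \near F, forall t, cabs (f t - (g : ws_type) t) <= e * w t.
  move=> e0; have [|f Ff] := cF e%:C; first by rewrite ltcR.
  have fF : \forall g \near F, forall t, cabs (f t - (g : ws_type) t) <= e * w t.
    apply: filterS Ff => g; rewrite -ball_normE /= normr_wnorm ltcR => fg t.
    by rewrite (le_trans (le_wnorm (f - g) t))// ler_wpM2r// ltW.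
  exists f; split => // t; apply/ler_addgt0Pr => d d0.
  have /cvg_cabsP/(_ d d0) Ul := projT2 (lim t).
  have [g [lg fg]] := @filter_ex _ U _ _ (@filterI _ U _ _ _ Ul (FU _ fF)).
  apply: (le_trans (cabs_dist _ (g t) _)); rewrite addrC (cabsBC (g t)).
  by apply: lerD; [exact: fg|exact: ltW].
have lX : ws_set X l.
  apply: ws_closed => e e0; have [f [lf _]] := l_dist e e0.
  by exists f => //; exact: ws_inE.
apply/cvg_ex; exists (ws_of lX); apply/cvgrPdist_lt => e.
rewrite ltcE /= => /andP[/eqP e2 e1].
have -> : e = (complex.Re e)%:C by case: e e2 {e1} => a b /= ->.
have e4 : 0 < complex.Re e / 4 by rewrite divr_gt0.
have [f [lf fF]] := l_dist _ e4; apply: filterS fF => g fg.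
rewrite normr_wnorm ltcR; apply: (@le_lt_trans _ _ (complex.Re e / 2)); last first.
  by rewrite ltr_pdivrMr// ltr_pMr// ltr1n.
apply: wnorm_le => [|t]; first by rewrite ltW// divr_gt0.
apply: (le_trans (cabs_dist _ (f t) _)).
rewrite (_ : _ / 2 = complex.Re e / 4 + complex.Re e / 4); last by field.
by rewrite mulrDl lerD.
Qed.

HB.instance Definition _ := Uniform_isComplete.Build ws_type ws_complete.

End weighted_function_spaces.

(** * Duals of spaces of weighted functions *)

Section dual_spaces.
Context {R : realType} {T : Type} (X : @weighted_space R T).
Local Notation C := (R[i]^o).
Local Notation E' := (ws_type X).

Definition dual_set : set (E' -> C) :=
  [set u | linear u /\ exists K, forall f, cabs (u f) <= K * wnorm f].

Lemma dual_set_zero : dual_set (fun=> 0).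
Proof.
by split=> [a f g|]; [rewrite scaler0 addr0|exists 0 => f; rewrite cabs0 mul0r].
Qed.

Lemma dual_set_linear (a : C) u v : dual_set u -> dual_set v ->
  dual_set (fun f => a * u f + v f).
Proof.
move=> [ul [K uK]] [vl [L vL]]; split.
  by move=> b f g; rewrite ul vl !scalerDr /GRing.scale/=; ring.
exists (cabs a * K + L) => f; rewrite (le_trans (cabsD _ _))// mulrDl lerD// cabsM.
by rewrite -mulrA ler_wpM2l// cabs_ge0.
Qed.

Lemma dual_set_closed u : (forall e : R, 0 < e -> exists2 v, dual_set v &
  forall f, cabs (u f - v f) <= e * wnorm f) -> dual_set u.
Proof.
move=> uv; split.
  move=> a f g; apply/eqP; rewrite -subr_eq0 -cabs_eq0 eq_le cabs_ge0 andbT.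
  have K0 : 0 <= wnorm (a *: f + g) + (cabs a * wnorm f + wnorm g).
    by rewrite !addr_ge0 ?mulr_ge0 ?cabs_ge0 ?wnorm_ge0.
  apply/ler_addgt0Pr => e e0; rewrite add0r.
  have [v [vl _] uve] := uv _ (divr_gt0 e0 (ltr_wpDl K0 ltr01)).
  set d := e / _ in uve.
  have -> : u (a *: f + g) - (a *: u f + u g) =
      (u (a *: f + g) - v (a *: f + g)) - (a * (u f - v f) + (u g - v g)).
    by rewrite vl /GRing.scale/=; ring.
  apply: le_trans (ltW (mul_divD1_lt e0 K0)); rewrite -/d [leRHS]mulrDr.
  apply: (le_trans (cabsB _ _)); apply: lerD; first exact: uve.
  apply: (le_trans (cabsD _ _)); rewrite [leRHS]mulrDr cabsM; apply: lerD; last exact: uve.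
  by rewrite mulrCA; apply: ler_wpM2l; [exact: cabs_ge0|exact: uve].
have [v [_ [K vK]] uv1] := uv _ ltr01; exists (1 + K) => f.
rewrite -[u f](subrK (v f)) (le_trans (cabsD _ _))// mulrDl lerD//; exact: uv1.
Qed.

Definition dual_space : @weighted_space R E' := WeightedSpace (@wnorm_ge0 _ _ X)
  dual_set_zero dual_set_linear (fun u Hu => proj2 Hu) dual_set_closed.

Lemma dual_spaceP : is_dual (fun (f : E') (u : ws_type dual_space) => u f).
Proof.
split.
- by move=> u; have [] := ws_inE u.
- by move=> f a u v.
- move=> u K K0; have [k k0 ->] : exists2 k, 0 <= k & K = k%:C.
    case: K K0 => a b; rewrite lecE /= => /andP[/eqP -> a0]; exists a => //.
  rewrite normr_wnorm lecR; split.
    move=> uk f; rewrite normr_cabs normr_wnorm -rmorphM lecR.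
    by rewrite (le_trans (le_wnorm u f))// ler_wpM2r// wnorm_ge0.
  move=> uk; apply: wnorm_le => // f; have := uk f.
  by rewrite normr_cabs normr_wnorm -rmorphM lecR.
- move=> u ul uc; have [d d0 ud] : exists2 d : R, 0 < d &
      forall f : E', wnorm f < d -> cabs (u f) < 1.
    have : \forall f \near (0 : E'), cabs (u f) < 1.
      have /cvg_cabsP/(_ 1 ltr01) : u f @[f --> (0 : E')] --> u 0 by exact: uc.
      by apply: filterS => f; rewrite (linear_fun0 ul) sub0r cabsN.
    move=> /nbhs_normP[e /=]; rewrite ltcE /= => /andP[/eqP e2 e1] eu.
    exists (complex.Re e) => // f fe; apply: eu; rewrite /= sub0r normrN.
    by rewrite normr_wnorm; case: e e2 e1 fe => a b /= -> _; rewrite ltcR.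
  have Hu : dual_set u.
    split => //; exists (2 / d) => f; have := wnorm_ge0 f.
    rewrite le_eqVlt => /predU1P[f0|f0].
      have -> : f = 0 by apply/eqP; rewrite -normr_eq0 normr_wnorm -f0.
      by rewrite (linear_fun0 ul) cabs0 mulr_ge0 ?wnorm_ge0// divr_ge0// ltW.
    pose c := d / (2 * wnorm f); have c0 : 0 < c by rewrite divr_gt0// mulr_gt0.
    have cf : wnorm (c%:C *: f) = c * wnorm f.
      apply/(@complexI R); rewrite -normr_wnorm normrZ normr_wnorm normr_cabs cabs_real.
      by rewrite -rmorphM ger0_norm// ltW.
    have : cabs (u (c%:C *: f)) < 1.
      apply: ud; rewrite cf /c invfM !mulrA mulfVK ?gt_eqF//.
      by rewrite ltr_pdivrMr// ltr_pMr// ltr1n.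
    rewrite (linear_funZ ul) cabsM cabs_real ger0_norm; last exact: ltW.
    rewrite mulrC -ltr_pdivlMr// => /ltW /le_trans; apply.
    by rewrite /c invf_div mul1r mulrAC.
  by exists (ws_of (X := dual_space) Hu).
Qed.

End dual_spaces.

(** * Functionals along norm continuous functions *)

Section vector_valued_functions.
Context {R : realType} {G : topologicalGroupType}.
Local Notation C := (R[i]^o).
Local Notation M := (measure_algebra R G).
Hypotheses (G_hausdorff : hausdorff_space G) (G_lc : locally_compact [set: G]).
Context {T : Type} (X : @weighted_space R T).
Hypothesis X_weight : forall t, ws_weight X t = 1.
Local Notation E' := (ws_type X).
Local Notation E := (ws_type (dual_space X)).
Implicit Types (u : E) (f g : E').

Lemma cabs_wnorm f t : cabs (f t) <= wnorm f.
Proof. by have := le_wnorm f t; rewrite X_weight mulr1. Qed.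

Lemma wnorm_sup_le f (K : R) : 0 <= K -> (forall t, cabs (f t) <= K) -> wnorm f <= K.
Proof. by move=> K0 fK; apply: wnorm_le => // t; rewrite X_weight mulr1. Qed.

Lemma dual_linear u : linear (u : E' -> C). Proof. by have [] := ws_inE u. Qed.

Lemma dual_le u f : cabs (u f) <= wnorm u * wnorm f.
Proof. exact: (le_wnorm u f). Qed.

Variables (Th : G -> E') (B : R).
Hypotheses (Th_cont : forall x (e : R), 0 < e -> \forall y \near x, wnorm (Th y - Th x) < e)
  (Th_le : forall x, wnorm (Th x) <= B).

Lemma Cb_dual u : Cb (fun x => u (Th x)).
Proof.
split; last first.
  by exists (wnorm u * B) => x; rewrite (le_trans (dual_le _ _))// ler_wpM2l// wnorm_ge0.
apply/continuous_cabsP => x e e0.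
have d0 := divr_gt0 e0 (ltr_wpDl (wnorm_ge0 u) ltr01).
apply: filterS (Th_cont x d0) => y xy; rewrite cabsBC -(linear_funB (dual_linear u)).
apply: (le_lt_trans (dual_le _ _)); apply: le_lt_trans (mul_divD1_lt e0 (wnorm_ge0 u)).
by rewrite mulrC ler_wpM2r// ?wnorm_ge0// ltW.
Qed.

(* The integral of a norm-continuous bounded function with values in E' lies in E'. *)
Lemma Bochner (a : M) : exists f, forall u, pr (fun x => u (Th x)) a = u f.
Proof.
have B0 : 0 <= B by exact: le_trans (wnorm_ge0 _) (Th_le point).
have dualS u n (c : nat -> C) (x : nat -> G) :
    \sum_(i < n) c i * u (Th (x i)) = u (\sum_(i < n) c i *: Th (x i)).
  elim: n => [|n IH]; first by rewrite !big_ord0 (linear_fun0 (dual_linear u)).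
  by rewrite !big_ord_recr /= IH addrC [in RHS]addrC (dual_linear u).
have valS t n (c : nat -> C) (x : nat -> G) :
    \sum_(i < n) c i * Th (x i) t = (\sum_(i < n) c i *: Th (x i) : E') t.
  elim: n => [|n IH]; first by rewrite !big_ord0.
  by rewrite !big_ord_recr /= IH.
have Th_t t x y (d : R) : wnorm (Th y - Th x) < d -> cabs (Th y t - Th x t) < d.
  by apply: le_lt_trans; exact: (cabs_wnorm (Th y - Th x)).
have Cb_t t : Cb (fun x => Th x t).
  split; last by exists B => x; exact: le_trans (cabs_wnorm _ _) (Th_le x).
  apply/continuous_cabsP => x e e0; apply: filterS (Th_cont x e0) => y /(Th_t t).
  by rewrite cabsBC.
pose F t : C := pr (fun x => Th x t) a.
have approx u (e : R) : 0 < e -> exists n (x : nat -> G) (c : nat -> C),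
    cabs (pr (fun x => u (Th x)) a - \sum_(i < n) c i * u (Th (x i))) <= e /\
    forall t, cabs (F t - \sum_(i < n) c i * Th (x i) t) <= e.
  (* One finite sum has to approximate all coordinates of the integral and the integral of u at the
     same time; the index [None] stands for the latter. *)
  move=> e0; pose h (j : option T) x : C := if j is Some t then Th x t else u (Th x).
  have u0 := wnorm_ge0 u.
  have [|||n [x [c [_ cF]]]] := @approximation _ _ G_hausdorff G_lc _ h (B + wnorm u * B) e a e0.
  - by case=> [t|]; [exact: Cb_t|exact: Cb_dual].
  - case=> [t|] x /=.
      rewrite (le_trans (cabs_wnorm _ _))// (le_trans (Th_le x))// lerDl.
      by rewrite mulr_ge0.
    rewrite (le_trans (dual_le _ _))//.
    by rewrite (le_trans (ler_wpM2l u0 (Th_le x)))// lerDr.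
  - move=> x d d0; have d1 := divr_gt0 d0 (ltr_wpDl u0 ltr01).
    apply: filterS2 (Th_cont x d0) (Th_cont x d1) => y y0 y1 [t|] /=; first exact: Th_t.
    rewrite -(linear_funB (dual_linear u)); apply: (le_lt_trans (dual_le _ _)).
    by apply: le_lt_trans (mul_divD1_lt d0 u0); rewrite mulrC ler_wpM2r// ltW.
  - by exists n, x, c; split; [exact: (cF None)|move=> t; exact: (cF (Some t))].
have XF : ws_set X F.
  apply: ws_closed => e e0; have [n [x [c [_ cF]]]] := approx 0 e e0.
  exists (\sum_(i < n) c i *: Th (x i) : E'); first exact: ws_inE.
  by move=> t; rewrite X_weight mulr1 -valS.
exists (ws_of XF) => u; apply/eqP; rewrite -subr_eq0 -cabs_eq0 eq_le cabs_ge0 andbT.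
have u0 := wnorm_ge0 u; have u1 : 0 < wnorm u + 1 by rewrite ltr_wpDl.
apply/ler_addgt0Pr => e e0; rewrite add0r.
have d0 : 0 < e / (wnorm u + 1) by rewrite divr_gt0.
have [n [x [c [cu cF]]]] := approx u _ d0; set d := e / _ in d0 cu cF.
rewrite dualS in cu; set S := \sum_(i < n) _ in cu.
apply: (le_trans (cabs_dist _ (u S) _)).
rewrite -(linear_funB (dual_linear u)).
have -> : e = d + d * wnorm u.
  by rewrite -{1}[d]mulr1 -mulrDr addrC /d mulfVK// gt_eqF.
apply: lerD => //; apply: (le_trans (dual_le _ _)); rewrite mulrC ler_wpM2r//.
apply: wnorm_sup_le => [|t]; first exact: ltW.
by rewrite -cabsN opprB (_ : _ - _ = F t - \sum_(i < n) c i * Th (x i) t) ?cF// valS.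
Qed.

(* If the values Th x are concentrated on regions that become disjoint as x leaves
   compact sets, a functional can only be large on few of them. *)
Hypothesis Th_disjoint : forall (e : R) x, 0 < e -> exists2 L : set G, compact L &
  forall y, ~ L y -> forall t, cabs (Th x t) < e \/ cabs (Th y t) < e.

Lemma isC0_dual u : isC0 (fun x => u (Th x)).
Proof.
split; first exact: (Cb_dual u).1.
move=> e e0; apply: contrapT => noK.
have large K : compact K -> {x | ~ K x & e <= cabs (u (Th x))}.
  move=> cK; apply: cid2; apply: contrapT => nx; apply: noK; exists K => // x nKx.
  by rewrite ltNge; apply/negP => ex; apply: nx; exists x.
have B0 : 0 <= B by exact: le_trans (wnorm_ge0 _) (Th_le point).
have u0 := wnorm_ge0 u; have u1 : 0 < 2 * wnorm u + 1 by rewrite ltr_wpDl// mulr_ge0.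
pose d := e / (2 * wnorm u + 1) / 2.
have d0 : 0 < d by rewrite !divr_gt0.
(* If u stayed large off every compact set, n rescaled and rotated values Th x could be added with u
   f = n e, while at each t at most one summand reaches d, so that f is bounded by B + n d. As |u| d
   <= e/2, a large n contradicts the boundedness of u. *)
have many n : exists f (K : set G), [/\ compact K,
    (n%:R * e)%:C = u f,
    forall t, cabs (f t) <= B + n%:R * d &
    forall x, ~ K x -> forall t, cabs (Th x t) < d \/ cabs (f t) <= n%:R * d].
  elim: n => [|n [f [K [cK uf fB fd]]]].
    exists 0, set0; split.
    - exact: compact0.
    - by rewrite mul0r (linear_fun0 (dual_linear u)).
    - by move=> t; rewrite cabs0 mul0r addr0.
    - by move=> x _ t; right; rewrite cabs0 mul0r.
  have [x nKx ex] := large K cK; have [c c1 cx] := cabs_phase (u (Th x)).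
  have [L cL HL] := Th_disjoint x d0.
  pose k : C := (e / cabs (u (Th x)))%:C * c.
  have ux : 0 < cabs (u (Th x)) by exact: lt_le_trans ex.
  have k1 : cabs k <= 1.
    by rewrite cabsM cabs_real c1 mulr1 ger0_norm ?ler_pdivrMr ?mul1r// divr_ge0 ?ltW.
  have kt t : cabs ((k *: Th x) t) <= cabs (Th x t) by rewrite cabsM ler_piMl// cabs_ge0.
  have nd : n.+1%:R * d = d + n%:R * d by rewrite -addn1 natrD mulrDl mul1r addrC.
  exists (k *: Th x + f), (K `|` L); split.
  - exact: compactU.
  - rewrite (dual_linear u) -uf /GRing.scale/= -mulrA cx -rmorphM -rmorphD; congr (_%:C).
    by rewrite divfK ?gt_eqF// -addn1 natrD mulrDl mul1r addrC.
  - move=> t; rewrite (le_trans (cabsD _ _))//; have [dx|df] := fd x nKx t.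
      rewrite nd addrCA; apply: lerD; last exact: fB.
      by apply: (le_trans (kt t)); exact: ltW.
    apply: lerD.
      exact: le_trans (kt t) (le_trans (cabs_wnorm _ _) (Th_le x)).
    by rewrite (le_trans df)// nd lerDr ltW.
  - move=> y /not_orP[nKy nLy] t; have [dy|df] := fd y nKy t; first by left.
    have [dx|dy] := HL y nLy t; last by left.
    right; rewrite (le_trans (cabsD _ _))// nd lerD//.
    by apply: (le_trans (kt t)); exact: ltW.
have [n nB] : exists n : nat, 2 * (wnorm u * B) < n%:R * e.
  exists (Num.trunc (2 * (wnorm u * B) / e)).+1.
  by rewrite -ltr_pdivrMr//; exact: truncnS_gt.
have [f [K [_ uf fB _]]] := many n.
have ne0 : 0 <= n%:R * e by rewrite mulr_ge0// ltW.
have fle : wnorm f <= B + n%:R * d.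
  by apply: wnorm_sup_le => //; rewrite addr_ge0// mulr_ge0// ltW.
have := le_trans (dual_le u f) (ler_wpM2l u0 fle).
rewrite -uf cabs_real ger0_norm// mulrDr leNgt => /negP; apply.
apply: (@le_lt_trans _ _ (wnorm u * B + n%:R * e / 2)); last by lra.
have ud : wnorm u * d <= e / 2.
  have := ltW (mul_divD1_lt e0 (mulr_ge0 (ler0n R 2) u0)).
  by rewrite /d; set q := e / _; lra.
by rewrite lerD2l mulrCA -mulrA ler_wpM2l.
Qed.

End vector_valued_functions.

(** * The test bimodule and its derivation *)

Section band_functions.
Context {R : realType} {G : topologicalGroupType}.
Local Notation C := (R[i]^o).
Local Notation M := (measure_algebra R G).
Hypotheses (G_hausdorff : hausdorff_space G) (G_lc : locally_compact [set: G]).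
Implicit Types (F : G * G -> C) (x y s r u : G).

(* band_vanishing is what makes the bimodule normal, through actl_C0 and actr_C0. *)
Record band F : Prop := {
  band_bounded : exists K, forall t, cabs (F t) <= K * 1 ;
  band_left : forall e : R, 0 < e ->
    \forall u \near 1%g, forall s r, cabs (F ((u * s)%g, r) - F (s, r)) < e ;
  band_right : forall e : R, 0 < e ->
    \forall u \near 1%g, forall s r, cabs (F (s, (r * u)%g) - F (s, r)) < e ;
  band_vanishing : forall e : R, 0 < e -> exists2 K : set G, compact K &
    forall s r, ~ K (s * r)%g -> cabs (F (s, r)) < e }.

Lemma band0 : band (fun=> 0).
Proof.
split=> [|e e0|e e0|e e0].
- by exists 0 => t; rewrite cabs0 mul0r.
- by apply: nearW => u s r; rewrite subrr cabs0.
- by apply: nearW => u s r; rewrite subrr cabs0.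
- by exists set0; [exact: compact0|move=> s r _; rewrite cabs0].
Qed.

Let linear_lt (a z w z' w' : C) (e : R) : cabs (z - w) < e / 2 / (cabs a + 1) ->
  cabs (z' - w') < e / 2 -> 0 < e -> cabs (a * z + z' - (a * w + w')) < e.
Proof.
move=> zw zw' e0; have e2 : 0 < e / 2 by rewrite divr_gt0.
rewrite (_ : _ - _ = a * (z - w) + (z' - w')); last by ring.
apply: (le_lt_trans (cabsD _ _)); rewrite [ltRHS]splitr cabsM; apply: ler_ltD => //.
apply: (le_trans (ler_wpM2l (cabs_ge0 a) (ltW zw))).
by rewrite mulrC; exact/ltW/mul_divD1_lt/cabs_ge0.
Qed.

Lemma band_linear (a : C) F F' : band F -> band F' -> band (fun t => a * F t + F' t).
Proof.
move=> [[K FK] lF rF vF] [[K' FK'] lF' rF' vF'].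
have h e : 0 < e -> 0 < e / 2 :> R by move=> e0; rewrite divr_gt0.
have d e : 0 < e -> 0 < e / 2 / (cabs a + 1) :> R.
  by move=> e0; rewrite divr_gt0 ?h// ltr_wpDl// cabs_ge0.
split=> [|e e0|e e0|e e0].
- exists (cabs a * K + K') => t; rewrite (le_trans (cabsD _ _))// mulrDl lerD// cabsM.
  by rewrite -mulrA ler_wpM2l// cabs_ge0.
- by apply: filterS2 (lF _ (d e e0)) (lF' _ (h e e0)) => u H H' s r; exact: linear_lt.
- by apply: filterS2 (rF _ (d e e0)) (rF' _ (h e e0)) => u H H' s r; exact: linear_lt.
- have [L cL FL] := vF _ (d e e0); have [L' cL' FL'] := vF' _ (h e e0).
  exists (L `|` L'); first exact: compactU.
  move=> s r /not_orP[nL nL']; rewrite -[X in cabs X]subr0 -[X in _ - X](mulr0 a).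
  rewrite -[X in _ - X]addr0; apply: linear_lt e0; rewrite subr0; [exact: FL|exact: FL'].
Qed.

Lemma band_closed F : (forall e : R, 0 < e -> exists2 F', band F' &
  forall t, cabs (F t - F' t) <= e * 1) -> band F.
Proof.
move=> HF.
have h e : 0 < e -> 0 < e / 3 :> R by move=> e0; rewrite divr_gt0.
have dist (F' : G * G -> C) e t t' : (forall t, cabs (F t - F' t) <= e / 3 * 1) ->
    cabs (F' t - F' t') < e / 3 -> cabs (F t - F t') < e.
  move=> FF' tt'; rewrite (_ : e = e / 3 + (e / 3 + e / 3)); last by field.
  apply: (le_lt_trans (cabs_dist _ (F' t) _)); apply: ler_ltD.
    by rewrite -[leRHS]mulr1.
  apply: (le_lt_trans (cabs_dist _ (F' t') _)); apply: ltr_leD => //.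
  by rewrite cabsBC -[leRHS]mulr1.
split=> [|e e0|e e0|e e0].
- have [F' [[K FK] _ _ _] FF'] := HF 1 ltr01; exists (1 + K) => t.
  by rewrite -[F t](subrK (F' t)) (le_trans (cabsD _ _))// mulrDl lerD.
- have [F' bF' FF'] := HF _ (h e e0).
  by apply: filterS (band_left bF' (h e e0)) => u Fu s r; exact: dist FF' (Fu s r).
- have [F' bF' FF'] := HF _ (h e e0).
  by apply: filterS (band_right bF' (h e e0)) => u Fu s r; exact: dist FF' (Fu s r).
- have e2 : 0 < e / 2 by rewrite divr_gt0.
  have [F' bF' FF'] := HF _ e2; have [K cK FK] := band_vanishing bF' e2.
  exists K => // s r nK; rewrite -[F _](subrK (F' (s, r))) (le_lt_trans (cabsD _ _))//.
  by rewrite [ltRHS]splitr; apply: ler_ltD; [rewrite -[leRHS]mulr1|exact: FK].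
Qed.

Definition band_space : @weighted_space R (G * G) :=
  WeightedSpace (fun=> ler01) band0 band_linear band_bounded band_closed.
Local Notation E' := (ws_type band_space).
Local Notation E := (ws_type (dual_space band_space)).

Let compact_lmul x (K : set G) : compact K -> compact [set (x * y)%g | y in K].
Proof.
by move=> cK; apply: continuous_compact => //; apply: continuous_subspaceT; exact: continuous_lmul.
Qed.

Let compact_rmul x (K : set G) : compact K -> compact [set (y * x)%g | y in K].
Proof.
by move=> cK; apply: continuous_compact => //; apply: continuous_subspaceT; exact: continuous_rmul.
Qed.

Lemma band_jointly_continuous F : band F -> continuous F.
Proof.
move=> bF; apply/continuous_cabsP => -[s r] e e0.
have e2 : 0 < e / 2 by rewrite divr_gt0.
have Ns : \forall y \near s, forall r', cabs (F (y, r') - F (s, r')) < e / 2.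
  by apply: near_of_lmul; apply: filterS (band_left bF e2) => u Fu r'; exact: Fu.
have Nr : \forall y \near r, forall s', cabs (F (s', y) - F (s', r)) < e / 2.
  by apply: near_of_rmul; apply: filterS (band_right bF e2) => u Fu s'; exact: Fu.
exists ([set y | forall r', cabs (F (y, r') - F (s, r')) < e / 2],
        [set y | forall s', cabs (F (s', y) - F (s', r)) < e / 2]) => //.
move=> [s' r'] /= [Fs Fr]; rewrite cabsBC.
apply: (le_lt_trans (cabs_dist _ (F (s, r')) _)); rewrite [ltRHS]splitr.
exact: ltrD.
Qed.

Lemma isC0_band_section F x : band F -> isC0 (fun y => F (x, y)).
Proof.
move=> bF; split.
  apply: (@continuous_compose _ _ _ (fun y => (x, y)) F); last exact: band_jointly_continuous.
  by move=> y; apply: cvg_pair; [exact: cvg_cst|exact: cvg_id].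
move=> e e0; have [K cK FK] := band_vanishing bF e0.
exists [set (x^-1 * y)%g | y in K]; first exact: compact_lmul.
by move=> y nKy; apply: FK => Kxy; apply: nKy; exists (x * y)%g => //; rewrite mulKg.
Qed.

Lemma isC0_band_section1 F : band F -> isC0 (fun x => F (x, 1%g)).
Proof.
move=> bF; split.
  apply: (@continuous_compose _ _ _ (fun y => (y, 1%g)) F); last exact: band_jointly_continuous.
  by move=> y; apply: cvg_pair; [exact: cvg_id|exact: cvg_cst].
move=> e e0; have [K cK FK] := band_vanishing bF e0.
by exists K => // x nK; apply: FK; rewrite mulg1.
Qed.

(* The actions of delta_x on the predual of the bimodule; the term F (x, s * r) is
   there to make band_derivation a derivation. *)
Definition actl_fun F x : G * G -> C := fun t => F ((x * t.1)%g, t.2) - F (x, (t.1 * t.2)%g).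
Definition actr_fun F x : G * G -> C := fun t => F (t.1, (t.2 * x)%g).

Lemma band_actl F x : band F -> band (actl_fun F x).
Proof.
move=> bF; have [K FK] := band_bounded bF; have c0 := isC0_band_section x bF.
have h e : 0 < e -> 0 < e / 2 :> R by move=> e0; rewrite divr_gt0.
have split4 (z w z' w' : C) e : cabs (z - z') < e / 2 -> cabs (w - w') < e / 2 ->
    cabs (z - w - (z' - w')) < e.
  move=> zz ww; rewrite (_ : _ - _ = (z - z') - (w - w')); last by ring.
  by apply: (le_lt_trans (cabsB _ _)); rewrite [ltRHS]splitr ltrD.
split=> [|e e0|e e0|e e0].
- exists (K + K) => t; rewrite (le_trans (cabsB _ _))// mulrDl.
  by apply: lerD; exact: FK.
- have := near_conj x^-1%g (band_left bF (h e e0)).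
  apply: filterS2 (isC0_left_uniform c0 (h e e0)) => u cu Fu s r; apply: split4 => /=.
    by have := Fu (x * s)%g r; rewrite invgK !mulgA mulgVK.
  by rewrite -mulgA; exact: cu.
- apply: filterS2 (isC0_right_uniform c0 (h e e0)) (band_right bF (h e e0)) => u cu Fu s r.
  by apply: split4 => /=; [exact: Fu|rewrite mulgA; exact: cu].
- have [L cL FL] := band_vanishing bF (h e e0).
  exists [set (x^-1 * y)%g | y in L]; first exact: compact_lmul.
  move=> s r nL; have nL' : ~ L (x * (s * r))%g.
    by move=> H; apply: nL; exists (x * (s * r))%g => //; rewrite mulKg.
  apply: (le_lt_trans (cabsB _ _)); rewrite [ltRHS]splitr.
  by apply: ltrD; apply: FL => //=; rewrite -mulgA.
Qed.

Lemma band_actr F x : band F -> band (actr_fun F x).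
Proof.
move=> bF; have [K FK] := band_bounded bF; split=> [|e e0|e e0|e e0].
- by exists K => t; exact: FK.
- by apply: filterS (band_left bF e0) => u Fu s r; exact: Fu.
- have := near_conj x (band_right bF e0); apply: filterS => u Fu s r.
  by have := Fu s (r * x)%g; rewrite /actr_fun /= !mulgA mulgK.
- have [L cL FL] := band_vanishing bF e0.
  exists [set (y * x^-1)%g | y in L]; first exact: compact_rmul.
  move=> s r nL; apply: FL => /= H; apply: nL; exists (s * (r * x))%g => //.
  by rewrite mulgA mulgK.
Qed.

Definition actl (F : E') x : E' := ws_of (X := band_space) (band_actl x (ws_inE F)).
Definition actr (F : E') x : E' := ws_of (X := band_space) (band_actr x (ws_inE F)).

Lemma actlM (F : E') x y : actl (actl F x) y = actl F (x * y)%g.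
Proof.
apply/val_inj/funext => -[s r]; rewrite /= /actl_fun /= !mulgA.
by rewrite opprB [RHS]addrC addrA subrK addrC.
Qed.

Lemma actrM (F : E') x y : actr (actr F y) x = actr F (x * y)%g.
Proof. by apply/val_inj/funext => -[s r]; rewrite /= /actr_fun /= mulgA. Qed.

Lemma actl_actr (F : E') x y : actr (actl F x) y = actl (actr F y) x.
Proof. by apply/val_inj/funext => -[s r]; rewrite /= /actr_fun /actl_fun /= mulgA. Qed.

Lemma actl_linear x (a : C) (F F' : E') : actl (a *: F + F') x = a *: actl F x + actl F' x.
Proof.
have E (z w z' w' : C) : a * z + z' - (a * w + w') = a * (z - w) + (z' - w') by ring.
apply/val_inj/funext => -[s r].
exact: (E (F ((x * s)%g, r)) (F (x, (s * r)%g)) (F' ((x * s)%g, r)) (F' (x, (s * r)%g))).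
Qed.

Lemma actr_linear x (a : C) (F F' : E') : actr (a *: F + F') x = a *: actr F x + actr F' x.
Proof. by apply/val_inj/funext. Qed.

Let cabs_le (F : E') t : cabs (F t) <= wnorm F.
Proof. exact: (@cabs_wnorm R _ band_space (fun=> erefl) F t). Qed.

Lemma actl_le (F : E') x : wnorm (actl F x) <= 2 * wnorm F.
Proof.
apply: (@wnorm_sup_le R _ band_space (fun=> erefl)) => [|t].
  by rewrite mulr_ge0// wnorm_ge0.
by rewrite (le_trans (cabsB _ _))// mulrDl mul1r lerD.
Qed.

Lemma actr_le (F : E') x : wnorm (actr F x) <= wnorm F.
Proof.
apply: (@wnorm_sup_le R _ band_space (fun=> erefl)) => [|t]; first exact: wnorm_ge0.
exact: (cabs_le F (t.1, (t.2 * x)%g)).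
Qed.

Lemma actl_continuous (F : E') x (e : R) : 0 < e ->
  \forall y \near x, wnorm (actl F y - actl F x) < e.
Proof.
move=> e0; have e4 : 0 < e / 4 by rewrite divr_gt0.
apply: near_of_lmul; apply: filterS (band_left (ws_inE F) e4) => u Fu.
apply: (@le_lt_trans _ _ (e / 2)); last by rewrite ltr_pdivrMr// ltr_pMr// ltr1n.
apply: (@wnorm_sup_le R _ band_space (fun=> erefl)) => [|[s r]].
  by rewrite ltW// divr_gt0.
rewrite (_ : (_ - _ : E') (s, r) = (F ((u * x * s)%g, r) - F ((x * s)%g, r)) -
  (F ((u * x)%g, (s * r)%g) - F (x, (s * r)%g))); last first.
  have E (z w z' w' : C) : z - w - (z' - w') = z - z' - (w - w') by ring.
  exact: (E (F ((u * x * s)%g, r)) (F ((u * x)%g, (s * r)%g))).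
apply: (le_trans (cabsB _ _)); rewrite (_ : e / 2 = e / 4 + e / 4); last by field.
by apply: lerD; apply: ltW; rewrite ?Fu// -mulgA; exact: Fu.
Qed.

Lemma actr_continuous (F : E') x (e : R) : 0 < e ->
  \forall y \near x, wnorm (actr F y - actr F x) < e.
Proof.
move=> e0; have e2 : 0 < e / 2 by rewrite divr_gt0.
apply: near_of_rmul; apply: filterS (band_right (ws_inE F) e2) => u Fu.
apply: (@le_lt_trans _ _ (e / 2)); last by rewrite ltr_pdivrMr// ltr_pMr// ltr1n.
apply: (@wnorm_sup_le R _ band_space (fun=> erefl)) => [|[s r]]; first exact: ltW.
by apply: ltW; have := Fu s (r * x)%g; rewrite -mulgA; exact.
Qed.

(** [actl F x] is at least e only where x s r lies in K. If y s r lies in K as well, then y = (y s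
    r) (x s r)^-1 x belongs to the compact set K K^-1 x. *)
Lemma actl_disjoint (F : E') (e : R) x : 0 < e -> exists2 L : set G, compact L &
  forall y, ~ L y -> forall t, cabs (actl F x t) < e \/ cabs (actl F y t) < e.
Proof.
move=> e0; have e2 : 0 < e / 2 by rewrite divr_gt0.
have [K cK FK] := band_vanishing (ws_inE F) e2.
have small y s r : ~ K (y * (s * r))%g -> cabs (actl F y (s, r)) < e.
  move=> nK; apply: (le_lt_trans (cabsB _ _)); rewrite [ltRHS]splitr.
  by apply: ltrD; apply: FK => //=; rewrite -mulgA.
exists [set (z.1 * (z.2^-1 * x))%g | z in K `*` K].
  apply: (@compact_mul _ (fun a b => a * (b^-1 * x))%g) => //.
  apply: continuous_mul; first exact: continuous_fst.
  apply: (@continuous_compose _ _ _ (fun z : G * G => z.2^-1)%g (fun b => b * x)%g).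
    by apply: continuous_inv; exact: continuous_snd.
  exact: continuous_rmul.
move=> y nL [s r]; have [Kx|/small] := pselect (K (x * (s * r))%g); last by left.
right; apply: small => Ky; apply: nL.
exists ((y * (s * r))%g, (x * (s * r))%g) => //=.
by rewrite invgM mulgVK mulgK.
Qed.

(** Here s r x and s r y in K give y = x (s r x)^-1 (s r y), an element of x K^-1 K. *)
Lemma actr_disjoint (F : E') (e : R) x : 0 < e -> exists2 L : set G, compact L &
  forall y, ~ L y -> forall t, cabs (actr F x t) < e \/ cabs (actr F y t) < e.
Proof.
move=> e0; have [K cK FK] := band_vanishing (ws_inE F) e0.
exists [set (x * z.1^-1 * z.2)%g | z in K `*` K].
  apply: (@compact_mul _ (fun a b => x * a^-1 * b)%g) => //.
  apply: continuous_mul; last exact: continuous_snd.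
  apply: (@continuous_compose _ _ _ (fun z : G * G => z.1^-1)%g (fun b => x * b)%g).
    by apply: continuous_inv; exact: continuous_fst.
  exact: continuous_lmul.
move=> y nL [s r]; have [Kx|nK] := pselect (K (s * (r * x))%g); last first.
  by left; exact: FK.
right; apply: FK => Ky; apply: nL.
exists ((s * (r * x))%g, (s * (r * y))%g) => //=.
by rewrite !invgM !mulgA !mulgV !mul1g mulgVK mulVg mul1g.
Qed.

Lemma actl_C0 (F : E') (u : E) : isC0 (fun x => u (actl F x)).
Proof.
exact: (@isC0_dual R G _ band_space (fun=> erefl) (actl F) _
  (@actl_continuous F) (@actl_le F) (@actl_disjoint F) u).
Qed.

Lemma actr_C0 (F : E') (u : E) : isC0 (fun x => u (actr F x)).
Proof.
exact: (@isC0_dual R G _ band_space (fun=> erefl) (actr F) _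
  (@actr_continuous F) (@actr_le F) (@actr_disjoint F) u).
Qed.

Local Notation Wl u a := (fun F : E' => pr (fun x => u (actl F x)) a).
Local Notation Wr u a := (fun F : E' => pr (fun x => u (actr F x)) a).

Lemma actl_dual (a : M) (u : E) : dual_set (X := band_space) (Wl u a).
Proof.
split=> [c F F'|].
  rewrite -(pr_linear _ _ (isC0_Cb (actl_C0 F u)) (isC0_Cb (actl_C0 F' u))).
  by congr (pr _ a); apply/funext => x; rewrite actl_linear (dual_linear u).
exists (4 * (wnorm u * 2) * tvR a) => F.
apply: (le_trans (pr_le (s := wnorm u * (2 * wnorm F)) _ (isC0_Cb (actl_C0 F u)) _)).
  move=> x; apply: (le_trans (dual_le _ _)); apply: ler_wpM2l; first exact: wnorm_ge0.
  exact: actl_le.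
by rewrite le_eqVlt; apply/orP; left; apply/eqP; ring.
Qed.

Lemma actr_dual (a : M) (u : E) : dual_set (X := band_space) (Wr u a).
Proof.
split=> [c F F'|].
  rewrite -(pr_linear _ _ (isC0_Cb (actr_C0 F u)) (isC0_Cb (actr_C0 F' u))).
  by congr (pr _ a); apply/funext => x; rewrite actr_linear (dual_linear u).
exists (4 * wnorm u * tvR a) => F.
apply: (le_trans (pr_le (s := wnorm u * wnorm F) _ (isC0_Cb (actr_C0 F u)) _)).
  move=> x; apply: (le_trans (dual_le _ _)); apply: ler_wpM2l; first exact: wnorm_ge0.
  exact: actr_le.
by rewrite le_eqVlt; apply/orP; left; apply/eqP; ring.
Qed.

(** The integrals over x against [a] of the actions of delta_x on the dual, which are the transposes
    of [actl] and [actr]. *)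
Definition modl (a : M) (u : E) : E := ws_of (X := dual_space band_space) (actl_dual a u).
Definition modr (u : E) (a : M) : E := ws_of (X := dual_space band_space) (actr_dual a u).

Lemma derivation_dual (a : M) : dual_set (X := band_space) (fun F : E' => pr (fun x => F (x, 1%g)) a).
Proof.
have c0 (F : E') : Cb (fun x => F (x, 1%g)) := isC0_Cb (isC0_band_section1 (ws_inE F)).
split=> [c F F'|]; first by rewrite -(pr_linear _ _ (c0 F) (c0 F')).
exists (4 * tvR a) => F; apply: (le_trans (pr_le (s := wnorm F) _ (c0 F) _)) => [x|].
  exact: (cabs_le F (x, 1%g)).
by rewrite mulrAC.
Qed.

Definition band_derivation (a : M) : E := ws_of (X := dual_space band_space) (derivation_dual a).

Local Notation "a '**' b" := (conv a b) (at level 40, left associativity).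
Local Notation pE := (fun (F : E') (u : E) => u F).

Let dual_ext (u v : E) : (forall F : E', u F = v F) -> u = v.
Proof. by move=> uv; apply/val_inj/funext. Qed.

Let joint_continuity (u : E) (F : E') :
  continuous (fun z : G * G => u (actl (actr F z.2) z.1)).
Proof.
apply/continuous_cabsP => -[x y] e e0.
have u0 := wnorm_ge0 u; have u1 : 0 < wnorm u + 1 by rewrite ltr_wpDl.
have d0 : 0 < e / 4 / (wnorm u + 1) by rewrite !divr_gt0.
exists ([set x' | wnorm (actl (actr F y) x' - actl (actr F y) x) < e / 4 / (wnorm u + 1)],
        [set y' | wnorm (actr F y' - actr F y) < e / 4 / (wnorm u + 1)]).
  by split; [exact: actl_continuous|exact: actr_continuous].
move=> [x' y'] /= [Hx Hy].
have bound (f : E') c : 0 <= c -> wnorm f <= c * (e / 4 / (wnorm u + 1)) ->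
    cabs (u f) <= c * (e / 4).
  move=> c0 fc; apply: (le_trans (dual_le _ _)); apply: (le_trans (ler_wpM2l u0 fc)).
  rewrite mulrCA; apply: ler_wpM2l => //; rewrite mulrC; apply/ltW/mul_divD1_lt => //.
  by rewrite divr_gt0.
apply: (le_lt_trans (cabs_dist _ (u (actl (actr F y) x')) _)).
rewrite (_ : e = e / 4 + (e / 4 + e / 4) + e / 4); last by field.
rewrite (le_lt_trans (y := e / 4 + (e / 4 + e / 4)))//; last by rewrite ltrDl divr_gt0.
apply: lerD.
  rewrite cabsBC -(linear_funB (dual_linear u)) -[leRHS]mul1r; apply: bound => //.
  by rewrite mul1r ltW.
rewrite cabsBC -(linear_funB (dual_linear u)) (_ : e / 4 + e / 4 = 2 * (e / 4)); last by ring.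
apply: bound => //.
have -> : actl (actr F y') x' - actl (actr F y) x' = actl (actr F y' - actr F y) x'.
  by have := actl_linear x' (-1) (actr F y) (actr F y'); rewrite !scaleN1r addrC => ->; rewrite addrC.
by apply: (le_trans (actl_le _ _)); apply: ler_wpM2l => //; exact: ltW.
Qed.

Let joint_bound (u : E) (F : E') x y : cabs (u (actl (actr F y) x)) <= wnorm u * (2 * wnorm F).
Proof.
apply: (le_trans (dual_le _ _)); apply: ler_wpM2l; first exact: wnorm_ge0.
by apply: (le_trans (actl_le _ _)); apply: ler_wpM2l => //; exact: actr_le.
Qed.

Lemma modl_mul a b (u : E) : modl (a ** b) u = modl a (modl b u).
Proof.
apply: dual_ext => F /=; rewrite (pr_conv_ract G_hausdorff G_lc _ _ (isC0_Cb (actl_C0 F u))).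
congr (pr _ a); apply/funext => x; congr (pr _ b); apply/funext => y.
by rewrite actlM.
Qed.

Lemma modr_mul a b (u : E) : modr u (a ** b) = modr (modr u a) b.
Proof.
apply: dual_ext => F /=; rewrite (pr_conv G_hausdorff G_lc _ _ (isC0_Cb (actr_C0 F u))).
congr (pr _ b); apply/funext => y; congr (pr _ a); apply/funext => x.
by rewrite actrM.
Qed.

Lemma modl_modr a b (u : E) : modl a (modr u b) = modr (modl a u) b.
Proof.
apply: dual_ext => F /=.
have -> : (fun x => pr (fun y => u (actr (actl F x) y)) b) =
    fun x => pr (fun y => u (actl (actr F y) x)) b.
  by apply/funext => x; congr (pr _ b); apply/funext => y; rewrite actl_actr.
pose K x y : C := u (actl (actr F y) x).
exact: (@fubini R G G_hausdorff G_lc K _ a b (@joint_continuity u F) (@joint_bound u F)).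
Qed.

(** Integrate F(xy, 1) = (F(xy, 1) - F(x, y)) + F(x, y). The bracket is [actl F x] at (y, 1) and
    F(x, y) is [actr F y] at (x, 1): the correction term in the left action accounts for the right
    one. *)
Lemma band_derivation_mul a b :
  band_derivation (a ** b) = modl a (band_derivation b) + modr (band_derivation a) b.
Proof.
apply: dual_ext => F; have bF := ws_inE F.
have c1 := isC0_Cb (isC0_band_section1 bF).
have FB z1 z2 : cabs (F (z1, z2)) <= wnorm F by exact: cabs_le.
have cF : continuous (fun z : G * G => F (z.1, z.2)).
  rewrite (_ : (fun z => _) = F); first exact: band_jointly_continuous.
  by apply/funext => -[].
rewrite [LHS](pr_conv_ract G_hausdorff G_lc _ _ c1).
have E1 : modl a (band_derivation b) F =
    pr (fun x => pr (fun y => F ((x * y)%g, 1%g)) b - pr (fun y => F (x, y)) b) a.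
  congr (pr _ a); apply/funext => x.
  rewrite -(prB _ (Cb_lmul x c1) (isC0_Cb (isC0_band_section x bF))).
  by congr (pr _ b); apply/funext => y; rewrite /= /actl_fun /= mulg1.
have E2 : modr (band_derivation a) b F = pr (fun x => pr (fun y => F (x, y)) b) a.
  rewrite (fubini G_hausdorff G_lc a b cF (fun x y => FB x y)).
  congr (pr _ b); apply/funext => y; congr (pr _ a); apply/funext => x.
  by rewrite /= /actr_fun /= mul1g.
have c2 := Cb_pr_param G_hausdorff b cF (fun x y => FB x y).
have H := prB a (Cb_ract G_hausdorff b c1) c2.
apply/esym; apply: (etrans (congr2 (fun z w : C => z + w) (etrans E1 H) E2)).
exact: subrK.
Qed.

Lemma band_bimodule : is_Banach_bimodule (@conv R G) modl modr.
Proof.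
split.
- move=> u; split=> c a b; apply: dual_ext => F.
    exact: (pr_linear_measure c a b (isC0_Cb (actl_C0 F u))).
  exact: (pr_linear_measure c a b (isC0_Cb (actr_C0 F u))).
- move=> a; split=> c u v; apply: dual_ext => F.
    exact: (pr_linear c a (isC0_Cb (actl_C0 F u)) (isC0_Cb (actl_C0 F v))).
  exact: (pr_linear c a (isC0_Cb (actr_C0 F u)) (isC0_Cb (actr_C0 F v))).
- exact: modl_mul.
- exact: modr_mul.
- exact: modl_modr.
- exists 8%:R => a u; have u0 := wnorm_ge0 u; have a0 := tvR_ge0 a.
  have -> : 8%:R * `|a| * `|u| = (8 * tvR a * wnorm u)%:C :> R[i].
    by rewrite (rmorphM (real_complex R)) (rmorphM (real_complex R)) rmorph_nat.
  rewrite !normr_wnorm; split; rewrite lecR.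
    apply: wnorm_le => [|F]; first by rewrite !mulr_ge0.
    apply: (le_trans (pr_le (s := wnorm u * (2 * wnorm F)) _ (isC0_Cb (actl_C0 F u)) _)).
      move=> x; apply: (le_trans (dual_le _ _)); apply: ler_wpM2l => //; exact: actl_le.
    by rewrite le_eqVlt; apply/orP; left; apply/eqP; rewrite /=; ring.
  apply: wnorm_le => [|F]; first by rewrite !mulr_ge0.
  apply: (le_trans (pr_le (s := wnorm u * (2 * wnorm F)) _ (isC0_Cb (actr_C0 F u)) _)).
    move=> x; apply: (le_trans (dual_le _ _)); apply: ler_wpM2l => //.
    by apply: (le_trans (actr_le _ _)); rewrite ler_peMl ?wnorm_ge0// ler1n.
  by rewrite le_eqVlt; apply/orP; left; apply/eqP; rewrite /=; ring.
Qed.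

Lemma C0_pr_continuous f : isC0 f -> continuous (pr f : wstar (@C0_pairing R G) -> C).
Proof. by move=> f0; exact: (@continuous_wstar_pairing _ _ _ (@C0_pairing R G) (C0_of f0)). Qed.

(** In the algebra variable, normality says that x |-> u(F.x) is in C_0(G). In the module variable,
    it says that the integral of the translates of F is an element of the predual, which is
    [Bochner]. *)
Lemma band_normal : is_normal (@C0_pairing R G) pE modl modr.
Proof.
split.
- by move=> u; apply: continuous_to_wstar => F; exact: C0_pr_continuous (actl_C0 F u).
- by move=> u; apply: continuous_to_wstar => F; exact: C0_pr_continuous (actr_C0 F u).
- move=> a; apply: continuous_to_wstar => F.
  have [F' F'E] := @Bochner R G G_hausdorff G_lc _ band_space (fun=> erefl) (actl F) _
    (@actl_continuous F) (@actl_le F) a.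
  have E0 : (fun u : E => modl a u F) = pE F' by apply/funext => u; exact: F'E.
  apply: (eq_ind_r (fun h : E -> C => continuous (h : wstar pE -> C)) _ E0).
  exact: (@continuous_wstar_pairing _ _ _ pE F').
- move=> a; apply: continuous_to_wstar => F.
  have [F' F'E] := @Bochner R G G_hausdorff G_lc _ band_space (fun=> erefl) (actr F) _
    (@actr_continuous F) (@actr_le F) a.
  have E0 : (fun u : E => modr u a F) = pE F' by apply/funext => u; exact: F'E.
  apply: (eq_ind_r (fun h : E -> C => continuous (h : wstar pE -> C)) _ E0).
  exact: (@continuous_wstar_pairing _ _ _ pE F').
Qed.

Lemma band_derivation_inner : Connes_amenable (@conv R G) (@C0_pairing R G) ->
  exists u : E, forall a (F : E'), pr (fun x => F (x, 1%g)) a =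
    pr (fun x => u (actl F x)) a - pr (fun x => u (actr F x)) a.
Proof.
move=> CA; have [|||| u uE] := CA _ _ _ _ _ (dual_spaceP band_space) band_bimodule band_normal
    band_derivation.
- move=> c a b; apply: dual_ext => F.
  exact: (pr_linear_measure c a b (isC0_Cb (isC0_band_section1 (ws_inE F)))).
- exists 4%:R => a; have -> : 4%:R * `|a| = (4 * tvR a)%:C :> R[i].
    by rewrite (rmorphM (real_complex R)) rmorph_nat.
  rewrite normr_wnorm lecR; apply: wnorm_le => [|F]; first by rewrite mulr_ge0// tvR_ge0.
  rewrite mulrAC; apply: pr_le (isC0_Cb (isC0_band_section1 (ws_inE F))) _ => x.
  exact: (cabs_le F (x, 1%g)).
- exact: band_derivation_mul.
- apply: continuous_to_wstar => F.
  exact: C0_pr_continuous (isC0_band_section1 (ws_inE F)).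
by exists u => a F; have /(congr1 (fun v : E => v F)) := uE a.
Qed.

End band_functions.

(** * The invariant functional given by an inner derivation *)

Section invariant_functional.
Context {R : realType} {G : topologicalGroupType}.
Local Notation C := (R[i]^o).
Local Notation M := (measure_algebra R G).
Local Notation dl := (@point_mass R G).
Local Notation E' := (ws_type (@band_space R G)).
Local Notation E := (ws_type (dual_space (@band_space R G))).
Hypotheses (G_hausdorff : hausdorff_space G) (G_lc : locally_compact [set: G]).
Implicit Types (f k : G -> C).

(** The shape is stable under both actions: the left one by x replaces f and k by f(x .) and k(x .),
    as the correction term exchanges f(1) for f(x), and the right one replaces k by k(. x). *)
Definition slant f k : G * G -> C := fun t => (f t.1 - f 1%g) * k (t.1 * t.2)%g.

Lemma band_slant f k : LUC f -> isC0 k -> band (slant f k).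
Proof.
move=> [[cf [B fB]] uf] k0; have [ck [K kK]] := isC0_Cb k0.
have B0 : 0 <= B by rewrite (le_trans _ (fB point))// cabs_ge0.
have K0 : 0 <= K by rewrite (le_trans _ (kK point))// cabs_ge0.
have fB2 s : cabs (f s - f 1%g) <= 2 * B.
  by rewrite (le_trans (cabsB _ _))// mulrDl mul1r lerD.
have B2 : 0 <= 2 * B by rewrite mulr_ge0.
have small (z w : C) (d : R) : cabs z <= 2 * B -> cabs w < d / (2 * B + 1) -> 0 < d ->
    cabs (z * w) < d.
  move=> zB wd d0; rewrite cabsM; apply: le_lt_trans (mul_divD1_lt d0 B2).
  by rewrite [leRHS]mulrC; apply: ler_pM; rewrite ?cabs_ge0// ltW.
have dB e : 0 < e -> 0 < e / (2 * B + 1) :> R by move=> e0; rewrite divr_gt0// ltr_wpDl.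
split=> [|e e0|e e0|e e0].
- exists (2 * B * K) => t; rewrite mulr1 cabsM.
  by apply: ler_pM; rewrite ?cabs_ge0// fB2.
- have e2 : 0 < e / 2 by rewrite divr_gt0.
  have eK : 0 < e / 2 / (K + 1) by rewrite divr_gt0// ltr_wpDl.
  apply: filterS2 (uf _ eK) (isC0_left_uniform k0 (dB _ e2)) => x fx kx s r.
  have -> : slant f k ((x * s)%g, r) - slant f k (s, r) =
      (f (x * s)%g - f s) * k (x * (s * r))%g +
      (f s - f 1%g) * (k (x * (s * r))%g - k (s * r)%g).
    by rewrite /slant /= mulgA; ring.
  apply: (le_lt_trans (cabsD _ _)); rewrite [ltRHS]splitr; apply: ltrD.
    rewrite cabsM; apply: le_lt_trans (mul_divD1_lt e2 K0).
    by apply: ler_pM; rewrite ?cabs_ge0// ltW.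
  by apply: small (fB2 s) (kx (s * r)%g) e2.
- apply: filterS (isC0_right_uniform k0 (dB _ e0)) => x kx s r.
  by rewrite /slant /= -mulrBr mulgA; exact: small (fB2 s) (kx (s * r)%g) e0.
- have [L cL kL] := k0.2 _ (dB _ e0); exists L => // s r nL.
  exact: small (fB2 s) (kL _ nL) e0.
Qed.

Lemma slant_le f k (B s : R) : (forall x, cabs (f x) <= B) -> (forall x, cabs (k x) <= s) ->
  forall t, cabs (slant f k t) <= 2 * B * s.
Proof.
move=> fB ks t; rewrite cabsM; apply: ler_pM; rewrite ?cabs_ge0//.
by rewrite (le_trans (cabsB _ _))// mulrDl mul1r lerD.
Qed.

Variable u : E.
Hypothesis u_inner : forall a (F : E'), pr (fun x => F (x, 1%g)) a =
    pr (fun x => u (actl F x)) a - pr (fun x => u (actr F x)) a.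

Lemma inner_point (F : E') x :
  F (x, 1%g) = u (actl F x) - u (actr F x).
Proof.
have := u_inner (dl x) F; rewrite !(pr_point_mass G_hausdorff G_lc)//.
- exact: isC0_Cb (actr_C0 F u).
- exact: isC0_Cb (actl_C0 F u).
- exact: isC0_Cb (isC0_band_section1 (ws_inE F)).
Qed.

Lemma slant_measure f (B : R) : LUC f -> (forall x, cabs (f x) <= B) ->
  exists a : M, tvR a <= 4 * (B + wnorm u * (2 * B)) /\ forall k (k0 : isC0 k) (lf : LUC f),
    pr k a = f 1%g * k 1%g - u (ws_of (X := band_space) (band_slant lf k0)).
Proof.
move=> lf fB; have B0 : 0 <= B by rewrite (le_trans _ (fB point))// cabs_ge0.
(* A total map k |-> slant, independent of the proof that k is in C_0, so that the functional below
   is defined on all functions. *)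
have [P PE] : exists P : (G -> C) -> E', forall k (k0 : isC0 k) lf,
    P k = ws_of (X := band_space) (band_slant (f := f) lf k0).
  exists (fun k => if pselect (isC0 k) is left k0 then
    ws_of (X := band_space) (band_slant lf k0) else 0).
  by move=> k k0 lf'; case: pselect => // k0'; exact: val_inj.
pose nu k := f 1%g * k 1%g - u (P k).
have K0 : 0 <= B + wnorm u * (2 * B) by rewrite addr_ge0// !mulr_ge0// wnorm_ge0.
have [c k k' k0 k0'|k s k0 ks|a [aE a4]] := riesz_representation G_hausdorff G_lc (u := nu) K0.
- have PL : P (fun x => c * k x + k' x) = c *: P k + P k'.
    rewrite (PE _ (isC0_linear c k0 k0') lf) (PE _ k0 lf) (PE _ k0' lf).
    have R0 (z v w : C) : z * (c * v + w) = c * (z * v) + z * w by ring.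
    by apply/val_inj/funext => t; exact: R0.
  rewrite /nu PL (dual_linear u) /GRing.scale/=; ring.
- have s0 : 0 <= s by rewrite (le_trans _ (ks point))// cabs_ge0.
  rewrite /nu (le_trans (cabsB _ _))// mulrDl; apply: lerD.
    by rewrite cabsM; apply: ler_pM; rewrite ?cabs_ge0.
  rewrite -mulrA (PE _ k0 lf); apply: (le_trans (dual_le _ _)).
  apply: ler_wpM2l; first exact: wnorm_ge0.
  apply: (@wnorm_sup_le R _ band_space (fun=> erefl)) => [|t]; first by rewrite !mulr_ge0.
  exact: slant_le.
- by exists a; split => // k k0 lf'; rewrite aE// /nu (PE _ k0 lf').
Qed.

Lemma LUC_mean_exists : exists n : (G -> C) -> C, LUC_mean n.
Proof.
have [A AE] : exists A : (G -> C) -> M, forall f (B : R), LUC f -> (forall x, cabs (f x) <= B) ->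
    tvR (A f) <= 4 * (B + wnorm u * (2 * B)) /\ forall k (k0 : isC0 k) (lf : LUC f),
    pr k (A f) = f 1%g * k 1%g - u (ws_of (X := band_space) (band_slant lf k0)).
  pose Q f (a : M) := forall (B : R), LUC f -> (forall x, cabs (f x) <= B) ->
    tvR a <= 4 * (B + wnorm u * (2 * B)) /\ forall k (k0 : isC0 k) (lf : LUC f),
    pr k a = f 1%g * k 1%g - u (ws_of (X := band_space) (band_slant lf k0)).
  suff H f : exists a, Q f a by have [A AP] := choice H; exists A => f B; exact: AP.
  have [lf|nlf] := pselect (LUC f); last by exists 0 => B /nlf.
  have [[_ [B0 fB0]] _] := lf; have [a [_ aE]] := slant_measure lf fB0.
  exists a => B _ fB; split => //; have [b [b4 bE]] := slant_measure lf fB.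
  suff -> : a = b by [].
  by apply: (pr_inj G_hausdorff G_lc) => k k0; rewrite (aE k k0 lf) (bE k k0 lf).
have AE2 f k (lf : LUC f) (k0 : isC0 k) : pr k (A f) =
    f 1%g * k 1%g - u (ws_of (X := band_space) (band_slant lf k0)).
  by have [[_ [B fB]] _] := lf; exact: (AE f B lf fB).2.
(* One factor 4 comes from [slant_measure], the other from integrating the constant 1 with
   [pr_le]. *)
apply: (@LUC_mean_of_invariant R G (fun f => mass (A f)) (4 * (4 * (1 + wnorm u * 2)))).
- move=> z f g lf lg; have lfg := LUC_linear z lf lg.
  suff -> : A (fun x => z * f x + g x) = z *: A f + A g by exact: mass_linear.
  apply: (pr_inj G_hausdorff G_lc) => k k0.
  rewrite (pr_linear_measure z _ _ (isC0_Cb k0)) (AE2 _ _ lfg k0) (AE2 _ _ lf k0) (AE2 _ _ lg k0).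
  have -> : ws_of (X := band_space) (band_slant lfg k0) =
      z *: ws_of (X := band_space) (band_slant lf k0) + ws_of (X := band_space) (band_slant lg k0).
    have R0 (v v' w w' c : C) : (z * v + w - (z * v' + w')) * c = z * ((v - v') * c) + (w - w') * c.
      by ring.
    by apply/val_inj/funext => t; exact: R0.
  rewrite (dual_linear u) /GRing.scale/=; ring.
- move=> f s lf fs; have [As _] := AE f s lf fs.
  apply: (le_trans (pr_le (s := 1) _ (Cb_cst 1) _)) => [x|]; first by rewrite cabs1.
  rewrite mulr1 -[leRHS]mulrA; apply: ler_wpM2l => //; apply: (le_trans As).
  by rewrite le_eqVlt; apply/orP; left; apply/eqP; ring.
- suff -> : A (fun=> 1) = dl 1%g by exact: mass_point_mass.
  apply: (pr_inj G_hausdorff G_lc) => k k0.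
  rewrite (AE2 _ _ (LUC_cst 1) k0) (pr_point_mass G_hausdorff G_lc _ (isC0_Cb k0)).
  have -> : ws_of (X := band_space) (band_slant (LUC_cst 1) k0) = 0.
    by apply/val_inj/funext => t; rewrite /= /slant subrr mul0r.
  by rewrite (linear_fun0 (dual_linear u)) mul1r subr0.
- move=> x f lf; have lfx := LUC_lmul x lf.
  suff E0 : conv (dl x) (A (fun s => f (x * s)%g)) = conv (A f) (dl x).
    have := congr1 mass E0; rewrite !mass_conv// mass_point_mass//.
    by rewrite mul1r mulr1.
  apply: (pr_inj G_hausdorff G_lc) => k k0.
  have kl : isC0 (fun y => k (x * y)%g).
    have := isC0_lact G_hausdorff (dl x) k0; congr (isC0 _); apply/funext => y.
    exact: (pr_point_mass G_hausdorff G_lc _ (Cb_rmul y (isC0_Cb k0))).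
  have kr : isC0 (fun y => k (y * x)%g).
    have := isC0_ract G_hausdorff (dl x) k0; congr (isC0 _); apply/funext => y.
    exact: (pr_point_mass G_hausdorff G_lc _ (Cb_lmul y (isC0_Cb k0))).
  rewrite (pr_lmul G_hausdorff G_lc _ _ (isC0_Cb k0)) (pr_rmul G_hausdorff G_lc _ _ (isC0_Cb k0)).
  rewrite (AE2 _ _ lfx kl) (AE2 _ _ lf kr).
  (* At the point (x, 1) the slant is (f(x) - f(1)) k(x). Innerness equates this with the difference
     of u at the left and right translates of the slant, which is what separates the two sides of
     the identity to be proved. *)
  have := inner_point (ws_of (X := band_space) (band_slant lf k0)) x.
  have -> : actl (ws_of (X := band_space) (band_slant lf k0)) x =
      ws_of (X := band_space) (band_slant lfx kl).
    apply/val_inj/funext => -[s r]; rewrite /= /actl_fun /slant /= !mulgA mulg1.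
    by rewrite -mulrBl opprB addrA subrK.
  have -> : actr (ws_of (X := band_space) (band_slant lf k0)) x =
      ws_of (X := band_space) (band_slant lf kr).
    by apply/val_inj/funext => -[s r]; rewrite /= /actr_fun /slant /= !mulgA.
  move: (u (ws_of (X := band_space) (band_slant lfx kl))) => p.
  move: (u (ws_of (X := band_space) (band_slant lf kr))) => q.
  rewrite /= /slant /= !mulg1 mul1g => Epq.
  have -> : p = (f x - f 1%g) * k x + q by rewrite Epq subrK.
  by ring.
Qed.

End invariant_functional.

Lemma Connes_amenable_amenable (R : realType) (G : topologicalGroupType) :
  hausdorff_space G -> locally_compact [set: G] ->
  Connes_amenable (@convolution R G) (@C0_pairing R G) -> amenable R G.
Proof.
move=> G_hausdorff G_lc; have -> : @convolution R G = @conv R G by rewrite conv.unlock.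
move=> /(band_derivation_inner G_hausdorff G_lc)[u uE].
have [n n_mean] := LUC_mean_exists G_hausdorff G_lc uE.
exact: (LUC_mean_amenable G_hausdorff G_lc n_mean).
Qed.

Theorem theorem1 (R : realType) (G : topologicalGroupType)
    (G_hausdorff : hausdorff_space G) (G_lc : locally_compact [set: G]) :
  (amenable R G <->
     Connes_amenable (@convolution R G) (@C0_pairing R G)) /\
  (Connes_amenable (@convolution R G) (@C0_pairing R G) <->
     exists M, is_normal_virtual_diagonal (@convolution R G) (@C0_pairing R G) M).
Proof.
have diag := @amenable_virtual_diagonal R G G_hausdorff G_lc.
have conn := @virtual_diagonal_Connes_amenable R G G_hausdorff G_lc.
have amen := @Connes_amenable_amenable R G G_hausdorff G_lc.
split; split=> [H|H]; [|exact: amen|exact: diag (amen H)|by have [M /conn] := H].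
by have [M /conn] := diag H.
Qed.
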